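(* Let $k\ge1$ be an integer and let $X_k$ be a random variable with density $x^{-1}v_k(x)$ on $(0,\infty)$. For real $\lambda\ge0$ and $t\in\mathbb{C}$ consider $$F_{\lambda,k}(t)=\mathbb{E}\!\left(\sqrt{X_k}\,e^{\lambda(\log X_k)^2+it\log X_k}\right)=\int_0^\infty e^{\lambda(\log x)^2+it\log x}\sqrt{x}\,v_k(x)\,\frac{dx}{x}.$$ Then: (i) for every $\lambda\ge 1/8$, every zero $t\in\mathbb{C}$ of $F_{\lambda,k}$ is real; (ii) for $\lambda=0$, $F_{0,k}(t)=0$ for infinitely many real $t$.
   Context: Let $\xi(s)=\frac12 s(s-1)\pi^{-s/2}\Gamma(s/2)\zeta(s)$ be the Riemann xi-function. For an integer $k\ge1$ and $x>0$ define $$v_k(x)=\frac{1}{2\pi i}\int_{c-i\infty}^{c+i\infty}2^k\,\xi(s)^k\,x^{s-1}\,ds,\qquad 0<c<1,$$ so that $\int_0^\infty x^{s-1}v_k(x)\,dx=2^k\xi(s)^k$. It is known that $v_k(x)>0$ for $x>0$ and $x^{-1}v_k(x)$ is a probability density on $(0,\infty)$; $X_k$ denotes a random variable with this density. *)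

(* Defs.v *)
From Stdlib Require Import Reals ClassicalEpsilon.
From Coquelicot Require Export Coquelicot.
Open Scope R_scope.

Definition cexp (z : C) : C :=
  (exp (Re z) * cos (Im z), exp (Re z) * sin (Im z)).

Definition rcpow (x : R) (z : C) : C := cexp (Cmult z (RtoC (ln x))).

(* Riemann zeta by its Dirichlet series (meaningful for Re s > 1) *)
Definition zeta_dirichlet (s : C) : C :=
  (Series (fun n => Re (rcpow (INR (S n)) (Copp s))),
   Series (fun n => Im (rcpow (INR (S n)) (Copp s)))).

(* Euler's Gamma integral (meaningful for Re s > 0) *)
Definition Gamma_euler (s : C) : C :=
  @RInt_gen C_R_CompleteNormedModule (fun t => Cmult (rcpow t (Cminus s 1)) (RtoC (exp (- t))))
           (at_right 0) (Rbar_locally p_infty).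

Definition xi_product (s : C) : C :=
  Cmult (Cmult (Cmult (RtoC (1/2)) (Cmult s (Cminus s 1)))
               (rcpow PI (Copp (Cdiv s 2))))
        (Cmult (Gamma_euler (Cdiv s 2)) (zeta_dirichlet s)).

Definition entire (f : C -> C) : Prop :=
  forall z : C, @ex_derive C_AbsRing C_NormedModule f z.

(* xi = the (unique) entire function agreeing with
   (1/2) s (s-1) pi^{-s/2} Gamma(s/2) zeta(s) on Re s > 1 *)
Definition xi : C -> C :=
  epsilon (inhabits (fun _ : C => RtoC 0))
    (fun f => entire f /\ forall s : C, 1 < Re s -> f s = xi_product s).

(* v_k(x) = (1/(2 pi i)) int_{c - i oo}^{c + i oo} 2^k xi(s)^k x^{s-1} ds,
   with c = 1/2; parametrizing s = c + i tau, ds = i dtau. *)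
Definition v (k : nat) (x : R) : C :=
  Cmult (RtoC (/ (2 * PI)))
    (@RInt_gen C_R_CompleteNormedModule (fun tau : R =>
        let s : C := (1/2, tau) in
        Cmult (Cpow (Cmult (RtoC 2) (xi s)) k) (rcpow x (Cminus s 1)))
      (Rbar_locally m_infty) (Rbar_locally p_infty)).

Definition F (lambda : R) (k : nat) (t : C) : C :=
  @RInt_gen C_R_CompleteNormedModule (fun x : R =>
      Cmult (cexp (Cplus (RtoC (lambda * (ln x) ^ 2))
                         (Cmult (Cmult Ci t) (RtoC (ln x)))))
            (Cmult (RtoC (sqrt x / x)) (v k x)))
    (at_right 0) (Rbar_locally p_infty).

(* Main.v *)
Require Import Defs.
From Stdlib Require Import Reals List Lra Lia Psatz Classical ClassicalEpsilon FunctionalExtensionality.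
From Coquelicot Require Import Coquelicot.
Open Scope R_scope.

(** With [Xi t = 2 xi (1/2 + i t)] one has [F lambda k t = Ig (Phi_k (u) exp (lambda u^2 + i t u))],
    where [Phi_k] is the [k]-th convolution power of the classical kernel
    [Phi u = Sum (8 pi^2 n^4 e^(9u/2) - 12 pi n^2 e^(5u/2)) exp (- pi n^2 e^(2u))], an even positive
    function, because the Fourier transform of [Phi] is [Xi].

    (i) The zeros of [Xi^k] lie in [|Im z| <= 1/2], since Gamma and zeta do not vanish on [Re s > 1].
    Multiplying a kernel by [cosh (a u)] averages the transform over [z + i a] and [z - i a]; comparing
    moduli factor by factor in the Hadamard product, the strip [y^2 <= D] containing the zeros shrinks
    to [y^2 <= D - a^2] (de Bruijn). Taking [n] steps with [a^2 = 2 lambda / n] the factors tend to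
    [exp (lambda u^2)], and [D = 1/4] is exhausted as soon as [lambda >= 1/8].

    (ii) It suffices that [Xi] has infinitely many real zeros (Hardy). The integral of
    [exp (a t) Xi t / (t^2 + 1/4)] is, up to an elementary cosine, a theta function at
    [exp (2 i a)], which vanishes to infinite order as [a] tends to [pi/4]; if [Xi] had constant sign
    for large [t], the high second differences in [a] could not remain bounded as they do. *)

(** * Limits and derivatives of complex functions *)

(** With [u = ln x] and [s = 1/2 + i t], the factor [exp (- u / 2)] in [v] cancels the [sqrt x] of
    the expectation; what remains is the even kernel. As [xi] is chosen by [epsilon] and [v] is an
    integral of its powers, nothing can be read off them until an explicit entire candidate is
    identified with [xi] and Fourier inversion recovers the kernel from its transform. De Bruijn's
    comparison is strict for finite products, but a limit of strict inequalities is weak. The gain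
    of one factor, belonging to an actual zero of the transform, is therefore carried through the
    limit as a pair of constants; that a zero exists at all is itself a consequence of the
    factorisation. In the last limit, from powers of [cosh] to the Gaussian, it is the monotonicity
    of the modulus in [|Im z|] that is transported, since it survives pointwise limits. On
    [Re s > 1], Gamma is moved by its recurrence to large real part, where a second moment estimate
    excludes zeros, and zeta is handled by sieving its partial sums. All estimates rest on one
    dominating weight, on geometric series and on Cauchy's formula for discs. *)

Definition clim {T : Type} (F : (T -> Prop) -> Prop) (f : T -> C) (l : C) : Prop :=
  forall eps : R, 0 < eps -> F (fun t => Cmod (f t - l) < eps).

Lemma Cmod_minus_sym (a b : C) : Cmod (a - b) = Cmod (b - a).
Proof. replace (a - b)%C with (- (b - a))%C by ring. apply Cmod_opp. Qed.

Lemma Cmod_triangle3 (a b c : C) : Cmod (a - c) <= Cmod (a - b) + Cmod (b - c).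
Proof. replace (a - c)%C with ((a - b) + (b - c))%C by ring. apply Cmod_triangle. Qed.

Lemma Cmod_triangle_rev (a b : C) : Cmod a - Cmod b <= Cmod (a - b).
Proof.
  pose proof (Cmod_triangle (a - b) b) as H.
  replace (a - b + b)%C with a in H by ring. lra.
Qed.

Lemma Cmod_small_eq (a b : C) : (forall eps, 0 < eps -> Cmod (a - b) <= eps) -> a = b.
Proof.
  intro H. assert (Cmod (a - b) = 0) as H0.
  { pose proof (Cmod_ge_0 (a - b)). destruct (Req_dec (Cmod (a - b)) 0) as [|Hn]; auto.
    specialize (H (Cmod (a - b) / 2)). lra. }
  apply Cmod_eq_0 in H0. replace a with (a - b + b)%C by ring. rewrite H0. ring.
Qed.

Lemma Cmod_le_add (c : C) : Cmod c <= Rabs (Re c) + Rabs (Im c).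
Proof.
  destruct c as [a b]. simpl. unfold Cmod. simpl.
  apply Rsqr_incr_0_var; [|pose proof (Rabs_pos a); pose proof (Rabs_pos b); lra].
  rewrite Rsqr_sqrt; [|nra]. unfold Rsqr.
  pose proof (Rabs_pos a); pose proof (Rabs_pos b).
  assert (Rabs a * Rabs a = a * a) by (rewrite <- Rabs_mult; apply Rabs_right; nra).
  assert (Rabs b * Rabs b = b * b) by (rewrite <- Rabs_mult; apply Rabs_right; nra).
  nra.
Qed.

Lemma im_le_Cmod (c : C) : Rabs (Im c) <= Cmod c.
Proof. eapply Rle_trans; [|apply (Rmax_Cmod c)]. apply Rmax_r. Qed.

Lemma re_le (c : C) : Re c <= Cmod c.
Proof. eapply Rle_trans; [apply Rle_abs|apply re_le_Cmod]. Qed.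

Lemma re_ge (c : C) : - Cmod c <= Re c.
Proof. pose proof (re_le_Cmod c) as H. apply Rabs_le_between in H. lra. Qed.

Lemma Ceq_parts (a b : C) : Re a = Re b -> Im a = Im b -> a = b.
Proof. destruct a, b. simpl. intros; subst; reflexivity. Qed.

Lemma re_plus (a b : C) : Re (a + b)%C = Re a + Re b. Proof. reflexivity. Qed.
Lemma im_plus (a b : C) : Im (a + b)%C = Im a + Im b. Proof. reflexivity. Qed.
Lemma re_minus (a b : C) : Re (a - b)%C = Re a - Re b. Proof. reflexivity. Qed.
Lemma im_minus (a b : C) : Im (a - b)%C = Im a - Im b. Proof. reflexivity. Qed.
Lemma re_mult (a b : C) : Re (a * b)%C = Re a * Re b - Im a * Im b. Proof. reflexivity. Qed.
Lemma im_mult (a b : C) : Im (a * b)%C = Re a * Im b + Im a * Re b. Proof. reflexivity. Qed.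
Lemma re_RtoC (x : R) : Re (RtoC x) = x. Proof. reflexivity. Qed.
Lemma im_RtoC (x : R) : Im (RtoC x) = 0. Proof. reflexivity. Qed.
Lemma re_opp (a : C) : Re (- a)%C = - Re a. Proof. reflexivity. Qed.
Lemma im_opp (a : C) : Im (- a)%C = - Im a. Proof. reflexivity. Qed.

Lemma RtoC_neq0 (x : R) : x <> 0 -> RtoC x <> 0.
Proof. intros H H'. apply H. apply RtoC_inj. exact H'. Qed.

Lemma Cmod_pos_RtoC (x : R) : 0 <= x -> Cmod x = x.
Proof. intro. rewrite Cmod_R. apply Rabs_right. lra. Qed.

Section Limits.
Context {T : Type} {F : (T -> Prop) -> Prop} {FF : Filter F}.

Lemma clim_const (c : C) : clim F (fun _ => c) c.
Proof.
  intros e He. apply filter_forall. intros _. replace (c - c)%C with (RtoC 0) by ring.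
  rewrite Cmod_0. exact He.
Qed.

Lemma clim_eq (f : T -> C) a b : clim F f a -> a = b -> clim F f b.
Proof. now intros H <-. Qed.

Lemma clim_ext (f g : T -> C) l : F (fun t => f t = g t) -> clim F f l -> clim F g l.
Proof.
  intros E H e He. generalize (filter_and _ _ E (H e He)). apply filter_imp.
  intros t [<- Ht]. exact Ht.
Qed.

Lemma clim_plus (f g : T -> C) (a b : C) :
  clim F f a -> clim F g b -> clim F (fun t => f t + g t)%C (a + b)%C.
Proof.
  intros Hf Hg e He.
  assert (He2 : 0 < e / 2) by lra.
  generalize (filter_and _ _ (Hf _ He2) (Hg _ He2)). apply filter_imp. intros t [H1 H2].
  replace (f t + g t - (a + b))%C with ((f t - a) + (g t - b))%C by ring.
  eapply Rle_lt_trans; [apply Cmod_triangle|lra].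
Qed.

Lemma clim_opp (f : T -> C) (a : C) : clim F f a -> clim F (fun t => - f t)%C (- a)%C.
Proof.
  intros Hf e He. generalize (Hf e He). apply filter_imp. intros t H.
  replace (- f t - - a)%C with (- (f t - a))%C by ring. now rewrite Cmod_opp.
Qed.

Lemma clim_minus (f g : T -> C) (a b : C) :
  clim F f a -> clim F g b -> clim F (fun t => f t - g t)%C (a - b)%C.
Proof. intros. apply clim_plus; auto. now apply clim_opp. Qed.

Lemma clim_mult (f g : T -> C) (a b : C) :
  clim F f a -> clim F g b -> clim F (fun t => f t * g t)%C (a * b)%C.
Proof.
  intros Hf Hg e He.
  set (M := Cmod a + Cmod b + 1).
  assert (HM : 0 < M) by (unfold M; pose proof (Cmod_ge_0 a); pose proof (Cmod_ge_0 b); lra).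
  set (d := Rmin 1 (e / (2 * M))).
  assert (Hd : 0 < d) by (apply Rmin_glb_lt; [lra|apply Rdiv_lt_0_compat; lra]).
  generalize (filter_and _ _ (Hf _ Hd) (Hg _ Hd)). apply filter_imp. intros t [H1 H2].
  replace (f t * g t - a * b)%C with ((f t - a) * (g t - b) + ((f t - a) * b + a * (g t - b)))%C by ring.
  eapply Rle_lt_trans; [apply Cmod_triangle|].
  eapply Rle_lt_trans; [apply Rplus_le_compat_l, Cmod_triangle|].
  rewrite !Cmod_mult.
  pose proof (Rmin_l 1 (e / (2 * M))). pose proof (Rmin_r 1 (e / (2 * M))).
  fold d in H, H0.
  assert (d * M <= e / 2).
  { apply Rle_trans with (e / (2 * M) * M); [apply Rmult_le_compat_r; lra|].
    right. field. lra. }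
  pose proof (Cmod_ge_0 a). pose proof (Cmod_ge_0 b).
  pose proof (Cmod_ge_0 (f t - a)). pose proof (Cmod_ge_0 (g t - b)).
  unfold M in H3. nra.
Qed.

Lemma clim_inv (f : T -> C) (a : C) : a <> 0 -> clim F f a -> clim F (fun t => / f t)%C (/ a)%C.
Proof.
  intros Ha Hf e He.
  assert (Hp : 0 < Cmod a) by now apply Cmod_gt_0.
  set (d := Rmin (Cmod a / 2) (e * (Cmod a * Cmod a) / 2)).
  assert (Hpp : 0 < e * (Cmod a * Cmod a)) by (apply Rmult_lt_0_compat; [auto|nra]).
  assert (Hd : 0 < d) by (apply Rmin_glb_lt; lra).
  generalize (Hf _ Hd). apply filter_imp. intros t H.
  pose proof (Rmin_l (Cmod a / 2) (e * (Cmod a * Cmod a) / 2)) as H1.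
  pose proof (Rmin_r (Cmod a / 2) (e * (Cmod a * Cmod a) / 2)) as H2. fold d in H1, H2.
  assert (Hft : Cmod a / 2 < Cmod (f t)).
  { pose proof (Cmod_triangle_rev a (f t)). rewrite Cmod_minus_sym in H0. lra. }
  assert (f t <> 0) by (apply Cmod_gt_0; lra).
  replace (/ f t - / a)%C with (- ((f t - a) * / (f t * a)))%C by (field; auto).
  rewrite Cmod_opp, Cmod_mult, Cmod_inv, Cmod_mult; [|now apply Cmult_neq_0].
  apply Rmult_lt_reg_r with (Cmod (f t) * Cmod a); [nra|].
  rewrite Rmult_assoc, Rinv_l, Rmult_1_r; [|apply Rgt_not_eq; nra].
  assert (Cmod (f t - a) < d) by exact H. nra.
Qed.

Lemma clim_conj (f : T -> C) (a : C) : clim F f a -> clim F (fun t => Cconj (f t)) (Cconj a).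
Proof.
  intros Hf e He. generalize (Hf e He). apply filter_imp. intros t H.
  rewrite <- Cminus_conj, Cmod_conj. exact H.
Qed.

Lemma clim_pow (f : T -> C) (a : C) n : clim F f a -> clim F (fun t => f t ^ n)%C (a ^ n)%C.
Proof.
  intro H. induction n; simpl; [apply clim_const|].
  now apply clim_mult.
Qed.

Lemma clim_re (f : T -> C) (a : C) : clim F f a -> filterlim (fun t => Re (f t)) F (locally (Re a)).
Proof.
  intro H. apply filterlim_locally. intro e. generalize (H e (cond_pos e)). apply filter_imp.
  intros t Ht. unfold ball; simpl; unfold AbsRing_ball, abs, minus, plus, opp; simpl.
  eapply Rle_lt_trans; [|exact Ht]. apply (re_le_Cmod (f t - a)).
Qed.

Lemma clim_im (f : T -> C) (a : C) : clim F f a -> filterlim (fun t => Im (f t)) F (locally (Im a)).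
Proof.
  intro H. apply filterlim_locally. intro e. generalize (H e (cond_pos e)). apply filter_imp.
  intros t Ht. unfold ball; simpl; unfold AbsRing_ball, abs, minus, plus, opp; simpl.
  eapply Rle_lt_trans; [|exact Ht]. apply (im_le_Cmod (f t - a)).
Qed.

Lemma clim_parts (f : T -> C) (a : C) :
  filterlim (fun t => Re (f t)) F (locally (Re a)) ->
  filterlim (fun t => Im (f t)) F (locally (Im a)) -> clim F f a.
Proof.
  intros H1 H2 e He. assert (He2 : 0 < e / 2) by lra.
  pose proof (proj1 (filterlim_locally _ _) H1 (mkposreal _ He2)) as K1.
  pose proof (proj1 (filterlim_locally _ _) H2 (mkposreal _ He2)) as K2.
  generalize (filter_and _ _ K1 K2). apply filter_imp. intros t [A B].
  change (Rabs (Re (f t) - Re a) < e / 2) in A. change (Rabs (Im (f t) - Im a) < e / 2) in B.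
  eapply Rle_lt_trans; [apply Cmod_le_add|]. rewrite re_minus, im_minus. lra.
Qed.

Lemma clim_RtoC (g : T -> R) (a : R) : filterlim g F (locally a) -> clim F (fun t => RtoC (g t)) a.
Proof. intro H. apply clim_parts; simpl; auto. apply filterlim_const. Qed.

Lemma clim_Cmod (f : T -> C) (a : C) : clim F f a -> filterlim (fun t => Cmod (f t)) F (locally (Cmod a)).
Proof.
  intro H. apply filterlim_locally. intro e. generalize (H e (cond_pos e)). apply filter_imp.
  intros t Ht. change (Rabs (Cmod (f t) - Cmod a) < e).
  pose proof (Cmod_triangle_rev (f t) a). pose proof (Cmod_triangle_rev a (f t)).
  rewrite (Cmod_minus_sym a) in H1. apply Rabs_def1; lra.
Qed.

End Limits.

Lemma clim_comp {S T} (F : (S -> Prop) -> Prop) (G : (T -> Prop) -> Prop) {FF : Filter F} (h : S -> T) (f : T -> C) l :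
  filterlim h F G -> clim G f l -> clim F (fun s => f (h s)) l.
Proof. intros Hh Hf e He. exact (Hh _ (Hf e He)). Qed.

Section Limits2.
Context {T : Type} {F : (T -> Prop) -> Prop} {FF : ProperFilter F}.

Lemma clim_unique (f : T -> C) (a b : C) : clim F f a -> clim F f b -> a = b.
Proof.
  intros Ha Hb. apply Cmod_small_eq. intros e He.
  assert (He2 : 0 < e / 2) by lra.
  destruct (filter_ex _ (filter_and _ _ (Ha _ He2) (Hb _ He2))) as [t [H1 H2]].
  eapply Rle_trans; [apply (Cmod_triangle3 a (f t) b)|]. rewrite (Cmod_minus_sym a). lra.
Qed.

Lemma clim_Cmod_le (f : T -> C) (a : C) M : clim F f a -> F (fun t => Cmod (f t) <= M) -> Cmod a <= M.
Proof.
  intros Ha Hb. apply le_epsilon. intros e He.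
  destruct (filter_ex _ (filter_and _ _ (Ha _ He) Hb)) as [t [H1 H2]].
  pose proof (Cmod_triangle_rev a (f t)). rewrite Cmod_minus_sym in H. lra.
Qed.

Lemma clim_Cmod_le2 (f g : T -> C) (a b : C) : clim F f a -> clim F g b ->
  F (fun t => Cmod (f t) <= Cmod (g t)) -> Cmod a <= Cmod b.
Proof.
  intros Ha Hg Hb. apply le_epsilon. intros e He.
  assert (He2 : 0 < e / 2) by lra.
  destruct (filter_ex _ (filter_and _ _ (filter_and _ _ (Ha _ He2) (Hg _ He2)) Hb)) as [t [[H1 H2] H3]].
  pose proof (Cmod_triangle_rev a (f t)). rewrite Cmod_minus_sym in H.
  pose proof (Cmod_triangle_rev (g t) b). lra.
Qed.
End Limits2.

(** Neighbourhoods are discs for [Cmod], not the squares of the product topology. The bridges to the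
    library's notions are [ex_derive_cder] for derivatives and [C_R_locally] for improper
    integrals. *)
Definition cnb (z : C) (P : C -> Prop) : Prop :=
  exists d : R, 0 < d /\ forall w, Cmod (w - z) < d -> P w.

Global Instance cnb_filter z : ProperFilter (cnb z).
Proof.
  constructor.
  - intros P [d [Hd H]]. exists z. apply H. replace (z - z)%C with (RtoC 0) by ring. now rewrite Cmod_0.
  - constructor.
    + exists 1. split; [lra|auto].
    + intros P Q [d [Hd H]] [d' [Hd' H']]. exists (Rmin d d'). split; [now apply Rmin_glb_lt|].
      intros w Hw. split; [apply H|apply H']; eapply Rlt_le_trans; eauto; [apply Rmin_l|apply Rmin_r].
    + intros P Q HPQ [d [Hd H]]. exists d. split; auto.
Qed.

Lemma cnb_center z P : cnb z P -> P z.
Proof. intros [d [Hd H]]. apply H. replace (z - z)%C with (RtoC 0) by ring. now rewrite Cmod_0. Qed.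

Lemma cnb_ball z r : 0 < r -> cnb z (fun w => Cmod (w - z) < r).
Proof. intro. exists r. auto. Qed.

Lemma cnb_disc z c r : Cmod (z - c) < r -> cnb z (fun w => Cmod (w - c) < r).
Proof.
  intro H. exists (r - Cmod (z - c)). split; [lra|]. intros w Hw.
  eapply Rle_lt_trans; [apply (Cmod_triangle3 w z c)|lra].
Qed.

Definition ccr (f : R -> C) (x : R) := clim (locally x) f (f x).
Definition ccc (f : C -> C) (z : C) := clim (cnb z) f (f z).

Lemma clim_cnb_id z : clim (cnb z) (fun w => w) z.
Proof. intros e He. now apply cnb_ball. Qed.

Lemma clim_cnb_comp {T} (F : (T -> Prop) -> Prop) {FF : Filter F} (f : C -> C) (h : T -> C) (z l : C) :
  clim F h z -> clim (cnb z) f l -> clim F (fun t => f (h t)) l.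
Proof.
  intros Hh Hf e He. destruct (Hf e He) as [d [Hd H]].
  generalize (Hh d Hd). apply filter_imp. auto.
Qed.

Lemma ccr_comp (f : C -> C) (h : R -> C) x : ccr h x -> ccc f (h x) -> ccr (fun t => f (h t)) x.
Proof. intros H1 H2. unfold ccr. now apply (clim_cnb_comp _ f h (h x)). Qed.

Lemma ccr_re f x : ccr f x -> continuous (fun t => Re (f t)) x.
Proof. intro H. exact (clim_re _ _ H). Qed.
Lemma ccr_im f x : ccr f x -> continuous (fun t => Im (f t)) x.
Proof. intro H. exact (clim_im _ _ H). Qed.
Lemma ccr_RtoC g x : continuous g x -> ccr (fun t => RtoC (g t)) x.
Proof. intro H. exact (clim_RtoC _ _ H). Qed.
Lemma ccr_Cmod f x : ccr f x -> continuous (fun t => Cmod (f t)) x.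
Proof. intro H. exact (clim_Cmod _ _ H). Qed.

(* Caratheodory's form of differentiability, for [T = C] with [j] the identity and for [T = R] with [j = RtoC]. *)
Definition gder {T} (F : (T -> Prop) -> Prop) (j : T -> C) (f : T -> C) (x : T) (d : C) : Prop :=
  exists q : T -> C, clim F q d /\ F (fun y => f y = f x + q y * (j y - j x))%C.

Definition cder (f : C -> C) (z d : C) := gder (cnb z) (fun w => w) f z d.
Definition rder (f : R -> C) (x : R) (d : C) := gder (locally x) RtoC f x d.

Section Gder.
Context {T : Type} {F : (T -> Prop) -> Prop} {FF : Filter F} (j : T -> C) (x : T).

Lemma gder_clim (f : T -> C) d : clim F j (j x) -> gder F j f x d -> clim F f (f x).
Proof.
  intros Hj [q [Hq E]].
  apply clim_ext with (f := fun y => (f x + q y * (j y - j x))%C).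
  { generalize E. apply filter_imp. auto. }
  apply clim_eq with (f x + d * (j x - j x))%C; [|ring].
  apply clim_plus; [apply clim_const|]. apply clim_mult; auto. apply clim_minus; auto. apply clim_const.
Qed.

Lemma gder_eq (f : T -> C) a b : gder F j f x a -> a = b -> gder F j f x b.
Proof. now intros H <-. Qed.

Lemma gder_const c : gder F j (fun _ => c) x 0.
Proof.
  exists (fun _ => RtoC 0). split; [apply clim_const|]. apply filter_forall. intro y. ring.
Qed.

Lemma gder_id : gder F j j x 1.
Proof. exists (fun _ => RtoC 1). split; [apply clim_const|]. apply filter_forall. intro y. ring. Qed.

Lemma gder_ext (f g : T -> C) d : F (fun y => f y = g y) -> f x = g x -> gder F j f x d -> gder F j g x d.
Proof.
  intros E Ex [q [Hq Q]]. exists q. split; auto.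
  generalize (filter_and _ _ E Q). apply filter_imp. intros y [<- H]. now rewrite <- Ex.
Qed.

Lemma gder_plus (f g : T -> C) a b :
  gder F j f x a -> gder F j g x b -> gder F j (fun y => f y + g y)%C x (a + b)%C.
Proof.
  intros [p [Hp P]] [q [Hq Q]]. exists (fun y => p y + q y)%C. split; [now apply clim_plus|].
  generalize (filter_and _ _ P Q). apply filter_imp. intros y [-> ->]. ring.
Qed.

Lemma gder_opp (f : T -> C) a : gder F j f x a -> gder F j (fun y => - f y)%C x (- a)%C.
Proof.
  intros [p [Hp P]]. exists (fun y => - p y)%C. split; [now apply clim_opp|].
  generalize P. apply filter_imp. intros y ->. ring.
Qed.

Lemma gder_minus (f g : T -> C) a b :
  gder F j f x a -> gder F j g x b -> gder F j (fun y => f y - g y)%C x (a - b)%C.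
Proof. intros. apply gder_plus; auto. now apply gder_opp. Qed.

Lemma gder_mult (f g : T -> C) a b : clim F j (j x) ->
  gder F j f x a -> gder F j g x b -> gder F j (fun y => f y * g y)%C x (a * g x + f x * b)%C.
Proof.
  intros Hj Hf Hg. pose proof (gder_clim _ _ Hj Hg) as Cg.
  destruct Hf as [p [Hp P]]. destruct Hg as [q [Hq Q]].
  exists (fun y => p y * g y + f x * q y)%C. split.
  { apply clim_plus; apply clim_mult; auto. apply clim_const. }
  generalize (filter_and _ _ P Q). apply filter_imp. intros y [E1 E2].
  rewrite E1. replace (f x * q y)%C with (f x * q y)%C by ring.
  rewrite E2 at 1. rewrite E2. ring.
Qed.

Lemma gder_comp (f : C -> C) (h : T -> C) a b : clim F j (j x) ->
  cder f (h x) a -> gder F j h x b -> gder F j (fun y => f (h y)) x (a * b)%C.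
Proof.
  intros Hj [p [Hp P]] Hh. pose proof (gder_clim _ _ Hj Hh) as Ch. destruct Hh as [q [Hq Q]].
  exists (fun y => p (h y) * q y)%C. split.
  { apply clim_mult; auto. now apply (clim_cnb_comp _ p h (h x)). }
  assert (P' : F (fun y => f (h y) = f (h x) + p (h y) * (h y - h x))%C).
  { destruct P as [d [Hd P]]. generalize (Ch d Hd). apply filter_imp. intros y Hy. now apply P. }
  generalize (filter_and _ _ P' Q). apply filter_imp. intros y [-> E]. rewrite E at 2. ring.
Qed.
End Gder.

Lemma cder_ccc f z d : cder f z d -> ccc f z.
Proof. apply (gder_clim (fun w => w) z f d). apply clim_cnb_id. Qed.

Lemma clim_RtoC_id x : clim (locally x) RtoC (RtoC x).
Proof. apply (clim_RtoC (fun t => t)). apply filterlim_id. Qed.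

Lemma rder_ccr f x d : rder f x d -> ccr f x.
Proof. apply (gder_clim RtoC x f d). apply clim_RtoC_id. Qed.

Lemma cder_inv (z : C) : z <> 0 -> cder (fun w => / w)%C z (- / (z * z))%C.
Proof.
  intro Hz. exists (fun w => - / (w * z))%C. split.
  - apply clim_opp. apply clim_inv; [now apply Cmult_neq_0|].
    apply clim_mult; [apply clim_cnb_id|apply clim_const].
  - exists (Cmod z). split; [now apply Cmod_gt_0|]. intros w Hw.
    assert (w <> 0).
    { intros ->. replace (0 - z)%C with (- z)%C in Hw by ring. rewrite Cmod_opp in Hw. lra. }
    field. auto.
Qed.

Lemma cder_const c z : cder (fun _ => c) z 0. Proof. apply gder_const. Qed.
Lemma cder_id z : cder (fun w => w) z 1. Proof. apply (gder_id (fun w => w)). Qed.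
Lemma cder_plus f g z a b : cder f z a -> cder g z b -> cder (fun w => f w + g w)%C z (a + b)%C.
Proof. apply gder_plus. Qed.
Lemma cder_minus f g z a b : cder f z a -> cder g z b -> cder (fun w => f w - g w)%C z (a - b)%C.
Proof. apply gder_minus. Qed.
Lemma cder_opp f z a : cder f z a -> cder (fun w => - f w)%C z (- a)%C.
Proof. apply gder_opp. Qed.
Lemma cder_mult f g z a b : cder f z a -> cder g z b -> cder (fun w => f w * g w)%C z (a * g z + f z * b)%C.
Proof. apply gder_mult, clim_cnb_id. Qed.
Lemma cder_comp f g z a b : cder f (g z) a -> cder g z b -> cder (fun w => f (g w)) z (a * b)%C.
Proof. apply (gder_comp (fun w => w)), clim_cnb_id. Qed.
Lemma cder_ext f g z d : cnb z (fun w => f w = g w) -> cder f z d -> cder g z d.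
Proof. intros E. apply gder_ext; auto. exact (cnb_center _ _ E). Qed.
Lemma cder_ext_all f g z d : (forall w, f w = g w) -> cder f z d -> cder g z d.
Proof. intros E. apply cder_ext. exists 1. split; [lra|auto]. Qed.
Lemma rder_const c z : rder (fun _ => c) z 0. Proof. apply gder_const. Qed.
Lemma rder_id z : rder RtoC z 1. Proof. apply (gder_id RtoC). Qed.
Lemma rder_plus f g z a b : rder f z a -> rder g z b -> rder (fun w => f w + g w)%C z (a + b)%C.
Proof. apply gder_plus. Qed.
Lemma rder_mult f g z a b : rder f z a -> rder g z b -> rder (fun w => f w * g w)%C z (a * g z + f z * b)%C.
Proof. apply gder_mult, clim_RtoC_id. Qed.
Lemma rder_comp f g z a b : cder f (g z) a -> rder g z b -> rder (fun w => f (g w)) z (a * b)%C.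
Proof. apply gder_comp, clim_RtoC_id. Qed.

Lemma cder_div f g z a b : cder f z a -> cder g z b -> g z <> 0 ->
  cder (fun w => f w / g w)%C z ((a * g z - f z * b) / (g z * g z))%C.
Proof.
  intros Hf Hg Hz.
  replace ((a * g z - f z * b) / (g z * g z))%C
    with (a * / g z + f z * (- / (g z * g z) * b))%C by (field; auto).
  apply (cder_mult f (fun w => / g w)%C); auto. apply (cder_comp (fun w => / w)%C g); auto.
  now apply cder_inv.
Qed.

Lemma cder_pow f z d n : cder f z d -> cder (fun w => f w ^ n)%C z (RtoC (INR n) * f z ^ (pred n) * d)%C.
Proof.
  intro H. induction n.
  - simpl. replace (RtoC 0 * 1 * d)%C with (RtoC 0) by ring. apply cder_const.
  - replace (RtoC (INR (S n)) * f z ^ pred (S n) * d)%C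
      with (d * f z ^ n + f z * (RtoC (INR n) * f z ^ pred n * d))%C.
    + apply (cder_mult f (fun w => f w ^ n)%C); auto.
    + rewrite S_INR, RtoC_plus. simpl pred. destruct n; simpl; ring.
Qed.

Lemma cder_unique f z a b : cder f z a -> cder f z b -> a = b.
Proof.
  intros [p [Hp P]] [q [Hq Q]].
  apply Cmod_small_eq. intros e He. assert (He2 : 0 < e / 2) by lra.
  destruct (filter_and _ _ (filter_and _ _ (Hp _ He2) (Hq _ He2)) (filter_and _ _ P Q)) as [d [Hd H]].
  destruct (H (z + RtoC (d / 2))%C) as [[H1 H2] [E1 E2]].
  { replace (z + RtoC (d/2) - z)%C with (RtoC (d/2)) by ring. rewrite Cmod_R, Rabs_right; lra. }
  set (w := (z + RtoC (d / 2))%C) in *.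
  assert (E : p w = q w).
  { assert (Hw : (w - z <> 0)%C).
    { unfold w. replace (z + RtoC (d/2) - z)%C with (RtoC (d/2)) by ring. apply RtoC_neq0. lra. }
    assert (p w * (w - z) = q w * (w - z))%C.
    { apply (f_equal (fun t => t - f z)%C) in E1. rewrite E2 in E1 at 1.
      replace (p w * (w - z))%C with (f z + p w * (w - z) - f z)%C by ring. rewrite <- E1. ring. }
    replace (p w) with (p w * (w - z) / (w - z))%C by (field; auto). rewrite H0. field; auto. }
  eapply Rle_trans; [apply (Cmod_triangle3 a (p w) b)|]. rewrite (Cmod_minus_sym a).
  rewrite E at 2. lra.
Qed.

Lemma cder_eps f z d : (forall e, 0 < e -> cnb z (fun w => Cmod (f w - f z - d * (w - z)) <= e * Cmod (w - z))) ->
  cder f z d.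
Proof.
  intro H. exists (fun w => if excluded_middle_informative (w = z) then d else (f w - f z) / (w - z))%C. split.
  - intros e He. assert (He2 : 0 < e / 2) by lra. generalize (H _ He2). apply filter_imp. intros w Hw.
    destruct (excluded_middle_informative (w = z)) as [_|n].
    + replace (d - d)%C with (RtoC 0) by ring. now rewrite Cmod_0.
    + assert (Hn : (w - z <> 0)%C). { intro E. apply n. replace w with (w - z + z)%C by ring. rewrite E. ring. }
      replace ((f w - f z) / (w - z) - d)%C with ((f w - f z - d * (w - z)) * / (w - z))%C by (field; auto).
      rewrite Cmod_mult, Cmod_inv; auto. assert (0 < Cmod (w - z)) by now apply Cmod_gt_0.
      apply Rle_lt_trans with (e / 2); [|lra].
      apply Rmult_le_reg_r with (Cmod (w - z)); auto. rewrite Rmult_assoc, Rinv_l; lra.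
  - apply filter_forall. intro w. destruct (excluded_middle_informative (w = z)) as [->|n]; [ring|].
    assert (Hn : (w - z <> 0)%C). { intro E. apply n. replace w with (w - z + z)%C by ring. rewrite E. ring. }
    field. auto.
Qed.

Lemma cder_eps_inv f z d : cder f z d ->
  forall e, 0 < e -> cnb z (fun w => Cmod (f w - f z - d * (w - z)) <= e * Cmod (w - z)).
Proof.
  intros [q [Hq Q]] e He. generalize (filter_and _ _ (Hq e He) Q). apply filter_imp.
  intros w [H1 ->]. replace (f z + q w * (w - z) - f z - d * (w - z))%C with ((q w - d) * (w - z))%C by ring.
  rewrite Cmod_mult. apply Rmult_le_compat_r; [apply Cmod_ge_0|lra].
Qed.

(** A quadratic remainder is the form in which derivatives of integrals are found below: an identity
    for the integrand with a remainder bounded uniformly in the parameter replaces every theorem on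
    differentiation under the integral sign. *)
Lemma cder_quad f z d K r : 0 < r ->
  (forall w, Cmod (w - z) < r -> Cmod (f w - f z - d * (w - z)) <= K * (Cmod (w - z) * Cmod (w - z))) -> cder f z d.
Proof.
  intros Hr H. apply cder_eps. intros e He. set (K' := Rabs K + 1).
  assert (HK : 0 < K') by (unfold K'; pose proof (Rabs_pos K); lra).
  exists (Rmin r (e / K')). split; [apply Rmin_glb_lt; auto; now apply Rdiv_lt_0_compat|].
  intros w Hw. pose proof (Rmin_l r (e / K')). pose proof (Rmin_r r (e / K')).
  eapply Rle_trans; [apply H; lra|]. set (t := Cmod (w - z)) in *.
  assert (0 <= t) by apply Cmod_ge_0.
  assert (K' * t <= e).
  { apply Rle_trans with (K' * (e / K')); [apply Rmult_le_compat_l; lra|]. right. field. lra. }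
  rewrite <- Rmult_assoc. apply Rmult_le_compat_r; auto. pose proof (Rle_abs K). unfold K' in *. nra.
Qed.

Lemma rder_re f x d : rder f x d -> is_derive (fun t => Re (f t)) x (Re d).
Proof.
  intros [q [Hq Q]]. apply is_derive_Reals. intros e He.
  destruct (filter_and _ _ (Hq e He) Q) as [dd H]. exists dd. intros h Hh0 Hh.
  destruct (H (x + h)) as [H1 H2].
  { change (Rabs (x + h - x) < dd).
    replace (x + h - x) with h by ring. exact Hh. }
  rewrite H2. replace ((RtoC (x + h) - RtoC x)%C) with (RtoC h) by (rewrite RtoC_plus; ring).
  rewrite re_plus, re_mult, re_RtoC, im_RtoC.
  replace ((Re (f x) + (Re (q (x + h)) * h - Im (q (x + h)) * 0) - Re (f x)) / h - Re d)
    with (Re (q (x + h)%R - d)%C) by (rewrite re_minus; field; auto).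
  eapply Rle_lt_trans; [apply re_le_Cmod|exact H1].
Qed.

Lemma rder_im f x d : rder f x d -> is_derive (fun t => Im (f t)) x (Im d).
Proof.
  intros H.
  (* The imaginary part of [f] is the real part of [- i f]. *)
  assert (H2 : rder (fun t => - Ci * f t)%C x (- Ci * d)%C).
  { replace (- Ci * d)%C with (0 * f x + - Ci * d)%C by ring.
    apply (rder_mult (fun _ => - Ci)%C f); auto. apply rder_const. }
  apply rder_re in H2. rewrite re_mult in H2. simpl in H2.
  replace (Im d) with (- 0 * Re d - - (1) * Im d) by (simpl; ring).
  eapply is_derive_ext; [|exact H2]. intro t. simpl. unfold Im. ring.
Qed.

Lemma is_derive_carath (g : R -> R) x d : is_derive g x d -> rder (fun t => RtoC (g t)) x (RtoC d).
Proof.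
  intro H. apply is_derive_Reals in H.
  exists (fun y => RtoC (if Req_EM_T y x then d else (g y - g x) / (y - x))). split.
  - intros e He. destruct (H e He) as [dd Hd]. exists dd. intros y Hy.
    change (Rabs (y - x) < dd) in Hy.
    rewrite <- RtoC_minus, Cmod_R. destruct (Req_EM_T y x) as [_|n].
    + unfold Rminus. rewrite Rplus_opp_r, Rabs_R0. exact He.
    + specialize (Hd (y - x)). replace (x + (y - x)) with y in Hd by exact (eq_sym (Rplus_minus x y)). apply Hd; auto. lra.
  - apply filter_forall. refine (fun y : R => _). cbv beta. rewrite <- RtoC_minus, <- RtoC_mult, <- RtoC_plus. f_equal.
    destruct (Req_EM_T y x) as [->|n]; [ring|]. field. intro E. apply n. lra.
Qed.

Lemma rder_parts (f : R -> C) (x : R) d : is_derive (fun t => Re (f t)) x (Re d) -> is_derive (fun t => Im (f t)) x (Im d) -> rder f x d.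
Proof.
  intros H1 H2. apply is_derive_carath in H1. apply is_derive_carath in H2.
  apply gder_ext with (f := fun t => (RtoC (Re (f t)) + Ci * RtoC (Im (f t)))%C).
  - apply filter_forall. intro y. apply Ceq_parts; simpl; ring.
  - apply Ceq_parts; simpl; ring.
  - apply gder_eq with (RtoC (Re d) + (0 * RtoC (Im (f x)) + Ci * RtoC (Im d)))%C.
    + apply (rder_plus _ (fun t => Ci * RtoC (Im (f t)))%C); auto.
      apply (rder_mult (fun _ => Ci) (fun t => RtoC (Im (f t)))); auto. apply rder_const.
    + apply Ceq_parts; simpl; ring.
Qed.

(** Links [entire], as it occurs in the definition of [xi], with the derivatives used everywhere
    else. *)
Lemma ex_derive_cder (f : C -> C) (z : C) : @ex_derive C_AbsRing C_NormedModule f z <-> exists d, cder f z d.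
Proof.
  split.
  - intros [d [_ Hd]]. exists d. apply cder_eps. intros e He.
    specialize (Hd z (fun P H => H) (mkposreal e He)). destruct Hd as [dd Hdd].
    exists dd. split; [apply cond_pos|]. intros w Hw. specialize (Hdd w Hw).
    simpl in Hdd. unfold minus, plus, opp, scal, norm in Hdd. simpl in Hdd.
    replace (f w - f z - d * (w - z))%C with (f w + - f z + - ((w + - z) * d))%C by ring. exact Hdd.
  - intros [d Hd]. exists d. split; [apply is_linear_scal_l|]. intros y Hy e.
    assert (y = z) by (symmetry; exact (@is_filter_lim_locally_unique C_AbsRing (AbsRing_NormedModule C_AbsRing) z y Hy)).
    subst y. destruct (cder_eps_inv _ _ _ Hd e (cond_pos e)) as [dd [Hdd H]].
    exists (mkposreal dd Hdd). intros w Hw. specialize (H w Hw).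
    change (Cmod (f w - f z - (w - z) * d)%C <= e * Cmod (w - z)%C).
    rewrite (Cmult_comm (w - z)). exact H.
Qed.

(** * Integrals and the complex exponential *)

(** Componentwise, so that real integration applies directly; [is_RInt_cint] returns to the integral
    of the normed module [C]. *)
Definition cint (f : R -> C) (a b : R) : C :=
  (RInt (fun t => Re (f t)) a b, RInt (fun t => Im (f t)) a b).

Definition conab (f : R -> C) (a b : R) := forall x, Rmin a b <= x <= Rmax a b -> ccr f x.

Lemma conab_all f a b : (forall x, ccr f x) -> conab f a b.
Proof. intros H x _. apply H. Qed.

Lemma ccr_const c x : ccr (fun _ => c) x. Proof. apply clim_const. Qed.
Lemma ccr_plus f g x : ccr f x -> ccr g x -> ccr (fun t => f t + g t)%C x. Proof. apply clim_plus. Qed.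
Lemma ccr_minus f g x : ccr f x -> ccr g x -> ccr (fun t => f t - g t)%C x. Proof. apply clim_minus. Qed.
Lemma ccr_opp f x : ccr f x -> ccr (fun t => - f t)%C x. Proof. apply clim_opp. Qed.
Lemma ccr_mult f g x : ccr f x -> ccr g x -> ccr (fun t => f t * g t)%C x. Proof. apply clim_mult. Qed.
Lemma ccr_div f g x : ccr f x -> ccr g x -> g x <> 0 -> ccr (fun t => f t / g t)%C x.
Proof. intros. apply clim_mult; auto. now apply clim_inv. Qed.
Lemma ccr_pow f n x : ccr f x -> ccr (fun t => f t ^ n)%C x. Proof. apply clim_pow. Qed.
Lemma ccr_id x : ccr RtoC x. Proof. apply clim_RtoC_id. Qed.
Lemma ccc_const c z : ccc (fun _ => c) z. Proof. apply clim_const. Qed.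
Lemma ccc_id z : ccc (fun w => w) z. Proof. apply clim_cnb_id. Qed.
Lemma ccc_plus f g z : ccc f z -> ccc g z -> ccc (fun t => f t + g t)%C z. Proof. apply clim_plus. Qed.
Lemma ccc_minus f g z : ccc f z -> ccc g z -> ccc (fun t => f t - g t)%C z. Proof. apply clim_minus. Qed.
Lemma ccc_opp f z : ccc f z -> ccc (fun t => - f t)%C z. Proof. apply clim_opp. Qed.
Lemma ccc_mult f g z : ccc f z -> ccc g z -> ccc (fun t => f t * g t)%C z. Proof. apply clim_mult. Qed.
Lemma ccc_comp f g z : ccc f (g z) -> ccc g z -> ccc (fun w => f (g w)) z.
Proof. intros H1 H2. unfold ccc. now apply (clim_cnb_comp _ f g (g z)). Qed.
Lemma ccc_re z : ccc (fun w => RtoC (Re w)) z.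
Proof. apply clim_RtoC. exact (clim_re _ _ (clim_cnb_id z)). Qed.
Lemma ccc_im z : ccc (fun w => RtoC (Im w)) z.
Proof. apply clim_RtoC. exact (clim_im _ _ (clim_cnb_id z)). Qed.
Lemma ccc_RtoC (g : R -> R) (h : C -> R) z : continuous g (h z) -> ccc (fun w => RtoC (h w)) z ->
  ccc (fun w => RtoC (g (h w))) z.
Proof.
  intros Hg Hh. apply clim_RtoC. apply filterlim_comp with (G := locally (h z)); [|exact Hg].
  exact (clim_re _ _ Hh).
Qed.
Lemma ccc_of_ccr (f : R -> C) (h : C -> R) z : ccr f (h z) -> ccc (fun w => RtoC (h w)) z -> ccc (fun w => f (h w)) z.
Proof. intros Hf Hh. apply (clim_comp _ (locally (h z))); [|exact Hf]. exact (clim_re _ _ Hh). Qed.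

Section Cint.
Variables (a b : R).

Lemma cint_ex_re f : conab f a b -> ex_RInt (fun t => Re (f t)) a b.
Proof. intro H. apply (ex_RInt_continuous (V := R_CompleteNormedModule)). intros z Hz. apply ccr_re. auto. Qed.
Lemma cint_ex_im f : conab f a b -> ex_RInt (fun t => Im (f t)) a b.
Proof. intro H. apply (ex_RInt_continuous (V := R_CompleteNormedModule)). intros z Hz. apply ccr_im. auto. Qed.

Lemma cint_ext f g : (forall x, Rmin a b <= x <= Rmax a b -> f x = g x) -> cint f a b = cint g a b.
Proof. intro H. unfold cint. f_equal; apply RInt_ext; intros x Hx; rewrite H; auto; lra. Qed.

Lemma cint_plus f g : conab f a b -> conab g a b ->
  cint (fun t => f t + g t)%C a b = (cint f a b + cint g a b)%C.
Proof.
  intros Hf Hg. apply Ceq_parts.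
  - exact (RInt_plus (V := R_CompleteNormedModule) _ _ a b (cint_ex_re f Hf) (cint_ex_re g Hg)).
  - exact (RInt_plus (V := R_CompleteNormedModule) _ _ a b (cint_ex_im f Hf) (cint_ex_im g Hg)).
Qed.

Lemma cint_scal c f : conab f a b -> cint (fun t => c * f t)%C a b = (c * cint f a b)%C.
Proof.
  intros Hf. pose proof (cint_ex_re f Hf) as H1. pose proof (cint_ex_im f Hf) as H2.
  assert (E1 : forall k, RInt (fun t => k * Re (f t)) a b = k * RInt (fun t => Re (f t)) a b)
    by (intro k; exact (RInt_scal (V := R_CompleteNormedModule) _ a b k H1)).
  assert (E2 : forall k, RInt (fun t => k * Im (f t)) a b = k * RInt (fun t => Im (f t)) a b)
    by (intro k; exact (RInt_scal (V := R_CompleteNormedModule) _ a b k H2)).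
  apply Ceq_parts.
  - rewrite re_mult. unfold cint; cbn [Re Im fst snd]. rewrite <- E1, <- E2.
    exact (RInt_minus (V := R_CompleteNormedModule) _ _ a b (ex_RInt_scal _ a b (Re c) H1) (ex_RInt_scal _ a b (Im c) H2)).
  - rewrite im_mult. unfold cint; cbn [Re Im fst snd]. rewrite <- E1, <- E2.
    exact (RInt_plus (V := R_CompleteNormedModule) _ _ a b (ex_RInt_scal _ a b (Re c) H2) (ex_RInt_scal _ a b (Im c) H1)).
Qed.

Lemma conab_scal c f : conab f a b -> conab (fun t => c * f t)%C a b.
Proof. intros H x Hx. apply ccr_mult; auto. apply ccr_const. Qed.

Lemma cint_minus f g : conab f a b -> conab g a b ->
  cint (fun t => f t - g t)%C a b = (cint f a b - cint g a b)%C.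
Proof.
  intros Hf Hg. apply Ceq_parts.
  - exact (RInt_minus (V := R_CompleteNormedModule) _ _ a b (cint_ex_re f Hf) (cint_ex_re g Hg)).
  - exact (RInt_minus (V := R_CompleteNormedModule) _ _ a b (cint_ex_im f Hf) (cint_ex_im g Hg)).
Qed.

Lemma cint_const c : cint (fun _ => c) a b = (c * RtoC (b - a))%C.
Proof.
  unfold cint. rewrite !RInt_const. apply Ceq_parts.
  - rewrite re_mult. simpl. unfold scal; simpl; unfold mult; simpl. ring.
  - rewrite im_mult. simpl. unfold scal; simpl; unfold mult; simpl. ring.
Qed.

End Cint.

Lemma cint_conj f a b : conab f a b -> cint (fun t => Cconj (f t)) a b = Cconj (cint f a b).
Proof.
  intro H. unfold cint, Cconj; simpl. f_equal.
  exact (RInt_opp (V := R_CompleteNormedModule) _ a b (cint_ex_im a b f H)).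
Qed.

Lemma cint_Chasles f a b c : conab f a b -> conab f b c -> (cint f a b + cint f b c)%C = cint f a c.
Proof.
  intros H1 H2. apply Ceq_parts.
  - exact (RInt_Chasles (V := R_CompleteNormedModule) _ a b c (cint_ex_re a b f H1) (cint_ex_re b c f H2)).
  - exact (RInt_Chasles (V := R_CompleteNormedModule) _ a b c (cint_ex_im a b f H1) (cint_ex_im b c f H2)).
Qed.

(** Multiplication by the unit number [c], conjugate to the phase of the integral, makes the
    integral real and nonnegative; then [Re (c f) <= |f|] is integrated. *)
Lemma cint_norm_int f a b : a <= b -> conab f a b -> Cmod (cint f a b) <= RInt (fun t => Cmod (f t)) a b.
Proof.
  intros Hab Hf.
  assert (HC : ex_RInt (fun t => Cmod (f t)) a b).
  { apply (ex_RInt_continuous (V := R_CompleteNormedModule)). intros z Hz. apply ccr_Cmod. auto. }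
  destruct (Req_dec (Cmod (cint f a b)) 0) as [E|E].
  - rewrite E. apply RInt_ge_0; auto. intros. apply Cmod_ge_0.
  - set (I := cint f a b) in *. pose proof (Cmod_ge_0 I).
    set (c := (Cconj I / RtoC (Cmod I))%C).
    assert (Hc : Cmod c = 1).
    { unfold c. rewrite Cmod_div, Cmod_conj, Cmod_R, Rabs_right; [|lra|now apply RtoC_neq0]. field. auto. }
    assert (HI : (c * I = RtoC (Cmod I))%C).
    { unfold c. replace (Cconj I / RtoC (Cmod I) * I)%C with (I * Cconj I / RtoC (Cmod I))%C by (field; now apply RtoC_neq0).
      rewrite <- Cmod2_conj, RtoC_pow. field. now apply RtoC_neq0. }
    replace (Cmod I) with (Re (c * I)) by (rewrite HI; reflexivity).
    clearbody c. unfold I. rewrite <- cint_scal; auto.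
    change (RInt (fun t => Re (c * f t)%C) a b <= RInt (fun t => Cmod (f t)) a b).
    apply RInt_le; auto.
    + exact (cint_ex_re a b _ (conab_scal a b c f Hf)).
    + intros x Hx. eapply Rle_trans; [apply re_le|]. rewrite Cmod_mult, Hc. lra.
Qed.

Lemma cint_norm f a b M : a <= b -> conab f a b -> (forall x, a <= x <= b -> Cmod (f x) <= M) ->
  Cmod (cint f a b) <= M * (b - a).
Proof.
  intros Hab Hf HM. eapply Rle_trans; [now apply cint_norm_int|].
  replace (M * (b - a)) with (RInt (fun _ => M) a b) by (rewrite RInt_const; unfold scal; simpl; unfold mult; simpl; ring).
  apply RInt_le; auto.
  - apply (ex_RInt_continuous (V := R_CompleteNormedModule)). intros z Hz. apply ccr_Cmod. auto.
  - apply ex_RInt_const.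
  - intros x Hx. apply HM. lra.
Qed.

Lemma cint_ftc F f a b : (forall x, Rmin a b <= x <= Rmax a b -> rder F x (f x)) -> conab f a b ->
  cint f a b = (F b - F a)%C.
Proof.
  intros HF Hf. apply Ceq_parts; unfold cint; simpl.
  - apply is_RInt_unique. apply (is_RInt_derive (fun t => Re (F t))).
    + intros x Hx. now apply rder_re, HF.
    + intros x Hx. now apply ccr_re, Hf.
  - apply is_RInt_unique. apply (is_RInt_derive (fun t => Im (F t))).
    + intros x Hx. now apply rder_im, HF.
    + intros x Hx. now apply ccr_im, Hf.
Qed.

(** The factor [u] stays outside the left integral, which covers [u = 0] and lets a negative [u]
    reverse the ends. *)
Lemma cint_comp_lin f u v a b : conab f (u * a + v) (u * b + v) ->
  (RtoC u * cint (fun t => f (u * t + v)%R) a b)%C = cint f (u * a + v) (u * b + v).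
Proof.
  intro H.
  assert (Hc : forall g : R -> R, ex_RInt g (u * a + v) (u * b + v) ->
     u * RInt (fun t => g (u * t + v)) a b = RInt g (u * a + v) (u * b + v)).
  { intros g Hg. pose proof (RInt_comp_lin (V := R_CompleteNormedModule) g u v a b Hg) as E.
    destruct (Req_dec u 0) as [->|Hu].
    - rewrite !Rmult_0_l, RInt_point. reflexivity.
    - rewrite <- E. symmetry.
      apply (RInt_scal (V := R_CompleteNormedModule) (fun t => g (u * t + v)) a b u).
      apply (ex_RInt_ext (fun t => scal (/ u) (scal u (g (u * t + v))))).
      { intros x _. unfold scal; simpl; unfold mult; simpl. field. auto. }
      apply (ex_RInt_scal (V := R_NormedModule)). now apply (ex_RInt_comp_lin (V := R_NormedModule)). }
  apply Ceq_parts.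
  - rewrite re_mult. unfold cint; cbn [Re Im fst snd RtoC]. rewrite Rmult_0_l, Rminus_0_r.
    now apply (Hc (fun t => Re (f t))), cint_ex_re.
  - rewrite im_mult. unfold cint; cbn [Re Im fst snd RtoC]. rewrite Rmult_0_l, Rplus_0_r.
    now apply (Hc (fun t => Im (f t))), cint_ex_im.
Qed.

Lemma cint_point f a : cint f a a = RtoC 0.
Proof. unfold cint. rewrite !RInt_point. reflexivity. Qed.

(** * The complex exponential *)

Lemma cexp_plus (z w : C) : cexp (z + w) = (cexp z * cexp w)%C.
Proof.
  destruct z, w. unfold cexp. apply Ceq_parts; simpl; rewrite exp_plus, ?cos_plus, ?sin_plus; ring.
Qed.

Lemma cexp_0 : cexp 0 = RtoC 1.
Proof. unfold cexp. simpl. rewrite exp_0, cos_0, sin_0. apply Ceq_parts; simpl; ring. Qed.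

Lemma Cmod_cexp z : Cmod (cexp z) = exp (Re z).
Proof.
  unfold cexp, Cmod. simpl.
  replace (_ + _) with (exp (Re z) * exp (Re z) * (Rsqr (sin (Im z)) + Rsqr (cos (Im z)))) by (unfold Rsqr; ring).
  rewrite sin2_cos2, Rmult_1_r. apply sqrt_square. left. apply exp_pos.
Qed.

Lemma cexp_neq0 z : cexp z <> 0.
Proof. apply Cmod_gt_0. rewrite Cmod_cexp. apply exp_pos. Qed.

Lemma cexp_opp z : cexp (- z) = (/ cexp z)%C.
Proof.
  assert (cexp (- z) * cexp z = 1)%C by (rewrite <- cexp_plus, <- cexp_0; f_equal; ring).
  replace (cexp (- z)) with (cexp (- z) * cexp z * / cexp z)%C by (field; apply cexp_neq0).
  rewrite H. field. apply cexp_neq0.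
Qed.

Lemma cexp_RtoC x : cexp (RtoC x) = RtoC (exp x).
Proof. unfold cexp. simpl. rewrite cos_0, sin_0. apply Ceq_parts; simpl; ring. Qed.

Lemma cexp_conj z : cexp (Cconj z) = Cconj (cexp z).
Proof. destruct z. unfold cexp, Cconj. simpl. rewrite cos_neg, sin_neg. apply Ceq_parts; simpl; ring. Qed.

Lemma cexp_Ci x : cexp (Ci * RtoC x) = (cos x, sin x).
Proof.
  unfold cexp. simpl. replace (0 * x - 1 * 0) with 0 by ring. replace (0 * 0 + 1 * x) with x by ring.
  rewrite exp_0. apply Ceq_parts; simpl; ring.
Qed.

Lemma cexp_pow z n : (cexp z ^ n)%C = cexp (RtoC (INR n) * z).
Proof.
  induction n.
  - simpl. rewrite Cmult_0_l, cexp_0. reflexivity.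
  - rewrite Cpow_S, IHn, S_INR, RtoC_plus, <- cexp_plus. f_equal. ring.
Qed.

Lemma exp_mono x y : x <= y -> exp x <= exp y.
Proof. intros [H | ->]; [left; now apply exp_increasing|right; reflexivity]. Qed.

Lemma rder_cexp_line (h : C) (t : R) : rder (fun t => cexp (RtoC t * h)) t (h * cexp (RtoC t * h))%C.
Proof.
  destruct h as [p q].
  apply rder_parts; unfold cexp; simpl.
  - auto_derive; auto. unfold Rminus; ring.
  - auto_derive; auto. unfold Rminus; ring.
Qed.

Lemma cexp_m1_bound (h : C) : Cmod (cexp h - 1) <= Cmod h * exp (Cmod h).
Proof.
  assert (Hc : conab (fun t => h * cexp (RtoC t * h))%C 0 1).
  { intros x _. apply ccr_mult; [apply ccr_const|]. exact (rder_ccr _ _ _ (rder_cexp_line h x)). }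
  pose proof (cint_ftc _ _ 0 1 (fun x _ => rder_cexp_line h x) Hc) as E.
  cbv beta in E. rewrite Cmult_1_l, Cmult_0_l, cexp_0 in E. rewrite <- E.
  replace (Cmod h * exp (Cmod h)) with (Cmod h * exp (Cmod h) * (1 - 0)) by ring.
  apply cint_norm; auto; [lra|]. intros x Hx. rewrite Cmod_mult, Cmod_cexp.
  apply Rmult_le_compat_l; [apply Cmod_ge_0|].
  apply exp_mono. eapply Rle_trans; [apply re_le|]. rewrite Cmod_mult, Cmod_pos_RtoC; [|lra].
  pose proof (Cmod_ge_0 h). nra.
Qed.

(** The difference is the integral over [[0, 1]] of [h (cexp (t h) - 1)], to which the first order
    bound applies. *)
Lemma cexp_m1h_bound (h : C) : Cmod (cexp h - 1 - h) <= Cmod h * Cmod h * exp (Cmod h).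
Proof.
  set (F := fun t : R => (cexp (RtoC t * h) + (- h) * RtoC t)%C).
  assert (HF : forall x, rder F x (h * (cexp (RtoC x * h) - 1))%C).
  { intro x. unfold F. eapply gder_eq.
    - apply rder_plus; [apply rder_cexp_line|]. apply (rder_mult (fun _ => - h)%C RtoC); [apply rder_const|apply rder_id].
    - simpl. ring. }
  assert (Hc : conab (fun t => h * (cexp (RtoC t * h) - 1))%C 0 1).
  { intros x _. apply ccr_mult; [apply ccr_const|]. apply ccr_minus; [|apply ccr_const].
    exact (rder_ccr _ _ _ (rder_cexp_line h x)). }
  pose proof (cint_ftc F _ 0 1 (fun x _ => HF x) Hc) as E.
  unfold F in E. cbv beta in E. rewrite Cmult_1_l, Cmult_0_l, cexp_0 in E.
  replace (cexp h - 1 - h)%C with (cexp h + - h * 1 - (1 + - h * 0))%C by ring. rewrite <- E.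
  replace (Cmod h * Cmod h * exp (Cmod h)) with (Cmod h * (Cmod h * exp (Cmod h)) * (1 - 0)) by ring.
  apply cint_norm; auto; [lra|]. intros x Hx. rewrite Cmod_mult.
  apply Rmult_le_compat_l; [apply Cmod_ge_0|].
  eapply Rle_trans; [apply cexp_m1_bound|]. rewrite Cmod_mult, Cmod_pos_RtoC; [|lra].
  pose proof (Cmod_ge_0 h). apply Rmult_le_compat; try nra. left; apply exp_pos. apply exp_mono. nra.
Qed.

Lemma cder_cexp z : cder cexp z (cexp z).
Proof.
  apply cder_quad with (K := Cmod (cexp z) * exp 1) (r := 1); [lra|]. intros w Hw.
  replace (cexp w - cexp z - cexp z * (w - z))%C with (cexp z * (cexp (w - z) - 1 - (w - z)))%C.
  2:{ replace (cexp w) with (cexp z * cexp (w - z))%C; [ring|]. rewrite <- cexp_plus. f_equal. ring. }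
  rewrite Cmod_mult, Rmult_assoc. apply Rmult_le_compat_l; [apply Cmod_ge_0|].
  eapply Rle_trans; [apply cexp_m1h_bound|]. rewrite Rmult_comm.
  apply Rmult_le_compat_r; [pose proof (Cmod_ge_0 (w - z)); nra|]. apply exp_mono. lra.
Qed.

Lemma ccc_cexp z : ccc cexp z.
Proof. exact (cder_ccc _ _ _ (cder_cexp z)). Qed.

Lemma ccr_cexp f x : ccr f x -> ccr (fun t => cexp (f t)) x.
Proof. intro. apply (ccr_comp cexp f); auto. apply ccc_cexp. Qed.

Lemma ccc_cexp_comp f z : ccc f z -> ccc (fun w => cexp (f w)) z.
Proof. intro. apply (ccc_comp cexp f); auto. apply ccc_cexp. Qed.

Ltac ccont := repeat match goal with
  | H : ?G |- ?G => exact H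
  | |- ccr (fun _ => ?c) _ => apply ccr_const
  | |- ccr RtoC _ => apply ccr_id
  | |- ccr (fun t => RtoC t) _ => apply ccr_id
  | |- ccr (fun t => (@?f t + @?g t)%C) _ => apply (ccr_plus f g)
  | |- ccr (fun t => (@?f t - @?g t)%C) _ => apply (ccr_minus f g)
  | |- ccr (fun t => (@?f t * @?g t)%C) _ => apply (ccr_mult f g)
  | |- ccr (fun t => (- @?f t)%C) _ => apply (ccr_opp f)
  | |- ccr (fun t => (@?f t ^ ?n)%C) _ => apply (ccr_pow f n)
  | |- ccr (fun t => cexp (@?f t)) _ => apply (ccr_cexp f)
  | |- ccr (fun t => RtoC (@?f t)) _ => apply (ccr_RtoC f)
  | |- ccc (fun _ => ?c) _ => apply ccc_const
  | |- ccc (fun w => w) _ => apply ccc_id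
  | |- ccc (fun w => RtoC (Re w)) _ => apply ccc_re
  | |- ccc (fun w => RtoC (Im w)) _ => apply ccc_im
  | |- ccc (fun w => (@?f w + @?g w)%C) _ => apply (ccc_plus f g)
  | |- ccc (fun w => (@?f w - @?g w)%C) _ => apply (ccc_minus f g)
  | |- ccc (fun w => (@?f w * @?g w)%C) _ => apply (ccc_mult f g)
  | |- ccc (fun w => (- @?f w)%C) _ => apply (ccc_opp f)
  | |- ccc (fun w => cexp (@?f w)) _ => apply (ccc_cexp_comp f)
  end.

Ltac rcont := apply (ex_derive_continuous (V := R_NormedModule)); auto_derive; auto.

(** * Theorems of Goursat and Cauchy *)

Section Cousin.
Variable P : R -> R -> R -> R -> Prop.

Let quad := (R * R * (R * R))%type.
Let PQ (s : quad) := let '((a, b), (c, d)) := s in P a b c d.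
Let wf (s : quad) := let '((a, b), (c, d)) := s in a <= b /\ c <= d.
Let half (s t : quad) : Prop :=
  let '((a, b), (c, d)) := s in let '((a', b'), (c', d')) := t in
  a <= a' /\ b' <= b /\ c <= c' /\ d' <= d /\ b' - a' = (b - a) / 2 /\ d' - c' = (d - c) / 2.

Hypothesis split : forall a b c d, a <= b -> c <= d ->
  P a ((a + b) / 2) c ((c + d) / 2) -> P ((a + b) / 2) b c ((c + d) / 2) ->
  P a ((a + b) / 2) ((c + d) / 2) d -> P ((a + b) / 2) b ((c + d) / 2) d -> P a b c d.

Lemma bisect_step (s : quad) : wf s -> ~ PQ s -> exists t, wf t /\ half s t /\ ~ PQ t.
Proof.
  destruct s as [[a b] [c d]]. simpl. intros [Hab Hcd] H.
  apply NNPP. intro K. apply H. apply split; auto; apply NNPP; intro N; apply K.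
  - exists ((a, (a + b) / 2), (c, (c + d) / 2)). simpl. repeat split; auto; lra.
  - exists (((a + b) / 2, b), (c, (c + d) / 2)). simpl. repeat split; auto; lra.
  - exists ((a, (a + b) / 2), ((c + d) / 2, d)). simpl. repeat split; auto; lra.
  - exists (((a + b) / 2, b), ((c + d) / 2, d)). simpl. repeat split; auto; lra.
Qed.

Lemma nested_point (a b : nat -> R) L : (forall n, a n <= a (S n)) -> (forall n, b (S n) <= b n) ->
  (forall n, a n <= b n) -> (forall n, b n - a n = L / 2 ^ n) ->
  exists u, (forall n, a n <= u <= b n).
Proof.
  intros Ha Hb Hab HL.
  assert (Ha' : forall n m, (n <= m)%nat -> a n <= a m).
  { intros n m H. induction H; [lra|]. specialize (Ha m). lra. }
  assert (Hb' : forall n m, (n <= m)%nat -> b m <= b n).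
  { intros n m H. induction H; [lra|]. specialize (Hb m). lra. }
  assert (Hx : forall n m, a n <= b m).
  { intros n m. destruct (Nat.le_ge_cases n m) as [H|H].
    - specialize (Ha' _ _ H). specialize (Hab m). lra.
    - specialize (Hb' _ _ H). specialize (Hab n). lra. }
  destruct (completeness (fun x => exists n, x = a n)) as [u [Hu1 Hu2]].
  - exists (b 0%nat). intros x [n ->]. apply Hx.
  - exists (a 0%nat). eauto.
  - exists u. intro n. split; [apply Hu1; eauto|]. apply Hu2. intros x [m ->]. apply Hx.
Qed.

(* Cousin's lemma: the rectangles in the local hypothesis contain their tag [(u, v)]. *)
Lemma cousin a b c d : a <= b -> c <= d ->
  (forall u v, a <= u <= b -> c <= v <= d -> exists rho, 0 < rho /\
     forall a' b' c' d', a <= a' <= u -> u <= b' <= b -> c <= c' <= v -> v <= d' <= d ->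
       b' - a' < rho -> d' - c' < rho -> P a' b' c' d') ->
  P a b c d.
Proof.
  intros Hab Hcd Hloc. apply NNPP. intro HN.
  set (s0 := ((a, b), (c, d)) : quad).
  (* A well-formed bad rectangle is replaced by one of its bad quarters; the other branch is a
     default that the sequence starting from [s0] never takes. *)
  set (step := fun s : quad => match excluded_middle_informative (wf s /\ ~ PQ s) with
     | left H => proj1_sig (constructive_indefinite_description _ (bisect_step s (proj1 H) (proj2 H)))
     | right _ => s end).
  assert (Hstep : forall s, wf s -> ~ PQ s -> wf (step s) /\ half s (step s) /\ ~ PQ (step s)).
  { intros s H1 H2. unfold step. destruct (excluded_middle_informative _) as [H|H]; [|tauto].
    now destruct (constructive_indefinite_description _ _). }
  set (sq := fix sq n := match n with O => s0 | S n => step (sq n) end).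
  assert (Hsq : forall n, wf (sq n) /\ ~ PQ (sq n)).
  { induction n as [|n [H1 H2]]; [split; simpl; auto|]. destruct (Hstep _ H1 H2) as [A [_ B]]. split; auto. }
  assert (Hhalf : forall n, half (sq n) (sq (S n))).
  { intro n. destruct (Hsq n) as [H1 H2]. now destruct (Hstep _ H1 H2) as [_ [A _]]. }
  set (an := fun n => fst (fst (sq n))). set (bn := fun n => snd (fst (sq n))).
  set (cn := fun n => fst (snd (sq n))). set (dn := fun n => snd (snd (sq n))).
  assert (K : forall n, an n <= an (S n) /\ bn (S n) <= bn n /\ cn n <= cn (S n) /\ dn (S n) <= dn n /\
     bn (S n) - an (S n) = (bn n - an n) / 2 /\ dn (S n) - cn (S n) = (dn n - cn n) / 2).
  { intro n. unfold an, bn, cn, dn. pose proof (Hhalf n) as H. unfold half in H.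
    destruct (sq n) as [[? ?] [? ?]], (sq (S n)) as [[? ?] [? ?]]. simpl. tauto. }
  assert (W : forall n, an n <= bn n /\ cn n <= dn n).
  { intro n. unfold an, bn, cn, dn. destruct (Hsq n) as [H _]. unfold wf in H.
    destruct (sq n) as [[? ?] [? ?]]. exact H. }
  assert (LX : forall n, bn n - an n = (b - a) / 2 ^ n).
  { induction n. simpl; unfold an, bn; simpl; field. destruct (K n) as [_ [_ [_ [_ [-> _]]]]]. rewrite IHn. simpl. field.
    apply pow_nonzero. lra. }
  assert (LY : forall n, dn n - cn n = (d - c) / 2 ^ n).
  { induction n. simpl; unfold cn, dn; simpl; field. destruct (K n) as [_ [_ [_ [_ [_ ->]]]]]. rewrite IHn. simpl. field.
    apply pow_nonzero. lra. }
  destruct (nested_point an bn (b - a)) as [u Hu]; try (intro n; apply K || apply W || apply LX).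
  destruct (nested_point cn dn (d - c)) as [v Hv]; try (intro n; apply K || apply W || apply LY).
  destruct (Hloc u v (Hu 0%nat) (Hv 0%nat)) as [rho [Hrho HP]].
  assert (exists n, (b - a) / 2 ^ n < rho /\ (d - c) / 2 ^ n < rho) as [n [H1 H2]].
  { destruct (pow_lt_1_zero (1/2) ltac:(rewrite Rabs_right; lra) (rho / ((b - a) + (d - c) + 1))) as [N HN'].
    - apply Rdiv_lt_0_compat; lra.
    - exists N. specialize (HN' N (le_n _)).
      rewrite Rabs_right in HN' by (left; apply Rlt_gt, pow_lt; lra).
      replace ((1/2)^N) with (/ 2 ^ N) in HN' by (rewrite <- pow_inv; f_equal; lra).
      assert (H0 : 0 < / 2 ^ N) by (apply Rinv_0_lt_compat, pow_lt; lra).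
      apply (Rmult_lt_compat_r ((b - a) + (d - c) + 1)) in HN'; [|lra].
      unfold Rdiv in HN'. rewrite Rmult_assoc, Rinv_l, Rmult_1_r in HN'; [|lra].
      unfold Rdiv. split; nra. }
  assert (M : forall n, a <= an n /\ bn n <= b /\ c <= cn n /\ dn n <= d).
  { induction n0; [unfold an, bn, cn, dn; simpl; lra|]. destruct (K n0) as [? [? [? [? _]]]]. lra. }
  destruct (Hsq n) as [_ Bad]. apply Bad.
  assert (G : P (an n) (bn n) (cn n) (dn n)).
  { specialize (M n). specialize (Hu n). specialize (Hv n). specialize (LX n). specialize (LY n).
    apply HP; lra. }
  unfold PQ, an, bn, cn, dn in *. destruct (sq n) as [[? ?] [? ?]]. exact G.
Qed.
End Cousin.

(** * Integrals along the boundary of a rectangle *)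

Definition inrect (a b c d : R) (z : C) := a <= Re z <= b /\ c <= Im z <= d.

(** The contour integral of [f], counterclockwise, with [dz = dx] on horizontal and [dz = i dy] on
    vertical sides. *)
Definition Jrect (f : C -> C) (a b c d : R) : C :=
  (cint (fun x => f (x, c)) a b - cint (fun x => f (x, d)) a b
   + Ci * (cint (fun y => f (b, y)) c d - cint (fun y => f (a, y)) c d))%C.

Lemma pair_C x y : ((x, y) : C) = (RtoC x + Ci * RtoC y)%C.
Proof. apply Ceq_parts; simpl; ring. Qed.

Lemma ccr_pair_l y x : ccr (fun t => (t, y) : C) x.
Proof. apply clim_parts; simpl; [apply filterlim_id|apply filterlim_const]. Qed.
Lemma ccr_pair_r y x : ccr (fun t => (x, t) : C) y.
Proof. apply clim_parts; simpl; [apply filterlim_const|apply filterlim_id]. Qed.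

Lemma ccr_hor f y x : ccc f (x, y) -> ccr (fun t => f (t, y)) x.
Proof. intro H. apply (ccr_comp f (fun t => (t, y) : C)); auto. apply ccr_pair_l. Qed.
Lemma ccr_ver f y x : ccc f (x, y) -> ccr (fun t => f (x, t)) y.
Proof. intro H. apply (ccr_comp f (fun t => (x, t) : C)); auto. apply ccr_pair_r. Qed.

Definition crect f a b c d := forall z, inrect a b c d z -> ccc f z.

Lemma conab_hor f a b c d y : crect f a b c d -> a <= b -> c <= y <= d -> conab (fun x => f (x, y)) a b.
Proof. intros H Hab Hy x Hx. rewrite Rmin_left, Rmax_right in Hx by lra. apply ccr_hor, H. split; simpl; lra. Qed.
Lemma conab_ver f a b c d x : crect f a b c d -> c <= d -> a <= x <= b -> conab (fun y => f (x, y)) c d.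
Proof. intros H Hcd Hx y Hy. rewrite Rmin_left, Rmax_right in Hy by lra. apply ccr_ver, H. split; simpl; lra. Qed.

Lemma crect_sub f a b c d a' b' c' d' : crect f a b c d -> a <= a' -> b' <= b -> c <= c' -> d' <= d -> crect f a' b' c' d'.
Proof. intros H ? ? ? ? z [Hx Hy]. apply H. split; lra. Qed.

Lemma Jrect_bound f a b c d M : a <= b -> c <= d -> crect f a b c d ->
  (forall z, inrect a b c d z -> Cmod (f z) <= M) -> Cmod (Jrect f a b c d) <= 2 * M * ((b - a) + (d - c)).
Proof.
  intros Hab Hcd Hf HM. unfold Jrect.
  assert (K1 : forall y, c <= y <= d -> Cmod (cint (fun x => f (x, y)) a b) <= M * (b - a)).
  { intros y Hy. apply cint_norm; auto; [eapply conab_hor; eauto|]. intros x Hx. apply HM. split; simpl; lra. }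
  assert (K2 : forall x, a <= x <= b -> Cmod (cint (fun y => f (x, y)) c d) <= M * (d - c)).
  { intros x Hx. apply cint_norm; auto; [eapply conab_ver; eauto|]. intros y Hy. apply HM. split; simpl; lra. }
  eapply Rle_trans; [apply Cmod_triangle|]. rewrite Cmod_mult, Cmod_Ci, Rmult_1_l.
  pose proof (K1 c ltac:(lra)). pose proof (K1 d ltac:(lra)). pose proof (K2 a ltac:(lra)). pose proof (K2 b ltac:(lra)).
  assert (T : forall u v : C, Cmod (u - v) <= Cmod u + Cmod v).
  { intros u v. rewrite <- (Cmod_opp v). apply Cmod_triangle. }
  pose proof (T (cint (fun x => f (x, c)) a b) (cint (fun x => f (x, d)) a b)).
  pose proof (T (cint (fun x => f (b, x)) c d) (cint (fun x => f (a, x)) c d)). lra.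
Qed.

Lemma Jrect_plus f g a b c d : a <= b -> c <= d -> crect f a b c d -> crect g a b c d ->
  Jrect (fun z => f z + g z)%C a b c d = (Jrect f a b c d + Jrect g a b c d)%C.
Proof.
  intros Hab Hcd Hf Hg. unfold Jrect.
  rewrite !cint_plus; try (eapply conab_hor; eauto; lra); try (eapply conab_ver; eauto; lra). ring.
Qed.

Lemma Jrect_ext f g a b c d : a <= b -> c <= d -> (forall z, inrect a b c d z -> f z = g z) ->
  Jrect f a b c d = Jrect g a b c d.
Proof.
  intros Hab Hcd H. unfold Jrect.
  rewrite (cint_ext a b (fun x => f (x, c)) (fun x => g (x, c))), (cint_ext a b (fun x => f (x, d)) (fun x => g (x, d))),
    (cint_ext c d (fun x => f (a, x)) (fun x => g (a, x))), (cint_ext c d (fun x => f (b, x)) (fun x => g (b, x)));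
  [reflexivity|..]; intros x Hx; rewrite Rmin_left, Rmax_right in Hx by lra; apply H; split; simpl; lra.
Qed.

Lemma rder_hor F x y d : cder F (x, y) d -> rder (fun t => F (t, y)) x d.
Proof.
  intro H. eapply gder_eq; [apply (rder_comp F (fun t => (t, y) : C) x d 1); auto|ring].
  eapply gder_ext; [apply filter_forall; intro t; symmetry; apply pair_C|symmetry; apply pair_C|].
  eapply gder_eq; [apply (rder_plus RtoC (fun _ => Ci * RtoC y)%C); [apply rder_id|apply rder_const]|ring].
Qed.
Lemma rder_ver F x y d : cder F (x, y) d -> rder (fun t => F (x, t)) y (Ci * d)%C.
Proof.
  intro H. eapply gder_eq; [apply (rder_comp F (fun t => (x, t) : C) y d Ci); auto|ring].
  eapply gder_ext; [apply filter_forall; intro t; symmetry; apply pair_C|symmetry; apply pair_C|].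
  eapply gder_eq; [apply (rder_plus (fun _ => RtoC x) (fun t => Ci * RtoC t)%C); [apply rder_const|]|].
  apply (rder_mult (fun _ => Ci) RtoC); [apply rder_const|apply rder_id]. simpl. ring.
Qed.

Lemma Jrect_primitive F f a b c d : a <= b -> c <= d -> crect f a b c d ->
  (forall z, inrect a b c d z -> cder F z (f z)) -> Jrect f a b c d = 0.
Proof.
  intros Hab Hcd Hf HF.
  assert (K1 : forall y, c <= y <= d -> cint (fun x => f (x, y)) a b = (F (b, y) - F (a, y))%C).
  { intros y Hy. rewrite (cint_ftc (fun x => F (x, y))); auto; [|eapply conab_hor; eauto].
    intros x Hx. rewrite Rmin_left, Rmax_right in Hx by lra. apply rder_hor, HF. split; simpl; lra. }
  assert (K2 : forall x, a <= x <= b -> (Ci * cint (fun y => f (x, y)) c d = F (x, d) - F (x, c))%C).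
  { intros x Hx. rewrite <- cint_scal; [|eapply conab_ver; eauto].
    rewrite (cint_ftc (fun y => F (x, y))); auto; [|apply conab_scal; eapply conab_ver; eauto].
    intros y Hy. rewrite Rmin_left, Rmax_right in Hy by lra. apply rder_ver, HF. split; simpl; lra. }
  unfold Jrect. rewrite !K1 by lra.
  replace (Ci * (cint (fun y => f (b, y)) c d - cint (fun y => f (a, y)) c d))%C
    with (Ci * cint (fun y => f (b, y)) c d - Ci * cint (fun y => f (a, y)) c d)%C by ring.
  rewrite !K2 by lra. ring.
Qed.

Lemma Jrect_split_x f a m b c d : a <= m <= b -> c <= d -> crect f a b c d ->
  Jrect f a b c d = (Jrect f a m c d + Jrect f m b c d)%C.
Proof.
  intros Hm Hcd Hf. unfold Jrect.
  rewrite <- (cint_Chasles (fun x => f (x, c)) a m b), <- (cint_Chasles (fun x => f (x, d)) a m b); [ring|..];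
  (eapply conab_hor with (c := c) (d := d); [eapply crect_sub; [exact Hf|..]|..]; lra).
Qed.
Lemma Jrect_split_y f a b c m d : a <= b -> c <= m <= d -> crect f a b c d ->
  Jrect f a b c d = (Jrect f a b c m + Jrect f a b m d)%C.
Proof.
  intros Hm Hcd Hf. unfold Jrect.
  rewrite <- (cint_Chasles (fun x => f (b, x)) c m d), <- (cint_Chasles (fun x => f (a, x)) c m d); [ring|..];
  (eapply conab_ver with (a := a) (b := b); [eapply crect_sub; [exact Hf|..]|..]; lra).
Qed.

(** Near a point the affine part of [f] has a primitive and drops out, and the remainder is at most
    a multiple of the diameter; so the contour integral of a small rectangle is at most [e] times
    the sum of the squares of its sides. This bound is exactly reproduced by adding four
    quarters. *)
Theorem goursat f a b c d : a <= b -> c <= d -> (forall z, inrect a b c d z -> exists l, cder f z l) ->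
  Jrect f a b c d = 0.
Proof.
  intros Hab Hcd Hf.
  assert (Hc : crect f a b c d). { intros z Hz. destruct (Hf z Hz) as [l Hl]. exact (cder_ccc _ _ _ Hl). }
  apply Cmod_small_eq. intros eps Heps.
  set (L := (b - a) * (b - a) + (d - c) * (d - c) + 1).
  assert (HL : 0 < L) by (unfold L; nra).
  set (e := eps / L). assert (He : 0 < e) by (now apply Rdiv_lt_0_compat).
  replace (Jrect f a b c d - 0)%C with (Jrect f a b c d) by ring.
  (* The trivial premises give the goal the shape of the predicate handed to [cousin], in which a
     rectangle has to lie inside the original one. *)
  assert (G : a <= a -> b <= b -> c <= c -> d <= d ->
    Cmod (Jrect f a b c d) <= e * ((b - a) * (b - a) + (d - c) * (d - c))).
  2:{ eapply Rle_trans; [apply G; lra|]. unfold e, Rdiv. rewrite Rmult_assoc.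
      rewrite <- (Rmult_1_r eps) at 2. apply Rmult_le_compat_l; [lra|].
      apply Rmult_le_reg_l with L; auto. rewrite <- Rmult_assoc, Rinv_r; unfold L in *; lra. }
  apply (cousin (fun a' b' c' d' => a <= a' -> b' <= b -> c <= c' -> d' <= d ->
    Cmod (Jrect f a' b' c' d') <= e * ((b' - a') * (b' - a') + (d' - c') * (d' - c')))); auto.
  - intros a' b' c' d' Ha' Hc' H1 H2 H3 H4 Ia Ib Ic Id.
    assert (crect f a' b' c' d') by (eapply crect_sub; eauto).
    rewrite (Jrect_split_x f a' ((a' + b') / 2) b') by (auto; lra).
    rewrite (Jrect_split_y f a' _ c' ((c' + d') / 2) d'), (Jrect_split_y f _ b' c' ((c' + d') / 2) d')
      by (try lra; eapply crect_sub; eauto; lra).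
    specialize (H1 ltac:(lra) ltac:(lra) ltac:(lra) ltac:(lra)).
    specialize (H2 ltac:(lra) ltac:(lra) ltac:(lra) ltac:(lra)).
    specialize (H3 ltac:(lra) ltac:(lra) ltac:(lra) ltac:(lra)).
    specialize (H4 ltac:(lra) ltac:(lra) ltac:(lra) ltac:(lra)).
    eapply Rle_trans; [apply Cmod_triangle|].
    eapply Rle_trans; [apply Rplus_le_compat; apply Cmod_triangle|].
    replace ((a' + b') / 2 - a') with ((b' - a') / 2) in * by field.
    replace (b' - (a' + b') / 2) with ((b' - a') / 2) in * by field.
    replace ((c' + d') / 2 - c') with ((d' - c') / 2) in * by field.
    replace (d' - (c' + d') / 2) with ((d' - c') / 2) in * by field. lra.
  - intros u v Hu Hv. destruct (Hf (u, v)) as [l Hl]; [split; simpl; lra|].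
    assert (He4 : 0 < e / 4) by lra.
    destruct (cder_eps_inv _ _ _ Hl (e / 4) He4) as [rho [Hrho Hr]].
    exists (rho / 2). split; [lra|]. intros a' b' c' d' Ha' Hb' Hc' Hd' Hx Hy _ _ _ _.
    set (g := fun z => (f (u, v) + l * (z - (u, v)))%C).
    assert (Hg : forall z, ccc g z) by (intro z; unfold g; ccont).
    set (r := fun z => (f z - g z)%C).
    assert (crect f a' b' c' d') by (eapply crect_sub; eauto; lra).
    assert (Hrc : crect r a' b' c' d') by (intros z Hz; apply ccc_minus; auto).
    rewrite (Jrect_ext f (fun z => g z + r z)%C); try lra; [|intros; unfold r; ring].
    rewrite Jrect_plus; try lra; auto; [|intros z _; apply Hg].
    rewrite (Jrect_primitive (fun z => f (u, v) * z + l * ((z - (u, v)) * (z - (u, v)) * / 2))%C g); try lra;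
      [|intros z _; apply Hg|].
    + rewrite Cplus_0_l. eapply Rle_trans.
      * apply (Jrect_bound r a' b' c' d' (e / 4 * ((b' - a') + (d' - c')))); try lra; auto.
        intros z [Hzx Hzy].
        assert (Hz : Cmod (z - (u, v)) <= (b' - a') + (d' - c')).
        { eapply Rle_trans; [apply Cmod_le_add|]. simpl. apply Rplus_le_compat; apply Rabs_le; split; unfold Re, Im in *; lra. }
        unfold r, g. replace (f z - (f (u, v) + l * (z - (u, v))))%C with (f z - f (u, v) - l * (z - (u, v)))%C by ring.
        eapply Rle_trans; [apply Hr; lra|]. apply Rmult_le_compat_l; lra.
      * set (p := b' - a') in *. set (q := d' - c') in *.
        replace (2 * (e / 4 * (p + q)) * (p + q)) with (e * ((p + q) * (p + q) / 2)) by field.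
        apply Rmult_le_compat_l; [lra|]. pose proof (Rle_0_sqr (p - q)). unfold Rsqr in *. lra.
    + intros z _. unfold g. eapply gder_eq.
      * apply cder_plus.
        { apply (cder_mult (fun _ => f (u, v)) (fun w => w)); [apply cder_const|apply cder_id]. }
        apply (cder_mult (fun _ => l) (fun w => (w - (u, v)) * (w - (u, v)) * / 2)%C); [apply cder_const|].
        apply (cder_mult (fun w => (w - (u, v)) * (w - (u, v)))%C (fun _ => / 2)%C); [|apply cder_const].
        apply (cder_mult (fun w => w - (u, v))%C (fun w => w - (u, v))%C);
          apply cder_minus; try apply cder_id; apply cder_const.
      * cbv beta. field.
Qed.

Lemma unif_cont_rect f a b c d : crect f a b c d -> forall e, 0 < e -> exists dl, 0 < dl /\
  forall z w, inrect a b c d z -> inrect a b c d w -> Cmod (w - z) < dl -> Cmod (f w - f z) < e.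
Proof.
  intros Hf e He.
  (* The radius is [4 D] because a point within [D] of the tag in each coordinate is within [2 D] in
     modulus, and a second point at distance below [dl <= D] must still be covered. Outside the
     rectangle [D = 1] is a default. *)
  assert (HD : forall u v, exists D : posreal, a <= u <= b -> c <= v <= d ->
     forall w, Cmod (w - (u, v)) < 4 * D -> Cmod (f w - f (u, v)) < e / 2).
  { intros u v. destruct (classic (a <= u <= b /\ c <= v <= d)) as [[Hu Hv]|N].
    - destruct (Hf (u, v) (conj Hu Hv) (e / 2) ltac:(lra)) as [r [Hr H]].
      exists (mkposreal (r / 4) ltac:(lra)). intros _ _ w Hw. simpl in Hw. apply H. lra.
    - exists (mkposreal 1 Rlt_0_1). tauto. }
  set (D := fun u v => proj1_sig (constructive_indefinite_description _ (HD u v))).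
  destruct (compactness_value_2d a b c d D) as [dl Hdl].
  exists dl. split; [apply cond_pos|]. intros z w [Hzx Hzy] Hw Hzw.
  specialize (Hdl (Re z) (Im z) Hzx Hzy). apply NNPP in Hdl.
  destruct Hdl as [u [v [Hu [Hv [H1 [H2 H3]]]]]].
  unfold D in *. destruct (constructive_indefinite_description _ (HD u v)) as [D0 HD0]. simpl in *.
  specialize (HD0 Hu Hv).
  assert (Hz : Cmod (z - (u, v)) < 2 * D0).
  { eapply Rle_lt_trans; [apply Cmod_le_add|]. rewrite re_minus, im_minus. unfold Re, Im in *; simpl. lra. }
  pose proof (cond_pos D0). pose proof (HD0 z ltac:(lra)) as A.
  assert (B : Cmod (f w - f (u, v)) < e / 2).
  { apply HD0. eapply Rle_lt_trans; [apply (Cmod_triangle3 w z)|]. pose proof (cond_pos D0). lra. }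
  eapply Rle_lt_trans; [apply (Cmod_triangle3 _ (f (u, v)))|]. rewrite (Cmod_minus_sym (f (u, v))). lra.
Qed.

(** By uniform continuity the two long sides of a thin strip nearly cancel, and the short ones
    contribute in proportion to the width. Only continuity is required, so the strip may contain a
    line on which differentiability is unknown. *)
Lemma thin_rect f a b c d e : a <= b -> c <= d -> crect f a b c d -> 0 < e -> exists dl, 0 < dl /\
  forall p p' q, a <= p <= q -> q <= p' <= b -> p' - p < dl ->
  Cmod (Jrect f p p' c d) <= (Cmod (f (q, c)) + Cmod (f (q, d)) + 2 * e) * (p' - p) + e * (d - c).
Proof.
  intros Hab Hcd Hf He. destruct (unif_cont_rect f a b c d Hf e He) as [dl [Hdl H]].
  exists dl. split; auto. intros p p' q H1 H2 H3.
  assert (Hd : forall x x' y, Cmod ((x, y) - (x', y)) = Rabs (x - x')).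
  { intros x x' y. replace ((x, y) - (x', y))%C with (RtoC (x - x')) by (apply Ceq_parts; simpl; ring). apply Cmod_R. }
  assert (K : forall y, c <= y <= d -> Cmod (cint (fun x => f (x, y)) p p') <= (Cmod (f (q, y)) + e) * (p' - p)).
  { intros y Hy. apply cint_norm; try lra.
    - eapply conab_hor with (c := c) (d := d); [eapply crect_sub; [exact Hf|..]|..]; lra.
    - intros x Hx. assert (Cmod (f (x, y) - f (q, y)) < e).
      { apply H; try (split; simpl; lra). rewrite Hd. apply Rabs_def1; lra. }
      pose proof (Cmod_triangle_rev (f (x, y)) (f (q, y))). lra. }
  unfold Jrect. eapply Rle_trans; [apply Cmod_triangle|]. rewrite Cmod_mult, Cmod_Ci, Rmult_1_l.
  apply Rle_trans with (((Cmod (f (q, c)) + e) * (p' - p) + (Cmod (f (q, d)) + e) * (p' - p)) + e * (d - c)); [|lra].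
  apply Rplus_le_compat.
  - eapply Rle_trans; [|apply Rplus_le_compat; apply K; lra].
    rewrite <- (Cmod_opp (cint (fun x => f (x, d)) p p')). apply Cmod_triangle.
  - assert (forall x, p <= x <= p' -> conab (fun y => f (x, y)) c d).
    { intros x Hx. eapply conab_ver; [exact Hf|..]; lra. }
    rewrite <- cint_minus by (apply H0; lra). apply cint_norm; auto.
    + intros y Hy. apply ccr_minus; apply H0; auto; lra.
    + intros y Hy. left. apply H; try (split; simpl; lra). rewrite Hd. apply Rabs_def1; lra.
Qed.

Lemma thin_rect_zero f a b c d q : a <= b -> c <= d -> crect f a b c d -> (q = a \/ q = b) ->
  (forall z, inrect a b c d z -> Re z <> q -> exists l, cder f z l) -> Jrect f a b c d = 0.
Proof.
  intros Hab Hcd Hf Hq Hd.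
  apply Cmod_small_eq. intros e He. replace (Jrect f a b c d - 0)%C with (Jrect f a b c d) by ring.
  destruct (Req_dec a b) as [E|E].
  { rewrite E. unfold Jrect. rewrite !cint_point.
    match goal with |- Cmod ?x <= _ => replace x with (RtoC 0) by ring end. rewrite Cmod_0. lra. }
  set (M := Cmod (f (q, c)) + Cmod (f (q, d)) + 2).
  assert (HM : 0 < M) by (unfold M; pose proof (Cmod_ge_0 (f (q, c))); pose proof (Cmod_ge_0 (f (q, d))); lra).
  set (e1 := Rmin 1 (e / (2 * (d - c + 1)))).
  assert (He1 : 0 < e1) by (apply Rmin_glb_lt; [lra|apply Rdiv_lt_0_compat; lra]).
  destruct (thin_rect f a b c d e1 Hab Hcd Hf He1) as [dl [Hdl H]].
  set (h := Rmin (b - a) (Rmin (dl / 2) (e / (2 * M)))).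
  assert (Hh : 0 < h).
  { repeat apply Rmin_glb_lt; try lra. apply Rdiv_lt_0_compat; lra. }
  assert (Hh1 : h <= b - a) by apply Rmin_l.
  assert (Hh2 : h <= dl / 2) by (eapply Rle_trans; [apply Rmin_r|apply Rmin_l]).
  assert (Hh3 : h <= e / (2 * M)) by (eapply Rle_trans; [apply Rmin_r|apply Rmin_r]).
  assert (B : (Cmod (f (q, c)) + Cmod (f (q, d)) + 2 * e1) * h + e1 * (d - c) <= e).
  { assert (e1 <= 1) by apply Rmin_l. assert (e1 <= e / (2 * (d - c + 1))) by apply Rmin_r.
    assert (e1 * (d - c + 1) <= e / 2).
    { apply Rle_trans with (e / (2 * (d - c + 1)) * (d - c + 1)); [apply Rmult_le_compat_r; lra|]. right. field. lra. }
    assert (M * h <= e / 2).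
    { apply Rle_trans with (M * (e / (2 * M))); [apply Rmult_le_compat_l; lra|]. right. field. lra. }
    unfold M in *. pose proof (Cmod_ge_0 (f (q, c))). pose proof (Cmod_ge_0 (f (q, d))).
    apply Rle_trans with ((Cmod (f (q, c)) + Cmod (f (q, d)) + 2) * h + e1 * (d - c + 1)); [|lra].
    apply Rplus_le_compat; [apply Rmult_le_compat_r|]; nra. }
  destruct Hq as [-> | ->].
  - rewrite (Jrect_split_x f a (a + h) b) by (auto; lra).
    rewrite (goursat f (a + h) b c d); try lra.
    + rewrite Cplus_0_r. eapply Rle_trans; [apply (H a (a + h) a); lra|]. replace (a + h - a) with h by ring. exact B.
    + intros z [Hx Hy]. apply Hd; [split|]; lra.
  - rewrite (Jrect_split_x f a (b - h) b) by (auto; lra).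
    rewrite (goursat f a (b - h) c d); try lra.
    + rewrite Cplus_0_l. eapply Rle_trans; [apply (H (b - h) b b); lra|]. replace (b - (b - h)) with h by ring. exact B.
    + intros z [Hx Hy]. apply Hd; [split|]; lra.
Qed.

(** Continuity suffices on one vertical line. The difference quotient in Cauchy's formula is not
    known to be differentiable at its centre, and in logarithmic coordinates the circle through the
    centre becomes such a line. *)
Lemma goursat_exc f a b c d x0 : a <= b -> c <= d -> crect f a b c d ->
  (forall z, inrect a b c d z -> Re z <> x0 -> exists l, cder f z l) -> Jrect f a b c d = 0.
Proof.
  intros Hab Hcd Hf Hd.
  destruct (Rle_dec a x0) as [H1|H1]; [destruct (Rle_dec x0 b) as [H2|H2]|].
  - rewrite (Jrect_split_x f a x0 b) by (auto; lra).
    rewrite (thin_rect_zero f a x0 c d x0), (thin_rect_zero f x0 b c d x0); try lra; auto; try ring;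
      try (eapply crect_sub; eauto; lra); intros z [Hx Hy] Hn; apply Hd; auto; split; lra.
  - apply goursat; auto. intros z Hz. apply Hd; auto. destruct Hz. lra.
  - apply goursat; auto. intros z Hz. apply Hd; auto. destruct Hz. lra.
Qed.

(** * Circle means and Cauchy's formula *)

Definition cis (t : R) : C := cexp (Ci * RtoC t)%C.

Lemma Cmod_cis t : Cmod (cis t) = 1.
Proof. unfold cis. rewrite Cmod_cexp. rewrite re_mult. simpl. rewrite <- exp_0. f_equal. ring. Qed.
Lemma cis_neq0 t : cis t <> 0.
Proof. apply cexp_neq0. Qed.
Lemma cis_2PI : cis (2 * PI) = 1.
Proof. unfold cis. rewrite cexp_Ci, cos_2PI, sin_2PI. reflexivity. Qed.
Lemma cis_0 : cis 0 = 1.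
Proof. unfold cis. rewrite cexp_Ci, cos_0, sin_0. reflexivity. Qed.
Lemma ccr_cis t : ccr cis t.
Proof. unfold cis. ccont. Qed.

(** Integral with respect to the angle, not [dw]; the Cauchy kernel therefore appears as
    [w / (w - z)] and no factor [i] occurs. *)
Definition circ (f : C -> C) (r : R) : C := cint (fun t => f (RtoC r * cis t)%C) 0 (2 * PI).

Lemma ccr_circ f r t : (forall w, Cmod w = r -> ccc f w) -> 0 <= r -> ccr (fun t => f (RtoC r * cis t)%C) t.
Proof.
  intros H Hr. apply (ccr_comp f (fun t => RtoC r * cis t)%C).
  - apply ccr_mult; [apply ccr_const|apply ccr_cis].
  - apply H. rewrite Cmod_mult, Cmod_cis, Cmod_pos_RtoC; lra.
Qed.

Lemma conab_circ f r : (forall w, Cmod w = r -> ccc f w) -> 0 <= r -> conab (fun t => f (RtoC r * cis t)%C) 0 (2 * PI).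
Proof. intros H Hr x _. now apply ccr_circ. Qed.

Lemma Cmod_rcis r t : 0 <= r -> Cmod (RtoC r * cis t) = r.
Proof. intro. rewrite Cmod_mult, Cmod_cis, Cmod_pos_RtoC; lra. Qed.

(** Under [w = exp zeta] the annulus becomes a rectangle of height [2 pi]. Its horizontal sides
    cancel by periodicity, so the vertical ones, which are the two circle integrals, agree. *)
Lemma circ_const f z r1 r2 : 0 < r1 <= r2 ->
  (forall w : C, w <> RtoC 0 -> Cmod w <= r2 -> ccc f w) ->
  (forall w : C, w <> RtoC 0 -> Cmod w <= r2 -> Cmod w <> Cmod z -> exists l, cder f w l) -> circ f r1 = circ f r2.
Proof.
  intros Hr Hc Hd.
  set (G := fun zeta => f (cexp zeta)).
  assert (Hm : forall zeta, Re zeta <= ln r2 -> Cmod (cexp zeta) <= r2).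
  { intros zeta H. rewrite Cmod_cexp. rewrite <- (exp_ln r2) by lra. now apply exp_mono. }
  assert (Hln : ln r1 <= ln r2) by (apply ln_le; lra).
  assert (HG : Jrect G (ln r1) (ln r2) 0 (2 * PI) = 0).
  { apply goursat_exc with (x0 := ln (Cmod z)); auto.
    - pose proof PI_RGT_0; lra.
    - intros w [Hx Hy]. unfold G. apply (ccc_comp f cexp); [|apply ccc_cexp]. apply Hc; [apply cexp_neq0|apply Hm; lra].
    - intros w [Hx Hy] Hn. destruct (Hd (cexp w)) as [l Hl]; [apply cexp_neq0|apply Hm; lra| |].
      + intro E. apply Hn. rewrite <- E, Cmod_cexp, ln_exp. reflexivity.
      + exists (l * cexp w)%C. apply (cder_comp f cexp); auto. apply cder_cexp. }
  assert (E : forall x t, cexp (x, t) = (RtoC (exp x) * cis t)%C).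
  { intros x t. unfold cis. rewrite <- cexp_RtoC, <- cexp_plus, pair_C. reflexivity. }
  unfold Jrect, G in HG.
  rewrite (cint_ext _ _ (fun x => f (cexp (x, 2 * PI))) (fun x => f (cexp (x, 0)))) in HG.
  2:{ intros x _. rewrite !E, cis_2PI, cis_0. reflexivity. }
  rewrite (cint_ext 0 (2*PI) (fun y => f (cexp (ln r2, y))) (fun y => f (RtoC r2 * cis y)%C)) in HG.
  2:{ intros x _. rewrite !E, exp_ln; [reflexivity|lra]. }
  rewrite (cint_ext 0 (2*PI) (fun y => f (cexp (ln r1, y))) (fun y => f (RtoC r1 * cis y)%C)) in HG.
  2:{ intros x _. rewrite !E, exp_ln; [reflexivity|lra]. }
  change (cint (fun y => f (RtoC r2 * cis y)%C) 0 (2 * PI)) with (circ f r2) in HG.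
  change (cint (fun y => f (RtoC r1 * cis y)%C) 0 (2 * PI)) with (circ f r1) in HG.
  assert (HH : (Ci * (circ f r2 - circ f r1) = 0)%C) by (rewrite <- HG; ring).
  apply (f_equal (fun u => - Ci * u)%C) in HH.
  assert (Ci2 : (Ci * Ci = - (1))%C) by (apply Ceq_parts; simpl; ring).
  replace (- Ci * (Ci * (circ f r2 - circ f r1)))%C with (- (Ci * Ci) * (circ f r2 - circ f r1))%C in HH by ring.
  rewrite Ci2 in HH. replace (circ f r1) with (circ f r2 - (- - (1) * (circ f r2 - circ f r1)))%C by ring.
  rewrite HH. ring.
Qed.

Lemma mean_value f z r : 0 < r -> (forall w, Cmod w <= r -> ccc f w) ->
  (forall w : C, w <> RtoC 0 -> Cmod w <= r -> Cmod w <> Cmod z -> exists l, cder f w l) ->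
  circ f r = (RtoC (2 * PI) * f (RtoC 0))%C.
Proof.
  intros Hr Hc Hd. pose proof PI_RGT_0.
  apply Cmod_small_eq. intros e He.
  assert (Hk : 0 < e / (2 * PI)) by (apply Rdiv_lt_0_compat; lra).
  destruct (Hc (RtoC 0) ltac:(rewrite Cmod_0; lra) _ Hk) as [d [Hdp H0]].
  set (r1 := Rmin (d / 2) r).
  assert (Hr1 : 0 < r1) by (apply Rmin_glb_lt; lra).
  assert (r1 <= d / 2) by apply Rmin_l. assert (r1 <= r) by apply Rmin_r.
  rewrite <- (circ_const f z r1 r); auto.
  replace (RtoC (2 * PI) * f (RtoC 0))%C with (cint (fun _ => f (RtoC 0)) 0 (2 * PI)).
  2:{ rewrite cint_const, Rminus_0_r. ring. }
  unfold circ. rewrite <- cint_minus.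
  - replace e with (e / (2 * PI) * (2 * PI - 0)) by (field; lra).
    apply cint_norm; [lra| |].
    + intros x Hx. apply ccr_minus; [|apply ccr_const]. apply ccr_circ; try lra. intros w Hw. apply Hc. lra.
    + intros x Hx. left. apply H0. replace (RtoC r1 * cis x - RtoC 0)%C with (RtoC r1 * cis x)%C by ring.
      rewrite Cmod_rcis; lra.
  - apply conab_circ; try lra. intros w Hw. apply Hc. lra.
  - intros x _. apply ccr_const.
Qed.

(** Discs are centred at 0 only; another centre is reached by translating the function. *)
Definition hol (f : C -> C) (R0 : R) := forall w, Cmod w < R0 -> exists l, cder f w l.

Lemma hol_ccc f R0 w : hol f R0 -> Cmod w < R0 -> ccc f w.
Proof. intros H Hw. destruct (H w Hw) as [l Hl]. exact (cder_ccc _ _ _ Hl). Qed.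

Lemma Cminus_neq0 (a b : C) : a <> b -> (a - b)%C <> 0.
Proof. intros H E. apply H. replace a with (a - b + b)%C by ring. rewrite E. ring. Qed.

Lemma rcis_neq r t z : Cmod z < r -> (RtoC r * cis t - z)%C <> 0.
Proof.
  intros H. apply Cminus_neq0. intros E. pose proof (Cmod_ge_0 z).
  assert (K : Cmod (RtoC r * cis t) = r) by (apply Cmod_rcis; lra). rewrite E in K. lra.
Qed.

(** On [|w| = r] the conjugate of [w] is [r^2 / w], so [w / (w - z)] is the conjugate of
    [k w = 1 / (1 - conj z * w / r^2)]. This [k] is holomorphic on the closed disc with [k 0 = 1],
    and the mean value property evaluates its integral. *)
Lemma cauchy_kernel z r : Cmod z < r -> circ (fun w => w / (w - z))%C r = RtoC (2 * PI).
Proof.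
  intro Hz. pose proof (Cmod_ge_0 z). assert (Hr : 0 < r) by lra.
  set (k := fun w : C => (/ (1 - Cconj z * / RtoC (r * r) * w))%C).
  assert (Hrr : RtoC (r * r) <> 0) by (apply RtoC_neq0; nra).
  assert (Hk : forall w, Cmod w <= r -> (1 - Cconj z * / RtoC (r * r) * w)%C <> 0).
  { intros w Hw. apply Cminus_neq0. intro E. apply (f_equal Cmod) in E.
    rewrite Cmod_1, !Cmod_mult, Cmod_conj, Cmod_inv, Cmod_pos_RtoC in E; auto; [|nra].
    assert (Cmod z * / (r * r) * Cmod w < 1); [|lra].
    apply Rle_lt_trans with (Cmod z * / (r * r) * r).
    - apply Rmult_le_compat_l; auto. apply Rmult_le_pos; auto. left. apply Rinv_0_lt_compat. nra.
    - replace (Cmod z * / (r * r) * r) with (Cmod z / r) by (field; lra).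
      apply Rmult_lt_reg_r with r; auto. unfold Rdiv. rewrite Rmult_assoc, Rinv_l; lra. }
  assert (Dk : forall w, Cmod w <= r -> exists l, cder k w l).
  { intros w Hw. eexists. unfold k. apply (cder_comp (fun u => / u)%C (fun w => 1 - Cconj z * / RtoC (r * r) * w)%C).
    - apply cder_inv. now apply Hk.
    - apply cder_minus; [apply cder_const|].
      apply (cder_mult (fun _ => Cconj z * / RtoC (r * r))%C (fun w => w)); [apply cder_const|apply cder_id]. }
  assert (Ck : forall w, Cmod w <= r -> ccc k w).
  { intros w Hw. destruct (Dk w Hw) as [l Hl]. exact (cder_ccc _ _ _ Hl). }
  pose proof (mean_value k 0 r Hr Ck (fun w _ Hw _ => Dk w Hw)) as M.
  unfold k in M at 2. rewrite Cmult_0_r in M.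
  assert (E : circ (fun w => w / (w - z))%C r = Cconj (circ k r)).
  { unfold circ. rewrite <- cint_conj.
    - apply cint_ext. intros t _. unfold k.
      assert (Hct : (cis t * Cconj (cis t) = 1)%C).
      { rewrite <- Cmod2_conj, Cmod_cis. apply Ceq_parts; simpl; ring. }
      assert (Hnz := rcis_neq r t z Hz).
      rewrite Cinv_conj by (apply Hk; rewrite Cmod_rcis; lra).
      rewrite Cminus_conj, !Cmult_conj, Cinv_conj, Cconj_conj by auto.
      replace (Cconj (RtoC (r * r))) with (RtoC (r * r)) by (apply Ceq_parts; simpl; ring).
      replace (Cconj (RtoC r)) with (RtoC r) by (apply Ceq_parts; simpl; ring).
      replace (Cconj 1) with (RtoC 1) by (apply Ceq_parts; simpl; ring).
      assert (Hcj : Cconj (cis t) = (/ cis t)%C).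
      { replace (Cconj (cis t)) with (cis t * Cconj (cis t) * / cis t)%C by (field; apply cis_neq0).
        rewrite Hct. field. apply cis_neq0. }
      rewrite Hcj, RtoC_mult. field. repeat split; try apply cis_neq0; try (apply RtoC_neq0; lra); auto.
    - apply conab_circ; [|lra]. intros w Hw. apply Ck. lra. }
  rewrite E, M. apply Ceq_parts; simpl; field.
Qed.

(** The mean value property is applied to [g w = w (f w - f z) / (w - z)], which vanishes at 0. At
    [w = z] this function is filled in continuously, and the circle [|w| = |z|] is the exceptional
    set. *)
Theorem cauchy_formula f R0 r z : 0 < r < R0 -> hol f R0 -> Cmod z < r ->
  circ (fun w => f w * (w / (w - z)))%C r = (RtoC (2 * PI) * f z)%C.
Proof.
  intros Hr Hf Hz. pose proof (Cmod_ge_0 z).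
  destruct (Hf z ltac:(lra)) as [d Hd]. destruct Hd as [q [Hq Q]].
  set (g := fun w => (w * (if excluded_middle_informative (w = z) then d else (f w - f z) / (w - z)))%C).
  assert (Hg0 : g (RtoC 0) = RtoC 0) by (unfold g; ring).
  assert (Eg : forall w, w <> z -> g w = (w * ((f w - f z) / (w - z)))%C).
  { intros w Hw. unfold g. destruct (excluded_middle_informative (w = z)); tauto. }
  assert (Hnear : forall w, w <> z -> cnb w (fun u => (u * ((f u - f z) / (u - z)))%C = g u)).
  { intros w Hw. exists (Cmod (w - z)). split; [apply Cmod_gt_0, Cminus_neq0; auto|].
    intros u Hu. symmetry. apply Eg. intros ->. rewrite Cmod_minus_sym in Hu. lra. }
  assert (Dg : forall w, w <> z -> Cmod w < R0 -> exists l, cder g w l).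
  { intros w Hw HR. destruct (Hf w HR) as [l Hl]. eexists.
    apply (cder_ext _ g w _ (Hnear w Hw)).
    apply (cder_mult (fun u => u)); [apply cder_id|].
    apply (cder_div (fun u => f u - f z)%C (fun u => u - z)%C).
    - apply cder_minus; [exact Hl|apply cder_const].
    - apply cder_minus; [apply cder_id|apply cder_const].
    - now apply Cminus_neq0. }
  assert (Cg : forall w, Cmod w < R0 -> ccc g w).
  { intros w Hw. destruct (classic (w = z)) as [->|Hn].
    - unfold ccc. replace (g z) with (z * d)%C by (unfold g; destruct (excluded_middle_informative (z = z)); tauto).
      unfold g. apply clim_mult; [apply clim_cnb_id|].
      intros e He. generalize (filter_and _ _ (Hq e He) Q). apply filter_imp. intros u [H1 H2].
      destruct (excluded_middle_informative (u = z)) as [_|Hu].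
      + replace (d - d)%C with (RtoC 0) by ring. now rewrite Cmod_0.
      + rewrite H2. replace ((f z + q u * (u - z) - f z) / (u - z))%C with (q u); auto.
        field. now apply Cminus_neq0.
    - destruct (Dg w Hn Hw) as [l Hl]. exact (cder_ccc _ _ _ Hl). }
  assert (M : circ g r = (RtoC (2 * PI) * g (RtoC 0))%C).
  { apply (mean_value g z r); try lra.
    - intros w Hw. apply Cg. lra.
    - intros w _ Hw Hn. apply Dg; [congruence|lra]. }
  rewrite Hg0, Cmult_0_r in M.
  assert (Ck : conab (fun t => RtoC r * cis t / (RtoC r * cis t - z))%C 0 (2 * PI)).
  { intros t _. apply ccr_div; [| |now apply rcis_neq]; ccont; apply ccr_cis. }
  assert (Cf : conab (fun t => f (RtoC r * cis t)%C * (RtoC r * cis t / (RtoC r * cis t - z)))%C 0 (2 * PI)).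
  { intros t Ht. apply ccr_mult; [|now apply Ck]. apply ccr_circ; [|lra]. intros w Hw. apply (hol_ccc f R0); auto; lra. }
  unfold circ in M. rewrite (cint_ext _ _ _
    (fun t => f (RtoC r * cis t) * (RtoC r * cis t / (RtoC r * cis t - z)) - f z * (RtoC r * cis t / (RtoC r * cis t - z)))%C) in M.
  - rewrite cint_minus, cint_scal in M; auto; [|now apply conab_scal].
    pose proof (cauchy_kernel z r Hz) as K. unfold circ in K. rewrite K in M.
    unfold circ. match goal with |- ?x = _ => replace x with (x - f z * RtoC (2 * PI) + f z * RtoC (2 * PI))%C by ring end.
    rewrite M. ring.
  - intros t _. assert (Hn := rcis_neq r t z Hz). rewrite Eg.
    + field. auto.
    + intro E. rewrite E in Hn. apply Hn. ring.
Qed.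

(** * Holomorphic functions on discs *)

Definition rc (r t : R) : C := (RtoC r * cis t)%C.

Lemma ccr_rc r t : ccr (rc r) t.
Proof. unfold rc. apply ccr_mult; [apply ccr_const|apply ccr_cis]. Qed.

Lemma Cmod_rc r t : 0 <= r -> Cmod (rc r t) = r.
Proof. apply Cmod_rcis. Qed.

Lemma rc_neq r t z : Cmod z < r -> (rc r t - z)%C <> 0.
Proof. apply rcis_neq. Qed.

Lemma rc_dist r t z : 0 <= r -> r - Cmod z <= Cmod (rc r t - z).
Proof. intro H. pose proof (Cmod_triangle_rev (rc r t) z). rewrite Cmod_rc in H0; lra. Qed.

Ltac crc := ccont; try match goal with
  | |- ccr (fun t => rc ?r t) _ => apply ccr_rc
  | H : forall t, ccr _ t |- ccr _ _ => apply H
  end.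

(** Cauchy transform of an arbitrary continuous function on the circle, followed by its first and
    second derivative in [z]. The second is what makes the derivative of a holomorphic function
    holomorphic. *)
Definition cau (phi : R -> C) (r : R) (z : C) : C :=
  (cint (fun t => phi t * (rc r t / (rc r t - z))) 0 (2 * PI) / RtoC (2 * PI))%C.
Definition cau1 (phi : R -> C) (r : R) (z : C) : C :=
  (cint (fun t => phi t * (rc r t / ((rc r t - z) * (rc r t - z)))) 0 (2 * PI) / RtoC (2 * PI))%C.
Definition cau2 (phi : R -> C) (r : R) (z : C) : C :=
  (cint (fun t => phi t * (2 * rc r t / ((rc r t - z) * (rc r t - z) * (rc r t - z)))) 0 (2 * PI) / RtoC (2 * PI))%C.

Lemma TPI_neq0 : RtoC (2 * PI) <> 0.
Proof. apply RtoC_neq0. pose proof PI_RGT_0. lra. Qed.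

Lemma mean_bound (psi : R -> C) B : (forall t, ccr psi t) -> (forall t, 0 <= t <= 2 * PI -> Cmod (psi t) <= B) ->
  Cmod (cint psi 0 (2 * PI) / RtoC (2 * PI)) <= B.
Proof.
  intros H HB. pose proof PI_RGT_0. rewrite Cmod_div by apply TPI_neq0. rewrite Cmod_pos_RtoC by lra.
  apply Rmult_le_reg_r with (2 * PI); [lra|]. unfold Rdiv. rewrite Rmult_assoc, Rinv_l, Rmult_1_r by lra.
  eapply Rle_trans; [apply (cint_norm psi 0 (2 * PI) B); try lra; auto|right; ring].
  now apply conab_all.
Qed.

Lemma ccr_cau phi r z t : Cmod z < r -> (forall t, ccr phi t) -> ccr (fun t => phi t * (rc r t / (rc r t - z)))%C t.
Proof. intros Hz H. apply ccr_mult; auto. apply ccr_div; [apply ccr_rc| |now apply rc_neq]. apply ccr_minus; [apply ccr_rc|apply ccr_const]. Qed.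
Lemma ccr_cau1 phi r z t : Cmod z < r -> (forall t, ccr phi t) ->
  ccr (fun t => phi t * (rc r t / ((rc r t - z) * (rc r t - z))))%C t.
Proof.
  intros Hz H. apply ccr_mult; auto. apply ccr_div; [apply ccr_rc| |apply Cmult_neq_0; now apply rc_neq].
  crc.
Qed.
Lemma ccr_cau2 phi r z t : Cmod z < r -> (forall t, ccr phi t) ->
  ccr (fun t => phi t * (2 * rc r t / ((rc r t - z) * (rc r t - z) * (rc r t - z))))%C t.
Proof.
  intros Hz H. apply ccr_mult; auto.
  apply ccr_div; [crc| |repeat apply Cmult_neq_0; now apply rc_neq]. crc.
Qed.

Lemma Cmod_inv_le (a : C) m : 0 < m <= Cmod a -> Cmod (/ a) <= / m.
Proof.
  intro H. rewrite Cmod_inv by (apply Cmod_gt_0; lra). apply Rinv_le_contravar; lra.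
Qed.

(** The remainder of the kernel is exactly [(w - z)^2 / ((zeta - z)^2 (zeta - w))]. Keeping [w]
    within half the distance from [z] to the circle bounds every denominator below by that half
    distance [rho]. *)
Lemma cau_quad phi r z w M : Cmod z < r -> Cmod (w - z) <= (r - Cmod z) / 2 ->
  (forall t, ccr phi t) -> (forall t, 0 <= t <= 2 * PI -> Cmod (phi t) <= M) ->
  Cmod (cau phi r w - cau phi r z - cau1 phi r z * (w - z))
    <= M * r * / (((r - Cmod z) / 2) ^ 3) * (Cmod (w - z) * Cmod (w - z)).
Proof.
  intros Hz Hw Hphi HM. set (rho := (r - Cmod z) / 2) in *. assert (0 < rho) by (unfold rho; lra).
  pose proof (Cmod_ge_0 z) as Hz0.
  assert (Hwr : Cmod w < r).
  { pose proof (Cmod_triangle_rev w z). unfold rho in *. lra. }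
  assert (E : (cau phi r w - cau phi r z - cau1 phi r z * (w - z))%C =
     (cint (fun t => phi t * rc r t * (w - z) * (w - z) * / ((rc r t - z) * (rc r t - z) * (rc r t - w))) 0 (2*PI) / RtoC (2 * PI))%C).
  { unfold cau, cau1.
    rewrite (cint_ext _ _ (fun t => phi t * rc r t * (w - z) * (w - z) * / ((rc r t - z) * (rc r t - z) * (rc r t - w)))%C
      (fun t => phi t * (rc r t / (rc r t - w)) - phi t * (rc r t / (rc r t - z)) -
        (w - z) * (phi t * (rc r t / ((rc r t - z) * (rc r t - z)))))%C).
    - rewrite !cint_minus, cint_scal; try (apply conab_all; intro t);
        [field; apply TPI_neq0|..]; try (now apply ccr_cau); try (now apply ccr_cau1).
      + apply ccr_minus; now apply ccr_cau.
      + apply ccr_mult; [apply ccr_const|now apply ccr_cau1].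
    - intros t _. pose proof (rc_neq r t z Hz). pose proof (rc_neq r t w Hwr). field. auto. }
  rewrite E. apply mean_bound.
  - intro t. apply ccr_mult.
    + crc.
    + apply clim_inv; [repeat apply Cmult_neq_0; now apply rc_neq|].
      change (ccr (fun t => (rc r t - z) * (rc r t - z) * (rc r t - w))%C t). crc.
  - intros t Ht. rewrite !Cmod_mult, Cmod_rc by lra.
    assert (Hd : rho <= Cmod (rc r t - z)) by (pose proof (rc_dist r t z ltac:(lra)); unfold rho in *; lra).
    assert (Hd2 : rho <= Cmod (rc r t - w)).
    { pose proof (rc_dist r t w ltac:(lra)). pose proof (Cmod_triangle_rev w z). unfold rho in *. lra. }
    assert (Hp : 0 < rho ^ 3) by now apply pow_lt.
    assert (Hi : Cmod (/ ((rc r t - z) * (rc r t - z) * (rc r t - w))) <= / rho ^ 3).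
    { apply Cmod_inv_le. split; auto. rewrite !Cmod_mult. simpl. rewrite Rmult_1_r, <- Rmult_assoc.
      apply Rmult_le_compat; try lra; nra. }
    pose proof (Cmod_ge_0 (w - z)). pose proof (Cmod_ge_0 (phi t)). specialize (HM t Ht).
    replace (M * r * / rho ^ 3 * (Cmod (w - z) * Cmod (w - z)))
      with (M * r * (Cmod (w - z) * Cmod (w - z)) * / rho ^ 3) by ring.
    apply Rmult_le_compat; auto; try apply Cmod_ge_0.
    + repeat apply Rmult_le_pos; auto; lra.
    + rewrite <- !Rmult_assoc. repeat apply Rmult_le_compat_r; auto; lra.
Qed.

Lemma curve_bounded (phi : R -> C) a b : a <= b -> (forall t, ccr phi t) -> exists M, 0 < M /\ forall t, a <= t <= b -> Cmod (phi t) <= M.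
Proof.
  intros Hab H. destruct (continuity_ab_maj (fun t => Cmod (phi t)) a b Hab) as [m [Hm _]].
  - intros c _. apply continuity_pt_filterlim. apply (ccr_Cmod phi c (H c)).
  - exists (Cmod (phi m) + 1). pose proof (Cmod_ge_0 (phi m)). split; [lra|]. intros t Ht. specialize (Hm t Ht). lra.
Qed.

Lemma cau1_quad phi r z w M : Cmod z < r -> Cmod (w - z) <= (r - Cmod z) / 2 ->
  (forall t, ccr phi t) -> (forall t, 0 <= t <= 2 * PI -> Cmod (phi t) <= M) ->
  Cmod (cau1 phi r w - cau1 phi r z - cau2 phi r z * (w - z))
    <= M * r * (6 * r) * / (((r - Cmod z) / 2) ^ 5) * (Cmod (w - z) * Cmod (w - z)).
Proof.
  intros Hz Hw Hphi HM. set (rho := (r - Cmod z) / 2) in *. assert (0 < rho) by (unfold rho; lra).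
  pose proof (Cmod_ge_0 z) as Hz0.
  assert (Hwr : Cmod w < r).
  { pose proof (Cmod_triangle_rev w z). unfold rho in *. lra. }
  assert (E : (cau1 phi r w - cau1 phi r z - cau2 phi r z * (w - z))%C =
     (cint (fun t => phi t * rc r t * (3 * (rc r t - z) - 2 * (w - z)) * (w - z) * (w - z) *
        / ((rc r t - z) * (rc r t - z) * (rc r t - z) * (rc r t - w) * (rc r t - w))) 0 (2*PI) / RtoC (2 * PI))%C).
  { unfold cau1, cau2.
    rewrite (cint_ext _ _ (fun t => phi t * rc r t * (3 * (rc r t - z) - 2 * (w - z)) * (w - z) * (w - z) *
        / ((rc r t - z) * (rc r t - z) * (rc r t - z) * (rc r t - w) * (rc r t - w)))%C
      (fun t => phi t * (rc r t / ((rc r t - w) * (rc r t - w))) - phi t * (rc r t / ((rc r t - z) * (rc r t - z))) -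
        (w - z) * (phi t * (2 * rc r t / ((rc r t - z) * (rc r t - z) * (rc r t - z)))))%C).
    - rewrite !cint_minus, cint_scal; try (apply conab_all; intro t);
        [field; apply TPI_neq0|..]; try (now apply ccr_cau1); try (now apply ccr_cau2).
      + apply ccr_minus; now apply ccr_cau1.
      + apply ccr_mult; [apply ccr_const|now apply ccr_cau2].
    - intros t _. pose proof (rc_neq r t z Hz). pose proof (rc_neq r t w Hwr). field. auto. }
  rewrite E. apply mean_bound.
  - intro t. apply ccr_mult.
    + crc.
    + apply clim_inv; [repeat apply Cmult_neq_0; now apply rc_neq|].
      change (ccr (fun t => (rc r t - z) * (rc r t - z) * (rc r t - z) * (rc r t - w) * (rc r t - w))%C t). crc.
  - intros t Ht. rewrite !Cmod_mult, Cmod_rc by lra.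
    assert (Hd : rho <= Cmod (rc r t - z)) by (pose proof (rc_dist r t z ltac:(lra)); unfold rho in *; lra).
    assert (Hd2 : rho <= Cmod (rc r t - w)).
    { pose proof (rc_dist r t w ltac:(lra)). pose proof (Cmod_triangle_rev w z). unfold rho in *. lra. }
    assert (Hp : 0 < rho ^ 5) by now apply pow_lt.
    assert (Hi : Cmod (/ ((rc r t - z) * (rc r t - z) * (rc r t - z) * (rc r t - w) * (rc r t - w))) <= / rho ^ 5).
    { apply Cmod_inv_le. split; auto. rewrite !Cmod_mult. simpl. rewrite Rmult_1_r, <- !Rmult_assoc.
      repeat (apply Rmult_le_compat; try lra; try (repeat apply Rmult_le_pos; lra)). }
    (* At most [3 (r + |z|) + (r - |z|)], and [|z| < r]. *)
    assert (H5 : Cmod (3 * (rc r t - z) - 2 * (w - z)) <= 6 * r).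
    { eapply Rle_trans; [apply Cmod_triangle|]. rewrite Cmod_opp, !Cmod_mult, !Cmod_pos_RtoC by lra.
      assert (Cmod (rc r t - z) <= r + Cmod z).
      { eapply Rle_trans; [apply Cmod_triangle|]. rewrite Cmod_opp, Cmod_rc; lra. }
      unfold rho in *. lra. }
    pose proof (Cmod_ge_0 (w - z)) as Hh. pose proof (Cmod_ge_0 (phi t)) as Hph. specialize (HM t Ht).
    replace (M * r * (6 * r) * / rho ^ 5 * (Cmod (w - z) * Cmod (w - z)))
      with (M * r * (6 * r) * (Cmod (w - z) * Cmod (w - z)) * / rho ^ 5) by ring.
    apply Rmult_le_compat; auto; try apply Cmod_ge_0.
    + repeat apply Rmult_le_pos; auto; try lra; apply Cmod_ge_0.
    + rewrite Rmult_assoc. apply Rmult_le_compat_r; [now apply Rmult_le_pos|].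
      apply Rmult_le_compat; [apply Rmult_le_pos; lra|apply Cmod_ge_0|apply Rmult_le_compat_r; lra|exact H5].
Qed.

Lemma cder_cau phi r z : Cmod z < r -> (forall t, ccr phi t) -> cder (cau phi r) z (cau1 phi r z).
Proof.
  intros Hz H. destruct (curve_bounded phi 0 (2 * PI)) as [M [HM0 HM]]; auto; [pose proof PI_RGT_0; lra|].
  apply cder_quad with (K := M * r * / (((r - Cmod z) / 2) ^ 3)) (r := (r - Cmod z) / 2); [lra|].
  intros w Hw. apply cau_quad; auto. lra.
Qed.

Lemma cder_cau1 phi r z : Cmod z < r -> (forall t, ccr phi t) -> cder (cau1 phi r) z (cau2 phi r z).
Proof.
  intros Hz H. destruct (curve_bounded phi 0 (2 * PI)) as [M [HM0 HM]]; auto; [pose proof PI_RGT_0; lra|].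
  apply cder_quad with (K := M * r * (6 * r) * / (((r - Cmod z) / 2) ^ 5)) (r := (r - Cmod z) / 2); [lra|].
  intros w Hw. apply cau1_quad; auto. lra.
Qed.

Lemma hol_ccr_circle f R0 r t : 0 < r < R0 -> hol f R0 -> ccr (fun t => f (rc r t)) t.
Proof. intros Hr Hf. apply ccr_circ; [|lra]. intros w Hw. apply (hol_ccc f R0); auto; lra. Qed.

Lemma hol_cau f R0 r z : 0 < r < R0 -> hol f R0 -> Cmod z < r -> f z = cau (fun t => f (rc r t)) r z.
Proof.
  intros Hr Hf Hz. unfold cau. pose proof (cauchy_formula f R0 r z Hr Hf Hz) as H. unfold circ in H.
  change (cint (fun t => f (rc r t) * (rc r t / (rc r t - z)))%C 0 (2 * PI) = RtoC (2 * PI) * f z)%C in H.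
  rewrite H. field. apply TPI_neq0.
Qed.

Lemma cnb_ball0 z r : Cmod z < r -> cnb z (fun w => Cmod w < r).
Proof.
  intro H. generalize (cnb_disc z (RtoC 0) r). unfold Cminus. intro K.
  assert (E : forall w : C, (w + - RtoC 0)%C = w) by (intro; ring).
  rewrite E in K. specialize (K H). revert K. apply filter_imp. intros w. now rewrite E.
Qed.

Lemma hol_cder f R0 r z : 0 < r < R0 -> hol f R0 -> Cmod z < r -> cder f z (cau1 (fun t => f (rc r t)) r z).
Proof.
  intros Hr Hf Hz. apply cder_ext with (cau (fun t => f (rc r t)) r).
  - generalize (cnb_ball0 z r Hz). apply filter_imp. intros w Hw. symmetry. now apply (hol_cau f R0).
  - apply cder_cau; auto. intro t. now apply (hol_ccr_circle f R0).
Qed.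

Lemma mid_radius z R0 : Cmod z < R0 -> exists r, 0 < r < R0 /\ Cmod z < r.
Proof. intro H. pose proof (Cmod_ge_0 z). exists ((Cmod z + R0) / 2). lra. Qed.

Definition Cder (f : C -> C) (z : C) : C := epsilon (inhabits (RtoC 0)) (fun d => cder f z d).

Lemma Cder_eq f z d : cder f z d -> Cder f z = d.
Proof.
  intro H. apply (cder_unique f z); auto. unfold Cder.
  apply (epsilon_spec (inhabits (RtoC 0)) (fun d => cder f z d)). eauto.
Qed.

Lemma hol_Cder f R0 z : hol f R0 -> Cmod z < R0 -> cder f z (Cder f z).
Proof. intros H Hz. destruct (H z Hz) as [l Hl]. now rewrite (Cder_eq f z l). Qed.

Lemma hol_deriv f R0 : hol f R0 -> hol (Cder f) R0.
Proof.
  intros Hf z Hz. destruct (mid_radius z R0 Hz) as [r [Hr Hzr]].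
  eexists. apply cder_ext with (cau1 (fun t => f (rc r t)) r).
  - generalize (cnb_ball0 z r Hzr). apply filter_imp. intros w Hw. symmetry. apply Cder_eq. now apply (hol_cder f R0).
  - apply cder_cau1; auto. intro t. now apply (hol_ccr_circle f R0).
Qed.

(** * Algebra of holomorphic functions, maximum principle and division by zeros *)

Lemma hol_le f R0 R1 : R1 <= R0 -> hol f R0 -> hol f R1.
Proof. intros H Hf z Hz. apply Hf. lra. Qed.
Lemma hol_const c R0 : hol (fun _ => c) R0. Proof. intros z _. exists 0. apply cder_const. Qed.
Lemma hol_plus f g R0 : hol f R0 -> hol g R0 -> hol (fun w => f w + g w)%C R0.
Proof. intros Hf Hg z Hz. destruct (Hf z Hz), (Hg z Hz). eexists. apply cder_plus; eauto. Qed.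
Lemma hol_minus f g R0 : hol f R0 -> hol g R0 -> hol (fun w => f w - g w)%C R0.
Proof. intros Hf Hg z Hz. destruct (Hf z Hz), (Hg z Hz). eexists. apply cder_minus; eauto. Qed.
Lemma hol_mult f g R0 : hol f R0 -> hol g R0 -> hol (fun w => f w * g w)%C R0.
Proof. intros Hf Hg z Hz. destruct (Hf z Hz), (Hg z Hz). eexists. apply cder_mult; eauto. Qed.
Lemma hol_div f g R0 : hol f R0 -> hol g R0 -> (forall w, Cmod w < R0 -> g w <> 0) -> hol (fun w => f w / g w)%C R0.
Proof. intros Hf Hg Hn z Hz. destruct (Hf z Hz), (Hg z Hz). eexists. apply cder_div; eauto. Qed.
Lemma hol_pow f n R0 : hol f R0 -> hol (fun w => f w ^ n)%C R0.
Proof. intros Hf z Hz. destruct (Hf z Hz). eexists. apply cder_pow; eauto. Qed.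

(* Landau's trick: Cauchy's formula for [f ^ n] loses a factor independent of [n]. *)
Lemma max_principle f R0 r z M : 0 < r < R0 -> hol f R0 -> Cmod z < r ->
  (forall w, Cmod w = r -> Cmod (f w) <= M) -> Cmod (f z) <= M.
Proof.
  intros Hr Hf Hz HM. pose proof (Cmod_ge_0 z) as Hz0.
  assert (HM0 : 0 <= M).
  { eapply Rle_trans; [apply Cmod_ge_0|]. apply (HM (RtoC r)). apply Cmod_pos_RtoC. lra. }
  set (K := r / (r - Cmod z)).
  assert (HK : 0 < K) by (apply Rdiv_lt_0_compat; lra).
  assert (Hn : forall n, Cmod (f z) ^ n <= K * M ^ n).
  { intro n. rewrite <- Cmod_pow.
    rewrite (hol_cau (fun w => f w ^ n)%C R0 r z); auto; [|now apply hol_pow].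
    unfold cau. apply mean_bound.
    - intro t. apply ccr_cau; auto. intro u. apply (hol_ccr_circle (fun w => f w ^ n)%C R0); auto. now apply hol_pow.
    - intros t _. rewrite Cmod_mult, Cmod_pow, Cmod_div by now apply rc_neq. rewrite Cmod_rc by lra.
      rewrite (Rmult_comm K). apply Rmult_le_compat; try (apply pow_le, Cmod_ge_0).
      + apply Rmult_le_pos; [lra|]. left. apply Rinv_0_lt_compat. apply Cmod_gt_0. now apply rc_neq.
      + apply pow_incr. split; [apply Cmod_ge_0|]. apply HM. apply Cmod_rc. lra.
      + unfold K, Rdiv. apply Rmult_le_compat_l; [lra|]. apply Rinv_le_contravar; [lra|]. apply rc_dist. lra. }
  destruct (Rle_dec (Cmod (f z)) M) as [|N]; auto. exfalso.
  apply Rnot_le_lt in N. set (q := Cmod (f z) / ((M + Cmod (f z)) / 2)).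
  assert (Hq : 1 < q).
  { unfold q. apply Rmult_lt_reg_r with ((M + Cmod (f z)) / 2); [lra|]. unfold Rdiv at 2. rewrite Rmult_assoc, Rinv_l; lra. }
  assert (Hqn : forall n, q ^ n <= K).
  { intro n. unfold q. unfold Rdiv at 1. rewrite Rpow_mult_distr, pow_inv.
    assert (0 < ((M + Cmod (f z)) / 2) ^ n) by (apply pow_lt; lra).
    apply Rmult_le_reg_r with (((M + Cmod (f z)) / 2) ^ n); auto.
    rewrite Rmult_assoc, Rinv_l, Rmult_1_r by lra. eapply Rle_trans; [apply Hn|].
    apply Rmult_le_compat_l; [lra|]. apply pow_incr. lra. }
  destruct (Pow_x_infinity q ltac:(rewrite Rabs_right; lra) (K + 1)) as [N0 HN].
  specialize (HN N0 (le_n _)). specialize (Hqn N0). rewrite Rabs_right in HN; [lra|]. apply Rle_ge, pow_le. lra.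
Qed.

(** The quotient, completed by [f'(a)], is the Cauchy transform of [f / (w - a)] on a circle
    enclosing both points, because the difference of two Cauchy kernels is [z - a] times their
    product over [w]. The factorisation holds at every [z], outside the disc as well, since [g] is
    there the plain quotient. *)
Lemma hol_divide f R0 a : Cmod a < R0 -> hol f R0 -> f a = RtoC 0 ->
  exists g, hol g R0 /\ forall z, f z = ((z - a) * g z)%C.
Proof.
  intros Ha Hf Hfa.
  set (g := fun z => if excluded_middle_informative (z = a) then Cder f a else (f z / (z - a))%C).
  exists g. split.
  2:{ intro z. unfold g. destruct (excluded_middle_informative (z = a)) as [->|H]; [rewrite Hfa; ring|].
      field. now apply Cminus_neq0. }
  assert (Hrep : forall r z, 0 < r < R0 -> Cmod a < r -> Cmod z < r -> g z = cau (fun t => f (rc r t) / (rc r t - a))%C r z).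
  { intros r z Hr Har Hz.
    assert (Hcf : forall t, ccr (fun t => f (rc r t)) t) by (intro t; now apply (hol_ccr_circle f R0)).
    unfold g. destruct (excluded_middle_informative (z = a)) as [->|H].
    - rewrite (Cder_eq f a _ (hol_cder f R0 r a Hr Hf Har)). unfold cau1, cau. f_equal.
      apply cint_ext. intros t _. pose proof (rc_neq r t a Har). field. auto.
    - replace (f z) with (f z - f a)%C by (rewrite Hfa; ring).
      rewrite (hol_cau f R0 r z), (hol_cau f R0 r a) by auto. unfold cau.
      assert (Hza := Cminus_neq0 _ _ H).
      rewrite (cint_ext _ _ (fun t => f (rc r t) / (rc r t - a) * (rc r t / (rc r t - z)))%C
        (fun t => / (z - a) * (f (rc r t) * (rc r t / (rc r t - z)) - f (rc r t) * (rc r t / (rc r t - a))))%C).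
      + rewrite cint_scal, cint_minus; try (apply conab_all; intro t);
          [field; split; [exact Hza|apply TPI_neq0]|..]; try now apply ccr_cau.
        apply ccr_minus; now apply ccr_cau.
      + intros t _. pose proof (rc_neq r t a Har). pose proof (rc_neq r t z Hz). field. auto. }
  intros z Hz. destruct (mid_radius z R0 Hz) as [r1 [Hr1 Hz1]]. destruct (mid_radius a R0 Ha) as [r2 [Hr2 Ha2]].
  set (r := Rmax r1 r2).
  assert (Hr : 0 < r < R0). { unfold r. split; [eapply Rlt_le_trans; [|apply Rmax_l]; lra|]. apply Rmax_lub_lt; lra. }
  assert (Hzr : Cmod z < r) by (eapply Rlt_le_trans; [exact Hz1|apply Rmax_l]).
  assert (Har : Cmod a < r) by (eapply Rlt_le_trans; [exact Ha2|apply Rmax_r]).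
  eexists. apply cder_ext with (cau (fun t => f (rc r t) / (rc r t - a))%C r).
  - generalize (cnb_ball0 z r Hzr). apply filter_imp. intros w Hw. symmetry. now apply Hrep.
  - apply cder_cau; auto. intro t. apply ccr_div; [now apply (hol_ccr_circle f R0)| |now apply rc_neq].
    apply ccr_minus; [apply ccr_rc|apply ccr_const].
Qed.

(** Zeros accumulating at 0 allow division by [z] again and again. Cauchy's formula for the [n]-th
    quotient then gives [|f z| <= B (|z| / r)^n] with [B] independent of [n]. *)
Theorem identity_disc f R0 : hol f R0 ->
  (forall d, 0 < d -> exists w : C, w <> RtoC 0 /\ Cmod w < d /\ f w = RtoC 0) ->
  forall z, Cmod z < R0 -> f z = RtoC 0.
Proof.
  intros Hf Hz0 z Hz. pose proof (Cmod_ge_0 z).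
  assert (Hn : forall n, exists g, hol g R0 /\ (forall w, f w = w ^ n * g w)%C).
  { assert (H1 : forall g, hol g R0 -> (forall d, 0 < d -> exists w : C, w <> RtoC 0 /\ Cmod w < d /\ g w = RtoC 0) -> g (RtoC 0) = RtoC 0).
    { intros g Hg Hg0. apply Cmod_small_eq. intros e He.
      destruct (hol_ccc g R0 (RtoC 0) Hg ltac:(rewrite Cmod_0; lra) e He) as [d [Hd H1]].
      destruct (Hg0 d Hd) as [w [_ [Hw Hgw]]].
      specialize (H1 w). replace (w - RtoC 0)%C with w in H1 by ring. specialize (H1 Hw).
      rewrite Hgw, Cmod_minus_sym in H1. lra. }
    induction n as [|n [g [Hg E]]].
    - exists f. split; auto. intro w. simpl. ring.
    - assert (Hg0 : g (RtoC 0) = RtoC 0).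
      { apply H1; auto. intros d Hd. destruct (Hz0 d Hd) as [w [Hw [Hwd Hfw]]]. exists w. repeat split; auto.
        rewrite E in Hfw. apply (Cpow_nz w n) in Hw.
        replace (g w) with (w ^ n * g w / w ^ n)%C by (field; auto). rewrite Hfw. field. auto. }
      destruct (hol_divide g R0 (RtoC 0)) as [h [Hh Eh]]; auto; [rewrite Cmod_0; lra|].
      exists h. split; auto. intro w. rewrite E, Eh. simpl. ring. }
  destruct (mid_radius z R0 Hz) as [r [Hr Hzr]].
  destruct (curve_bounded (fun t => f (rc r t)) 0 (2 * PI)) as [M [HM0 HM]];
    [pose proof PI_RGT_0; lra|intro; now apply (hol_ccr_circle f R0)|].
  assert (HB : forall n, Cmod (f z) <= M * (r / (r - Cmod z)) * (Cmod z / r) ^ n).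
  { intro n. destruct (Hn n) as [g [Hg E]]. rewrite E, Cmod_mult, Cmod_pow.
    rewrite (hol_cau g R0 r z) by auto.
    replace (M * (r / (r - Cmod z)) * (Cmod z / r) ^ n) with (Cmod z ^ n * (M * / r ^ n * (r / (r - Cmod z)))).
    2:{ unfold Rdiv. rewrite Rpow_mult_distr, pow_inv. ring. }
    apply Rmult_le_compat_l; [apply pow_le; lra|]. apply mean_bound.
    - intro t. apply ccr_cau; auto. intro u. now apply (hol_ccr_circle g R0).
    - intros t Ht. rewrite Cmod_mult, Cmod_div by now apply rc_neq. rewrite Cmod_rc by lra.
      apply Rmult_le_compat; try apply Cmod_ge_0.
      + apply Rmult_le_pos; [lra|]. left. apply Rinv_0_lt_compat. apply Cmod_gt_0. now apply rc_neq.
      + specialize (HM t Ht). cbv beta in HM. rewrite E, Cmod_mult, Cmod_pow, Cmod_rc in HM by lra.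
        assert (0 < r ^ n) by (apply pow_lt; lra).
        apply Rmult_le_reg_l with (r ^ n); auto.
        replace (r ^ n * (M * / r ^ n)) with M by (field; lra). exact HM.
      + unfold Rdiv. apply Rmult_le_compat_l; [lra|]. apply Rinv_le_contravar; [lra|]. apply rc_dist. lra. }
  apply Cmod_small_eq. intros e He. replace (f z - RtoC 0)%C with (f z) by ring.
  set (B := M * (r / (r - Cmod z))) in *.
  assert (HBp : 0 < B) by (apply Rmult_lt_0_compat; auto; apply Rdiv_lt_0_compat; lra).
  destruct (pow_lt_1_zero (Cmod z / r)) with (y := e / B) as [N HN].
  - rewrite Rabs_right; [|apply Rle_ge, Rmult_le_pos; auto; left; apply Rinv_0_lt_compat; lra].
    apply Rmult_lt_reg_r with r; [lra|]. unfold Rdiv. rewrite Rmult_assoc, Rinv_l; lra.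
  - now apply Rdiv_lt_0_compat.
  - specialize (HN N (le_n _)). apply Rabs_def2 in HN.
    eapply Rle_trans; [apply (HB N)|]. apply Rle_trans with (B * (e / B)); [apply Rmult_le_compat_l; lra|].
    right. field. lra.
Qed.

Lemma hol_bounded f R0 r : r < R0 -> hol f R0 -> exists M, 0 < M /\ forall w, Cmod w <= r -> Cmod (f w) <= M.
Proof.
  intros Hr Hf. destruct (Rlt_dec r 0) as [H|H].
  { exists 1. split; [lra|]. intros w Hw. pose proof (Cmod_ge_0 w). lra. }
  set (r' := (r + R0) / 2).
  assert (Hr' : 0 < r' < R0) by (unfold r'; lra). assert (Hrr : r < r') by (unfold r'; lra).
  assert (Hcc : forall t, ccr (fun t => f (rc r' t)) t) by (intro t; now apply (hol_ccr_circle f R0)).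
  destruct (curve_bounded (fun t => f (rc r' t)) 0 (2 * PI)) as [M [HM0 HM]]; auto; [pose proof PI_RGT_0; lra|].
  exists (M * (r' / (r' - r))). split; [apply Rmult_lt_0_compat; auto; apply Rdiv_lt_0_compat; lra|].
  intros w Hw. rewrite (hol_cau f R0 r' w) by (auto; lra). unfold cau. apply mean_bound.
  - intro t. apply ccr_cau; auto. lra.
  - intros t Ht. rewrite Cmod_mult, Cmod_div by (apply rc_neq; lra). rewrite Cmod_rc by lra.
    apply Rmult_le_compat; try apply Cmod_ge_0.
    + apply Rmult_le_pos; [lra|]. left. apply Rinv_0_lt_compat. apply Cmod_gt_0. apply rc_neq. lra.
    + now apply HM.
    + unfold Rdiv. apply Rmult_le_compat_l; [lra|]. apply Rinv_le_contravar; [lra|].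
      pose proof (rc_dist r' t w ltac:(lra)). lra.
Qed.

Lemma hol_quad f R0 r z w M : 0 < r < R0 -> hol f R0 -> Cmod z < r -> Cmod (w - z) <= (r - Cmod z) / 2 ->
  (forall w, Cmod w <= r -> Cmod (f w) <= M) ->
  Cmod (f w - f z - Cder f z * (w - z)) <= M * r * / (((r - Cmod z) / 2) ^ 3) * (Cmod (w - z) * Cmod (w - z)).
Proof.
  intros Hr Hf Hz Hw HM.
  assert (Hwr : Cmod w < r) by (pose proof (Cmod_triangle_rev w z); lra).
  rewrite (Cder_eq f z _ (hol_cder f R0 r z Hr Hf Hz)).
  rewrite (hol_cau f R0 r w), (hol_cau f R0 r z) by auto.
  apply cau_quad; auto.
  - intro t. now apply (hol_ccr_circle f R0).
  - intros t _. apply HM. rewrite Cmod_rc; lra.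
Qed.

(** * Primitives and logarithms *)

Lemma rder_ray f R0 z t : hol f R0 -> Cmod z < R0 -> 0 <= t <= 1 ->
  rder (fun t => f (RtoC t * z)%C) t (Cder f (RtoC t * z) * z)%C.
Proof.
  intros Hf Hz Ht. apply (rder_comp f (fun t => RtoC t * z)%C).
  - apply (hol_Cder f R0); auto. rewrite Cmod_mult, Cmod_pos_RtoC by lra. pose proof (Cmod_ge_0 z). nra.
  - eapply gder_eq; [apply (rder_mult RtoC (fun _ => z)); [apply rder_id|apply rder_const]|]. cbv beta. ring.
Qed.

Lemma ray_in z t R0 : Cmod z < R0 -> 0 <= t <= 1 -> Cmod (RtoC t * z) < R0.
Proof. intros Hz Ht. rewrite Cmod_mult, Cmod_pos_RtoC by lra. pose proof (Cmod_ge_0 z). nra. Qed.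

Lemma conab_01 f : (forall t, 0 <= t <= 1 -> ccr f t) -> conab f 0 1.
Proof. intros H t Ht. rewrite Rmin_left, Rmax_right in Ht by lra. auto. Qed.

Lemma ccr_ray f R0 z t : hol f R0 -> Cmod z < R0 -> 0 <= t <= 1 -> ccr (fun t => f (RtoC t * z)%C) t.
Proof. intros. eapply rder_ccr. now apply (rder_ray f R0). Qed.

(** The primitive is the integral of [z q(t z)] over [0 <= t <= 1]. The [z]-derivative of the
    integrand is the [t]-derivative of [t q(t z)], hence integrates to [q z]; [hol_quad] bounds the
    remainders uniformly in [t]. *)
Lemma hol_primitive q R0 : hol q R0 -> exists L, L (RtoC 0) = RtoC 0 /\ forall z, Cmod z < R0 -> cder L z (q z).
Proof.
  intro Hq. set (k := fun (t : R) (z : C) => (z * q (RtoC t * z))%C).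
  exists (fun z => cint (fun t => k t z) 0 1). split.
  { rewrite (cint_ext 0 1 _ (fun _ => RtoC 0)); [rewrite cint_const; ring|]. intros; unfold k; ring. }
  intros z Hz. destruct (mid_radius z R0 Hz) as [r [Hr Hzr]].
  destruct (hol_bounded q R0 r ltac:(lra) Hq) as [M [HM0 HM]].
  set (D := fun t : R => (q (RtoC t * z) + RtoC t * (Cder q (RtoC t * z) * z))%C).
  assert (Hk : forall t, 0 <= t <= 1 -> hol (k t) R0).
  { intros t Ht w Hw. eexists. unfold k. apply (cder_mult (fun w => w) (fun w => q (RtoC t * w)%C)); [apply cder_id|].
    apply (cder_comp q (fun w => RtoC t * w)%C); [apply (hol_Cder q R0); auto; now apply ray_in|].
    apply (cder_mult (fun _ => RtoC t) (fun w => w)); [apply cder_const|apply cder_id]. }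
  assert (HD : forall t, 0 <= t <= 1 -> Cder (k t) z = D t).
  { intros t Ht. apply Cder_eq. unfold k. eapply gder_eq.
    - apply (cder_mult (fun w => w) (fun w => q (RtoC t * w)%C)); [apply cder_id|].
      apply (cder_comp q (fun w => RtoC t * w)%C); [apply (hol_Cder q R0); auto; now apply ray_in|].
      apply (cder_mult (fun _ => RtoC t) (fun w => w)); [apply cder_const|apply cder_id].
    - unfold D. cbv beta. ring. }
  assert (CD : conab D 0 1).
  { apply conab_01. intros t Ht. unfold D. apply ccr_plus; [now apply (ccr_ray q R0)|].
    apply ccr_mult; [apply ccr_id|]. apply ccr_mult; [|apply ccr_const]. apply (ccr_ray (Cder q) R0); auto. now apply hol_deriv. }
  assert (CK : forall w, Cmod w < R0 -> conab (fun t => k t w) 0 1).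
  { intros w Hw. apply conab_01. intros t Ht. unfold k. apply ccr_mult; [apply ccr_const|]. now apply (ccr_ray q R0). }
  assert (ID : cint D 0 1 = q z).
  { rewrite (cint_ftc (fun t => RtoC t * q (RtoC t * z))%C D 0 1); auto.
    - rewrite Cmult_1_l, Cmult_0_l, Cmult_1_l. ring.
    - intros t Ht. rewrite Rmin_left, Rmax_right in Ht by lra. eapply gder_eq.
      + apply (rder_mult RtoC (fun t => q (RtoC t * z)%C)); [apply rder_id|now apply (rder_ray q R0)].
      + unfold D. ring. }
  rewrite <- ID.
  apply cder_quad with (K := r * M * r * / (((r - Cmod z) / 2) ^ 3)) (r := (r - Cmod z) / 2); [lra|].
  intros w Hw. assert (Hwr : Cmod w < r) by (pose proof (Cmod_triangle_rev w z); lra).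
  rewrite <- cint_minus by (apply CK; lra).
  replace (cint D 0 1 * (w - z))%C with ((w - z) * cint D 0 1)%C by ring.
  rewrite <- cint_scal, <- cint_minus; auto.
  2:{ intros t Ht. apply ccr_minus; [exact (CK w ltac:(lra) t Ht)|exact (CK z Hz t Ht)]. }
  2:{ now apply conab_scal. }
  replace (r * M * r * / ((r - Cmod z) / 2) ^ 3 * (Cmod (w - z) * Cmod (w - z)))
    with (r * M * r * / ((r - Cmod z) / 2) ^ 3 * (Cmod (w - z) * Cmod (w - z)) * (1 - 0)) by ring.
  apply cint_norm; [lra| |].
  - intros t Ht. apply ccr_minus; [apply ccr_minus; [exact (CK w ltac:(lra) t Ht)|exact (CK z Hz t Ht)]|].
    exact (conab_scal 0 1 _ D CD t Ht).
  - intros t Ht. rewrite (Cmult_comm (w - z)), <- HD by auto.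
    apply (hol_quad (k t) R0); auto; [lra|]. intros u Hu. unfold k. rewrite Cmod_mult.
    apply Rmult_le_compat; try apply Cmod_ge_0; auto. apply HM.
    rewrite Cmod_mult, Cmod_pos_RtoC by lra. pose proof (Cmod_ge_0 u). nra.
Qed.

Lemma cder_zero_const h R0 z : Cmod z < R0 -> (forall w, Cmod w < R0 -> cder h w (RtoC 0)) -> h z = h (RtoC 0).
Proof.
  intros Hz H.
  assert (E : cint (fun _ => RtoC 0) 0 1 = (h (RtoC 1 * z) - h (RtoC 0 * z))%C).
  { apply (cint_ftc (fun t => h (RtoC t * z)%C)); [|intros x _; apply ccr_const].
    intros t Ht. rewrite Rmin_left, Rmax_right in Ht by lra. eapply gder_eq.
    - apply (rder_comp h (fun t => RtoC t * z)%C); [apply H; now apply ray_in|].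
      apply (rder_mult RtoC (fun _ => z)); [apply rder_id|apply rder_const].
    - ring. }
  rewrite cint_const, Cmult_0_l, Cmult_1_l, Cmult_0_l in E.
  replace (h z) with (h z - h (RtoC 0) + h (RtoC 0))%C by ring. rewrite <- E. ring.
Qed.

Theorem hol_log g R0 : 0 < R0 -> hol g R0 -> (forall w, Cmod w < R0 -> g w <> 0) ->
  exists L, hol L R0 /\ L (RtoC 0) = RtoC 0 /\ forall z, Cmod z < R0 -> g z = (g (RtoC 0) * cexp (L z))%C.
Proof.
  intros HR Hg Hn.
  assert (Hq : hol (fun z => Cder g z / g z)%C R0) by (apply hol_div; auto; now apply hol_deriv).
  destruct (hol_primitive _ R0 Hq) as [L [HL0 HL]].
  exists L. split; [intros w Hw; eexists; now apply HL|]. split; auto. intros z Hz.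
  assert (E : (g z * cexp (- L z) = g (RtoC 0) * cexp (- L (RtoC 0)))%C).
  { apply (cder_zero_const (fun z => g z * cexp (- L z))%C R0); auto. intros w Hw. eapply gder_eq.
    - apply cder_mult; [now apply (hol_Cder g R0)|]. apply (cder_comp cexp (fun z => - L z)%C); [apply cder_cexp|].
      apply cder_opp. now apply HL.
    - cbv beta. field. now apply Hn. }
  rewrite HL0 in E. replace (- RtoC 0)%C with (RtoC 0) in E by ring. rewrite cexp_0, Cmult_1_r in E.
  rewrite <- E, cexp_opp. field. apply cexp_neq0.
Qed.

(** After one division by [z] the quotient is odd away from 0. Its value at 0 is obtained as a limit
    along positive reals, where oddness forces it to vanish, and a second division is possible. *)
Lemma even_double_zero f R0 : 0 < R0 -> hol f R0 -> f (RtoC 0) = RtoC 0 -> (forall z, Cmod z < R0 -> f (- z)%C = f z) ->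
  exists g, hol g R0 /\ forall z, f z = (z * z * g z)%C.
Proof.
  intros HR Hf H0 He. assert (Z : Cmod (RtoC 0) < R0) by now rewrite Cmod_0.
  destruct (hol_divide f R0 (RtoC 0) Z Hf H0) as [f1 [H1 E1]].
  assert (E1' : forall z, f z = (z * f1 z)%C) by (intro z; rewrite E1; ring).
  assert (Hodd : forall z : C, z <> RtoC 0 -> Cmod z < R0 -> f1 (- z)%C = (- f1 z)%C).
  { intros z Hz Hr. specialize (He z Hr). rewrite !E1' in He.
    assert (Hz' : (- z)%C <> RtoC 0).
    { intro K. apply Hz. replace z with (- - z)%C by ring. rewrite K. ring. }
    replace (f1 (- z)%C) with (- z * f1 (- z) / - z)%C by (field; auto). rewrite He. field. auto. }
  assert (Hf10 : f1 (RtoC 0) = RtoC 0).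
  { assert (K : (f1 (RtoC 0) = - f1 (RtoC 0))%C).
    { set (un := fun x : R => RtoC x).
      assert (Hlim : clim (at_right 0) un (RtoC 0)).
      { apply clim_RtoC. apply filter_le_trans with (locally 0); [apply filter_le_within|apply filter_le_refl]. }
      assert (Hlim' : clim (at_right 0) (fun x => - un x)%C (RtoC 0)).
      { eapply clim_eq; [apply clim_opp, Hlim|ring]. }
      pose proof (hol_ccc f1 R0 (RtoC 0) H1 Z) as C1.
      apply (clim_unique (F := at_right 0) (fun x => f1 (- un x)%C)).
      - exact (clim_cnb_comp (at_right 0) f1 (fun x => - un x)%C _ _ Hlim' C1).
      - apply clim_ext with (f := fun x => (- f1 (un x))%C).
        + assert (Hr : locally 0 (fun x => x < R0)) by (apply open_lt; auto).
          unfold at_right, within. generalize Hr. apply filter_imp. intros x Hx1 Hx2. symmetry. apply Hodd.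
          * unfold un. apply RtoC_neq0. lra.
          * unfold un. rewrite Cmod_pos_RtoC; lra.
        + apply clim_opp. exact (clim_cnb_comp (at_right 0) f1 un _ _ Hlim C1). }
    apply (f_equal (fun u => u + f1 (RtoC 0))%C) in K.
    replace (- f1 (RtoC 0) + f1 (RtoC 0))%C with (RtoC 0) in K by ring.
    replace (f1 (RtoC 0)) with ((f1 (RtoC 0) + f1 (RtoC 0)) / 2)%C by field. rewrite K. field. }
  destruct (hol_divide f1 R0 (RtoC 0) Z H1 Hf10) as [f2 [H2 E2]].
  exists f2. split; auto. intro z. rewrite E1', E2. ring.
Qed.

(* Borel--Caratheodory, with the gain of a factor [|z| / r] for even functions. *)
Lemma borel_caratheodory_even L R0 r A z : 0 < r < R0 -> 0 < A -> hol L R0 -> L (RtoC 0) = RtoC 0 ->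
  (forall w, Cmod w < R0 -> L (- w)%C = L w) -> (forall w, Cmod w < R0 -> Re (L w) <= A) -> Cmod z < r ->
  Cmod (L z) <= 2 * A * (Cmod z ^ 2 / (r ^ 2 - Cmod z ^ 2)).
Proof.
  intros Hr HA HL L0 He HRe Hz. pose proof (Cmod_ge_0 z) as Hz0.
  (* [Re L <= A] says that [L] is at least as close to 0 as to [2 A], so [L / (2 A - L)] maps into
     the closed unit disc. Being even and zero at 0, it satisfies Schwarz's lemma with [z^2] in
     place of [z]. *)
  set (D := fun w => (RtoC (2 * A) - L w)%C).
  assert (HD : forall w, Cmod w < R0 -> Cmod (L w) <= Cmod (D w) /\ D w <> 0).
  { intros w Hw. specialize (HRe w Hw). split.
    - apply Rsqr_incr_0_var; [|apply Cmod_ge_0]. unfold Rsqr.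
      pose proof (Cmod2_alt (L w)). pose proof (Cmod2_alt (D w)). unfold D in *.
      rewrite re_minus, im_minus, re_RtoC, im_RtoC in H0. nra.
    - unfold D. intro K. apply (f_equal Re) in K. rewrite re_minus, !re_RtoC in K. lra. }
  assert (Hphi : hol (fun w => L w / D w)%C R0).
  { apply hol_div; auto; [|intros; now apply HD]. unfold D. apply hol_minus; auto. apply hol_const. }
  destruct (even_double_zero (fun w => L w / D w)%C R0) as [g [Hg E]]; auto; try lra.
  { rewrite L0. unfold Cdiv. apply Cmult_0_l. }
  { intros w Hw. unfold D. now rewrite He. }
  assert (Hr2 : 0 < r ^ 2) by (apply pow_lt; lra).
  assert (Hgz : Cmod (g z) <= / r ^ 2).
  { apply (max_principle g R0 r); auto. intros w Hw.
    assert (HwR : Cmod w < R0) by lra. destruct (HD w HwR) as [H1 H2].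
    assert (K : Cmod (L w / D w) <= 1).
    { rewrite Cmod_div; auto. apply Cmod_gt_0 in H2. apply Rmult_le_reg_r with (Cmod (D w)); auto.
      unfold Rdiv. rewrite Rmult_assoc, Rinv_l; lra. }
    rewrite E in K. rewrite !Cmod_mult, Hw in K. apply Rmult_le_reg_l with (r ^ 2); auto.
    rewrite Rinv_r by lra. simpl. rewrite Rmult_1_r. exact K. }
  assert (HzR : Cmod z < R0) by lra. destruct (HD z HzR) as [H1 H2].
  set (s := Cmod z ^ 2 / r ^ 2).
  assert (Hs : 0 <= s < 1).
  { unfold s. split; [apply Rmult_le_pos; [apply pow_le; lra|left; now apply Rinv_0_lt_compat]|].
    apply Rmult_lt_reg_r with (r ^ 2); auto. unfold Rdiv. rewrite Rmult_assoc, Rinv_l by lra. simpl. nra. }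
  assert (Hphiz : Cmod (L z) <= s * Cmod (D z)).
  { replace (L z) with (L z / D z * D z)%C by (field; auto). rewrite E, !Cmod_mult.
    apply Rmult_le_compat_r; [apply Cmod_ge_0|]. unfold s. replace (Cmod z ^ 2) with (Cmod z * Cmod z) by ring.
    apply Rmult_le_compat_l; [nra|auto]. }
  assert (HDz : Cmod (D z) <= 2 * A + Cmod (L z)).
  { unfold D. eapply Rle_trans; [apply Cmod_triangle|]. rewrite Cmod_opp, Cmod_pos_RtoC; lra. }
  assert (Hfin : Cmod (L z) * (1 - s) <= 2 * A * s) by nra.
  replace (Cmod z ^ 2 / (r ^ 2 - Cmod z ^ 2)) with (s / (1 - s)).
  2:{ unfold s. field. split; [|lra]. apply Rgt_not_eq. simpl. nra. }
  apply Rmult_le_reg_r with (1 - s); [lra|]. unfold Rdiv. rewrite <- Rmult_assoc, Rmult_assoc, Rinv_l; lra.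
Qed.

(** * Locally uniform limits *)

Definition lunif (fn : nat -> C -> C) (f : C -> C) (R0 : R) : Prop :=
  forall r e, r < R0 -> 0 < e -> exists N, forall n, (N <= n)%nat -> forall w, Cmod w <= r -> Cmod (fn n w - f w) < e.

Lemma cau1_norm phi r z B : 0 < r -> Cmod z < r -> (forall t, ccr phi t) ->
  (forall t, 0 <= t <= 2 * PI -> Cmod (phi t) <= B) -> Cmod (cau1 phi r z) <= B * (r / (r - Cmod z) ^ 2).
Proof.
  intros Hr Hz H HB. unfold cau1. apply mean_bound; [intro t; now apply ccr_cau1|].
  intros t Ht. rewrite Cmod_mult, Cmod_div by (apply Cmult_neq_0; now apply rc_neq). rewrite Cmod_rc, Cmod_mult by lra.
  apply Rmult_le_compat; try apply Cmod_ge_0; auto.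
  - apply Rmult_le_pos; [lra|]. left. apply Rinv_0_lt_compat.
    apply Rmult_lt_0_compat; apply Cmod_gt_0; now apply rc_neq.
  - unfold Rdiv. apply Rmult_le_compat_l; [lra|]. apply Rinv_le_contravar; [apply pow_lt; lra|].
    replace ((r - Cmod z) ^ 2) with ((r - Cmod z) * (r - Cmod z)) by ring.
    pose proof (rc_dist r t z ltac:(lra)). apply Rmult_le_compat; lra.
Qed.

Lemma lunif_ccc fn f R0 z : (forall n, hol (fn n) R0) -> lunif fn f R0 -> Cmod z < R0 -> ccc f z.
Proof.
  intros Hh Hu Hz e He. destruct (mid_radius z R0 Hz) as [r [Hr Hzr]].
  assert (He3 : 0 < e / 3) by lra.
  destruct (Hu r (e / 3) ltac:(lra) He3) as [N HN]. specialize (HN N (le_n _)).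
  generalize (filter_and _ _ (hol_ccc (fn N) R0 z (Hh N) Hz (e / 3) He3) (cnb_ball0 z r Hzr)).
  apply filter_imp. intros w [H1 H2]. pose proof (HN w ltac:(lra)) as H3. pose proof (HN z ltac:(lra)) as H4.
  rewrite Cmod_minus_sym in H3.
  eapply Rle_lt_trans; [apply (Cmod_triangle3 _ (fn N w))|].
  eapply Rle_lt_trans; [apply Rplus_le_compat_l, (Cmod_triangle3 _ (fn N z))|]. lra.
Qed.

(** Cauchy's formula passes to the uniform limit, so [f] is the Cauchy transform of its own values
    on a circle. The derivatives converge because [cau1] is bounded by the supremum on the
    circle. *)
Theorem weierstrass fn f R0 : (forall n, hol (fn n) R0) -> lunif fn f R0 ->
  hol f R0 /\ lunif (fun n => Cder (fn n)) (Cder f) R0.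
Proof.
  intros Hh Hu.
  assert (Hc : forall r, 0 < r < R0 -> forall t, ccr (fun t => f (rc r t)) t).
  { intros r Hr t. apply ccr_circ; [|lra]. intros w Hw. apply (lunif_ccc fn f R0); auto. lra. }
  assert (Hrep : forall r z, 0 < r < R0 -> Cmod z < r -> f z = cau (fun t => f (rc r t)) r z).
  { intros r z Hr Hz. apply Cmod_small_eq. intros e He. pose proof (Cmod_ge_0 z).
    set (K := 1 + r / (r - Cmod z)).
    assert (HK : 0 < K) by (unfold K; assert (0 < r / (r - Cmod z)) by (apply Rdiv_lt_0_compat; lra); lra).
    destruct (Hu r (e / K) ltac:(lra) ltac:(now apply Rdiv_lt_0_compat)) as [N HN]. specialize (HN N (le_n _)).
    eapply Rle_trans; [apply (Cmod_triangle3 _ (fn N z))|].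
    pose proof (HN z ltac:(lra)) as H1. rewrite Cmod_minus_sym in H1.
    assert (H2 : Cmod (fn N z - cau (fun t => f (rc r t)) r z) <= e / K * (r / (r - Cmod z))).
    { rewrite (hol_cau (fn N) R0 r z) by auto. unfold cau.
      match goal with |- Cmod (?a / ?c - ?b / ?c) <= _ => replace (a / c - b / c)%C with ((a - b) / c)%C by (field; apply TPI_neq0) end.
      rewrite <- cint_minus; try (apply conab_all; intro t; apply ccr_cau; auto; intro u; now apply (hol_ccr_circle (fn N) R0)).
      apply mean_bound.
      - intro t. apply ccr_minus; apply ccr_cau; auto. intro u; now apply (hol_ccr_circle (fn N) R0).
      - intros t Ht.
        match goal with |- Cmod (?a * ?c - ?b * ?c) <= _ => replace (a * c - b * c)%C with ((a - b) * c)%C by ring end.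
        rewrite Cmod_mult, Cmod_div by now apply rc_neq. rewrite Cmod_rc by lra.
        apply Rmult_le_compat; try apply Cmod_ge_0.
        + apply Rmult_le_pos; [lra|]. left. apply Rinv_0_lt_compat. apply Cmod_gt_0. now apply rc_neq.
        + left. apply HN. rewrite Cmod_rc; lra.
        + unfold Rdiv. apply Rmult_le_compat_l; [lra|]. apply Rinv_le_contravar; [lra|]. apply rc_dist. lra. }
    apply Rle_trans with (e / K * K); [unfold K at 2; lra|]. right. field. lra. }
  assert (Hd : forall r z, 0 < r < R0 -> Cmod z < r -> cder f z (cau1 (fun t => f (rc r t)) r z)).
  { intros r z Hr Hz. apply cder_ext with (cau (fun t => f (rc r t)) r).
    - generalize (cnb_ball0 z r Hz). apply filter_imp. intros w Hw. symmetry. now apply Hrep.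
    - apply cder_cau; auto. }
  split.
  - intros z Hz. destruct (mid_radius z R0 Hz) as [r [Hr Hzr]]. eexists. eapply Hd; eauto.
  - intros r0 e Hr0 He. destruct (Rlt_dec r0 0) as [Hneg|Hpos].
    { exists 0%nat. intros n _ w Hw. pose proof (Cmod_ge_0 w). lra. }
    set (r := (r0 + R0) / 2). assert (Hr : 0 < r < R0) by (unfold r; lra). assert (Hrr : r0 < r) by (unfold r; lra).
    set (K := r / (r - r0) ^ 2). assert (HK : 0 < K) by (apply Rdiv_lt_0_compat; [lra|apply pow_lt; lra]).
    destruct (Hu r (e / (2 * K)) ltac:(lra) ltac:(apply Rdiv_lt_0_compat; lra)) as [N HN]. exists N. intros n Hn w Hw.
    rewrite (Cder_eq f w _ (Hd r w Hr ltac:(lra))).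
    rewrite (Cder_eq (fn n) w _ (hol_cder (fn n) R0 r w Hr (Hh n) ltac:(lra))).
    replace (cau1 (fun t => fn n (rc r t)) r w - cau1 (fun t => f (rc r t)) r w)%C
      with (cau1 (fun t => fn n (rc r t) - f (rc r t))%C r w).
    + apply Rle_lt_trans with (e / (2 * K) * (r / (r - Cmod w) ^ 2)).
      * apply cau1_norm; try lra.
        -- intro t. apply ccr_minus; auto. now apply (hol_ccr_circle (fn n) R0).
        -- intros t _. left. apply HN; auto. rewrite Cmod_rc; lra.
      * apply Rle_lt_trans with (e / (2 * K) * K).
        -- apply Rmult_le_compat_l; [left; apply Rdiv_lt_0_compat; lra|]. unfold K, Rdiv.
           apply Rmult_le_compat_l; [lra|]. apply Rinv_le_contravar; [apply pow_lt; lra|]. apply pow_incr. lra.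
        -- replace (e / (2 * K) * K) with (e / 2) by (field; lra). lra.
    + unfold cau1.
      match goal with |- _ = (?a / ?c - ?b / ?c)%C => replace (a / c - b / c)%C with ((a - b) / c)%C by (field; apply TPI_neq0) end.
      rewrite <- cint_minus; try (apply conab_all; intro t; apply ccr_cau1; auto; try lra; intro u; now apply (hol_ccr_circle (fn n) R0)).
      f_equal. apply cint_ext. intros t _. ring.
Qed.

Lemma cauchy_estimate f R0 r M : 0 < r < R0 -> hol f R0 -> (forall w, Cmod w <= r -> Cmod (f w) <= M) ->
  Cmod (Cder f (RtoC 0)) <= M / r.
Proof.
  intros Hr Hf HM. assert (Z : Cmod (RtoC 0) < r) by (rewrite Cmod_0; lra).
  rewrite (Cder_eq f _ _ (hol_cder f R0 r _ Hr Hf Z)).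
  eapply Rle_trans; [apply (cau1_norm _ r _ M); auto; try lra|].
  - intro t. now apply (hol_ccr_circle f R0).
  - intros t _. apply HM. rewrite Cmod_rc; lra.
  - rewrite Cmod_0, Rminus_0_r. right. field. lra.
Qed.

(** * Integrals over the real line *)

(** The single dominating weight for all integrals over the line. Its primitive is [atan], which
    makes tails explicit, and affine substitutions change it only by a constant factor. *)
Definition wt (u : R) : R := / (1 + u ^ 2).

Lemma wt_pos u : 0 < wt u.
Proof. apply Rinv_0_lt_compat. nra. Qed.
Lemma wt_le1 u : wt u <= 1.
Proof. unfold wt. rewrite <- Rinv_1. apply Rinv_le_contravar; nra. Qed.
Lemma wt_cont u : continuous wt u.
Proof. apply (ex_derive_continuous (V := R_NormedModule)). unfold wt. auto_derive. nra. Qed.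

Definition DomC (K : R) (f : R -> C) : Prop := (forall x, ccr f x) /\ forall u, Cmod (f u) <= K * wt u.

Lemma DomC_K K f : DomC K f -> 0 <= K.
Proof.
  intros [_ H]. specialize (H 0). pose proof (Cmod_ge_0 (f 0)). pose proof (wt_pos 0). nra.
Qed.

Lemma DomC_le K K' f : K <= K' -> DomC K f -> DomC K' f.
Proof. intros H [H1 H2]. split; auto. intro u. specialize (H2 u). pose proof (wt_pos u). nra. Qed.

Lemma DomC_conab K f a b : DomC K f -> conab f a b.
Proof. intros [H _]. now apply conab_all. Qed.

Lemma RInt_wt a b : RInt wt a b = atan b - atan a.
Proof.
  apply is_RInt_unique. apply (is_RInt_derive (V := R_CompleteNormedModule) atan wt).
  - intros x _. unfold wt. apply is_derive_Reals.
    apply derivable_pt_lim_atan.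
  - intros x _. apply wt_cont.
Qed.

Lemma cint_dom K f a b : a <= b -> DomC K f -> Cmod (cint f a b) <= K * (atan b - atan a).
Proof.
  intros Hab Hf. eapply Rle_trans; [apply cint_norm_int; auto; now apply (DomC_conab K)|].
  rewrite <- RInt_wt.
  assert (Hw : ex_RInt wt a b) by (apply (ex_RInt_continuous (V := R_CompleteNormedModule)); intros; apply wt_cont).
  rewrite <- (RInt_scal (V := R_CompleteNormedModule) wt a b K Hw : RInt (fun x => K * wt x) a b = K * RInt wt a b).
  apply RInt_le; auto.
  - apply (ex_RInt_continuous (V := R_CompleteNormedModule)). intros. apply ccr_Cmod, Hf.
  - exact (ex_RInt_scal (V := R_NormedModule) wt a b K Hw).
  - intros x _. apply Hf.
Qed.

(** Mass of [wt] outside [[-A, A]]. *)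
Definition atl (A : R) : R := PI - 2 * atan A.

Lemma tl_pos A : 0 < atl A.
Proof. unfold atl. pose proof (atan_bound A). lra. Qed.

Lemma tl_decr A B : A <= B -> atl B <= atl A.
Proof. intros [H | ->]; [|lra]. unfold atl. pose proof (atan_increasing A B H). lra. Qed.

Lemma tl_small e : 0 < e -> exists A, 0 < A /\ forall B, A <= B -> atl B < e.
Proof.
  intro He. pose proof PI_RGT_0. set (e' := Rmin (e / 4) (PI / 4)).
  assert (0 < e') by (apply Rmin_glb_lt; lra). assert (e' <= e / 4) by apply Rmin_l. assert (e' <= PI / 4) by apply Rmin_r.
  assert (E : atan (tan (PI / 2 - e')) = PI / 2 - e') by (apply atan_tan; lra).
  exists (Rmax 1 (tan (PI / 2 - e'))). split; [eapply Rlt_le_trans; [|apply Rmax_l]; lra|].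
  intros B HB. assert (atl B <= atl (tan (PI / 2 - e'))).
  { apply tl_decr. eapply Rle_trans; [apply Rmax_r|exact HB]. }
  unfold atl in *. rewrite E in *. lra.
Qed.

Definition isI (f : R -> C) (l : C) : Prop := clim (Rbar_locally p_infty) (fun A => cint f (- A) A) l.
(* Only meaningful when the symmetric integrals converge; [DomC] guarantees it. *)
Definition Ig (f : R -> C) : C := epsilon (inhabits (RtoC 0)) (isI f).

Lemma pinfty_gt A : Rbar_locally p_infty (fun x => A < x).
Proof. exists A. auto. Qed.

Lemma isI_unique f a b : isI f a -> isI f b -> a = b.
Proof. apply clim_unique. Qed.

Lemma Ig_eq f l : isI f l -> Ig f = l.
Proof.
  intro H. apply (isI_unique f); auto. unfold Ig. apply (epsilon_spec (inhabits (RtoC 0)) (isI f)). eauto.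
Qed.

Lemma cint_sym_diff K f A B : 0 <= A <= B -> DomC K f -> Cmod (cint f (- B) B - cint f (- A) A) <= K * (atl A - atl B).
Proof.
  intros H Hf.
  rewrite <- (cint_Chasles f (-B) (-A) B), <- (cint_Chasles f (-A) A B) by now apply (DomC_conab K).
  replace (cint f (- B) (- A) + (cint f (- A) A + cint f A B) - cint f (- A) A)%C
    with (cint f (- B) (- A) + cint f A B)%C by ring.
  eapply Rle_trans; [apply Cmod_triangle|].
  pose proof (cint_dom K f (-B) (-A) ltac:(lra) Hf). pose proof (cint_dom K f A B ltac:(lra) Hf).
  rewrite !atan_opp in *. unfold atl. lra.
Qed.

Lemma clim_cauchy {T} (F : (T -> Prop) -> Prop) {FF : ProperFilter F} (f : T -> C) :
  (forall e, 0 < e -> exists P, F P /\ forall x y, P x -> P y -> Cmod (f x - f y) < e) -> exists l, clim F f l.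
Proof.
  intro H.
  assert (Hp : forall p : C -> R, (forall x y, Rabs (p x - p y) <= Cmod (x - y)) -> exists a, filterlim (fun x => p (f x)) F (locally a)).
  { intros p Hp. apply (filterlim_locally_cauchy (U := R_CompleteSpace)). intro e. destruct (H e (cond_pos e)) as [P [HP HQ]].
    exists P. split; auto. intros u v Hu Hv. change (Rabs (p (f v) - p (f u)) < e). eapply Rle_lt_trans; [apply Hp|auto]. }
  destruct (Hp Re) as [a Ha]; [intros; rewrite <- re_minus; apply re_le_Cmod|].
  destruct (Hp Im) as [b Hb]; [intros; rewrite <- im_minus; apply im_le_Cmod|].
  exists (a, b). now apply clim_parts.
Qed.

Lemma tl_scaled K e : 0 <= K -> 0 < e -> exists A, 0 < A /\ forall B, A <= B -> K * atl B < e.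
Proof.
  intros HK He. destruct (tl_small (e / (K + 1))) as [A [HA H]]; [apply Rdiv_lt_0_compat; lra|].
  exists A. split; auto. intros B HB. specialize (H B HB). pose proof (tl_pos B).
  assert ((K + 1) * atl B < e).
  { replace e with ((K + 1) * (e / (K + 1))) by (field; lra). apply Rmult_lt_compat_l; lra. }
  nra.
Qed.

Lemma Ig_spec K f : DomC K f -> isI f (Ig f).
Proof.
  intro Hf. pose proof (DomC_K _ _ Hf) as HK.
  assert (E : exists l, isI f l).
  { apply (clim_cauchy (Rbar_locally p_infty)). intros e He. destruct (tl_scaled K e HK He) as [A [HA H]].
    exists (fun x => A < x). split; [apply pinfty_gt|].
    assert (S : forall x y, A < x -> x <= y -> Cmod (cint f (- y) y - cint f (- x) x) < e).
    { intros x y Hx Hy. eapply Rle_lt_trans; [apply (cint_sym_diff K); auto; lra|].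
      specialize (H x ltac:(lra)). pose proof (tl_pos y). nra. }
    intros x y Hx Hy. destruct (Rle_dec x y); [rewrite Cmod_minus_sym|]; apply S; lra. }
  destruct E as [l Hl]. now rewrite (Ig_eq f l Hl).
Qed.

Lemma Ig_tail K f A : DomC K f -> 0 <= A -> Cmod (Ig f - cint f (- A) A) <= K * atl A.
Proof.
  intros Hf HA. pose proof (DomC_K _ _ Hf) as HK.
  apply (clim_Cmod_le (F := Rbar_locally p_infty) (fun B => cint f (- B) B - cint f (- A) A)%C).
  - apply clim_minus; [now apply (Ig_spec K)|apply clim_const].
  - exists A. intros B HB. eapply Rle_trans; [apply (cint_sym_diff K); auto; lra|]. pose proof (tl_pos B). nra.
Qed.

Lemma Ig_bound K f : DomC K f -> Cmod (Ig f) <= K * PI.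
Proof.
  intro Hf. pose proof (Ig_tail K f 0 Hf ltac:(lra)) as H. rewrite Ropp_0, cint_point in H.
  unfold atl in H. rewrite atan_0 in H. replace (Ig f - RtoC 0)%C with (Ig f) in H by ring. lra.
Qed.

(** Asymmetric windows arise from affine substitutions and from improper integrals whose two ends
    move independently. *)
Lemma Ig_wide K f p q B : DomC K f -> 0 <= B -> p <= - B -> B <= q -> Cmod (Ig f - cint f p q) <= 2 * K * atl B.
Proof.
  intros Hf HB Hp Hq. pose proof (DomC_K _ _ Hf) as HK.
  rewrite <- (cint_Chasles f p (-B) q), <- (cint_Chasles f (-B) B q) by now apply (DomC_conab K).
  replace (Ig f - (cint f p (- B) + (cint f (- B) B + cint f B q)))%C
    with ((Ig f - cint f (-B) B) + (- cint f p (- B) + - cint f B q))%C by ring.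
  eapply Rle_trans; [apply Cmod_triangle|]. eapply Rle_trans; [apply Rplus_le_compat_l, Cmod_triangle|].
  rewrite !Cmod_opp. pose proof (Ig_tail K f B Hf HB).
  pose proof (cint_dom K f p (-B) ltac:(lra) Hf). pose proof (cint_dom K f B q ltac:(lra) Hf).
  rewrite atan_opp in *. unfold atl in *. pose proof (atan_bound p). pose proof (atan_bound q). nra.
Qed.

Lemma DomC_plus K K' f g : DomC K f -> DomC K' g -> DomC (K + K') (fun u => f u + g u)%C.
Proof.
  intros [H1 H2] [H3 H4]. split; [intro; now apply ccr_plus|]. intro u. eapply Rle_trans; [apply Cmod_triangle|].
  specialize (H2 u). specialize (H4 u). lra.
Qed.
Lemma DomC_mult K M f g : DomC K f -> (forall x, ccr g x) -> (forall u, Cmod (g u) <= M) -> DomC (M * K) (fun u => g u * f u)%C.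
Proof.
  intros [H1 H2] H3 H4. split; [intro; now apply ccr_mult|]. intro u. rewrite Cmod_mult, Rmult_assoc.
  apply Rmult_le_compat; try apply Cmod_ge_0; auto.
Qed.
Lemma DomC_scal K c f : DomC K f -> DomC (Cmod c * K) (fun u => c * f u)%C.
Proof. intro H. apply (DomC_mult K (Cmod c) f (fun _ => c)); auto; [intro; apply ccr_const|intro; lra]. Qed.
Lemma DomC_opp K f : DomC K f -> DomC K (fun u => - f u)%C.
Proof. intros [H1 H2]. split; [intro; now apply ccr_opp|]. intro. now rewrite Cmod_opp. Qed.
Lemma DomC_minus K K' f g : DomC K f -> DomC K' g -> DomC (K + K') (fun u => f u - g u)%C.
Proof. intros. apply DomC_plus; auto. now apply DomC_opp. Qed.

Lemma Ig_plus K K' f g : DomC K f -> DomC K' g -> Ig (fun u => f u + g u)%C = (Ig f + Ig g)%C.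
Proof.
  intros Hf Hg. apply Ig_eq. apply clim_ext with (f := fun A => (cint f (- A) A + cint g (- A) A)%C).
  - apply filter_forall. intro A. symmetry. apply cint_plus; eapply DomC_conab; eauto.
  - apply clim_plus; eapply Ig_spec; eauto.
Qed.
Lemma Ig_scal K c f : DomC K f -> Ig (fun u => c * f u)%C = (c * Ig f)%C.
Proof.
  intros Hf. apply Ig_eq. apply clim_ext with (f := fun A => (c * cint f (- A) A)%C).
  - apply filter_forall. intro A. symmetry. apply cint_scal; eapply DomC_conab; eauto.
  - apply clim_mult; [apply clim_const|]. eapply Ig_spec; eauto.
Qed.
Lemma Ig_minus K K' f g : DomC K f -> DomC K' g -> Ig (fun u => f u - g u)%C = (Ig f - Ig g)%C.
Proof.
  intros Hf Hg. apply Ig_eq. apply clim_ext with (f := fun A => (cint f (- A) A - cint g (- A) A)%C).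
  - apply filter_forall. intro A. symmetry. apply cint_minus; eapply DomC_conab; eauto.
  - apply clim_minus; eapply Ig_spec; eauto.
Qed.
Lemma Ig_ext f g : (forall u, f u = g u) -> Ig f = Ig g.
Proof. intro H. f_equal. now apply functional_extensionality. Qed.
Lemma DomC_ext K f g : (forall u, f u = g u) -> DomC K f -> DomC K g.
Proof. intro H. now replace g with f by now apply functional_extensionality. Qed.

Lemma Ig_conj K f : DomC K f -> Ig (fun u => Cconj (f u)) = Cconj (Ig f).
Proof.
  intro Hf. apply Ig_eq. apply clim_ext with (f := fun A => Cconj (cint f (- A) A)).
  - apply filter_forall. intro A. symmetry. apply cint_conj; eapply DomC_conab; eauto.
  - apply clim_conj. eapply Ig_spec; eauto.
Qed.

Lemma Ig_le K K' f (g : R -> R) : DomC K f -> DomC K' (fun u => RtoC (g u)) -> (forall u, Cmod (f u) <= g u) ->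
  Cmod (Ig f) <= Re (Ig (fun u => RtoC (g u))).
Proof.
  intros Hf Hg H.
  pose proof (clim_Cmod _ _ (Ig_spec K f Hf)) as L1. pose proof (clim_re _ _ (Ig_spec K' _ Hg)) as L2.
  refine (filterlim_le (F := Rbar_locally p_infty) _ _ (Finite _) (Finite _) _ L1 L2).
  exists 0. intros A HA. eapply Rle_trans; [apply cint_norm_int; [lra|now apply (DomC_conab K)]|].
  simpl. apply RInt_le; [lra| | |intros; apply H].
  - apply (ex_RInt_continuous (V := R_CompleteNormedModule)). intros. apply ccr_Cmod, Hf.
  - apply (cint_ex_re (-A) A (fun u => RtoC (g u))). now apply (DomC_conab K').
Qed.

Lemma Ig_real K (g : R -> R) : DomC K (fun u => RtoC (g u)) -> Ig (fun u => RtoC (g u)) = RtoC (Re (Ig (fun u => RtoC (g u)))).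
Proof.
  intro H. apply Ceq_parts; [reflexivity|]. rewrite im_RtoC.
  pose proof (Ig_conj K _ H) as E. rewrite (Ig_ext _ (fun u => RtoC (g u))) in E.
  - apply (f_equal Im) in E. rewrite im_conj in E. lra.
  - intro u. apply Ceq_parts; simpl; ring.
Qed.

Lemma Ig_ge0 K (g : R -> R) : DomC K (fun u => RtoC (g u)) -> (forall u, 0 <= g u) -> 0 <= Re (Ig (fun u => RtoC (g u))).
Proof.
  intros H Hg. assert (D0 : DomC 0 (fun _ => RtoC 0)).
  { split; [intro; apply ccr_const|]. intro u. rewrite Cmod_0. lra. }
  eapply Rle_trans; [apply Cmod_ge_0|apply (Ig_le 0 K (fun _ => RtoC 0) g D0 H)].
  intro u. rewrite Cmod_0. auto.
Qed.

Lemma Ig_mono K K' (f g : R -> R) : DomC K (fun u => RtoC (f u)) -> DomC K' (fun u => RtoC (g u)) ->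
  (forall u, f u <= g u) -> Re (Ig (fun u => RtoC (f u))) <= Re (Ig (fun u => RtoC (g u))).
Proof.
  intros Hf Hg H. pose proof (DomC_minus _ _ _ _ Hg Hf) as D.
  assert (D' : DomC (K' + K) (fun u => RtoC (g u - f u))) by (revert D; apply DomC_ext; intro; now rewrite RtoC_minus).
  pose proof (Ig_ge0 _ _ D' ltac:(intro u; specialize (H u); lra)) as G.
  rewrite (Ig_ext _ (fun u => RtoC (g u) - RtoC (f u))%C) in G by (intro; now rewrite RtoC_minus).
  rewrite (Ig_minus _ _ _ _ Hg Hf), re_minus in G. lra.
Qed.

Lemma Ig_ge_cint K (g : R -> R) a b : a <= b -> DomC K (fun u => RtoC (g u)) -> (forall u, 0 <= g u) ->
  RInt g a b <= Re (Ig (fun u => RtoC (g u))).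
Proof.
  intros Hab H Hg. pose proof (clim_re _ _ (Ig_spec K _ H)) as L.
  refine (filterlim_le (F := Rbar_locally p_infty) (fun _ => RInt g a b) _ (Finite _) (Finite _) _ (filterlim_const _) L).
  assert (Hex : forall p q, ex_RInt g p q) by (intros; apply (cint_ex_re p q (fun u => RtoC (g u))); now apply (DomC_conab K)).
  exists (Rmax (Rabs a) (Rabs b)). intros A HA.
  assert (Rabs a < A) by (eapply Rle_lt_trans; [apply Rmax_l|exact HA]).
  assert (Rabs b < A) by (eapply Rle_lt_trans; [apply Rmax_r|exact HA]).
  apply Rabs_def2 in H0. apply Rabs_def2 in H1. simpl.
  change (RInt g a b <= RInt g (- A) A).
  rewrite <- (RInt_Chasles (V := R_CompleteNormedModule) g (-A) a A), <- (RInt_Chasles (V := R_CompleteNormedModule) g a b A) by auto.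
  change (RInt g a b <= RInt g (- A) a + (RInt g a b + RInt g b A)).
  pose proof (RInt_ge_0 g (-A) a ltac:(lra) (Hex _ _) ltac:(auto)).
  pose proof (RInt_ge_0 g b A ltac:(lra) (Hex _ _) ltac:(auto)). lra.
Qed.

Lemma Ig_pos K (g : R -> R) : DomC K (fun u => RtoC (g u)) -> (forall u, 0 < g u) -> 0 < Re (Ig (fun u => RtoC (g u))).
Proof.
  intros H Hg. eapply Rlt_le_trans; [|apply (Ig_ge_cint K g 0 1); auto; [lra|intro; left; apply Hg]].
  apply RInt_gt_0; auto; [lra|]. intros x _. apply (ccr_re (fun u => RtoC (g u))). apply H.
Qed.

Lemma wt_lin_bound lam a : lam <> 0 -> exists K, 0 < K /\ forall u, wt (lam * u + a) <= K * wt u.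
Proof.
  intro Hl. exists (2 / lam ^ 2 + 2 * (a ^ 2 / lam ^ 2) + 1).
  assert (Hl2 : 0 < lam ^ 2) by (simpl; nra).
  assert (0 < 2 / lam ^ 2) by (apply Rdiv_lt_0_compat; lra).
  assert (0 <= a ^ 2 / lam ^ 2) by (apply Rmult_le_pos; [simpl; nra|left; now apply Rinv_0_lt_compat]).
  split; [lra|]. intro u. unfold wt.
  assert (P1 : 0 < 1 + (lam * u + a) ^ 2) by (pose proof (pow2_ge_0 (lam * u + a)); lra).
  assert (P2 : 0 < 1 + u ^ 2) by (pose proof (pow2_ge_0 u); lra).
  apply Rmult_le_reg_r with ((1 + (lam * u + a) ^ 2) * (1 + u ^ 2)); [now apply Rmult_lt_0_compat|].
  replace (/ (1 + (lam * u + a) ^ 2) * ((1 + (lam * u + a) ^ 2) * (1 + u ^ 2))) with (1 + u ^ 2) by (field; lra).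
  replace (_ * / (1 + u ^ 2) * _) with ((2 / lam ^ 2 + 2 * (a ^ 2 / lam ^ 2) + 1) * (1 + (lam * u + a) ^ 2)) by (field; lra).
  set (v := lam * u + a). replace u with ((v - a) / lam) by (unfold v; field; auto).
  replace (((v - a) / lam) ^ 2) with ((v - a) ^ 2 / lam ^ 2) by (field; auto).
  assert (E : (v - a) ^ 2 <= 2 * v ^ 2 + 2 * a ^ 2) by (pose proof (pow2_ge_0 (v + a)); lra).
  assert (Hi : 0 < / lam ^ 2) by now apply Rinv_0_lt_compat. unfold Rdiv in *.
  assert (Hv := pow2_ge_0 v). assert (Ha := pow2_ge_0 a).
  pose proof (Rmult_le_compat_r (/ lam ^ 2) _ _ (Rlt_le _ _ Hi) E) as E'.
  pose proof (Rmult_le_pos _ _ (Rmult_le_pos _ _ Ha (Rlt_le _ _ Hi)) Hv) as E2.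
  pose proof (Rmult_le_pos _ _ (Rlt_le _ _ Hi) Hv) as E3. clearbody v. lra.
Qed.

Lemma DomC_lin K f lam a : lam <> 0 -> DomC K f -> exists K', DomC K' (fun u => f (lam * u + a)%R).
Proof.
  intros Hl Hf. pose proof (DomC_K _ _ Hf). destruct (wt_lin_bound lam a Hl) as [K1 [HK1 H1]]. exists (K * K1). split.
  - intro x. apply (clim_comp (locally x) (locally (lam * x + a)) (fun u => lam * u + a) f).
    + apply (ex_derive_continuous (V := R_NormedModule) (fun u => lam * u + a)). auto_derive. auto.
    + apply Hf.
  - intro u. eapply Rle_trans; [apply Hf|]. rewrite Rmult_assoc. apply Rmult_le_compat_l; auto.
Qed.

Lemma Ig_lin_pos K f lam a : 0 < lam -> DomC K f -> (RtoC lam * Ig (fun u => f (lam * u + a)%R))%C = Ig f.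
Proof.
  intros Hl Hf. destruct (DomC_lin K f lam a ltac:(lra) Hf) as [K' Hf']. pose proof (DomC_K _ _ Hf) as HK.
  apply (clim_unique (F := Rbar_locally p_infty) (fun A => cint f (lam * (- A) + a) (lam * A + a))).
  - apply clim_ext with (f := fun A => (RtoC lam * cint (fun u => f (lam * u + a)%R) (- A) A)%C).
    + apply filter_forall. intro A. apply cint_comp_lin. now apply (DomC_conab K).
    + apply clim_mult; [apply clim_const|]. now apply (Ig_spec K').
  - intros e He. destruct (tl_scaled (2 * K) e ltac:(lra) He) as [B [HB H]].
    exists ((B + Rabs a) / lam). intros A HA.
    assert (HA' : B + Rabs a < lam * A).
    { apply (Rmult_lt_compat_l lam) in HA; auto. replace (lam * ((B + Rabs a) / lam)) with (B + Rabs a) in HA by (field; lra). lra. }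
    pose proof (Rle_abs a). pose proof (Rle_abs (- a)). rewrite Rabs_Ropp in H1.
    rewrite Cmod_minus_sym. eapply Rle_lt_trans; [apply (Ig_wide K f _ _ B); auto; lra|]. apply H. lra.
Qed.

Lemma Ig_shift K f a : DomC K f -> Ig (fun u => f (u + a)%R) = Ig f.
Proof.
  intro Hf. rewrite <- (Ig_lin_pos K f 1 a ltac:(lra) Hf). rewrite Cmult_1_l. apply Ig_ext. intro u. f_equal. ring.
Qed.

Lemma Ig_reflect K f : DomC K f -> Ig (fun u => f (- u)%R) = Ig f.
Proof.
  intro Hf. apply Ig_eq. apply clim_ext with (f := fun A => cint f (- A) A); [|now apply (Ig_spec K)].
  apply filter_forall. intro A.
  pose proof (cint_comp_lin f (-1) 0 (-A) A ltac:(now apply (DomC_conab K))) as E.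
  replace (-1 * - A + 0) with A in E by ring. replace (-1 * A + 0) with (- A) in E by ring.
  pose proof (cint_Chasles f (-A) A (-A) ltac:(now apply (DomC_conab K)) ltac:(now apply (DomC_conab K))) as E2.
  rewrite cint_point, <- E in E2.
  rewrite (cint_ext (-A) A (fun t => f (-1 * t + 0)%R) (fun t => f (- t)%R)) in E2 by (intros; f_equal; ring).
  apply (f_equal (fun z => z + cint (fun t => f (- t)%R) (- A) A)%C) in E2.
  replace (RtoC (-1)) with (- (1))%C in E2 by (apply Ceq_parts; simpl; ring).
  replace (cint f (- A) A) with (cint f (- A) A + - (1) * cint (fun t => f (- t)%R) (- A) A + cint (fun t => f (- t)%R) (- A) A)%C by ring.
  rewrite E2. ring.
Qed.

(** Dominated convergence in its elementary form: the common constant [K] controls all tails at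
    once, and uniform convergence on the remaining compact interval does the rest. *)
Lemma Ig_lim {T} (F : (T -> Prop) -> Prop) {FF : ProperFilter F} (f : T -> R -> C) g K :
  F (fun t => DomC K (f t)) -> DomC K g ->
  (forall A e, 0 < A -> 0 < e -> F (fun t => forall u, - A <= u <= A -> Cmod (f t u - g u) <= e)) ->
  clim F (fun t => Ig (f t)) (Ig g).
Proof.
  intros Hf Hg H e He. pose proof (DomC_K _ _ Hg) as HK.
  destruct (tl_scaled K (e / 4) HK ltac:(lra)) as [A [HA Ht]]. specialize (Ht A (Rle_refl _)).
  assert (He' : 0 < e / (8 * A)) by (apply Rdiv_lt_0_compat; lra).
  generalize (filter_and _ _ Hf (H A _ HA He')). apply filter_imp. intros t [Df Hu].
  pose proof (Ig_tail K (f t) A Df ltac:(lra)) as T1. pose proof (Ig_tail K g A Hg ltac:(lra)) as T2.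
  replace (Ig (f t) - Ig g)%C with ((Ig (f t) - cint (f t) (-A) A) + ((cint (f t) (-A) A - cint g (-A) A) - (Ig g - cint g (-A) A)))%C by ring.
  eapply Rle_lt_trans; [apply Cmod_triangle|]. eapply Rle_lt_trans; [apply Rplus_le_compat_l, Cmod_triangle|].
  rewrite Cmod_opp, <- cint_minus by (eapply DomC_conab; eauto).
  assert (Cmod (cint (fun u => f t u - g u)%C (- A) A) <= e / (8 * A) * (A - - A)).
  { apply cint_norm; auto; [lra|]. intros u _. apply ccr_minus; [apply Df|apply Hg]. }
  replace (e / (8 * A) * (A - - A)) with (e / 4) in H0 by (field; lra). lra.
Qed.

Lemma Ig_ftc K G g : (forall u, rder G u (g u)) -> DomC K g ->
  clim (Rbar_locally p_infty) G 0 -> clim (Rbar_locally p_infty) (fun A => G (- A)) 0 -> Ig g = 0.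
Proof.
  intros HG Hg H1 H2. apply Ig_eq. apply clim_ext with (f := fun A : R => (G A - G (- A)%R)%C).
  - apply filter_forall. intro A. symmetry. apply cint_ftc; [intros; apply HG|now apply (DomC_conab K)].
  - eapply clim_eq; [apply clim_minus; eauto|ring].
Qed.

(** * Fubini's theorem *)

Lemma Cmod_pair_l x x' y : Cmod ((x, y) - (x', y)) = Rabs (x - x').
Proof. replace ((x, y) - (x', y))%C with (RtoC (x - x')) by (apply Ceq_parts; simpl; ring). apply Cmod_R. Qed.

Lemma locally_abs x (P : R -> Prop) d : 0 < d -> (forall y, Rabs (y - x) < d -> P y) -> locally x P.
Proof. intros Hd H. exists (mkposreal d Hd). intros y Hy. apply H. exact Hy. Qed.

Lemma unif_vertical f x c d : (forall z, ccc f z) -> forall e, 0 < e ->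
  locally x (fun x' => forall y, c <= y <= d -> Cmod (f (x', y) - f (x, y)) <= e).
Proof.
  intros Hf e He. destruct (unif_cont_rect f (x - 1) (x + 1) c d (fun z _ => Hf z) e He) as [dl [Hdl H]].
  apply locally_abs with (Rmin 1 dl); [apply Rmin_glb_lt; lra|]. intros x' Hx' y Hy.
  pose proof (Rmin_l 1 dl). pose proof (Rmin_r 1 dl).
  left. apply H; [split; simpl; lra| |rewrite Cmod_pair_l; lra].
  assert (K : Rabs (x' - x) < 1) by lra. apply Rabs_def2 in K. split; simpl; lra.
Qed.

Lemma ccr_inner f c d x : c <= d -> (forall z, ccc f z) -> ccr (fun x => cint (fun y => f (x, y)) c d) x.
Proof.
  intros Hcd Hf e He.
  assert (He' : 0 < e / (2 * (d - c + 1))) by (apply Rdiv_lt_0_compat; lra).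
  generalize (unif_vertical f x c d Hf _ He'). apply filter_imp. intros x' H.
  assert (Hc : forall x, conab (fun y => f (x, y)) c d) by (intros; apply conab_all; intros; now apply ccr_ver).
  rewrite <- cint_minus by apply Hc.
  apply Rle_lt_trans with (e / (2 * (d - c + 1)) * (d - c)).
  - apply cint_norm; auto. intros y Hy. apply ccr_minus; now apply Hc.
  - apply Rle_lt_trans with (e / (2 * (d - c + 1)) * (d - c + 1)); [apply Rmult_le_compat_l; lra|].
    replace (e / (2 * (d - c + 1)) * (d - c + 1)) with (e / 2) by (field; lra). lra.
Qed.

Lemma ccc_swap f : (forall z, ccc f z) -> forall z, ccc (fun w => f (Im w, Re w)) z.
Proof.
  intros Hf z. apply (ccc_comp f (fun w => (Im w, Re w) : C)); auto.
  apply clim_parts; simpl; [exact (clim_im _ _ (clim_cnb_id z))|exact (clim_re _ _ (clim_cnb_id z))].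
Qed.

Lemma ccr_inner' f a b y : a <= b -> (forall z, ccc f z) -> ccr (fun y => cint (fun x => f (x, y)) a b) y.
Proof. intros Hab Hf. exact (ccr_inner (fun w => f (Im w, Re w)) a b y Hab (ccc_swap f Hf)). Qed.

(** The difference of the two iterated integrals is additive under quartering. On a small rectangle
    both are close to the value at the tag times the area, so [cousin] bounds the difference by [e1]
    times the area. *)
Theorem cint_fubini f a b c d : a <= b -> c <= d -> (forall z, ccc f z) ->
  cint (fun x => cint (fun y => f (x, y)) c d) a b = cint (fun y => cint (fun x => f (x, y)) a b) c d.
Proof.
  intros Hab Hcd Hf.
  set (T := fun a b c d => (cint (fun x => cint (fun y => f (x, y)) c d) a b - cint (fun y => cint (fun x => f (x, y)) a b) c d)%C).
  assert (V : forall x c d, conab (fun y => f (x, y)) c d) by (intros; apply conab_all; intros; now apply ccr_ver).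
  assert (Hh : forall y a b, conab (fun x => f (x, y)) a b) by (intros; apply conab_all; intros; now apply ccr_hor).
  assert (VI : forall c d a b, c <= d -> conab (fun x => cint (fun y => f (x, y)) c d) a b) by (intros; apply conab_all; intros; now apply ccr_inner).
  assert (HI : forall a b c d, a <= b -> conab (fun y => cint (fun x => f (x, y)) a b) c d) by (intros; apply conab_all; intros; now apply ccr_inner').
  apply Cmod_small_eq. intros e He. change (Cmod (T a b c d) <= e).
  set (L := (b - a) * (d - c) + 1). assert (HL : 0 < L) by (unfold L; nra).
  set (e1 := e / L). assert (He1 : 0 < e1) by now apply Rdiv_lt_0_compat.
  assert (G : Cmod (T a b c d) <= e1 * ((b - a) * (d - c))).
  2:{ eapply Rle_trans; [exact G|]. apply Rle_trans with (e1 * L); [apply Rmult_le_compat_l; unfold L; lra|].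
      unfold e1. right. field. lra. }
  apply (cousin (fun a b c d => Cmod (T a b c d) <= e1 * ((b - a) * (d - c)))); auto.
  - intros a' b' c' d' H1 H2 K1 K2 K3 K4.
    set (m := (a' + b') / 2) in *. set (n := (c' + d') / 2) in *.
    assert (Hm : a' <= m <= b') by (unfold m; lra). assert (Hn : c' <= n <= d') by (unfold n; lra).
    assert (E : T a' b' c' d' = ((T a' m c' n + T m b' c' n) + (T a' m n d' + T m b' n d'))%C).
    { unfold T.
      rewrite (cint_ext a' b' (fun x => cint (fun y => f (x, y)) c' d') (fun x => cint (fun y => f (x, y)) c' n + cint (fun y => f (x, y)) n d')%C)
        by (intros; now rewrite cint_Chasles).
      rewrite (cint_ext c' d' (fun y => cint (fun x => f (x, y)) a' b') (fun y => cint (fun x => f (x, y)) a' m + cint (fun x => f (x, y)) m b')%C)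
        by (intros; now rewrite cint_Chasles).
      rewrite (cint_plus a' b' (fun x => cint (fun y => f (x, y)) c' n) (fun x => cint (fun y => f (x, y)) n d')) by (apply VI; lra).
      rewrite (cint_plus c' d' (fun y => cint (fun x => f (x, y)) a' m) (fun y => cint (fun x => f (x, y)) m b')) by (apply HI; lra).
      rewrite <- (cint_Chasles (fun x => cint (fun y => f (x, y)) c' n) a' m b') by (apply VI; lra).
      rewrite <- (cint_Chasles (fun x => cint (fun y => f (x, y)) n d') a' m b') by (apply VI; lra).
      rewrite <- (cint_Chasles (fun y => cint (fun x => f (x, y)) a' m) c' n d') by (apply HI; lra).
      rewrite <- (cint_Chasles (fun y => cint (fun x => f (x, y)) m b') c' n d') by (apply HI; lra). ring. }
    rewrite E. eapply Rle_trans; [apply Cmod_triangle|]. eapply Rle_trans; [apply Rplus_le_compat; apply Cmod_triangle|].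
    replace (m - a') with ((b' - a') / 2) in * by (unfold m; field).
    replace (b' - m) with ((b' - a') / 2) in * by (unfold m; field).
    replace (n - c') with ((d' - c') / 2) in * by (unfold n; field).
    replace (d' - n) with ((d' - c') / 2) in * by (unfold n; field). lra.
  - intros u v Hu Hv. destruct (Hf (u, v) (e1 / 2) ltac:(lra)) as [r [Hr H]].
    exists (r / 2). split; [lra|]. intros a' b' c' d' Ha Hb Hc Hd Hx Hy.
    set (k := f (u, v)).
    assert (Hk : forall x y, a' <= x <= b' -> c' <= y <= d' -> Cmod (f (x, y) - k) <= e1 / 2).
    { intros x y Hx' Hy'. left. apply H. eapply Rle_lt_trans; [apply Cmod_le_add|].
      rewrite re_minus, im_minus. simpl. assert (Rabs (x - u) < r / 2) by (apply Rabs_def1; lra).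
      assert (Rabs (y - v) < r / 2) by (apply Rabs_def1; lra). lra. }
    assert (E1 : Cmod (cint (fun x => cint (fun y => f (x, y)) c' d') a' b' - k * RtoC (d' - c') * RtoC (b' - a')) <= e1 / 2 * (d' - c') * (b' - a')).
    { rewrite <- cint_const, <- cint_minus; [|apply VI; lra|intros x _; apply ccr_const].
      apply cint_norm; [lra| |].
      - intros x Hx'. apply ccr_minus; [apply ccr_inner; auto; lra|apply ccr_const].
      - intros x Hx'. rewrite <- cint_const, <- cint_minus; auto; [|intros y _; apply ccr_const].
        apply cint_norm; [lra| |intros; now apply Hk]. intros y Hy'. apply ccr_minus; [now apply ccr_ver|apply ccr_const]. }
    assert (E2 : Cmod (cint (fun y => cint (fun x => f (x, y)) a' b') c' d' - k * RtoC (b' - a') * RtoC (d' - c')) <= e1 / 2 * (b' - a') * (d' - c')).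
    { rewrite <- cint_const, <- cint_minus; [|apply HI; lra|intros x _; apply ccr_const].
      apply cint_norm; [lra| |].
      - intros x Hx'. apply ccr_minus; [apply ccr_inner'; auto; lra|apply ccr_const].
      - intros x Hx'. rewrite <- cint_const, <- cint_minus; auto; [|intros y _; apply ccr_const].
        apply cint_norm; [lra| |intros; now apply Hk]. intros y Hy'. apply ccr_minus; [now apply ccr_hor|apply ccr_const]. }
    unfold T. set (I1 := cint _ a' b') in *. set (I2 := cint _ c' d') in *.
    replace (I1 - I2)%C with ((I1 - k * RtoC (d' - c') * RtoC (b' - a')) - (I2 - k * RtoC (b' - a') * RtoC (d' - c')))%C by ring.
    eapply Rle_trans; [apply Cmod_triangle|]. rewrite Cmod_opp. lra.
Qed.

Lemma ccr_Ig f x K : (forall z, ccc f z) -> locally x (fun x' => forall y, Cmod (f (x', y)) <= K * wt y) ->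
  ccr (fun x => Ig (fun y => f (x, y))) x.
Proof.
  intros Hf H. apply (Ig_lim (locally x) (fun x y => f (x, y)) (fun y => f (x, y)) K).
  - generalize H. apply filter_imp. intros x' Hx'. split; auto. intro y. now apply ccr_ver.
  - split; [intro y; now apply ccr_ver|]. exact (locally_singleton _ _ H).
  - intros A e HA He. now apply unif_vertical.
Qed.

(** Under a product weight each iterated integral is approximated by the one over a square. The
    estimate [Main] is proved for a general integrand and used for [f] and for [f] with its
    variables exchanged; the squares are matched by the finite case. *)
Theorem Ig_fubini f K : (forall z, ccc f z) -> (forall x y, Cmod (f (x, y)) <= K * wt x * wt y) ->
  Ig (fun x => Ig (fun y => f (x, y))) = Ig (fun y => Ig (fun x => f (x, y))).
Proof.
  intros Hf HK.
  assert (HK0 : 0 <= K).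
  { specialize (HK 0 0). pose proof (Cmod_ge_0 (f (0, 0))). pose proof (wt_pos 0).
    assert (0 < wt 0 * wt 0) by now apply Rmult_lt_0_compat. nra. }
  assert (Main : forall g : C -> C, (forall z, ccc g z) -> (forall x y, Cmod (g (x, y)) <= K * wt x * wt y) -> forall A, 0 <= A ->
    Cmod (Ig (fun x => Ig (fun y => g (x, y))) - cint (fun x => cint (fun y => g (x, y)) (-A) A) (-A) A) <= 2 * (K * PI) * atl A).
  { intros g Hg HKg A HA.
    assert (Dv : forall x, DomC (K * wt x) (fun y => g (x, y))) by (intro x; split; [intro; now apply ccr_ver|apply HKg]).
    assert (DG : DomC (K * PI) (fun x => Ig (fun y => g (x, y)))).
    { split.
      - intro x. apply ccr_Ig with K; auto. apply filter_forall. intros x' y. eapply Rle_trans; [apply HKg|].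
        pose proof (wt_pos y). pose proof (wt_pos x'). pose proof (wt_le1 x'). apply Rmult_le_compat_r; [lra|]. nra.
      - intro x. eapply Rle_trans; [apply (Ig_bound (K * wt x)); auto|]. right. ring. }
    pose proof (Ig_tail _ _ A DG HA) as T1. pose proof (tl_pos A) as TA.
    assert (T2 : Cmod (cint (fun x => Ig (fun y => g (x, y))) (-A) A - cint (fun x => cint (fun y => g (x, y)) (-A) A) (-A) A) <= K * PI * atl A).
    { rewrite <- cint_minus; [|now apply (DomC_conab (K * PI))|apply conab_all; intro; apply ccr_inner; auto; lra].
      assert (DD : DomC (K * atl A) (fun x => Ig (fun y => g (x, y)) - cint (fun y => g (x, y)) (-A) A)%C).
      { split.
        - intro x. apply ccr_minus; [apply DG|apply ccr_inner; auto; lra].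
        - intro x. eapply Rle_trans; [apply (Ig_tail (K * wt x)); auto|]. right. ring. }
      eapply Rle_trans; [apply (cint_dom _ _ (-A) A ltac:(lra) DD)|].
      pose proof (atan_bound A). rewrite atan_opp.
      replace (K * PI * atl A) with (K * atl A * PI) by ring. apply Rmult_le_compat_l; [nra|lra]. }
    eapply Rle_trans; [eapply Cmod_triangle3|]. eapply Rle_trans; [apply Rplus_le_compat; [exact T1|exact T2]|]. lra. }
  apply Cmod_small_eq. intros e He. pose proof PI_RGT_0.
  destruct (tl_scaled (4 * (K * PI)) e ltac:(nra) He) as [A [HA HT]]. specialize (HT A (Rle_refl _)).
  pose proof (Main f Hf HK A ltac:(lra)) as M1.
  pose proof (Main (fun w => f (Im w, Re w)) (ccc_swap f Hf)
    ltac:(intros x y; simpl; rewrite Rmult_assoc, (Rmult_comm (wt x)), <- Rmult_assoc; apply HK) A ltac:(lra)) as M2.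
  simpl in M2. rewrite cint_fubini in M1 by (auto; lra).
  rewrite Cmod_minus_sym in M2. eapply Rle_trans; [eapply Cmod_triangle3|].
  eapply Rle_trans; [apply Rplus_le_compat; [exact M1|exact M2]|]. lra.
Qed.

(** * Passage to the improper integrals of the statement *)

Lemma is_RInt_cint f a b : conab f a b -> is_RInt (V := C_R_NormedModule) f a b (cint f a b).
Proof.
  intro H. apply (is_RInt_fct_extend_pair (U := R_NormedModule) (V := R_NormedModule) f a b (RInt (fun t => Re (f t)) a b) (RInt (fun t => Im (f t)) a b)).
  - apply (RInt_correct (V := R_CompleteNormedModule)). now apply cint_ex_re.
  - apply (RInt_correct (V := R_CompleteNormedModule)). now apply cint_ex_im.
Qed.

Lemma C_R_locally (l : C) (P : C -> Prop) : locally (T := C_R_NormedModule) l P -> cnb l P.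
Proof.
  intros [e He]. exists e. split; [apply cond_pos|]. intros w Hw. apply He.
  split.
  - change (Rabs (Re w - Re l) < e). rewrite <- re_minus. eapply Rle_lt_trans; [apply re_le_Cmod|exact Hw].
  - change (Rabs (Im w - Im l) < e). rewrite <- im_minus. eapply Rle_lt_trans; [apply im_le_Cmod|exact Hw].
Qed.

Lemma is_RInt_gen_Ig K f : DomC K f ->
  is_RInt_gen (V := C_R_NormedModule) f (Rbar_locally m_infty) (Rbar_locally p_infty) (Ig f).
Proof.
  intros Hf P HP. apply C_R_locally in HP. destruct HP as [e [He HP]].
  pose proof (DomC_K _ _ Hf). destruct (tl_scaled (2 * K) e ltac:(lra) He) as [B [HB H1]]. specialize (H1 B (Rle_refl _)).
  exists (fun p => p < - B) (fun q => B < q).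
  - exists (- B). auto.
  - exists B. auto.
  - intros p q Hp Hq. exists (cint f p q). split; [apply is_RInt_cint; now apply (DomC_conab K)|].
    apply HP. rewrite Cmod_minus_sym. eapply Rle_lt_trans; [apply (Ig_wide K f p q B); auto; lra|exact H1].
Qed.

(** Substitution [x = exp u] from the line to the half-line. Nothing is assumed on [f] itself: its
    continuity on [x > 0] is recovered from that of the transported integrand through [ln]. *)
Lemma is_RInt_gen_exp K f : DomC K (fun u => f (exp u) * RtoC (exp u))%C ->
  is_RInt_gen (V := C_R_NormedModule) f (at_right 0) (Rbar_locally p_infty) (Ig (fun u => f (exp u) * RtoC (exp u))%C).
Proof.
  intros Hf. set (g := fun u => (f (exp u) * RtoC (exp u))%C) in *.
  assert (Hfx : forall x, 0 < x -> ccr f x).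
  { intros x Hx. assert (C1 : ccr (fun x => g (ln x) / RtoC x)%C x).
    { apply ccr_div; [|apply ccr_id|apply RtoC_neq0; lra].
      apply (clim_comp (locally x) (locally (ln x)) ln g); [|apply Hf].
      apply (ex_derive_continuous (V := R_NormedModule)). eexists. apply is_derive_ln; auto. }
    assert (E : forall y, 0 < y -> (g (ln y) / RtoC y)%C = f y).
    { intros y Hy. unfold g. rewrite exp_ln by auto. field. apply RtoC_neq0. lra. }
    unfold ccr in *. rewrite E in C1 by auto. apply clim_ext with (f := fun x => (g (ln x) / RtoC x)%C); auto.
    apply locally_abs with x; auto. intros y Hy. apply E. apply Rabs_def2 in Hy. lra. }
  assert (Hsub : forall p q, p <= q -> is_RInt (V := C_R_NormedModule) f (exp p) (exp q) (cint g p q)).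
  { intros p q Hpq.
    assert (Hc : conab f (exp p) (exp q)).
    { intros x Hx. apply Hfx. pose proof (exp_pos p). pose proof (exp_pos q). unfold Rmin in Hx. destruct (Rle_dec _ _); lra. }
    replace (cint g p q) with (cint f (exp p) (exp q)); [now apply is_RInt_cint|].
    unfold cint. f_equal.
    - rewrite <- (RInt_comp (V := R_CompleteNormedModule) (fun x => Re (f x)) exp exp p q).
      + apply RInt_ext. intros x _. unfold g. rewrite re_mult, re_RtoC, im_RtoC. change (exp x * Re (f (exp x)) = Re (f (exp x)) * exp x - Im (f (exp x)) * 0). ring.
      + intros x _. apply ccr_re, Hfx, exp_pos.
      + intros x _. split; [apply is_derive_exp|]. apply (ex_derive_continuous (V := R_NormedModule)). eexists. apply is_derive_exp.
    - rewrite <- (RInt_comp (V := R_CompleteNormedModule) (fun x => Im (f x)) exp exp p q).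
      + apply RInt_ext. intros x _. unfold g. rewrite im_mult, re_RtoC, im_RtoC. change (exp x * Im (f (exp x)) = Re (f (exp x)) * 0 + Im (f (exp x)) * exp x). ring.
      + intros x _. apply ccr_im, Hfx, exp_pos.
      + intros x _. split; [apply is_derive_exp|]. apply (ex_derive_continuous (V := R_NormedModule)). eexists. apply is_derive_exp. }
  intros P HP. apply C_R_locally in HP. destruct HP as [e [He HP]].
  pose proof (DomC_K _ _ Hf). destruct (tl_scaled (2 * K) e ltac:(lra) He) as [B [HB H1]]. specialize (H1 B (Rle_refl _)).
  exists (fun x => 0 < x < exp (- B)) (fun y => exp B < y).
  - exists (mkposreal (exp (- B)) (exp_pos _)). intros y Hy Hy0.
    change (Rabs (y - 0) < exp (- B)) in Hy. apply Rabs_def2 in Hy. lra.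
  - exists (exp B). auto.
  - intros x y [Hx0 Hx] Hy. assert (Hy0 : 0 < y) by (pose proof (exp_pos B); lra).
    assert (Lx : ln x < - B) by (rewrite <- (ln_exp (- B)); now apply ln_increasing).
    assert (Ly : B < ln y) by (rewrite <- (ln_exp B); apply ln_increasing; [apply exp_pos|auto]).
    exists (cint g (ln x) (ln y)). split.
    + simpl. rewrite <- (exp_ln x), <- (exp_ln y) at 1 by auto. rewrite <- (exp_ln y) by auto. rewrite !ln_exp. apply Hsub. lra.
    + apply HP. rewrite Cmod_minus_sym. eapply Rle_lt_trans; [apply (Ig_wide K g _ _ B); auto; lra|exact H1].
Qed.

(** * Fourier transforms of rapidly decreasing kernels *)

(** Decay faster than every Gaussian makes the class stable under multiplication by [exp (lam u^2)]
    and gives the transform growth [exp (o(|z|^2))], the hypothesis of the factorisation. Evenness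
    and positivity make the transform even, real on the real line and nonzero at 0. *)
Definition Kern (Phi : R -> R) : Prop :=
  (forall u, continuous Phi u) /\ (forall u, Phi (- u) = Phi u) /\ (forall u, 0 < Phi u) /\
  (forall A, 0 < A -> exists K, forall u, Phi u <= K * exp (- A * u ^ 2)).

Definition FT (Phi : R -> R) (z : C) : C := Ig (fun u => RtoC (Phi u) * cexp (Ci * z * RtoC u))%C.

Lemma exp_ge_1p x : 1 + x <= exp x.
Proof. destruct (Req_dec x 0) as [->|H]; [rewrite exp_0; lra|]. left. now apply exp_ineq1. Qed.

Lemma exp_m2_wt u : exp (- u ^ 2) <= wt u.
Proof.
  rewrite exp_Ropp. unfold wt. apply Rinv_le_contravar; [pose proof (pow2_ge_0 u); lra|]. apply exp_ge_1p.
Qed.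

Lemma Rabs_sq u : Rabs u ^ 2 = u ^ 2.
Proof. simpl. rewrite !Rmult_1_r, <- Rabs_mult. apply Rabs_right. nra. Qed.

Lemma kern_pos K (Phi : R -> R) A : (forall u, 0 < Phi u) -> (forall u, Phi u <= K * exp (- A * u ^ 2)) -> 0 < K.
Proof.
  intros H1 H2. specialize (H1 0). specialize (H2 0). pose proof (exp_pos (- A * 0 ^ 2)). nra.
Qed.

(** Completing the square, [r |u| <= u^2 / (4 eps) + eps r^2]. The Gaussian rate [1 + 1 / (4 eps)]
    pays for the first term and leaves [exp (- u^2)] for the weight. *)
Lemma kern_dom Phi eps : Kern Phi -> 0 < eps -> exists K, 0 < K /\ forall r u, 0 <= r ->
  Phi u * exp (r * Rabs u) <= K * exp (eps * r ^ 2) * wt u.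
Proof.
  intros [_ [_ [Hp HA]]] He. destruct (HA (1 + / (4 * eps))) as [K HK].
  { assert (0 < / (4 * eps)) by (apply Rinv_0_lt_compat; lra). lra. }
  exists K. assert (HK0 := kern_pos K Phi _ Hp HK). split; auto. intros r u Hr.
  apply Rle_trans with (K * exp (- (1 + / (4 * eps)) * u ^ 2) * exp (r * Rabs u)).
  { apply Rmult_le_compat_r; [left; apply exp_pos|apply HK]. }
  rewrite !Rmult_assoc. apply Rmult_le_compat_l; [lra|].
  rewrite <- exp_plus. apply Rle_trans with (exp (eps * r ^ 2) * exp (- u ^ 2)).
  2:{ apply Rmult_le_compat_l; [left; apply exp_pos|apply exp_m2_wt]. }
  rewrite <- exp_plus. apply exp_mono.
  assert (E : 0 <= (Rabs u / (2 * sqrt eps) - sqrt eps * r) ^ 2) by apply pow2_ge_0.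
  assert (Hs : 0 < sqrt eps) by now apply sqrt_lt_R0.
  replace ((Rabs u / (2 * sqrt eps) - sqrt eps * r) ^ 2)
    with (Rabs u ^ 2 * / (4 * (sqrt eps * sqrt eps)) - r * Rabs u + (sqrt eps * sqrt eps) * r ^ 2) in E by (field; lra).
  rewrite sqrt_sqrt, Rabs_sq in E by lra. lra.
Qed.

Lemma kern_dom1 Phi r : Kern Phi -> 0 <= r -> exists K, 0 < K /\ forall u, Phi u * exp (r * Rabs u) <= K * wt u.
Proof.
  intros H Hr. destruct (kern_dom Phi 1 H Rlt_0_1) as [K [HK H1]]. exists (K * exp (1 * r ^ 2)). split; [|auto].
  apply Rmult_lt_0_compat; auto. apply exp_pos.
Qed.

Lemma Cmod_cexp_izu (z : C) u : Cmod (cexp (Ci * z * RtoC u)) <= exp (Cmod z * Rabs u).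
Proof.
  rewrite Cmod_cexp. apply exp_mono. eapply Rle_trans; [apply re_le|].
  rewrite !Cmod_mult, Cmod_Ci, Cmod_R. lra.
Qed.

Lemma ccr_kern Phi z u : (forall u, continuous Phi u) -> ccr (fun u => RtoC (Phi u) * cexp (Ci * z * RtoC u))%C u.
Proof. intro H. ccont. apply H. Qed.

Lemma FT_dom Phi r : Kern Phi -> 0 <= r -> exists K, 0 < K /\ forall z : C, Cmod z <= r ->
  DomC K (fun u => RtoC (Phi u) * cexp (Ci * z * RtoC u))%C.
Proof.
  intros HP Hr. destruct (kern_dom1 Phi r HP Hr) as [K [HK H]]. exists K. split; auto. intros z Hz. split.
  - intro u. apply ccr_kern, HP.
  - intro u. rewrite Cmod_mult, Cmod_R, Rabs_right by (apply Rle_ge; left; apply HP).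
    eapply Rle_trans; [|apply H]. apply Rmult_le_compat_l; [left; apply HP|].
    eapply Rle_trans; [apply Cmod_cexp_izu|]. apply exp_mono. apply Rmult_le_compat_r; [apply Rabs_pos|auto].
Qed.

Lemma FT_dom_ex Phi z : Kern Phi -> exists K, DomC K (fun u => RtoC (Phi u) * cexp (Ci * z * RtoC u))%C.
Proof. intro H. destruct (FT_dom Phi (Cmod z) H (Cmod_ge_0 z)) as [K [_ HK]]. exists K. apply HK. lra. Qed.

Lemma sq_le_exp u : u ^ 2 <= exp (2 * Rabs u).
Proof.
  replace (2 * Rabs u) with (Rabs u + Rabs u) by ring. rewrite exp_plus.
  rewrite <- Rabs_sq. pose proof (exp_ge_1p (Rabs u)). pose proof (Rabs_pos u). simpl. rewrite Rmult_1_r.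
  apply Rmult_le_compat; lra.
Qed.
Lemma abs_le_exp u : Rabs u <= exp (Rabs u).
Proof. pose proof (exp_ge_1p (Rabs u)). lra. Qed.

Lemma FT_cder Phi z : Kern Phi -> exists d, cder (FT Phi) z d.
Proof.
  intro HP. pose proof (Cmod_ge_0 z) as Hz.
  (* Of the three extra units of exponential rate, two absorb [u^2] and one absorbs
     [exp (|w - z| |u|)] with [|w - z| < 1]. *)
  destruct (kern_dom1 Phi (Cmod z + 3) HP ltac:(lra)) as [K [HK H]].
  set (fz := fun w u => (RtoC (Phi u) * cexp (Ci * w * RtoC u))%C).
  set (dz := fun u => (RtoC (Phi u) * cexp (Ci * z * RtoC u) * (Ci * RtoC u))%C).
  assert (Cd : forall u, ccr dz u). { intro u. apply ccr_mult; [apply ccr_kern, HP|ccont]. }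
  assert (Dd : DomC K dz).
  { split; auto. intro u. unfold dz. rewrite !Cmod_mult, Cmod_Ci, !Cmod_R, Rabs_right by (apply Rle_ge; left; apply HP).
    eapply Rle_trans; [|apply H]. rewrite Rmult_assoc. apply Rmult_le_compat_l; [left; apply HP|].
    pose proof (Cmod_cexp_izu z u). pose proof (abs_le_exp u). pose proof (Rabs_pos u).
    apply Rle_trans with (exp (Cmod z * Rabs u) * exp (Rabs u)).
    - apply Rmult_le_compat; try apply Cmod_ge_0; try lra.
    - rewrite <- exp_plus. apply exp_mono. nra. }
  exists (Ig dz). apply cder_quad with (K := K * PI) (r := 1); [lra|]. intros w Hw.
  destruct (FT_dom_ex Phi w HP) as [Kw Dw]. destruct (FT_dom_ex Phi z HP) as [Kz Dz].
  unfold FT. rewrite (Cmult_comm (Ig dz)), <- (Ig_scal K (w - z)%C dz Dd), <- (Ig_minus _ _ _ _ Dw Dz).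
  pose proof (DomC_scal _ (w - z)%C _ Dd) as Dsd.
  rewrite <- (Ig_minus _ _ _ _ (DomC_minus _ _ _ _ Dw Dz) Dsd).
  assert (D : DomC (K * (Cmod (w - z) * Cmod (w - z))) (fun u => RtoC (Phi u) * cexp (Ci * w * RtoC u) - RtoC (Phi u) * cexp (Ci * z * RtoC u) - (w - z) * dz u)%C).
  { split.
    - intro u. apply ccr_minus; [apply ccr_minus; apply ccr_kern, HP|]. apply ccr_mult; auto. apply ccr_const.
    - intro u. set (h := (Ci * (w - z) * RtoC u)%C).
      replace (RtoC (Phi u) * cexp (Ci * w * RtoC u) - RtoC (Phi u) * cexp (Ci * z * RtoC u) - (w - z) * dz u)%C
        with (RtoC (Phi u) * (cexp (Ci * z * RtoC u) * (cexp h - 1 - h)))%C.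
      2:{ replace (cexp (Ci * w * RtoC u)) with (cexp (Ci * z * RtoC u) * cexp h)%C.
          - unfold dz, h. ring.
          - rewrite <- cexp_plus. f_equal. unfold h. ring. }
      rewrite !Cmod_mult, Cmod_R, Rabs_right by (apply Rle_ge; left; apply HP).
      assert (Hh : Cmod h = Cmod (w - z) * Rabs u) by (unfold h; rewrite !Cmod_mult, Cmod_Ci, Cmod_R; ring).
      pose proof (cexp_m1h_bound h) as B. rewrite Hh in B.
      pose proof (Cmod_cexp_izu z u) as B1. pose proof (Cmod_ge_0 (w - z)) as Hwz. pose proof (Rabs_pos u) as Hu.
      apply Rle_trans with (Phi u * (exp (Cmod z * Rabs u) * (Cmod (w - z) * Cmod (w - z) * (exp (2 * Rabs u) * exp (Rabs u))))).
      + apply Rmult_le_compat_l; [left; apply HP|]. apply Rmult_le_compat; try apply Cmod_ge_0; auto.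
        eapply Rle_trans; [apply B|].
        replace (Cmod (w - z) * Rabs u * (Cmod (w - z) * Rabs u) * exp (Cmod (w - z) * Rabs u))
          with (Cmod (w - z) * Cmod (w - z) * (Rabs u ^ 2 * exp (Cmod (w - z) * Rabs u))) by ring.
        apply Rmult_le_compat_l; [nra|]. apply Rmult_le_compat; [apply pow2_ge_0|left; apply exp_pos| |].
        * rewrite Rabs_sq. apply sq_le_exp.
        * apply exp_mono. nra.
      + replace (Phi u * (exp (Cmod z * Rabs u) * (Cmod (w - z) * Cmod (w - z) * (exp (2 * Rabs u) * exp (Rabs u)))))
          with (Cmod (w - z) * Cmod (w - z) * (Phi u * exp ((Cmod z + 3) * Rabs u))).
        2:{ rewrite <- exp_plus. replace ((Cmod z + 3) * Rabs u) with (Cmod z * Rabs u + (2 * Rabs u + Rabs u)) by ring. rewrite exp_plus. ring. }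
        replace (K * (Cmod (w - z) * Cmod (w - z)) * wt u) with (Cmod (w - z) * Cmod (w - z) * (K * wt u)) by ring.
        apply Rmult_le_compat_l; [nra|apply H]. }
  eapply Rle_trans; [apply (Ig_bound _ _ D)|]. right. ring.
Qed.

Lemma FT_hol Phi R0 : Kern Phi -> hol (FT Phi) R0.
Proof. intros H w _. now apply FT_cder. Qed.

Lemma FT_even Phi z : Kern Phi -> FT Phi (- z) = FT Phi z.
Proof.
  intro HP. destruct (FT_dom_ex Phi z HP) as [K D]. unfold FT. rewrite <- (Ig_reflect K _ D).
  apply Ig_ext. intro u. destruct HP as [_ [He _]]. rewrite He. f_equal. f_equal. rewrite RtoC_opp. ring.
Qed.

Lemma FT_conj Phi z : Kern Phi -> FT Phi (Cconj z) = Cconj (FT Phi z).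
Proof.
  intro HP. destruct (FT_dom_ex Phi z HP) as [K D]. rewrite <- FT_even by auto. unfold FT. rewrite <- (Ig_conj K _ D).
  apply Ig_ext. intro u. rewrite Cmult_conj, <- cexp_conj. f_equal.
  - apply Ceq_parts; simpl; ring.
  - f_equal. apply Ceq_parts; simpl; ring.
Qed.

Lemma kern_DomC Phi : Kern Phi -> exists K, DomC K (fun u => RtoC (Phi u)).
Proof.
  intro HP. destruct (kern_dom1 Phi 0 HP (Rle_refl 0)) as [K [HK H]]. exists K. split.
  - intro u. apply ccr_RtoC, HP.
  - intro u. rewrite Cmod_R, Rabs_right by (apply Rle_ge; left; apply HP). specialize (H u).
    rewrite Rmult_0_l, exp_0, Rmult_1_r in H. exact H.
Qed.

Lemma FT_0 Phi : Kern Phi -> exists p, 0 < p /\ FT Phi (RtoC 0) = RtoC p.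
Proof.
  intro HP. destruct (kern_DomC Phi HP) as [K D]. exists (Re (Ig (fun u => RtoC (Phi u)))). split.
  - apply (Ig_pos K); auto. apply HP.
  - rewrite <- (Ig_real K) by auto. apply Ig_ext. intro u.
    replace (Ci * RtoC 0 * RtoC u)%C with (RtoC 0) by ring. rewrite cexp_0. ring.
Qed.

Lemma FT_growth Phi eps : Kern Phi -> 0 < eps -> exists K, 0 < K /\ forall z, Cmod (FT Phi z) <= K * exp (eps * Cmod z ^ 2).
Proof.
  intros HP He. destruct (kern_dom Phi eps HP He) as [K [HK H]]. exists (K * PI).
  pose proof PI_RGT_0. split; [now apply Rmult_lt_0_compat|]. intro z.
  assert (D : DomC (K * exp (eps * Cmod z ^ 2)) (fun u => RtoC (Phi u) * cexp (Ci * z * RtoC u))%C).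
  { split; [intro; apply ccr_kern, HP|]. intro u. rewrite Cmod_mult, Cmod_R, Rabs_right by (apply Rle_ge; left; apply HP).
    eapply Rle_trans; [|apply H; apply Cmod_ge_0]. apply Rmult_le_compat_l; [left; apply HP|apply Cmod_cexp_izu]. }
  eapply Rle_trans; [apply (Ig_bound _ _ D)|]. right. ring.
Qed.

(** * Kernels multiplied by Gaussians and by hyperbolic cosines *)

Lemma exp_cont_comp (f : R -> R) u : continuous f u -> continuous (fun u => exp (f u)) u.
Proof. intro H. apply (continuous_comp f exp); auto. apply (ex_derive_continuous (V := R_NormedModule)). eexists. apply is_derive_exp. Qed.

Lemma cosh_even x : cosh (- x) = cosh x.
Proof. unfold cosh. rewrite Ropp_involutive. field. Qed.
Lemma cosh_pos x : 0 < cosh x.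
Proof. unfold cosh. pose proof (exp_pos x). pose proof (exp_pos (- x)). lra. Qed.

Lemma kern_mult Phi g B c : Kern Phi -> (forall u, continuous g u) -> (forall u, g (- u) = g u) -> (forall u, 0 < g u) ->
  0 <= c -> (forall u, g u <= B * exp (c * u ^ 2)) -> Kern (fun u => Phi u * g u).
Proof.
  intros [H1 [H2 [H3 H4]]] G1 G2 G3 Hc G4. split; [|split; [|split]].
  - intro u. now apply (continuous_mult Phi g).
  - intro u. now rewrite H2, G2.
  - intro u. now apply Rmult_lt_0_compat.
  - intros A HA. destruct (H4 (A + c) ltac:(lra)) as [K HK]. exists (K * B). intro u.
    replace (K * B * exp (- A * u ^ 2)) with (K * exp (- (A + c) * u ^ 2) * (B * exp (c * u ^ 2))).
    + apply Rmult_le_compat; auto; left; auto.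
    + replace (- A * u ^ 2) with (- (A + c) * u ^ 2 + c * u ^ 2) by ring. rewrite exp_plus. ring.
Qed.

Lemma kern_gauss Phi lam : Kern Phi -> 0 <= lam -> Kern (fun u => Phi u * exp (lam * u ^ 2)).
Proof.
  intros HP Hl. apply (kern_mult Phi _ 1 lam); auto.
  - intro u. apply exp_cont_comp. apply (ex_derive_continuous (V := R_NormedModule) (fun u => lam * u ^ 2)). auto_derive. auto.
  - intro u. f_equal. ring.
  - intro u. apply exp_pos.
  - intro u. lra.
Qed.

Lemma is_derive_le (f df : R -> R) a b : a <= b -> (forall x, a <= x <= b -> is_derive f x (df x)) ->
  (forall x, a <= x <= b -> 0 <= df x) -> f a <= f b.
Proof.
  intros Hab Hd Hp. destruct (MVT_gen f a b df) as [c [Hc E]].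
  - intros x Hx. apply Hd. rewrite Rmin_left, Rmax_right in Hx by lra. lra.
  - intros x Hx. rewrite Rmin_left, Rmax_right in Hx by lra. apply continuity_pt_filterlim.
    apply (ex_derive_continuous (V := R_NormedModule)). eexists. now apply Hd.
  - rewrite Rmin_left, Rmax_right in Hc by lra. specialize (Hp c Hc). nra.
Qed.

Lemma sinh_ge x : 0 <= x -> x <= sinh x.
Proof.
  intro Hx. pose proof (is_derive_le (fun t => sinh t - t) (fun t => cosh t - 1) 0 x Hx) as H.
  cbv beta in H. rewrite sinh_0 in H. cut (0 - 0 <= sinh x - x); [lra|]. apply H.
  - intros t _. unfold sinh, cosh. auto_derive; auto. field.
  - intros t _. unfold cosh. pose proof (exp_pos t). pose proof (exp_pos (- t)).
    assert (exp t * exp (- t) = 1) by (rewrite <- exp_plus, Rplus_opp_r; apply exp_0).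
    pose proof (pow2_ge_0 (exp t - exp (- t))). nra.
Qed.

Lemma cosh_ge x : 1 + x ^ 2 / 2 <= cosh x.
Proof.
  assert (P : forall x, 0 <= x -> 1 + x ^ 2 / 2 <= cosh x).
  { clear x. intros x Hx. pose proof (is_derive_le (fun t => cosh t - t ^ 2 / 2) (fun t => sinh t - t) 0 x Hx) as H.
    cbv beta in H. rewrite cosh_0 in H. cut (1 - 0 ^ 2 / 2 <= cosh x - x ^ 2 / 2); [lra|]. apply H.
    - intros t _. unfold sinh, cosh. auto_derive; auto. field.
    - intros t Ht. pose proof (sinh_ge t ltac:(lra)). lra. }
  destruct (Rle_dec 0 x); [now apply P|]. rewrite <- cosh_even. replace (x ^ 2) with ((- x) ^ 2) by ring. apply P. lra.
Qed.

(** [cosh x * exp (- x^2 / 2)] decreases for [x >= 0], as [sinh x <= x cosh x]. Together with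
    [cosh_ge] this squeezes powers of [cosh] onto a Gaussian. *)
Lemma cosh_le_gauss x : cosh x <= exp (x ^ 2 / 2).
Proof.
  assert (P : forall x, 0 <= x -> cosh x <= exp (x ^ 2 / 2)).
  { clear x. intros x Hx.
    assert (T : forall t, 0 <= t -> 0 <= t * cosh t - sinh t).
    { intros t Ht. pose proof (is_derive_le (fun t => t * cosh t - sinh t) (fun t => t * sinh t) 0 t Ht) as H.
      cbv beta in H. rewrite sinh_0, Rmult_0_l, Rminus_0_r in H. apply H.
      - intros s _. unfold sinh, cosh. auto_derive; auto. field.
      - intros s Hs. pose proof (sinh_ge s ltac:(lra)). nra. }
    pose proof (is_derive_le (fun t => - (cosh t * exp (- (t ^ 2 / 2)))) (fun t => (t * cosh t - sinh t) * exp (- (t ^ 2 / 2))) 0 x Hx) as H.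
    cbv beta in H. rewrite cosh_0 in H. replace (- (0 ^ 2 / 2)) with 0 in H by field. rewrite exp_0 in H.
    assert (K : - (1 * 1) <= - (cosh x * exp (- (x ^ 2 / 2)))).
    { apply H.
      - intros t _. unfold sinh, cosh. auto_derive; auto. replace (t * (t * 1) * / 2) with (t ^ 2 / 2) by field. field.
      - intros t Ht. apply Rmult_le_pos; [apply T; lra|left; apply exp_pos]. }
    pose proof (exp_pos (x ^ 2 / 2)) as E. rewrite exp_Ropp in K.
    replace (cosh x) with (cosh x * / exp (x ^ 2 / 2) * exp (x ^ 2 / 2)) by (field; lra).
    rewrite <- (Rmult_1_l (exp (x ^ 2 / 2))) at 3. apply Rmult_le_compat_r; lra. }
  destruct (Rle_dec 0 x); [now apply P|]. rewrite <- cosh_even. replace (x ^ 2) with ((- x) ^ 2) by ring. apply P. lra.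
Qed.

Lemma cosh_cont u : continuous cosh u.
Proof. unfold cosh. rcont. Qed.

Lemma kern_cosh Phi a : Kern Phi -> Kern (fun u => Phi u * cosh (a * u)).
Proof.
  intro HP. apply (kern_mult Phi (fun u => cosh (a * u)) 1 (a ^ 2 / 2)); auto.
  - intro u. apply (continuous_comp (fun u => a * u) cosh); [|apply cosh_cont].
    apply (ex_derive_continuous (V := R_NormedModule) (fun u => a * u)). auto_derive. auto.
  - intro u. rewrite <- cosh_even. f_equal. ring.
  - intro u. apply cosh_pos.
  - pose proof (pow2_ge_0 a). lra.
  - intro u. eapply Rle_trans; [apply cosh_le_gauss|]. rewrite Rmult_1_l. apply exp_mono. right. field.
Qed.

Lemma FT_cosh Phi a z : Kern Phi ->
  FT (fun u => Phi u * cosh (a * u)) z = ((FT Phi (z + Ci * RtoC a) + FT Phi (z - Ci * RtoC a)) / 2)%C.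
Proof.
  intro HP. destruct (FT_dom_ex Phi (z + Ci * RtoC a)%C HP) as [K1 D1]. destruct (FT_dom_ex Phi (z - Ci * RtoC a)%C HP) as [K2 D2].
  unfold FT. rewrite <- (Ig_plus _ _ _ _ D1 D2).
  replace (Ig (fun u => RtoC (Phi u) * cexp (Ci * (z + Ci * RtoC a) * RtoC u) + RtoC (Phi u) * cexp (Ci * (z - Ci * RtoC a) * RtoC u)) / 2)%C
    with (/ 2 * Ig (fun u => RtoC (Phi u) * cexp (Ci * (z + Ci * RtoC a) * RtoC u) + RtoC (Phi u) * cexp (Ci * (z - Ci * RtoC a) * RtoC u)))%C
    by (unfold Cdiv; ring).
  rewrite <- (Ig_scal _ _ _ (DomC_plus _ _ _ _ D1 D2)). apply Ig_ext. intro u.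
  assert (C2 : (Ci * Ci = - (1))%C) by (apply Ceq_parts; simpl; ring).
  replace (Ci * (z + Ci * RtoC a) * RtoC u)%C with (Ci * z * RtoC u + RtoC (- (a * u)))%C.
  2:{ replace (Ci * (z + Ci * RtoC a) * RtoC u)%C with (Ci * z * RtoC u + (Ci * Ci) * RtoC a * RtoC u)%C by ring.
      rewrite C2, RtoC_opp, RtoC_mult. ring. }
  replace (Ci * (z - Ci * RtoC a) * RtoC u)%C with (Ci * z * RtoC u + RtoC (a * u))%C.
  2:{ replace (Ci * (z - Ci * RtoC a) * RtoC u)%C with (Ci * z * RtoC u - (Ci * Ci) * RtoC a * RtoC u)%C by ring.
      rewrite C2, RtoC_mult. ring. }
  rewrite !cexp_plus, !cexp_RtoC. unfold cosh. rewrite RtoC_mult, RtoC_div by lra. rewrite RtoC_plus. field.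
Qed.

(** * Zeros of even entire functions *)

(** One factor accounts for a pair of opposite zeros. *)
Fixpoint zprod (l : list C) (z : C) : C :=
  match l with nil => 1%C | cons r l' => ((1 - z * z / (r * r)) * zprod l' z)%C end.

Lemma hol_compopp f R0 : hol f R0 -> hol (fun z => f (- z)%C) R0.
Proof.
  intros Hf z Hz. destruct (Hf (- z)%C ltac:(rewrite Cmod_opp; auto)) as [d Hd]. eexists.
  apply (cder_comp f (fun z => - z)%C); [exact Hd|]. apply cder_opp, cder_id.
Qed.

Lemma even_divide f R0 r : hol f R0 -> (forall z, f (- z)%C = f z) -> Cmod r < R0 -> r <> RtoC 0 -> f r = RtoC 0 ->
  exists g, hol g R0 /\ (forall z, g (- z)%C = g z) /\ forall z, f z = ((1 - z * z / (r * r)) * g z)%C.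
Proof.
  intros Hf He Hr Hr0 Hfr.
  destruct (hol_divide f R0 r Hr Hf Hfr) as [g1 [H1 E1]].
  assert (Hg1 : g1 (- r)%C = RtoC 0).
  { pose proof (E1 (- r)%C) as E. rewrite He, Hfr in E.
    assert (Hn : (- r - r)%C <> RtoC 0).
    { intro K. apply Hr0. replace r with (- (- r - r) / 2)%C by field. rewrite K. field. }
    replace (g1 (- r)%C) with ((- r - r) * g1 (- r) / (- r - r))%C by (field; auto). rewrite <- E. field. auto. }
  destruct (hol_divide g1 R0 (- r)%C ltac:(rewrite Cmod_opp; auto) H1 Hg1) as [g2 [H2 E2]].
  set (h := fun z => (- (r * r) * g2 z)%C).
  assert (Hh : hol h R0) by (apply hol_mult; auto; apply hol_const).
  assert (Eh : forall z, f z = ((1 - z * z / (r * r)) * h z)%C).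
  { intro z. rewrite E1, E2. unfold h. field. auto. }
  (* Evenness of [h] is immediate only where the factor does not vanish; symmetrising gives it
     everywhere without a continuity argument. *)
  exists (fun z => (/ 2 * (h z + h (- z)))%C). split; [|split].
  - apply hol_mult; [apply hol_const|]. apply hol_plus; auto. now apply hol_compopp.
  - intro z. replace (- - z)%C with z by ring. ring.
  - intro z. replace (f z) with (/ 2 * (f z + f (- z)))%C by (rewrite He; field).
    rewrite (Eh z), (Eh (- z)%C). replace (- z * - z)%C with (z * z)%C by ring. ring.
Qed.

(** A zero [w] with [|w| <= r] gives a factor of modulus at least [9 - 1 >= 2] on [|z| = 3 r].
    Removing it thus halves the bound [M] on the large disc, by the maximum principle, and keeps the
    value at 0. After [n] removals the bound would lie below that value. *)
Lemma strip_zeros n : forall f R0 r M, 0 < r -> 3 * r < R0 -> hol f R0 -> (forall z, f (- z)%C = f z) ->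
  f (RtoC 0) <> RtoC 0 -> (forall z, Cmod z <= 3 * r -> Cmod (f z) <= M) -> M < 2 ^ n * Cmod (f (RtoC 0)) ->
  exists l g, hol g R0 /\ (forall z, g (- z)%C = g z) /\ g (RtoC 0) = f (RtoC 0) /\ (forall z, f z = zprod l z * g z)%C /\
    (forall w, In w l -> f w = RtoC 0 /\ w <> RtoC 0) /\ (forall z, Cmod z <= r -> g z <> RtoC 0) /\
    (forall z, Cmod z <= 3 * r -> Cmod (g z) <= M).
Proof.
  induction n as [|n IH]; intros f R0 r M Hr HR Hf He H0 HM Hn.
  { exfalso. specialize (HM (RtoC 0) ltac:(rewrite Cmod_0; lra)). simpl in Hn. lra. }
  destruct (classic (exists w, Cmod w <= r /\ f w = RtoC 0)) as [[w [Hw Hfw]]|N].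
  2:{ exists nil, f. split; [exact Hf|split; [exact He|split; [reflexivity|split; [|split; [|split; [|exact HM]]]]]].
      - intro z. simpl. ring.
      - intros w [].
      - intros z Hz E. apply N. eauto. }
  assert (Hw0 : w <> RtoC 0) by (intros ->; auto).
  destruct (even_divide f R0 w Hf He ltac:(lra) Hw0 Hfw) as [g [Hg [Eg E]]].
  assert (Hg0 : g (RtoC 0) = f (RtoC 0)) by (rewrite E; field; auto).
  assert (HMg : forall z, Cmod z <= 3 * r -> Cmod (g z) <= M / 2).
  { assert (Hcirc : forall z, Cmod z = 3 * r -> Cmod (g z) <= M / 2).
    { intros z Hz. specialize (HM z ltac:(lra)). rewrite E, Cmod_mult in HM.
      assert (H2 : 2 <= Cmod (1 - z * z / (w * w))).
      { assert (Hwp : 0 < Cmod w) by now apply Cmod_gt_0.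
        pose proof (Cmod_triangle_rev (z * z / (w * w)) 1) as T. rewrite Cmod_minus_sym, Cmod_1 in T.
        rewrite Cmod_div, !Cmod_mult, Hz in T by (now apply Cmult_neq_0).
        assert (9 <= 3 * r * (3 * r) / (Cmod w * Cmod w)).
        { apply Rmult_le_reg_r with (Cmod w * Cmod w); [nra|]. unfold Rdiv. rewrite Rmult_assoc, Rinv_l by nra. nra. }
        lra. }
      pose proof (Cmod_ge_0 (g z)). nra. }
    intros z Hz. destruct (Rle_lt_or_eq_dec _ _ Hz) as [Hlt|Heq]; auto.
    apply (max_principle g R0 (3 * r)); auto. lra. }
  destruct (IH g R0 r (M / 2) Hr HR Hg Eg) as [l [g' [A1 [A2 [A3 [A4 [A5 [A6 A7]]]]]]]]; auto.
  { now rewrite Hg0. }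
  { rewrite Hg0. simpl in Hn. lra. }
  assert (HM0 : 0 <= M). { eapply Rle_trans; [apply Cmod_ge_0|apply (HM (RtoC 0)); rewrite Cmod_0; lra]. }
  exists (w :: l), g'. split; [exact A1|split; [exact A2|split; [|split; [|split; [|split; [exact A6|]]]]]].
  - now rewrite A3.
  - intro z. simpl. rewrite E, A4. ring.
  - intros w0 [<-|H]; auto. destruct (A5 w0 H) as [H1 H2]. split; auto. rewrite E, H1. ring.
  - intros z Hz. specialize (A7 z Hz). lra.
Qed.

(** Borel-Caratheodory for a logarithm of [g]. Only the real part of the logarithm is known to be
    even, so the logarithm is symmetrised, which leaves its real part unchanged; the added 1 makes
    the upper bound strictly positive. *)
Lemma hol_bound_on_zero_free g R0 r M z : 0 < r -> 2 * r < R0 -> hol g R0 -> (forall z, g (- z)%C = g z) ->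
  (forall w, Cmod w <= 2 * r -> g w <> RtoC 0) -> (forall w, Cmod w <= 2 * r -> Cmod (g w) <= M) -> Cmod z < r ->
  exists th, Cmod (g z) = Cmod (g (RtoC 0)) * exp th /\
    Rabs th <= 2 * (ln (M / Cmod (g (RtoC 0))) + 1) * (Cmod z ^ 2 / (r ^ 2 - Cmod z ^ 2)).
Proof.
  intros Hr HR Hg He Hn HM Hz.
  assert (Hg2 : hol g (2 * r)) by (apply (hol_le g R0); auto; lra).
  destruct (hol_log g (2 * r)) as [L [HL [HL0 EL]]]; auto; [lra|intros w Hw; apply Hn; lra|].
  assert (G0 : 0 < Cmod (g (RtoC 0))) by (apply Cmod_gt_0, Hn; rewrite Cmod_0; lra).
  assert (HM1 : 1 <= M / Cmod (g (RtoC 0))).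
  { apply Rmult_le_reg_r with (Cmod (g (RtoC 0))); auto. unfold Rdiv. rewrite Rmult_assoc, Rinv_l by lra.
    rewrite Rmult_1_l, Rmult_1_r. apply HM. rewrite Cmod_0. lra. }
  assert (Hln : 0 <= ln (M / Cmod (g (RtoC 0)))) by (pose proof (ln_le 1 _ Rlt_0_1 HM1) as Hl; rewrite ln_1 in Hl; exact Hl).
  set (L2 := fun w => (/ 2 * (L w + L (- w)))%C).
  assert (Ere : forall w, Cmod w < 2 * r -> Cmod (g w) = Cmod (g (RtoC 0)) * exp (Re (L w))).
  { intros w Hw. rewrite EL, Cmod_mult, Cmod_cexp by auto. reflexivity. }
  assert (Hre : forall w, Cmod w < 2 * r -> Re (L (- w)%C) = Re (L w)).
  { intros w Hw. pose proof (Ere w Hw) as E1. pose proof (Ere (- w)%C ltac:(rewrite Cmod_opp; auto)) as E2.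
    rewrite He, E1 in E2. apply Rmult_eq_reg_l in E2; [|lra]. now apply exp_inv in E2. }
  assert (Hre2 : forall w, Cmod w < 2 * r -> Re (L2 w) = Re (L w)).
  { intros w Hw. unfold L2. replace (/ 2)%C with (RtoC (/ 2)) by (rewrite RtoC_inv; [reflexivity|lra]).
    rewrite re_mult, re_plus, Hre by auto. simpl. lra. }
  exists (Re (L2 z)). split.
  - rewrite Hre2 by lra. apply Ere. lra.
  - eapply Rle_trans; [apply re_le_Cmod|]. apply (borel_caratheodory_even L2 (2 * r) r); auto; try lra.
    + apply hol_mult; [apply hol_const|]. apply hol_plus; auto. now apply hol_compopp.
    + unfold L2. replace (- RtoC 0)%C with (RtoC 0) by ring. rewrite HL0. ring.
    + intros w _. unfold L2. replace (- - w)%C with w by ring. ring.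
    + intros w Hw. rewrite Hre2 by auto.
      assert (K : exp (Re (L w)) <= M / Cmod (g (RtoC 0))).
      { apply Rmult_le_reg_l with (Cmod (g (RtoC 0))); auto. rewrite <- Ere by auto.
        replace (Cmod (g (RtoC 0)) * (M / Cmod (g (RtoC 0)))) with M by (field; lra). apply HM. lra. }
      apply ln_le in K; [|apply exp_pos]. rewrite ln_exp in K. lra.
Qed.

(* Hadamard factorisation of an even entire function of growth [exp (o (|z| ^ 2))]: no convergence of
   the full product is needed, only the finite products over the zeros in large discs. *)
Theorem hadamard_even f : (forall R0, hol f R0) -> (forall z, f (- z)%C = f z) -> f (RtoC 0) <> RtoC 0 ->
  (forall eps, 0 < eps -> exists K, 0 < K /\ forall z, Cmod (f z) <= K * exp (eps * Cmod z ^ 2)) ->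
  forall S dl, 0 < S -> 0 < dl -> exists R1, forall R2, R1 <= R2 -> exists l,
    (forall w, In w l -> f w = RtoC 0 /\ w <> RtoC 0) /\
    (forall w, Cmod w <= R2 -> f w = RtoC 0 -> exists r, In r l /\ (r * r = w * w)%C) /\
    forall z, Cmod z <= S -> exists th, Rabs th <= dl /\ Cmod (f z) = Cmod (f (RtoC 0)) * Cmod (zprod l z) * exp th.
Proof.
  intros Hf He H0 Hgr S dl HS Hdl.
  set (p := Cmod (f (RtoC 0))). assert (Hp : 0 < p) by now apply Cmod_gt_0.
  (* With growth measured on radius [6 r] the error contains [2 * eps * 36 r^2 * 2 S^2 / r^2 = 144
     eps S^2], which becomes [dl / 4]. *)
  set (eps := dl / (576 * S ^ 2)). assert (HS2 : 0 < S ^ 2) by (apply pow_lt; auto).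
  assert (Heps : 0 < eps) by (apply Rdiv_lt_0_compat; lra).
  destruct (Hgr eps Heps) as [K [HK HKf]].
  set (B := Rabs (ln (K / p)) + 1). assert (HB : 0 < B) by (unfold B; pose proof (Rabs_pos (ln (K / p))); lra).
  (* [r >= 4 S] gives [r^2 - |z|^2 >= r^2 / 2]; [r >= 16 S^2 B / dl] together with [r >= 1] makes
     [4 B S^2 / r^2 <= dl / 4]. *)
  set (R1 := 4 * S + 16 * S * S * B / dl + 1 + B).
  assert (HBd : 0 < 16 * S * S * B / dl) by (apply Rdiv_lt_0_compat; auto; repeat apply Rmult_lt_0_compat; lra).
  exists R1. intros R2 HR2. set (r := R2).
  assert (Hr1 : 4 * S <= r) by (unfold r, R1 in *; lra).
  assert (Hr2 : 16 * S * S * B / dl <= r) by (unfold r, R1 in *; lra).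
  assert (Hr3 : 1 <= r) by (unfold r, R1 in *; lra).
  set (M := K * exp (eps * (6 * r) ^ 2)).
  assert (HMf : forall z, Cmod z <= 3 * (2 * r) -> Cmod (f z) <= M).
  { intros z Hz. eapply Rle_trans; [apply HKf|]. unfold M. apply Rmult_le_compat_l; [lra|]. apply exp_mono.
    apply Rmult_le_compat_l; [lra|]. apply pow_incr. pose proof (Cmod_ge_0 z). lra. }
  destruct (Pow_x_infinity 2 ltac:(rewrite Rabs_right; lra) (M / p + 1)) as [n Hn]. specialize (Hn n (le_n _)).
  rewrite Rabs_right in Hn by (apply Rle_ge, pow_le; lra).
  destruct (strip_zeros n f (6 * r + 1) (2 * r) M) as [l [g [A1 [A2 [A3 [A4 [A5 [A6 A7]]]]]]]]; auto; try lra.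
  { fold p. apply Rmult_lt_reg_r with (/ p); [now apply Rinv_0_lt_compat|].
    rewrite Rmult_assoc, Rinv_r by lra. unfold Rdiv in Hn. lra. }
  exists l. split; [exact A5|]. split.
  { intros w Hw Hfw. rewrite A4 in Hfw. specialize (A6 w ltac:(lra)).
    assert (Hz : zprod l w = RtoC 0).
    { replace (zprod l w) with (zprod l w * g w / g w)%C by (field; auto). rewrite Hfw. field. auto. }
    clear - Hz A5. induction l as [|x l IH]; simpl in Hz.
    - exfalso. apply (f_equal Re) in Hz. simpl in Hz. lra.
    - destruct (classic (x * x = w * w)%C) as [E|N]; [exists x; simpl; auto|].
      destruct IH as [y [H1 H2]]; [intros; apply A5; simpl; auto| |exists y; simpl; auto].
      assert (Hx : x <> RtoC 0) by (apply A5; simpl; auto).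
      assert (Hxx : (x * x)%C <> RtoC 0) by now apply Cmult_neq_0.
      assert (Hf1 : (1 - w * w / (x * x))%C <> RtoC 0).
      { intro K. apply N. replace (w * w)%C with ((1 - (1 - w * w / (x * x))) * (x * x))%C by (field; auto). rewrite K. ring. }
      set (t := (1 - w * w / (x * x))%C) in *. clearbody t.
      replace (zprod l w) with (t * zprod l w / t)%C by (field; auto). rewrite Hz. field. auto. }
  intros z Hz.
  destruct (hol_bound_on_zero_free g (6 * r + 1) r M z) as [th [E1 E2]]; auto; try lra.
  { intros w Hw. apply A7. lra. }
  exists th. split.
  2:{ rewrite (A4 z), Cmod_mult, E1, A3. fold p. ring. }
  eapply Rle_trans; [exact E2|]. rewrite A3. fold p.
  assert (Hln : ln (M / p) + 1 <= B + eps * (6 * r) ^ 2).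
  { unfold M. replace (K * exp (eps * (6 * r) ^ 2) / p) with (K / p * exp (eps * (6 * r) ^ 2)) by (field; lra).
    rewrite ln_mult, ln_exp; [|apply Rdiv_lt_0_compat; auto|apply exp_pos].
    unfold B. pose proof (Rle_abs (ln (K / p))). lra. }
  pose proof (Cmod_ge_0 z) as Hz0.
  assert (Hz2 : Cmod z ^ 2 <= S ^ 2) by (apply pow_incr; lra).
  assert (Hden : r ^ 2 / 2 <= r ^ 2 - Cmod z ^ 2). { assert ((4 * S) ^ 2 <= r ^ 2) by (apply pow_incr; lra). lra. }
  assert (Hr2p : 0 < r ^ 2) by (apply pow_lt; lra).
  assert (Hq : 0 <= Cmod z ^ 2 / (r ^ 2 - Cmod z ^ 2) <= 2 * S ^ 2 / r ^ 2).
  { split; [apply Rmult_le_pos; [apply pow2_ge_0|left; apply Rinv_0_lt_compat; lra]|].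
    unfold Rdiv. replace (2 * S ^ 2 * / r ^ 2) with (S ^ 2 * / (r ^ 2 / 2)) by (field; lra).
    apply Rmult_le_compat; auto; [apply pow2_ge_0|left; apply Rinv_0_lt_compat; lra|apply Rinv_le_contravar; lra]. }
  apply Rle_trans with (2 * (B + eps * (6 * r) ^ 2) * (2 * S ^ 2 / r ^ 2)).
  { assert (0 <= B + eps * (6 * r) ^ 2) by (pose proof (pow2_ge_0 (6 * r)); nra).
    apply Rle_trans with (2 * (B + eps * (6 * r) ^ 2) * (Cmod z ^ 2 / (r ^ 2 - Cmod z ^ 2))).
    - apply Rmult_le_compat_r; [apply Hq|lra].
    - apply Rmult_le_compat_l; [lra|apply Hq]. }
  replace (2 * (B + eps * (6 * r) ^ 2) * (2 * S ^ 2 / r ^ 2)) with (4 * B * S ^ 2 / r ^ 2 + 144 * (eps * S ^ 2)) by (field; lra).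
  replace (eps * S ^ 2) with (dl / 576) by (unfold eps; field; lra).
  assert (Hfin : 4 * B * S ^ 2 / r ^ 2 <= dl / 4); [|lra].
  assert (Hrd : 16 * S * S * B <= r * dl).
  { apply (Rmult_le_compat_r dl) in Hr2; [|lra]. replace (16 * S * S * B / dl * dl) with (16 * S * S * B) in Hr2 by (field; lra). exact Hr2. }
  apply Rmult_le_reg_r with (r ^ 2); auto. replace (4 * B * S ^ 2 / r ^ 2 * r ^ 2) with (4 * B * S ^ 2) by (field; lra).
  apply Rle_trans with (r * dl / 4); [lra|]. assert (r * dl <= r ^ 2 * dl) by (apply Rmult_le_compat_r; simpl; nra). lra.
Qed.

(** * De Bruijn's theorem *)

(** The transform takes conjugate values at conjugate points, so [|F z|^2 = |F z| |F (conj z)|].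
    Grouped in this way, the factor of [r] also sees the conjugate zero, and the comparison of two
    heights holds for each factor separately. *)
Definition Qf (r z : C) : R := Cmod (1 - z * z / (r * r)) * Cmod (1 - Cconj z * Cconj z / (r * r)).

Fixpoint Qprod (l : list C) (z : C) : R := match l with nil => 1 | cons r l' => Qf r z * Qprod l' z end.

Lemma Qf_ge0 r z : 0 <= Qf r z.
Proof. apply Rmult_le_pos; apply Cmod_ge_0. Qed.
Lemma Qprod_ge0 l z : 0 <= Qprod l z.
Proof. induction l; simpl; [lra|]. apply Rmult_le_pos; auto. apply Qf_ge0. Qed.
Lemma Qprod_eq l z : Cmod (zprod l z) * Cmod (zprod l (Cconj z)) = Qprod l z.
Proof. induction l as [|r l IH]; simpl; [rewrite Cmod_1; ring|]. rewrite !Cmod_mult, <- IH. unfold Qf. ring. Qed.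
Lemma Qf_sq r r' z : (r * r = r' * r')%C -> Qf r z = Qf r' z.
Proof. unfold Qf. now intros ->. Qed.

(** Product of the squared distances from a point at height [y] to two conjugate points at heights
    [b] and [- b], the horizontal distance being [X]. *)
Definition Pq (X y b : R) : R := (X ^ 2 + (y - b) ^ 2) * (X ^ 2 + (y + b) ^ 2).

Lemma Pq_ge0 X y b : 0 <= Pq X y b.
Proof. apply Rmult_le_pos; apply Rplus_le_le_0_compat; apply pow2_ge_0. Qed.

Lemma Qf_Pq r z : r <> RtoC 0 ->
  Qf r z ^ 2 = Pq (Re z - Re r) (Im z) (Im r) * Pq (Re z + Re r) (Im z) (Im r) / Cmod r ^ 8.
Proof.
  intro Hr. assert (Hp : 0 < Cmod r) by now apply Cmod_gt_0.
  assert (E : forall w, Cmod (1 - w * w / (r * r)) ^ 2 = Cmod (w - r) ^ 2 * Cmod (w + r) ^ 2 / Cmod r ^ 4).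
  { intro w. replace (1 - w * w / (r * r))%C with (- ((w - r) * (w + r) * / (r * r)))%C by (field; auto).
    rewrite Cmod_opp, !Cmod_mult, Cmod_inv, Cmod_mult by now apply Cmult_neq_0. field. lra. }
  unfold Qf. rewrite Rpow_mult_distr, !E, !Cmod2_alt, !re_minus, !im_minus, !re_plus, !im_plus, re_conj, im_conj.
  unfold Pq. field. lra.
Qed.

(** The difference is [8 y a (X^2 + y^2 + a^2 - b^2)]; this identity is the origin of the loss [a^2]
    in the width of the strip. *)
Lemma Pq_strict X y b a : 0 < y -> 0 < a -> b ^ 2 < y ^ 2 + a ^ 2 -> Pq X (y - a) b < Pq X (y + a) b.
Proof.
  intros Hy Ha Hb.
  assert (E : Pq X (y + a) b - Pq X (y - a) b = 8 * (y * a) * (X ^ 2 + (y ^ 2 + a ^ 2 - b ^ 2))) by (unfold Pq; ring).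
  assert (0 < y * a) by now apply Rmult_lt_0_compat. pose proof (pow2_ge_0 X).
  assert (0 < 8 * (y * a) * (X ^ 2 + (y ^ 2 + a ^ 2 - b ^ 2))) by (apply Rmult_lt_0_compat; lra). lra.
Qed.

Lemma Qf_strict r x y a : r <> RtoC 0 -> 0 < y -> 0 < a -> Im r ^ 2 < y ^ 2 + a ^ 2 ->
  Qf r (x, y - a) < Qf r (x, y + a).
Proof.
  intros Hr Hy Ha Hb. assert (Hp : 0 < Cmod r ^ 8) by (apply pow_lt; now apply Cmod_gt_0).
  apply Rsqr_incrst_0; try apply Qf_ge0. rewrite !Rsqr_pow2, !Qf_Pq by auto. simpl Re. simpl Im.
  apply Rmult_lt_compat_r; [now apply Rinv_0_lt_compat|].
  apply Rmult_le_0_lt_compat; try apply Pq_ge0; now apply Pq_strict.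
Qed.

Lemma Qf_mono r x y y' : r <> RtoC 0 -> Im r = 0 -> 0 <= y' <= y -> Qf r (x, y') <= Qf r (x, y).
Proof.
  intros Hr Hb Hy. assert (Hp : 0 < Cmod r ^ 8) by (apply pow_lt; now apply Cmod_gt_0).
  apply Rsqr_incr_0; try apply Qf_ge0. rewrite !Rsqr_pow2, !Qf_Pq by auto. simpl Re. simpl Im. rewrite Hb.
  apply Rmult_le_compat_r; [left; now apply Rinv_0_lt_compat|].
  assert (K : forall X, Pq X y' 0 <= Pq X y 0).
  { intro X. unfold Pq. assert (y' ^ 2 <= y ^ 2) by (apply pow_incr; lra). pose proof (pow2_ge_0 X). pose proof (pow2_ge_0 y').
    apply Rmult_le_compat; rewrite ?Rminus_0_r, ?Rplus_0_r; lra. }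
  apply Rmult_le_compat; try apply Pq_ge0; apply K.
Qed.

Lemma Qprod_mono l z z' : (forall r, In r l -> Qf r z' <= Qf r z) -> Qprod l z' <= Qprod l z.
Proof.
  induction l as [|r l IH]; intro H; simpl; [lra|].
  apply Rmult_le_compat; [apply Qf_ge0|apply Qprod_ge0|apply H; simpl; auto|apply IH; intros; apply H; simpl; auto].
Qed.

(** The ratio of the whole products is at most the ratio of the factor [r0]. It is stated by
    cross-multiplication because the products may vanish. *)
Lemma Qprod_strict l z z' r0 : (forall r, In r l -> Qf r z' <= Qf r z) -> In r0 l ->
  Qf r0 z * Qprod l z' <= Qf r0 z' * Qprod l z.
Proof.
  induction l as [|r l IH]; intros H Hin; [destruct Hin|]. simpl.
  destruct Hin as [->|Hin].
  - assert (Qprod l z' <= Qprod l z) by (apply Qprod_mono; intros; apply H; simpl; auto).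
    pose proof (Qf_ge0 r0 z). pose proof (Qf_ge0 r0 z').
    replace (Qf r0 z * (Qf r0 z' * Qprod l z')) with (Qf r0 z * Qf r0 z' * Qprod l z') by ring.
    replace (Qf r0 z' * (Qf r0 z * Qprod l z)) with (Qf r0 z * Qf r0 z' * Qprod l z) by ring.
    apply Rmult_le_compat_l; auto. now apply Rmult_le_pos.
  - assert (E : Qf r0 z * Qprod l z' <= Qf r0 z' * Qprod l z) by (apply IH; auto; intros; apply H; simpl; auto).
    assert (Hr : Qf r z' <= Qf r z) by (apply H; simpl; auto).
    pose proof (Qf_ge0 r z'). pose proof (Qf_ge0 r0 z). pose proof (Qprod_ge0 l z').
    replace (Qf r0 z * (Qf r z' * Qprod l z')) with (Qf r z' * (Qf r0 z * Qprod l z')) by ring.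
    replace (Qf r0 z' * (Qf r z * Qprod l z)) with (Qf r z * (Qf r0 z' * Qprod l z)) by ring.
    apply Rmult_le_compat; auto. now apply Rmult_le_pos.
Qed.

Lemma le_exp_limit a b : 0 <= b -> (forall d, 0 < d -> a <= b * exp d) -> a <= b.
Proof.
  intros Hb H. destruct (Rle_dec a b) as [|N]; auto. exfalso. apply Rnot_le_lt in N.
  destruct Hb as [Hb|<-].
  - assert (Ha : 0 < a) by lra. assert (Hl : ln b < ln a) by now apply ln_increasing.
    specialize (H ((ln a - ln b) / 2) ltac:(lra)).
    apply ln_le in H; auto. rewrite ln_mult, ln_exp in H by (auto; apply exp_pos). lra.
  - specialize (H 1 Rlt_0_1). lra.
Qed.

Section Compare.
Variable Phi : R -> R.
Hypothesis HP : Kern Phi.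
Let F := FT Phi.

Definition zero_list (R2 : R) (l : list C) : Prop :=
  (forall w, In w l -> F w = RtoC 0 /\ w <> RtoC 0) /\
  (forall w, Cmod w <= R2 -> F w = RtoC 0 -> exists r, In r l /\ (r * r = w * w)%C).

(** An inequality valid for all finite products passes to the transform, since the factorisation
    errors tend to 1. The weights [cp] and [cm] let the strict gain of one factor survive that
    limit; [R2] is the radius up to which zeros must be listed. *)
Lemma FT_compare zp zm cp cm R2 : 0 <= cp -> 0 <= cm ->
  (forall l, zero_list R2 l -> cp * Qprod l zm <= cm * Qprod l zp) ->
  cp * Cmod (F zm) ^ 2 <= cm * Cmod (F zp) ^ 2.
Proof.
  intros Hcp Hcm H.
  apply le_exp_limit; [apply Rmult_le_pos; auto; apply pow2_ge_0|]. intros d Hd.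
  set (S := Cmod zp + Cmod zm + 1). pose proof (Cmod_ge_0 zp). pose proof (Cmod_ge_0 zm).
  destruct (FT_0 Phi HP) as [p [Hp E0]]. fold F in E0.
  (* Four errors enter: at [zp], at [zm] and at their conjugates. *)
  destruct (hadamard_even F) with (S := S) (dl := d / 4) as [R1 HR1]; try (unfold S; lra).
  - intro R0. now apply FT_hol.
  - intro z. now apply FT_even.
  - rewrite E0. apply RtoC_neq0. lra.
  - intros eps Heps. now apply FT_growth.
  - destruct (HR1 (Rmax R1 R2) (Rmax_l _ _)) as [l [L1 [L2 L3]]].
    assert (Hl : zero_list R2 l).
    { split; auto. intros w Hw. apply L2. eapply Rle_trans; [exact Hw|apply Rmax_r]. }
    specialize (H l Hl).
    assert (G : forall z, Cmod z <= S -> exists th, Rabs th <= d / 2 /\ Cmod (F z) ^ 2 = p ^ 2 * Qprod l z * exp th).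
    { intros z Hz. destruct (L3 z Hz) as [t1 [T1 E1]]. destruct (L3 (Cconj z) ltac:(rewrite Cmod_conj; auto)) as [t2 [T2 E2]].
      exists (t1 + t2). split; [eapply Rle_trans; [apply Rabs_triang|lra]|].
      unfold F in E2 at 1. rewrite FT_conj, Cmod_conj in E2 by auto. fold F in E2.
      rewrite E0, Cmod_pos_RtoC in E1, E2 by lra.
      replace (Cmod (F z) ^ 2) with (Cmod (F z) * Cmod (F z)) by ring. rewrite E1 at 1. rewrite E2.
      rewrite <- Qprod_eq, exp_plus. ring. }
    destruct (G zp ltac:(unfold S; lra)) as [tp [Tp Ep]]. destruct (G zm ltac:(unfold S; lra)) as [tm [Tm Em]].
    rewrite Ep, Em. apply Rabs_le_between in Tp. apply Rabs_le_between in Tm.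
    assert (Hp2 : 0 < p ^ 2) by now apply pow_lt.
    replace (cp * (p ^ 2 * Qprod l zm * exp tm)) with (p ^ 2 * (cp * Qprod l zm) * exp tm) by ring.
    replace (cm * (p ^ 2 * Qprod l zp * exp tp) * exp d) with (p ^ 2 * (cm * Qprod l zp) * exp (tp + d)) by (rewrite exp_plus; ring).
    apply Rmult_le_compat.
    + apply Rmult_le_pos; [lra|]. apply Rmult_le_pos; auto. apply Qprod_ge0.
    + left. apply exp_pos.
    + apply Rmult_le_compat_l; lra.
    + apply exp_mono. lra.
Qed.

(** The separate alternative for real zeros keeps the predicate meaningful for negative [D], which
    occurs when the iteration overshoots. *)
Definition zeros_in (D : R) : Prop := forall z, F z = RtoC 0 -> Im z = 0 \/ Im z ^ 2 <= D.

(** The value at [i] is the integral of [Phi u * cosh u], and [cosh > 1] away from 0. *)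
Lemma FT_imag_growth : Cmod (F (RtoC 0)) < Cmod (F Ci).
Proof.
  destruct (FT_0 Phi HP) as [p [Hp E0]]. fold F in E0.
  assert (HK : Kern (fun u => Phi u * cosh (1 * u))) by now apply kern_cosh.
  assert (E1 : F Ci = Ig (fun u => RtoC (Phi u * cosh (1 * u)))).
  { transitivity (FT (fun u => Phi u * cosh (1 * u)) (RtoC 0)).
    - rewrite FT_cosh by auto. unfold F.
      replace (RtoC 0 + Ci * 1)%C with Ci by ring. replace (RtoC 0 - Ci * 1)%C with (- Ci)%C by ring.
      rewrite FT_even by auto. field.
    - apply Ig_ext. intro u. replace (Ci * RtoC 0 * RtoC u)%C with (RtoC 0) by ring. rewrite cexp_0. ring. }
  assert (E2 : F (RtoC 0) = Ig (fun u => RtoC (Phi u))).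
  { apply Ig_ext. intro u. replace (Ci * RtoC 0 * RtoC u)%C with (RtoC 0) by ring. rewrite cexp_0. ring. }
  destruct (kern_DomC _ HK) as [K1 D1]. destruct (kern_DomC _ HP) as [K2 D2].
  assert (DD : DomC (K1 + K2) (fun u => RtoC (Phi u * cosh (1 * u) - Phi u))).
  { generalize (DomC_minus _ _ _ _ D1 D2). apply DomC_ext. intro u. now rewrite RtoC_minus. }
  assert (Hpos : 0 < Re (Ig (fun u => RtoC (Phi u * cosh (1 * u) - Phi u)))).
  { eapply Rlt_le_trans; [|apply (Ig_ge_cint _ _ 1 2 ltac:(lra) DD)].
    - apply RInt_gt_0; [lra| |].
      + intros x Hx. rewrite Rmult_1_l. pose proof (cosh_ge x). destruct HP as [_ [_ [Hpp _]]]. specialize (Hpp x).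
        assert (0 < x ^ 2) by (apply pow_lt; lra). nra.
      + intros x _. exact (ccr_re _ x (proj1 DD x)).
    - intro u. rewrite Rmult_1_l. pose proof (cosh_ge u). destruct HP as [_ [_ [Hpp _]]]. specialize (Hpp u).
      pose proof (pow2_ge_0 u). nra. }
  rewrite (Ig_ext _ (fun u => RtoC (Phi u * cosh (1 * u)) - RtoC (Phi u))%C) in Hpos by (intro; now rewrite RtoC_minus).
  rewrite (Ig_minus _ _ _ _ D1 D2), re_minus, <- E1, <- E2, E0, re_RtoC in Hpos.
  rewrite E0, Cmod_pos_RtoC by lra. pose proof (re_le (F Ci)). lra.
Qed.

(** Without zeros all the finite products would be empty and the modulus constant, contrary to the
    growth along the imaginary axis. *)
Lemma FT_has_zero : exists r, F r = RtoC 0.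
Proof.
  apply NNPP. intro N. pose proof FT_imag_growth as G.
  assert (H : 1 * Cmod (F Ci) ^ 2 <= 1 * Cmod (F (RtoC 0)) ^ 2).
  { apply FT_compare with 0; try lra. intros l [L1 _]. destruct l as [|w l]; [simpl; lra|].
    exfalso. apply N. exists w. apply L1. simpl; auto. }
  pose proof (Cmod_ge_0 (F (RtoC 0))). assert (Cmod (F (RtoC 0)) ^ 2 < Cmod (F Ci) ^ 2) by (simpl; nra). lra.
Qed.

Lemma F0_neq : F (RtoC 0) <> RtoC 0.
Proof. destruct (FT_0 Phi HP) as [p [Hp E0]]. unfold F. rewrite E0. apply RtoC_neq0. lra. Qed.

(** At such a point the moduli at [z + i a] and [z - i a] agree. Were [z] too high, every factor
    would be strictly smaller at [z - i a], and the factor of an existing zero [r0] would force both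
    values to vanish. But [z + i a] is then a zero above the strip, as
    [(y + a)^2 > y^2 + a^2 > D]. *)
Lemma debruijn_upper D a z : zeros_in D -> 0 < a -> F (z + Ci * RtoC a)%C = (- F (z - Ci * RtoC a))%C ->
  0 < Im z -> Im z ^ 2 <= D - a ^ 2.
Proof.
  intros HZ Ha Hz Hy. destruct (Rle_dec (Im z ^ 2) (D - a ^ 2)) as [|N]; auto. exfalso. apply Rnot_le_lt in N.
  set (x := Re z). set (y := Im z) in *.
  assert (Ep : (z + Ci * RtoC a)%C = (x, y + a)) by (unfold x, y; destruct z; apply Ceq_parts; simpl; ring).
  assert (Em : (z - Ci * RtoC a)%C = (x, y - a)) by (unfold x, y; destruct z; apply Ceq_parts; simpl; ring).
  rewrite Ep, Em in Hz.
  assert (HQ : forall r, F r = RtoC 0 -> r <> RtoC 0 -> Qf r (x, y - a) < Qf r (x, y + a)).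
  { intros r Hr Hr0. apply Qf_strict; auto. destruct (HZ r Hr) as [-> | H]; [|lra].
    assert (0 < y ^ 2) by now apply pow_lt. pose proof (pow2_ge_0 a). simpl; simpl in *; lra. }
  destruct FT_has_zero as [r0 Hr0].
  assert (Hr0' : r0 <> RtoC 0) by (intros ->; now apply F0_neq).
  assert (C := FT_compare (x, y + a) (x, y - a) (Qf r0 (x, y + a)) (Qf r0 (x, y - a)) (Cmod r0)
    (Qf_ge0 _ _) (Qf_ge0 _ _)).
  assert (C' : Qf r0 (x, y + a) * Cmod (F (x, y - a)) ^ 2 <= Qf r0 (x, y - a) * Cmod (F (x, y + a)) ^ 2).
  { apply C. intros l [L1 L2]. destruct (L2 r0 (Rle_refl _) Hr0) as [r [Hin E]].
    rewrite <- !(Qf_sq r r0) by auto. apply Qprod_strict; auto.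
    intros w Hw. destruct (L1 w Hw). left. now apply HQ. }
  rewrite Hz, Cmod_opp in C'. pose proof (HQ r0 Hr0 Hr0').
  assert (Z : Cmod (F (x, y - a)) = 0).
  { destruct (Req_dec (Cmod (F (x, y - a))) 0) as [|Hn]; auto. pose proof (Cmod_ge_0 (F (x, y - a))).
    assert (0 < Cmod (F (x, y - a)) ^ 2) by (apply pow_lt; lra). nra. }
  apply Cmod_eq_0 in Z. rewrite Z in Hz. replace (- RtoC 0)%C with (RtoC 0) in Hz by ring.
  destruct (HZ _ Hz) as [K|K]; simpl in K; [lra|]. nra.
Qed.

Lemma FT_mono_imag x y y' : zeros_in 0 -> 0 <= y' <= y -> Cmod (F (x, y')) <= Cmod (F (x, y)).
Proof.
  intros HZ Hy.
  assert (H : 1 * Cmod (F (x, y')) ^ 2 <= 1 * Cmod (F (x, y)) ^ 2).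
  { apply FT_compare with 0; try lra. intros l [L1 _].
    assert (Qprod l (x, y') <= Qprod l (x, y)); [|lra]. apply Qprod_mono. intros r Hr. destruct (L1 r Hr) as [H1 H2].
    apply Qf_mono; auto. destruct (HZ r H1) as [|H3]; auto. pose proof (pow2_ge_0 (Im r)). nra. }
  apply Rsqr_incr_0; try apply Cmod_ge_0. rewrite !Rsqr_pow2. lra.
Qed.
End Compare.

Lemma debruijn_step Phi D a : Kern Phi -> 0 < a -> zeros_in Phi D ->
  zeros_in (fun u => Phi u * cosh (a * u)) (D - a ^ 2).
Proof.
  intros HP Ha HZ.
  assert (HK : Kern (fun u => Phi u * cosh (a * u))) by now apply kern_cosh.
  assert (Up : forall z, FT (fun u => Phi u * cosh (a * u)) z = RtoC 0 -> 0 < Im z -> Im z ^ 2 <= D - a ^ 2).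
  { intros z Hz Hy. apply (debruijn_upper Phi HP D a z); auto. rewrite FT_cosh in Hz by auto.
    set (A := FT Phi (z + Ci * RtoC a)%C) in *. set (B := FT Phi (z - Ci * RtoC a)%C) in *.
    replace A with ((A + B) / 2 * 2 - B)%C by field. rewrite Hz. ring. }
  intros z Hz. destruct (Rtotal_order (Im z) 0) as [H|[H|H]]; auto.
  right. rewrite <- (Rsqr_neg (Im z)) || idtac.
  replace (Im z ^ 2) with (Im (Cconj z) ^ 2) by (rewrite im_conj; ring). apply Up; [|rewrite im_conj; lra].
  rewrite FT_conj, Hz by auto. apply Ceq_parts; simpl; ring.
Qed.

Lemma debruijn_iter Phi D a n : Kern Phi -> 0 < a -> zeros_in Phi D ->
  Kern (fun u => Phi u * cosh (a * u) ^ n) /\ zeros_in (fun u => Phi u * cosh (a * u) ^ n) (D - INR n * a ^ 2).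
Proof.
  intros HP Ha HZ. induction n as [|n [IH1 IH2]].
  - replace (fun u => Phi u * cosh (a * u) ^ 0) with Phi by (apply functional_extensionality; intro; simpl; ring).
    split; auto. simpl INR. replace (D - 0 * a ^ 2) with D by ring. exact HZ.
  - replace (fun u => Phi u * cosh (a * u) ^ S n) with (fun u => (Phi u * cosh (a * u) ^ n) * cosh (a * u))
      by (apply functional_extensionality; intro; simpl; ring).
    split; [now apply kern_cosh|]. rewrite S_INR. replace (D - (INR n + 1) * a ^ 2) with (D - INR n * a ^ 2 - a ^ 2) by ring.
    now apply debruijn_step.
Qed.

(** Put [x = lam u^2] and [t = x / n]. From [1 + t <= cosh <= exp t] and [(1 - t) exp t <= 1]
    follows [cosh >= exp t (1 - t^2)]; Bernoulli's inequality bounds the [n]-th power of [1 - t^2]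
    below by [1 - x^2 / n]. *)
Lemma cosh_pow_limit lam u n : 0 <= lam -> (0 < n)%nat -> lam * u ^ 2 <= INR n ->
  Rabs (cosh (sqrt (2 * lam / INR n) * u) ^ n - exp (lam * u ^ 2)) <= exp (lam * u ^ 2) * (lam * u ^ 2) ^ 2 / INR n.
Proof.
  intros Hl Hn Hu. assert (Hn' : 0 < INR n) by now apply lt_0_INR.
  set (x := lam * u ^ 2) in *. assert (Hx : 0 <= x) by (unfold x; pose proof (pow2_ge_0 u); nra).
  set (t := x / INR n). assert (Ht : 0 <= t <= 1).
  { unfold t. split; [apply Rmult_le_pos; auto; left; now apply Rinv_0_lt_compat|].
    apply Rmult_le_reg_r with (INR n); auto. unfold Rdiv. rewrite Rmult_assoc, Rinv_l; lra. }
  assert (Es : (sqrt (2 * lam / INR n) * u) ^ 2 / 2 = t).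
  { rewrite Rpow_mult_distr. replace (sqrt (2 * lam / INR n) ^ 2) with (2 * lam / INR n).
    - unfold t, x. field. lra.
    - rewrite pow2_sqrt; auto. apply Rmult_le_pos; [lra|left; now apply Rinv_0_lt_compat]. }
  assert (Ex : exp t ^ n = exp x).
  { rewrite <- exp_pow_INR || idtac. clear - Hn'. unfold t.
    assert (forall m, exp (x / INR n) ^ m = exp (INR m * (x / INR n))) as ->.
    { induction m; [simpl; rewrite Rmult_0_l, exp_0; reflexivity|]. rewrite S_INR. simpl. rewrite IHm, <- exp_plus. f_equal. ring. }
    f_equal. field. lra. }
  set (c := cosh (sqrt (2 * lam / INR n) * u)).
  assert (H1 : 1 + t <= c) by (unfold c; rewrite <- Es; apply cosh_ge).
  assert (H2 : c <= exp t) by (unfold c; rewrite <- Es; apply cosh_le_gauss).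
  assert (H3 : c ^ n <= exp x) by (rewrite <- Ex; apply pow_incr; lra).
  assert (H4 : exp x * (1 - x ^ 2 / INR n) <= c ^ n).
  { assert (Bern : 1 - INR n * t ^ 2 <= (1 - t ^ 2) ^ n).
    { assert (Ht2 : 0 <= t ^ 2 <= 1) by (split; [apply pow2_ge_0|simpl; nra]). revert Ht2. generalize (t ^ 2) as s. clear. intros s Hs.
      induction n; [simpl; lra|]. rewrite S_INR. simpl. assert (0 <= INR n) by apply pos_INR.
      apply Rle_trans with ((1 - s) * (1 - INR n * s)); [nra|]. apply Rmult_le_compat_l; lra. }
    assert (Hb : exp t * (1 - t ^ 2) <= c).
    { assert (E1 : (1 - t) * exp t <= 1).
      { assert (Hm : 1 - t <= exp (- t)) by (pose proof (exp_ge_1p (- t)); lra). pose proof (exp_pos t).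
        assert (Hi : exp (- t) * exp t = 1) by (rewrite <- exp_plus, Rplus_opp_l; apply exp_0). nra. }
      replace (exp t * (1 - t ^ 2)) with ((1 - t) * exp t * (1 + t)) by ring. nra. }
    apply Rle_trans with ((exp t * (1 - t ^ 2)) ^ n).
    - rewrite Rpow_mult_distr, Ex. apply Rmult_le_compat_l; [left; apply exp_pos|]. eapply Rle_trans; [|exact Bern].
      right. unfold t. field. lra.
    - apply pow_incr. split; auto. apply Rmult_le_pos; [left; apply exp_pos|]. simpl; nra. }
  rewrite Rabs_left1 by lra. unfold Rdiv in *. lra.
Qed.

(** For each [n] the zeros are real, so the modulus increases with the height, and this passes to
    the limit. A zero above the real axis then kills the limit on the whole vertical segment below
    it; by the identity theorem the transform would vanish identically, contrary to its positive
    value at 0. *)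
Theorem debruijn_gauss Phi D lam : Kern Phi -> zeros_in Phi D -> D <= 2 * lam -> 0 < lam ->
  forall z, FT (fun u => Phi u * exp (lam * u ^ 2)) z = RtoC 0 -> Im z = 0.
Proof.
  intros HP HZ HD Hl.
  set (G := fun u => Phi u * exp (lam * u ^ 2)). assert (HG : Kern G) by (apply kern_gauss; auto; lra).
  set (Gn := fun n u => Phi u * cosh (sqrt (2 * lam / INR n) * u) ^ n).
  assert (Hs : forall n, (0 < n)%nat -> 0 < sqrt (2 * lam / INR n)).
  { intros n Hn. apply sqrt_lt_R0. apply Rdiv_lt_0_compat; [lra|now apply lt_0_INR]. }
  assert (HGn : forall n, (0 < n)%nat -> Kern (Gn n) /\ zeros_in (Gn n) 0).
  { intros n Hn. destruct (debruijn_iter Phi D (sqrt (2 * lam / INR n)) n HP (Hs n Hn) HZ) as [H1 H2].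
    split; auto. intros z Hz. destruct (H2 z Hz) as [|H3]; auto. right.
    rewrite pow2_sqrt in H3 by (apply Rmult_le_pos; [lra|left; apply Rinv_0_lt_compat; now apply lt_0_INR]).
    replace (INR n * (2 * lam / INR n)) with (2 * lam) in H3 by (field; apply Rgt_not_eq; now apply lt_0_INR). lra. }
  assert (Lim : forall z, clim eventually (fun n => FT (Gn n) z) (FT G z)).
  { intro z. destruct (FT_dom G (Cmod z) HG (Cmod_ge_0 z)) as [K [HK HKd]].
    assert (DG := HKd z (Rle_refl _)).
    destruct (FT_dom_ex G z HG) as [K2 D2].
    destruct (kern_dom1 G (Cmod z) HG (Cmod_ge_0 z)) as [K3 [HK3 HB3]].
    apply (Ig_lim eventually (fun n u => RtoC (Gn n u) * cexp (Ci * z * RtoC u))%C _ (K + K3)).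
    - exists 1%nat. intros n Hn. destruct (HGn n ltac:(lia)) as [H1 _]. split; [intro; apply ccr_kern, H1|].
      intro u. rewrite Cmod_mult, Cmod_R, Rabs_right by (apply Rle_ge; left; apply H1).
      apply Rle_trans with (G u * exp (Cmod z * Rabs u)).
      + apply Rmult_le_compat; [left; apply H1|apply Cmod_ge_0| |apply Cmod_cexp_izu].
        unfold Gn, G. apply Rmult_le_compat_l; [left; apply HP|].
        apply Rle_trans with (exp (2 * lam / INR n * u ^ 2 / 2) ^ n).
        * apply pow_incr. split; [left; apply cosh_pos|]. eapply Rle_trans; [apply cosh_le_gauss|]. apply exp_mono. right.
          rewrite Rpow_mult_distr, pow2_sqrt by (apply Rmult_le_pos; [lra|left; apply Rinv_0_lt_compat; apply lt_0_INR; lia]). field.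
          apply Rgt_not_eq, lt_0_INR. lia.
        * right. assert (forall y m, exp y ^ m = exp (INR m * y)) as ->.
          { intros y m. induction m; [simpl; rewrite Rmult_0_l, exp_0; reflexivity|]. rewrite S_INR. simpl. rewrite IHm, <- exp_plus. f_equal. ring. }
          f_equal. field. apply Rgt_not_eq, lt_0_INR. lia.
      + eapply Rle_trans; [apply HB3|]. pose proof (wt_pos u). nra.
    - revert DG. apply DomC_le. lra.
    - intros A e HA He.
      set (X := lam * A ^ 2). assert (HA2 : 0 < A ^ 2) by now apply pow_lt. assert (HX : 0 < X) by (unfold X; nra).
      destruct (curve_bounded (fun u => RtoC (G u) * cexp (Ci * z * RtoC u))%C (-A) A ltac:(lra)) as [M [HM0 HM]]; [intro; apply ccr_kern, HG|].
      (* [n > X] makes [cosh_pow_limit] applicable on all of [[-A, A]], and [n > M X^2 / e] brings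
         its error below [e]. *)
      destruct (nfloor_ex (X + M * X ^ 2 / e + 1)) as [N [HN1 HN2]].
      { assert (0 < M * X ^ 2 / e) by (apply Rdiv_lt_0_compat; auto; apply Rmult_lt_0_compat; auto; now apply pow_lt). lra. }
      exists (S N). intros n Hn u Hu.
      assert (HMX : 0 < M * X ^ 2 / e) by (apply Rdiv_lt_0_compat; auto; apply Rmult_lt_0_compat; auto; now apply pow_lt).
      assert (HnN : X + M * X ^ 2 / e + 1 < INR n).
      { eapply Rlt_le_trans; [exact HN2|]. rewrite <- S_INR. now apply le_INR. }
      assert (Hn0 : 0 < INR n) by lra.
      assert (Hu2 : lam * u ^ 2 <= X).
      { unfold X. apply Rmult_le_compat_l; [lra|]. rewrite <- (Rabs_sq u). apply pow_incr. split; [apply Rabs_pos|]. apply Rabs_le. lra. }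
      pose proof (cosh_pow_limit lam u n ltac:(lra) ltac:(lia) ltac:(lra)) as B.
      replace (RtoC (Gn n u) * cexp (Ci * z * RtoC u) - RtoC (G u) * cexp (Ci * z * RtoC u))%C
        with (RtoC (Gn n u - G u) * cexp (Ci * z * RtoC u))%C by (rewrite RtoC_minus; ring).
      rewrite Cmod_mult, Cmod_R.
      replace (Gn n u - G u) with (Phi u * (cosh (sqrt (2 * lam / INR n) * u) ^ n - exp (lam * u ^ 2))) by (unfold Gn, G; ring).
      rewrite Rabs_mult, (Rabs_right (Phi u)) by (apply Rle_ge; left; apply HP).
      specialize (HM u Hu). cbv beta in HM. rewrite Cmod_mult, Cmod_R, Rabs_right in HM by (apply Rle_ge; left; apply HG).
      apply Rle_trans with (Phi u * (exp (lam * u ^ 2) * (lam * u ^ 2) ^ 2 / INR n) * Cmod (cexp (Ci * z * RtoC u))).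
      { apply Rmult_le_compat_r; [apply Cmod_ge_0|]. apply Rmult_le_compat_l; [left; apply HP|exact B]. }
      replace (Phi u * (exp (lam * u ^ 2) * (lam * u ^ 2) ^ 2 / INR n) * Cmod (cexp (Ci * z * RtoC u)))
        with (G u * Cmod (cexp (Ci * z * RtoC u)) * ((lam * u ^ 2) ^ 2 * / INR n)) by (unfold G; field; lra).
      apply Rle_trans with (M * (X ^ 2 * / INR n)).
      { assert (0 < / INR n) by now apply Rinv_0_lt_compat.
        apply Rmult_le_compat; auto; [apply Rmult_le_pos; [left; apply HG|apply Cmod_ge_0]| |].
        - apply Rmult_le_pos; [apply pow2_ge_0|lra].
        - apply Rmult_le_compat_r; [lra|]. apply pow_incr. split; auto. pose proof (pow2_ge_0 u). nra. }
      apply Rmult_le_reg_r with (INR n); auto.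
      replace (M * (X ^ 2 * / INR n) * INR n) with (M * X ^ 2) by (field; lra).
      replace (M * X ^ 2) with (e * (M * X ^ 2 / e)) by (field; lra). apply Rmult_le_compat_l; lra. }
  assert (Mono : forall x y y', 0 <= y' <= y -> Cmod (FT G (x, y')) <= Cmod (FT G (x, y))).
  { intros x y y' Hy. apply (clim_Cmod_le2 (F := eventually) (fun n => FT (Gn n) (x, y')) (fun n => FT (Gn n) (x, y))); auto.
    exists 1%nat. intros n Hn. destruct (HGn n ltac:(lia)) as [H1 H2]. now apply FT_mono_imag. }
  assert (Up : forall z, FT G z = RtoC 0 -> Im z <= 0).
  { intros z Hz. destruct (Rle_dec (Im z) 0) as [|N]; auto. exfalso. apply Rnot_le_lt in N.
    assert (Z : forall y', 0 <= y' <= Im z -> FT G (Re z, y') = RtoC 0).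
    { intros y' Hy'. apply Cmod_eq_0. pose proof (Mono (Re z) (Im z) y' Hy').
      replace ((Re z, Im z) : C) with z in H by (destruct z; reflexivity). rewrite Hz, Cmod_0 in H.
      pose proof (Cmod_ge_0 (FT G (Re z, y'))). lra. }
    destruct (FT_0 G HG) as [p [Hp E0]].
    set (c := (Re z, 0) : C).
    assert (Hall : forall w, FT G (c + w)%C = RtoC 0).
    { intro w. apply (identity_disc (fun w => FT G (c + w)%C) (Cmod w + 1)); [| |lra].
      - intros v _. destruct (FT_cder G (c + v)%C HG) as [d Hd]. eexists.
        apply (cder_comp (FT G) (fun v => c + v)%C); [exact Hd|]. apply cder_plus; [apply cder_const|apply cder_id].
      - intros d Hd. set (y' := Rmin (d / 2) (Im z)). assert (0 < y') by (apply Rmin_glb_lt; lra).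
        assert (y' <= d / 2) by apply Rmin_l. assert (y' <= Im z) by apply Rmin_r.
        exists (0, y'). split; [|split].
        + intro E. apply (f_equal Im) in E. simpl in E. lra.
        + replace ((0, y') : C) with (Ci * RtoC y')%C by (apply Ceq_parts; simpl; ring).
          rewrite Cmod_mult, Cmod_Ci, Cmod_pos_RtoC; lra.
        + replace (c + (0, y'))%C with ((Re z, y') : C) by (apply Ceq_parts; simpl; ring). apply Z. lra. }
    specialize (Hall (- c)%C). replace (c + - c)%C with (RtoC 0) in Hall by ring. rewrite E0 in Hall.
    apply RtoC_inj in Hall. lra. }
  intros z Hz. pose proof (Up z Hz). pose proof (Up (Cconj z)) as H2. rewrite im_conj in H2.
  assert (FT G (Cconj z) = RtoC 0) by (rewrite FT_conj, Hz by auto; apply Ceq_parts; simpl; ring).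
  specialize (H2 H0). lra.
Qed.

(** * Contour shifts and Poisson summation *)

Fixpoint csum (a : nat -> C) (N : nat) : C := match N with O => RtoC 0 | S n => (csum a n + a n)%C end.

Lemma csum_ext a b N : (forall n, (n < N)%nat -> a n = b n) -> csum a N = csum b N.
Proof. induction N; intro H; simpl; auto. rewrite IHN, H; auto. Qed.
Lemma csum_scal c a N : csum (fun n => c * a n)%C N = (c * csum a N)%C.
Proof. induction N; simpl; [ring|]. rewrite IHN. ring. Qed.
Lemma csum_minus a b N : csum (fun n => a n - b n)%C N = (csum a N - csum b N)%C.
Proof. induction N; simpl; [ring|]. rewrite IHN. ring. Qed.

Lemma csum_geo_diff a B rho N M : 0 <= B -> 0 <= rho < 1 -> (forall n, Cmod (a n) <= B * rho ^ n) -> (N <= M)%nat ->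
  Cmod (csum a M - csum a N) <= B * (rho ^ N - rho ^ M) / (1 - rho).
Proof.
  intros HB Hr Ha H. induction H.
  - replace (csum a N - csum a N)%C with (RtoC 0) by ring. rewrite Cmod_0. right. field. lra.
  - simpl. replace (csum a m + a m - csum a N)%C with ((csum a m - csum a N) + a m)%C by ring.
    eapply Rle_trans; [apply Cmod_triangle|]. eapply Rle_trans; [apply Rplus_le_compat; [exact IHle|apply Ha]|].
    right. field. lra.
Qed.

Lemma csum_geo_tail a B rho N M : 0 <= B -> 0 <= rho < 1 -> (forall n, Cmod (a n) <= B * rho ^ n) -> (N <= M)%nat ->
  Cmod (csum a M - csum a N) <= B * rho ^ N / (1 - rho).
Proof.
  intros HB Hr Ha H. eapply Rle_trans; [now apply (csum_geo_diff a B rho)|].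
  unfold Rdiv. apply Rmult_le_compat_r; [left; apply Rinv_0_lt_compat; lra|].
  apply Rmult_le_compat_l; auto. pose proof (pow_le rho M (proj1 Hr)). lra.
Qed.

Definition CL (a : nat -> C) : C := epsilon (inhabits (RtoC 0)) (fun l => clim eventually a l).

Lemma CL_eq a l : clim eventually a l -> CL a = l.
Proof.
  intro H. apply (clim_unique (F := eventually) a); auto. unfold CL.
  apply (epsilon_spec (inhabits (RtoC 0)) (fun l => clim eventually a l)). eauto.
Qed.

Lemma geo_small B rho e : 0 <= B -> 0 <= rho < 1 -> 0 < e -> exists N, forall n, (N <= n)%nat -> B * rho ^ n < e.
Proof.
  intros HB Hr He. destruct (pow_lt_1_zero rho ltac:(rewrite Rabs_right; lra) (e / (B + 1)) ltac:(apply Rdiv_lt_0_compat; lra)) as [N HN].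
  exists N. intros n Hn. specialize (HN n ltac:(lia)). rewrite Rabs_right in HN by (apply Rle_ge, pow_le; lra).
  assert (0 <= rho ^ n) by (apply pow_le; lra).
  assert ((B + 1) * rho ^ n < e).
  { replace e with ((B + 1) * (e / (B + 1))) by (field; lra). apply Rmult_lt_compat_l; lra. }
  lra.
Qed.

Lemma csum_geo_lim a B rho : 0 <= B -> 0 <= rho < 1 -> (forall n, Cmod (a n) <= B * rho ^ n) ->
  clim eventually (csum a) (CL (csum a)).
Proof.
  intros HB Hr Ha. assert (E : exists l, clim eventually (csum a) l).
  { apply (clim_cauchy eventually). intros e He.
    destruct (geo_small (B / (1 - rho)) rho e) as [N HN]; auto; [apply Rmult_le_pos; auto; left; apply Rinv_0_lt_compat; lra|].
    exists (fun n => (N <= n)%nat). split; [exists N; auto|].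
    assert (S : forall n m, (N <= n)%nat -> (n <= m)%nat -> Cmod (csum a m - csum a n) < e).
    { intros n m H1 H2. eapply Rle_lt_trans; [now apply (csum_geo_tail a B rho)|].
      replace (B * rho ^ n / (1 - rho)) with (B / (1 - rho) * rho ^ n) by (field; lra). auto. }
    intros n m H1 H2. destruct (Nat.le_ge_cases n m); [rewrite Cmod_minus_sym|]; apply S; auto. }
  destruct E as [l Hl]. now rewrite (CL_eq _ _ Hl).
Qed.

Lemma CL_tail a B rho N : 0 <= B -> 0 <= rho < 1 -> (forall n, Cmod (a n) <= B * rho ^ n) ->
  Cmod (CL (csum a) - csum a N) <= B * rho ^ N / (1 - rho).
Proof.
  intros HB Hr Ha. apply (clim_Cmod_le (F := eventually) (fun M => csum a M - csum a N)%C).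
  - apply clim_minus; [now apply (csum_geo_lim a B rho)|apply clim_const].
  - exists N. intros M HM. now apply csum_geo_tail.
Qed.

Lemma contour_shift G K a : 0 <= a -> (forall x y, 0 <= y <= a -> exists d, cder G (x, y) d) ->
  (forall x y, 0 <= y <= a -> Cmod (G (x, y)) <= K * wt x) ->
  Ig (fun u => G (u, 0)) = Ig (fun u => G (u, a)).
Proof.
  intros Ha HG HK.
  assert (Cz : forall x y, 0 <= y <= a -> ccc G (x, y)) by (intros x y Hy; destruct (HG x y Hy) as [d Hd]; exact (cder_ccc _ _ _ Hd)).
  assert (D : forall y, 0 <= y <= a -> DomC K (fun u => G (u, y))).
  { intros y Hy. split; [intro x; apply ccr_hor; auto|auto]. }
  pose proof (DomC_K _ _ (D 0 ltac:(lra))) as HK0.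
  apply (clim_unique (F := Rbar_locally p_infty) (fun A => cint (fun u => G (u, 0)) (-A) A)); [apply (Ig_spec K), D; lra|].
  apply clim_ext with (f := fun A => (cint (fun u => G (u, a)) (-A) A - Ci * (cint (fun y => G (A, y)) 0 a - cint (fun y => G ((-A)%R, y)) 0 a))%C).
  - exists 0. intros A HA.
    assert (J : Jrect G (-A) A 0 a = 0).
    { apply goursat; try lra. intros [x y] [Hx Hy]. now apply HG. }
    unfold Jrect in J.
    replace (cint (fun u => G (u, 0)) (-A) A) with
      (cint (fun x => G (x, 0)) (- A) A - cint (fun x => G (x, a)) (- A) A + Ci * (cint (fun y => G (A, y)) 0 a - cint (fun y => G ((-A)%R, y)) 0 a)
       + (cint (fun u => G (u, a)) (- A) A - Ci * (cint (fun y => G (A, y)) 0 a - cint (fun y => G ((-A)%R, y)) 0 a)))%C by ring.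
    rewrite J. ring.
  - apply clim_eq with (Ig (fun u => G (u, a)) - Ci * (0 - 0))%C; [|ring].
    apply clim_minus; [apply (Ig_spec K), D; lra|]. apply clim_mult; [apply clim_const|].
    assert (V : forall s, (s = 1 \/ s = -1) -> clim (Rbar_locally p_infty) (fun A => cint (fun y => G ((s * A)%R, y)) 0 a) 0).
    (* A vertical side contributes at most [K a wt A], and [A * wt A < 1]; the sign [s] treats both
       sides together. *)
    { intros s Hs e He. exists (K * (a + 1) / e + 1). intros A HA.
      assert (Hq : 0 <= K * (a + 1) / e) by (apply Rmult_le_pos; [nra|left; now apply Rinv_0_lt_compat]).
      replace (cint (fun y => G ((s * A)%R, y)) 0 a - 0)%C with (cint (fun y => G ((s * A)%R, y)) 0 a) by ring.
      eapply Rle_lt_trans; [apply (cint_norm _ 0 a (K * wt A)); auto|].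
      - intros y Hy. rewrite Rmin_left, Rmax_right in Hy by lra. apply ccr_ver. auto.
      - intros y Hy. eapply Rle_trans; [now apply HK|]. destruct Hs as [-> | ->]; right; f_equal; unfold wt; f_equal; ring.
      - assert (Hw : A * wt A < 1).
        { unfold wt. apply Rmult_lt_reg_r with (1 + A ^ 2); [pose proof (pow2_ge_0 A); lra|].
          rewrite Rmult_assoc, Rinv_l by (pose proof (pow2_ge_0 A); lra). pose proof (pow2_ge_0 (A - 1)). pose proof (pow2_ge_0 A). nra. }
        pose proof (wt_pos A).
        assert (HKA : K * (a + 1) < e * A).
        { apply Rlt_le_trans with (e * (K * (a + 1) / e + 1)); [|apply Rmult_le_compat_l; lra].
          replace (e * (K * (a + 1) / e + 1)) with (K * (a + 1) + e) by (field; lra). lra. }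
        apply Rle_lt_trans with (K * (a + 1) * wt A); [nra|].
        apply Rlt_trans with (e * A * wt A); [now apply Rmult_lt_compat_r|]. nra. }
    pose proof (V 1 ltac:(auto)) as V1. pose proof (V (-1) ltac:(auto)) as V2.
    apply clim_minus.
    + revert V1. apply clim_ext. apply filter_forall. intro A. apply cint_ext. intros y _. f_equal. f_equal. ring.
    + revert V2. apply clim_ext. apply filter_forall. intro A. apply cint_ext. intros y _. f_equal. f_equal. ring.
Qed.

(** * The Gaussian and its Fourier transform *)

Definition gauss (u : R) : R := exp (- (PI * u ^ 2)).

Lemma gauss_wt u : gauss u <= wt u.
Proof.
  eapply Rle_trans; [|apply exp_m2_wt]. apply exp_mono. pose proof PI2_3_2. pose proof (pow2_ge_0 u). nra.
Qed.
Lemma gauss_pos u : 0 < gauss u. Proof. apply exp_pos. Qed.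
Lemma gauss_cont u : continuous gauss u.
Proof. unfold gauss. rcont. Qed.

Definition cpar (g : R -> R) (t : R) : R -> C := fun u => (RtoC (g u) * cexp (Ci * RtoC (t * u)))%C.

Lemma DomC_wave K f t : DomC K f -> DomC K (fun u => f u * cexp (Ci * RtoC (t * u)))%C.
Proof.
  intros [Hc Hf]. split.
  - intro u. apply ccr_mult; [apply Hc|]. ccont. rcont.
  - intro u. rewrite Cmod_mult, Cmod_cexp, re_mult. simpl. replace (0 * (t * u) - 1 * 0) with 0 by ring. rewrite exp_0, Rmult_1_r. apply Hf.
Qed.

Lemma cpar_Dom K g t : (forall u, continuous g u) -> (forall u, 0 <= g u <= K * wt u) -> DomC K (cpar g t).
Proof.
  intros Hc Hg. apply (DomC_wave K (fun u => RtoC (g u))). split; [intro; apply ccr_RtoC, Hc|].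
  intro u. rewrite Cmod_pos_RtoC; apply Hg.
Qed.

(** The Gaussian integral, left undetermined here. Its value comes out of Poisson summation at the
    self-dual point, in [cg_1]. *)
Definition cg : R := Re (Ig (fun u => RtoC (gauss u))).

(** Shifting the line of integration of [exp (- pi z^2)] to height [t] produces the wave of
    frequency [- 2 pi t] times [exp (pi t^2)]; reflection covers the other sign. *)
Lemma gauss_FT t : Ig (cpar gauss (2 * PI * t)) = RtoC (cg * gauss t).
Proof.
  assert (Dg : DomC 1 (fun u => RtoC (gauss u))).
  { split; [intro; apply ccr_RtoC, gauss_cont|]. intro u. rewrite Cmod_pos_RtoC by (left; apply gauss_pos). pose proof (gauss_wt u). lra. }
  assert (P : forall t, 0 <= t -> Ig (cpar gauss (2 * PI * (- t))) = RtoC (cg * gauss t)).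
  { clear t. intros t Ht. set (G := fun z : C => cexp (- (RtoC PI * (z * z)))%C).
    assert (E0 : Ig (fun u => G (u, 0)) = RtoC cg).
    { unfold cg. rewrite <- (Ig_real 1) by exact Dg. apply Ig_ext. intro u. unfold G, gauss. rewrite <- cexp_RtoC. f_equal.
      apply Ceq_parts; simpl; ring. }
    rewrite (contour_shift G (exp (PI * t ^ 2)) t) in E0; auto.
    - apply (f_equal (fun c => RtoC (gauss t) * c)%C) in E0.
      cbv beta in E0. rewrite RtoC_mult, Cmult_comm, <- E0.
      destruct (cpar_Dom 1 gauss (2 * PI * (- t)) gauss_cont) as [D1 D2].
      { intro u. pose proof (gauss_pos u). pose proof (gauss_wt u). lra. }
      assert (Eu : forall u, G (u, t) = (RtoC (exp (PI * t ^ 2)) * cpar gauss (2 * PI * (- t)) u)%C).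
      { intro u. unfold G, cpar, gauss. rewrite <- !cexp_RtoC, <- !cexp_plus. f_equal. apply Ceq_parts; simpl; ring. }
      rewrite (Ig_ext _ _ Eu), (Ig_scal 1) by (split; auto).
      rewrite Cmult_assoc, <- RtoC_mult.
      replace (gauss t * exp (PI * t ^ 2)) with 1 by (unfold gauss; rewrite <- exp_plus, Rplus_opp_l, exp_0; reflexivity). ring.
    - intros x y _. eexists. unfold G. apply (cder_comp cexp (fun z => - (RtoC PI * (z * z)))%C); [apply cder_cexp|].
      apply cder_opp. apply (cder_mult (fun _ => RtoC PI) (fun z => z * z)%C); [apply cder_const|].
      apply (cder_mult (fun z => z) (fun z => z)); apply cder_id.
    - intros x y Hy. unfold G. rewrite Cmod_cexp.
      replace (Re (- (RtoC PI * ((x, y) * (x, y)))%C)) with (PI * y ^ 2 + - (PI * x ^ 2)) by (simpl; ring).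
      rewrite exp_plus. apply Rmult_le_compat; try (left; apply exp_pos); [|apply gauss_wt].
      apply exp_mono. apply Rmult_le_compat_l; [pose proof PI_RGT_0; lra|]. apply pow_incr. lra. }
  assert (D : forall s, DomC 1 (cpar gauss s)).
  { intro s. apply cpar_Dom; [apply gauss_cont|]. intro u. pose proof (gauss_pos u). pose proof (gauss_wt u). lra. }
  destruct (Rle_dec 0 t) as [H|H].
  - rewrite <- (P t H), <- (Ig_reflect 1 (cpar gauss (2 * PI * - t))) by auto. apply Ig_ext. intro u. unfold cpar, gauss.
    f_equal; [f_equal; f_equal; ring|]. f_equal. f_equal. f_equal. ring.
  - replace (gauss t) with (gauss (- t)) by (unfold gauss; f_equal; ring). rewrite <- (P (- t)) by lra. now rewrite Ropp_involutive.
Qed.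

(** * The Poisson kernel of period one *)

Definition e1 (x : R) : C := cexp (Ci * RtoC (2 * PI * x)).
Definition qa (r x : R) : C := (RtoC r * e1 x)%C.
(** Herglotz kernel [(1 + q) / (1 - q)] with [q = r exp (2 pi i x)]; [SM] are the partial sums of
    its power series and its real part [PR] is the Poisson kernel. Integrating a Gaussian against
    [PR] and letting [r] tend to 1 yields Poisson summation by Abel means. *)
Definition PC (r x : R) : C := ((1 + qa r x) / (1 - qa r x))%C.
Definition SM (r : R) (M : nat) (x : R) : C := (1 + 2 * csum (fun m => qa r x ^ (S m)) M)%C.
Definition PR (r x : R) : R := Re (PC r x).

Lemma Cmod_e1 x : Cmod (e1 x) = 1.
Proof. unfold e1. rewrite Cmod_cexp, re_mult. simpl. rewrite <- exp_0. f_equal. ring. Qed.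
Lemma Cmod_qa r x : 0 < r -> Cmod (qa r x) = r.
Proof. intro. unfold qa. rewrite Cmod_mult, Cmod_e1, Cmod_pos_RtoC; lra. Qed.
Lemma ccr_e1 x : ccr e1 x.
Proof. unfold e1. ccont. rcont. Qed.
Lemma ccr_qa r x : ccr (qa r) x.
Proof. apply ccr_mult; [apply ccr_const|apply ccr_e1]. Qed.

Section Kernel.
Variable r : R.
Hypothesis Hr : 0 < r < 1.

Lemma qa_neq1 x : 1 - r <= Cmod (1 - qa r x).
Proof. pose proof (Cmod_triangle_rev 1 (qa r x)). rewrite Cmod_1, Cmod_qa in H; lra. Qed.
Lemma qa_neq1' x : (1 - qa r x)%C <> RtoC 0.
Proof. apply Cmod_gt_0. pose proof (qa_neq1 x). lra. Qed.

Lemma ccr_PC x : ccr (PC r) x.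
Proof.
  apply ccr_div; [| |apply qa_neq1'].
  - apply ccr_plus; [apply ccr_const|apply ccr_qa].
  - apply ccr_minus; [apply ccr_const|apply ccr_qa].
Qed.

Lemma PC_bound x : Cmod (PC r x) <= 2 / (1 - r).
Proof.
  unfold PC. rewrite Cmod_div by apply qa_neq1'. unfold Rdiv. apply Rmult_le_compat; try apply Cmod_ge_0.
  - left. apply Rinv_0_lt_compat. pose proof (qa_neq1 x). lra.
  - eapply Rle_trans; [apply Cmod_triangle|]. rewrite Cmod_1, Cmod_qa; lra.
  - apply Rinv_le_contravar; [lra|apply qa_neq1].
Qed.

Lemma SM_closed M x : (SM r M x * (1 - qa r x) = 1 + qa r x - 2 * qa r x ^ (S M))%C.
Proof.
  unfold SM. induction M as [|M IH]; [simpl; ring|]. cbn [csum].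
  replace ((1 + 2 * (csum (fun m => qa r x ^ S m) M + qa r x ^ S M)) * (1 - qa r x))%C
    with ((1 + 2 * csum (fun m => qa r x ^ S m) M) * (1 - qa r x) + 2 * qa r x ^ S M * (1 - qa r x))%C by ring.
  rewrite IH. rewrite (Cpow_S _ (S M)). ring.
Qed.

Lemma SM_PC M x : Cmod (PC r x - SM r M x) <= 2 * r ^ S M / (1 - r).
Proof.
  assert (E : (PC r x - SM r M x = 2 * qa r x ^ S M / (1 - qa r x))%C).
  { replace (SM r M x) with (SM r M x * (1 - qa r x) / (1 - qa r x))%C by (field; apply qa_neq1').
    rewrite SM_closed. unfold PC. field. apply qa_neq1'. }
  rewrite E, Cmod_div, Cmod_mult, Cmod_pow, Cmod_qa, Cmod_pos_RtoC; try lra; [|apply qa_neq1'].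
  unfold Rdiv. apply Rmult_le_compat_l; [pose proof (pow_le r (S M)); lra|].
  apply Rinv_le_contravar; [lra|apply qa_neq1].
Qed.

Lemma PR_eq x : PR r x = (1 - r ^ 2) / Cmod (1 - qa r x) ^ 2.
Proof.
  assert (Hp : 0 < Cmod (1 - qa r x) ^ 2) by (apply pow_lt; pose proof (qa_neq1 x); lra).
  assert (E : (PC r x * RtoC (Cmod (1 - qa r x) ^ 2) = (1 + qa r x) * Cconj (1 - qa r x))%C).
  { rewrite Cmod2_conj. unfold PC. field. apply qa_neq1'. }
  assert (Q : Cmod (qa r x) ^ 2 = r ^ 2) by (rewrite Cmod_qa; lra). rewrite Cmod2_alt in Q.
  apply (f_equal Re) in E. rewrite re_mult, re_RtoC, im_RtoC, Rmult_0_r, Rminus_0_r in E. fold (PR r x) in E.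
  rewrite re_mult, re_conj, im_conj, re_plus, re_minus, im_plus, im_minus in E. rewrite re_RtoC, im_RtoC in E.
  apply Rmult_eq_reg_r with (Cmod (1 - qa r x) ^ 2); [|lra]. rewrite E. unfold Rdiv. rewrite Rmult_assoc, Rinv_l by lra.
  rewrite <- Q. ring.
Qed.

Lemma PR_pos x : 0 < PR r x.
Proof.
  rewrite PR_eq. apply Rdiv_lt_0_compat; [simpl; nra|]. apply pow_lt. pose proof (qa_neq1 x). lra.
Qed.

Lemma e1_opp x : e1 (- x) = Cconj (e1 x).
Proof. unfold e1. rewrite <- cexp_conj. f_equal. apply Ceq_parts; simpl; ring. Qed.

Lemma PR_even x : PR r (- x) = PR r x.
Proof.
  rewrite !PR_eq. do 2 f_equal. rewrite <- (Cmod_conj (1 - qa r x)). f_equal. unfold qa. rewrite e1_opp, Cminus_conj, Cmult_conj.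
  f_equal; [apply Ceq_parts; simpl; ring|]. f_equal. f_equal. apply Ceq_parts; simpl; ring.
Qed.

Lemma e1_period x n : e1 (x + INR n) = e1 x.
Proof.
  induction n; [simpl; now rewrite Rplus_0_r|]. rewrite S_INR. replace (x + (INR n + 1)) with (x + INR n + 1) by ring.
  rewrite <- IHn. generalize (x + INR n) as y. clear. intro y. unfold e1.
  replace (Ci * RtoC (2 * PI * (y + 1)))%C with (Ci * RtoC (2 * PI * y) + Ci * RtoC (2 * PI))%C
    by (rewrite !RtoC_mult, RtoC_plus; ring).
  rewrite cexp_plus. fold (cis (2 * PI)). rewrite cis_2PI. ring.
Qed.

Lemma PR_period x n : PR r (x + INR n) = PR r x.
Proof. unfold PR, PC, qa. now rewrite e1_period. Qed.

(** From [sin y >= y - y^3 / 6] and [y^2 <= 4]. The constant is just enough for [sin (pi x) >= x] on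
    [[0, 1/2]], since [pi >= 3]. *)
Lemma sin_ge_third y : 0 <= y <= PI / 2 -> y / 3 <= sin y.
Proof.
  intro Hy. pose proof PI_4.
  assert (S1 : forall t, 0 <= t -> sin t <= t).
  { intros t Ht. pose proof (is_derive_le (fun t => t - sin t) (fun t => 1 - cos t) 0 t Ht) as H1.
    cbv beta in H1. rewrite sin_0 in H1. cut (0 - 0 <= t - sin t); [lra|]. apply H1.
    - intros s _. auto_derive; auto. ring.
    - intros s _. pose proof (COS_bound s). lra. }
  assert (S2 : forall t, 0 <= t -> 1 - t ^ 2 / 2 <= cos t).
  { intros t Ht. pose proof (is_derive_le (fun t => cos t - (1 - t ^ 2 / 2)) (fun t => t - sin t) 0 t Ht) as H1.
    cbv beta in H1. rewrite cos_0 in H1. cut (1 - (1 - 0 ^ 2 / 2) <= cos t - (1 - t ^ 2 / 2)); [lra|]. apply H1.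
    - intros s _. auto_derive; auto. field.
    - intros s Hs. pose proof (S1 s). lra. }
  assert (S3 : y - y ^ 3 / 6 <= sin y).
  { pose proof (is_derive_le (fun t => sin t - (t - t ^ 3 / 6)) (fun t => cos t - (1 - t ^ 2 / 2)) 0 y (proj1 Hy)) as H1.
    cbv beta in H1. rewrite sin_0 in H1. cut (0 - (0 - 0 ^ 3 / 6) <= sin y - (y - y ^ 3 / 6)); [lra|]. apply H1.
    - intros s _. auto_derive; auto. field.
    - intros s Hs. pose proof (S2 s). lra. }
  assert (y ^ 2 <= 4) by (simpl; nra). assert (y ^ 3 <= 4 * y) by (simpl in *; nra). lra.
Qed.

(** [|1 - q|^2 = (1 - r)^2 + 4 r sin(pi x)^2 >= 4 r x^2]. *)
Lemma PR_sq_bound x : Rabs x <= 1 / 2 -> x ^ 2 * PR r x <= (1 - r ^ 2) / (4 * r).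
Proof.
  intro Hx. pose proof PI2_3_2.
  assert (Hs : x ^ 2 <= sin (PI * x) ^ 2).
  { assert (P : forall x, 0 <= x <= 1 / 2 -> x <= sin (PI * x)).
    { intros y Hy. pose proof (sin_ge_third (PI * y) ltac:(nra)). nra. }
    rewrite <- (Rabs_sq x). destruct (Rle_dec 0 x) as [H0|H0].
    - rewrite Rabs_right in * by lra. apply pow_incr. split; [lra|]. apply P. lra.
    - rewrite Rabs_left in * by lra. replace (sin (PI * x) ^ 2) with (sin (PI * - x) ^ 2).
      + apply pow_incr. split; [lra|]. apply P. lra.
      + replace (PI * - x) with (- (PI * x)) by ring. rewrite sin_neg. ring. }
  assert (Hq : 4 * r * sin (PI * x) ^ 2 <= Cmod (1 - qa r x) ^ 2).
  { rewrite Cmod2_alt. unfold qa, e1. rewrite cexp_Ci. simpl.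
    replace (2 * PI * x) with (2 * (PI * x)) by ring. rewrite sin_2a, cos_2a.
    set (s := sin (PI * x)). set (c := cos (PI * x)).
    assert (E : s * s + c * c = 1) by (pose proof (sin2_cos2 (PI * x)) as E; unfold Rsqr in E; exact E).
    assert (E2 : (c * c - s * s) ^ 2 + (2 * s * c) ^ 2 = 1).
    { replace ((c * c - s * s) ^ 2 + (2 * s * c) ^ 2) with ((s * s + c * c) ^ 2) by ring. rewrite E. ring. }
    assert (E3 : c * c - s * s = 1 - 2 * (s * s)) by lra.
    apply Rle_trans with ((1 - r) ^ 2 + 4 * r * (s * s)); [pose proof (pow2_ge_0 (1 - r)); lra|]. right.
    transitivity (1 - 2 * r * (c * c - s * s) + r ^ 2 * ((c * c - s * s) ^ 2 + (2 * s * c) ^ 2)); [rewrite E2, E3|]; ring. }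
  rewrite PR_eq. assert (Hp0 : 0 < Cmod (1 - qa r x)) by (pose proof (qa_neq1 x); lra).
  set (D := Cmod (1 - qa r x)) in *. clearbody D. assert (Hp : 0 < D ^ 2) by now apply pow_lt.
  apply Rmult_le_reg_r with (4 * r * D ^ 2); [nra|].
  replace (x ^ 2 * ((1 - r ^ 2) / D ^ 2) * (4 * r * D ^ 2)) with ((1 - r ^ 2) * (4 * r * x ^ 2)) by (field; lra).
  replace ((1 - r ^ 2) / (4 * r) * (4 * r * D ^ 2)) with ((1 - r ^ 2) * D ^ 2) by (field; lra).
  apply Rmult_le_compat_l; [simpl; nra|]. eapply Rle_trans; [|exact Hq]. apply Rmult_le_compat_l; lra.
Qed.

Lemma e1_pow x m : (e1 x ^ m)%C = cexp (Ci * RtoC (2 * PI * INR m * x)).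
Proof. unfold e1. rewrite cexp_pow. f_equal. rewrite !RtoC_mult. ring. Qed.

Lemma qa_pow x m : (qa r x ^ m)%C = (RtoC (r ^ m) * cexp (Ci * RtoC (2 * PI * INR m * x)))%C.
Proof. unfold qa. rewrite Cpow_mult_l, e1_pow, RtoC_pow. reflexivity. Qed.

Lemma cint_qa_pow m : cint (fun x => qa r x ^ (S m))%C (- (1 / 2)) (1 / 2) = RtoC 0.
Proof.
  set (w := 2 * PI * INR (S m)). assert (Hw : 0 < w).
  { unfold w. pose proof PI_RGT_0. pose proof (lt_0_INR (S m) ltac:(lia)). apply Rmult_lt_0_compat; lra. }
  assert (HwC : (Ci * RtoC w)%C <> RtoC 0).
  { apply Cmult_neq_0; [|apply RtoC_neq0; lra]. intro E. apply (f_equal Im) in E. simpl in E. lra. }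
  rewrite (cint_ext _ _ _ (fun x => RtoC (r ^ S m) * cexp (RtoC x * (Ci * RtoC w)))%C).
  2:{ intros x _. rewrite qa_pow. f_equal. f_equal. unfold w. rewrite !RtoC_mult. ring. }
  assert (HC : forall x, ccr (fun x => cexp (RtoC x * (Ci * RtoC w)))%C x) by (intro; ccont).
  rewrite cint_scal by (now apply conab_all).
  rewrite (cint_ftc (fun x => / (Ci * RtoC w) * cexp (RtoC x * (Ci * RtoC w)))%C).
  - replace (cexp (RtoC (1 / 2) * (Ci * RtoC w))) with (cexp (RtoC (- (1 / 2)) * (Ci * RtoC w))); [ring|].
    assert (E : cexp (Ci * RtoC w) = 1%C).
    { pose proof (e1_period 0 (S m)) as E. rewrite Rplus_0_l in E. unfold e1 in E at 1. fold w in E. rewrite E.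
      unfold e1. rewrite Rmult_0_r, Cmult_0_r. apply cexp_0. }
    replace (cexp (RtoC (1 / 2) * (Ci * RtoC w))) with (cexp (RtoC (- (1 / 2)) * (Ci * RtoC w)) * cexp (Ci * RtoC w))%C.
    + rewrite E. ring.
    + rewrite <- cexp_plus. f_equal. replace (RtoC (1 / 2)) with (RtoC (- (1 / 2)) + 1)%C by (rewrite <- RtoC_plus; f_equal; lra). ring.
  - intros x _. eapply gder_eq.
    + apply (rder_mult (fun _ => / (Ci * RtoC w))%C); [apply rder_const|apply rder_cexp_line].
    + cbv beta. field. split; [apply RtoC_neq0; lra|]. intro E. apply (f_equal Im) in E. simpl in E. lra.
  - now apply conab_all.
Qed.

Lemma ccr_csum (a : nat -> R -> C) N x : (forall n, ccr (a n) x) -> ccr (fun x => csum (fun n => a n x) N) x.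
Proof. intro H. induction N; simpl; [apply ccr_const|]. now apply ccr_plus. Qed.

Lemma cint_csum (a : nat -> R -> C) N p q : (forall n x, ccr (a n) x) ->
  cint (fun x => csum (fun n => a n x) N) p q = csum (fun n => cint (a n) p q) N.
Proof.
  intro H. induction N; simpl; [rewrite cint_const; ring|]. rewrite cint_plus, IHN; auto; apply conab_all; auto.
  intro x. now apply ccr_csum.
Qed.

Lemma ccr_SM M x : ccr (SM r M) x.
Proof.
  apply ccr_plus; [apply ccr_const|]. apply ccr_mult; [apply ccr_const|]. apply (ccr_csum (fun m x => qa r x ^ S m)%C).
  intro n. apply ccr_pow, ccr_qa.
Qed.

Lemma cint_SM M : cint (SM r M) (- (1 / 2)) (1 / 2) = RtoC 1.
Proof.
  unfold SM.
  assert (HC : forall x, ccr (fun x => csum (fun m => qa r x ^ S m) M)%C x).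
  { intro x. apply (ccr_csum (fun m x => qa r x ^ S m)%C). intro n. apply ccr_pow, ccr_qa. }
  rewrite cint_plus; [|apply conab_all; intro; apply ccr_const|apply conab_all; intro; apply ccr_mult; [apply ccr_const|apply HC]].
  rewrite cint_const, cint_scal by (apply conab_all; exact HC).
  rewrite (cint_csum (fun m x => qa r x ^ S m)%C) by (intros; apply ccr_pow, ccr_qa).
  rewrite (csum_ext _ (fun _ => RtoC 0)) by (intros; apply cint_qa_pow).
  assert (E : csum (fun _ => RtoC 0) M = RtoC 0) by (clear; induction M; [reflexivity|cbn [csum]; rewrite IHM; apply Cplus_0_l]).
  rewrite E. apply Ceq_parts; simpl; field.
Qed.

Lemma cint_PC : cint (PC r) (- (1 / 2)) (1 / 2) = RtoC 1.
Proof.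
  apply Cmod_small_eq. intros e He.
  destruct (geo_small (2 * r / (1 - r)) r e) as [N HN]; auto; [|lra|].
  { apply Rmult_le_pos; [lra|left; apply Rinv_0_lt_compat; lra]. }
  specialize (HN N (le_n _)). rewrite <- (cint_SM N), <- cint_minus by (apply conab_all; intro; apply ccr_PC || apply ccr_SM).
  eapply Rle_trans; [apply (cint_norm _ _ _ (2 * r ^ S N / (1 - r)))|].
  - lra.
  - apply conab_all. intro. apply ccr_minus; [apply ccr_PC|apply ccr_SM].
  - intros x _. apply SM_PC.
  - simpl. unfold Rdiv in *. lra.
Qed.

Lemma PR_cont x : continuous (PR r) x.
Proof. exact (ccr_re (PC r) x (ccr_PC x)). Qed.

Lemma RInt_PR : RInt (PR r) (- (1 / 2)) (1 / 2) = 1.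
Proof. exact (f_equal Re cint_PC). Qed.

(* [|x| PR] is small on average: [|x| <= (eta + x ^ 2 / eta) / 2]. *)
Lemma PR_lipschitz (h : R -> R) B eta c : (forall x, continuous h x) -> 0 <= B -> 0 < eta -> (1 - r ^ 2) / (4 * r) <= c * eta ->
  (forall x, Rabs x <= 1 / 2 -> Rabs (h x) <= B * Rabs x) ->
  Cmod (cint (fun x => RtoC (h x * PR r x)) (- (1 / 2)) (1 / 2)) <= B * ((eta + c) / 2).
Proof.
  intros Hh HB He Hc Hb.
  assert (Hcont : forall x, ccr (fun x => RtoC (h x * PR r x)) x).
  { intro x. apply ccr_RtoC. apply (continuous_mult h (PR r)); auto. apply PR_cont. }
  assert (Hex : ex_RInt (fun x => B / 2 * eta * PR r x) (- (1 / 2)) (1 / 2)).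
  { apply (ex_RInt_scal (V := R_NormedModule) (PR r) _ _ (B / 2 * eta)).
    apply (ex_RInt_continuous (V := R_CompleteNormedModule)). intros; apply PR_cont. }
  eapply Rle_trans; [apply cint_norm_int; [lra|now apply conab_all]|].
  apply Rle_trans with (RInt (fun x => plus (B / 2 * eta * PR r x) (B / 2 * c)) (- (1 / 2)) (1 / 2)).
  - apply RInt_le; [lra| | |].
    + apply (ex_RInt_continuous (V := R_CompleteNormedModule)). intros. now apply ccr_Cmod.
    + apply (ex_RInt_plus (V := R_NormedModule)); auto. apply ex_RInt_const.
    + intros x Hx. assert (Hx' : Rabs x <= 1 / 2) by (apply Rabs_le; lra).
      pose proof (PR_pos x) as Hp. rewrite Cmod_R, Rabs_mult, (Rabs_right (PR r x)) by lra.
      eapply Rle_trans; [apply Rmult_le_compat_r; [lra|apply Hb; auto]|].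
      change (B * Rabs x * PR r x <= B / 2 * eta * PR r x + B / 2 * c).
      pose proof (PR_sq_bound x Hx') as Hsq.
      assert (K : Rabs x * PR r x <= (eta * PR r x + c) / 2).
      { apply Rmult_le_reg_l with eta; auto.
        assert (E : 0 <= (eta - Rabs x) ^ 2 * PR r x) by (apply Rmult_le_pos; [apply pow2_ge_0|lra]).
        pose proof (Rabs_sq x) as Es. assert (E2 : Rabs x ^ 2 * PR r x <= c * eta) by (rewrite Es; lra). nra. }
      nra.
  - rewrite (RInt_plus (V := R_CompleteNormedModule)); auto; [|apply ex_RInt_const].
    assert (HPR : ex_RInt (PR r) (- (1 / 2)) (1 / 2)) by (apply (ex_RInt_continuous (V := R_CompleteNormedModule)); intros; apply PR_cont).
    assert (E : RInt (fun x => B / 2 * eta * PR r x) (- (1 / 2)) (1 / 2) = B / 2 * eta * RInt (PR r) (- (1 / 2)) (1 / 2))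
      by exact (RInt_scal (V := R_CompleteNormedModule) (PR r) _ _ (B / 2 * eta) HPR).
    rewrite E, RInt_const, RInt_PR. unfold plus, scal; simpl; unfold mult; simpl. right. field.
Qed.
End Kernel.

Lemma lip_bound (f df : R -> R) a b M : (forall x, Rmin a b <= x <= Rmax a b -> is_derive f x (df x)) ->
  (forall x, Rmin a b <= x <= Rmax a b -> Rabs (df x) <= M) -> Rabs (f b - f a) <= M * Rabs (b - a).
Proof.
  intros Hd HM. destruct (MVT_gen f a b df) as [c [Hc E]].
  - intros x Hx. apply Hd. lra.
  - intros x Hx. apply continuity_pt_filterlim. apply (ex_derive_continuous (V := R_NormedModule)). eexists. now apply Hd.
  - rewrite E, Rabs_mult. apply Rmult_le_compat_r; [apply Rabs_pos|auto].
Qed.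

Lemma exp_pow (y : R) m : exp y ^ m = exp (INR m * y).
Proof. induction m; [simpl; rewrite Rmult_0_l, exp_0; reflexivity|]. rewrite S_INR. simpl. rewrite IHm, <- exp_plus. f_equal. ring. Qed.

Lemma INR_S_ge1 n : 1 <= INR (S n).
Proof. rewrite S_INR. pose proof (pos_INR n). lra. Qed.

(** Half of the exponent absorbs the factor [n + 1], the other half remains as a geometric ratio.
    Sums of Gaussian values at the integers are thereby compared with geometric series, and no other
    convergence test is needed for them. *)
Lemma nexp_bound k n : 0 < k -> INR (S n) * exp (- (k * INR (S n) ^ 2)) <= 2 / k * exp (- (k / 2)) ^ n.
Proof.
  intro Hk. set (m := INR (S n)). assert (Hm : 1 <= m) by apply INR_S_ge1.
  assert (H1 : exp (- (k * m ^ 2)) <= exp (- (k * m / 2)) * exp (- (k / 2)) ^ n).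
  { rewrite exp_pow, <- exp_plus. apply exp_mono. assert (m = INR n + 1) by (unfold m; apply S_INR). pose proof (pos_INR n).
    assert (m <= m ^ 2) by (simpl; nra). nra. }
  assert (H2 : m * exp (- (k * m / 2)) <= 2 / k).
  { rewrite exp_Ropp. pose proof (exp_ge_1p (k * m / 2)). pose proof (exp_pos (k * m / 2)).
    apply Rmult_le_reg_r with (exp (k * m / 2)); auto. rewrite Rmult_assoc, Rinv_l, Rmult_1_r by lra.
    apply Rle_trans with (2 / k * (k * m / 2)); [right; field; lra|]. apply Rmult_le_compat_l; [|lra].
    left. apply Rdiv_lt_0_compat; lra. }
  pose proof (exp_pos (- (k / 2))). assert (0 <= exp (- (k / 2)) ^ n) by (apply pow_le; lra).
  apply Rle_trans with (m * exp (- (k * m / 2)) * exp (- (k / 2)) ^ n).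
  - rewrite Rmult_assoc. apply Rmult_le_compat_l; lra.
  - apply Rmult_le_compat_r; auto.
Qed.

Lemma exp_neg_lt1 k : 0 < k -> 0 <= exp (- k) < 1.
Proof. intro. split; [left; apply exp_pos|]. rewrite <- exp_0. apply exp_increasing. lra. Qed.

Definition fz (z u : R) : R := exp (- (PI * z * u ^ 2)).

Lemma fz_gauss z u : 0 < z -> fz z u = gauss (sqrt z * u).
Proof. intro. unfold fz, gauss. f_equal. rewrite Rpow_mult_distr, pow2_sqrt by lra. ring. Qed.

Lemma fz_pos z u : 0 < fz z u. Proof. apply exp_pos. Qed.
Lemma fz_cont z u : continuous (fz z) u.
Proof. unfold fz. rcont. Qed.

Lemma fz_dom z : 0 < z -> exists K, 0 < K /\ forall u, fz z u <= K * wt u.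
Proof.
  intro Hz. assert (Hs : 0 < sqrt z) by now apply sqrt_lt_R0.
  destruct (wt_lin_bound (sqrt z) 0 ltac:(lra)) as [K [HK H]]. exists K. split; auto. intro u.
  rewrite fz_gauss by auto. eapply Rle_trans; [apply gauss_wt|]. specialize (H u). now rewrite Rplus_0_r in H.
Qed.

Lemma fz_FT z m : 0 < z -> Ig (cpar (fz z) (2 * PI * m)) = RtoC (cg / sqrt z * exp (- (PI / z * m ^ 2))).
Proof.
  intro Hz. assert (Hs : 0 < sqrt z) by now apply sqrt_lt_R0.
  assert (D : DomC 1 (cpar gauss (2 * PI * (m / sqrt z)))).
  { apply cpar_Dom; [apply gauss_cont|]. intro u. pose proof (gauss_pos u). pose proof (gauss_wt u). lra. }
  pose proof (Ig_lin_pos 1 _ (sqrt z) 0 Hs D) as E. rewrite gauss_FT in E.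
  rewrite (Ig_ext _ (cpar (fz z) (2 * PI * m))) in E.
  - assert (Hn : RtoC (sqrt z) <> RtoC 0) by (apply RtoC_neq0; lra).
    replace (Ig (cpar (fz z) (2 * PI * m))) with (RtoC (sqrt z) * Ig (cpar (fz z) (2 * PI * m)) / RtoC (sqrt z))%C by (field; auto).
    rewrite E. unfold gauss. rewrite <- RtoC_div by lra. f_equal.
    replace (PI * (m / sqrt z) ^ 2) with (PI / z * m ^ 2); [field; lra|].
    replace ((m / sqrt z) ^ 2) with (m ^ 2 / (sqrt z ^ 2)) by (field; lra). rewrite pow2_sqrt by lra. field. lra.
  - intro u. unfold cpar. rewrite Rplus_0_r, fz_gauss by auto. f_equal. f_equal. f_equal. f_equal. field. lra.
Qed.

Lemma DomC_csum (a : nat -> R -> C) N : (forall n, exists K, DomC K (a n)) -> exists K, DomC K (fun u => csum (fun n => a n u) N).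
Proof.
  intro H. induction N as [|N [K IH]]; simpl.
  - exists 0. split; [intro; apply ccr_const|]. intro. rewrite Cmod_0. lra.
  - destruct (H N) as [K' HK']. exists (K + K'). now apply DomC_plus.
Qed.

Lemma Ig_csum (a : nat -> R -> C) N : (forall n, exists K, DomC K (a n)) ->
  Ig (fun u => csum (fun n => a n u) N) = csum (fun n => Ig (a n)) N.
Proof.
  intro H. induction N as [|N IH]; simpl.
  - apply Ig_eq. intros e He. apply filter_forall. intro A. rewrite cint_const.
    replace (RtoC 0 * RtoC (A - - A) - RtoC 0)%C with (RtoC 0) by ring. now rewrite Cmod_0.
  - destruct (DomC_csum a N H) as [K D]. destruct (H N) as [K' D']. rewrite (Ig_plus _ _ _ _ D D'). now rewrite IH.
Qed.

Lemma Ig_re K h : DomC K h -> Re (Ig h) = Re (Ig (fun u => RtoC (Re (h u)))).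
Proof.
  intro D. assert (D' : DomC K (fun u => RtoC (Re (h u)))).
  { split; [intro; apply ccr_RtoC; apply ccr_re, D|]. intro u. rewrite Cmod_R. eapply Rle_trans; [apply re_le_Cmod|apply D]. }
  assert (DD := DomC_minus _ _ _ _ D D').
  assert (E : Ig (fun u => Cconj (h u - RtoC (Re (h u)))) = Ig (fun u => - (1) * (h u - RtoC (Re (h u))))%C).
  { apply Ig_ext. intro u. destruct (h u). apply Ceq_parts; simpl; ring. }
  rewrite (Ig_conj _ _ DD), (Ig_scal _ _ _ DD), (Ig_minus _ _ _ _ D D') in E.
  apply (f_equal Re) in E. rewrite re_conj, re_mult, re_minus in E. simpl in E. unfold Re in *. lra.
Qed.

Lemma cint_rev f a b : (forall x, ccr f x) -> cint f b a = (- cint f a b)%C.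
Proof.
  intro H. pose proof (cint_Chasles f a b a (conab_all f a b H) (conab_all f b a H)) as E. rewrite cint_point in E.
  replace (cint f b a) with (cint f a b + cint f b a - cint f a b)%C by ring. rewrite E. ring.
Qed.

(** * Poisson summation for a Gaussian *)

Section Poisson.
Variable z : R.
Hypothesis Hz : 0 < z.

(** Fourier transform of [fz z] at frequency [m]. In [ssum] and [ssum'], the two sides of Poisson's
    formula, the terms of [n] and [- n] are put together. *)
Let chat (m : R) : C := RtoC (cg / sqrt z * exp (- (PI / z * m ^ 2))).
Let ssum : C := (RtoC (fz z 0) + 2 * CL (csum (fun n => RtoC (fz z (INR (S n))))))%C.
Let ssum' : C := (chat 0 + 2 * CL (csum (fun n => chat (INR (S n)))))%C.

Lemma fz_seq_bound : exists rho, 0 <= rho < 1 /\ forall n, Cmod (RtoC (fz z (INR (S n)))) <= 2 / (PI * z) * rho ^ n.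
Proof.
  pose proof PI_RGT_0. assert (Hk : 0 < PI * z) by (apply Rmult_lt_0_compat; lra).
  exists (exp (- (PI * z / 2))). split; [apply exp_neg_lt1; lra|]. intro n.
  rewrite Cmod_pos_RtoC by (left; apply fz_pos). eapply Rle_trans; [|apply nexp_bound; auto].
  unfold fz. pose proof (INR_S_ge1 n). pose proof (exp_pos (- (PI * z * INR (S n) ^ 2))). nra.
Qed.

Lemma chat_seq_bound : exists B rho, 0 <= B /\ 0 <= rho < 1 /\ forall n, INR (S n) * Cmod (chat (INR (S n))) <= B * rho ^ n.
Proof.
  pose proof PI_RGT_0. assert (Hk : 0 < PI / z) by (apply Rdiv_lt_0_compat; lra).
  exists (Rabs (cg / sqrt z) * (2 / (PI / z))), (exp (- (PI / z / 2))).
  split; [apply Rmult_le_pos; [apply Rabs_pos|left; apply Rdiv_lt_0_compat; lra]|]. split; [apply exp_neg_lt1; lra|]. intro n.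
  unfold chat. rewrite Cmod_R, Rabs_mult, (Rabs_right (exp _)) by (left; apply exp_pos).
  replace (INR (S n) * (Rabs (cg / sqrt z) * exp (- (PI / z * INR (S n) ^ 2))))
    with (Rabs (cg / sqrt z) * (INR (S n) * exp (- (PI / z * INR (S n) ^ 2)))) by ring.
  rewrite Rmult_assoc. apply Rmult_le_compat_l; [apply Rabs_pos|]. now apply nexp_bound.
Qed.

Lemma fz_lip0 x : Rabs x <= 1 / 2 -> Rabs (fz z x - fz z 0) <= PI * z * Rabs x.
Proof.
  intro Hx. pose proof PI_RGT_0. assert (Hk : 0 < PI * z) by (apply Rmult_lt_0_compat; lra).
  replace (Rabs x) with (Rabs (x - 0)) by (f_equal; ring).
  apply (lip_bound (fz z) (fun s => - (2 * (PI * z) * s * fz z s))).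
  - intros s _. unfold fz. auto_derive; auto. simpl. ring.
  - intros s Hs. assert (Hs' : Rabs s <= 1 / 2).
    { apply Rabs_le_between in Hx. unfold Rmin, Rmax in Hs. destruct (Rle_dec 0 x); apply Rabs_le; lra. }
    rewrite Rabs_Ropp, !Rabs_mult, (Rabs_right 2), (Rabs_right PI), (Rabs_right z), (Rabs_right (fz z s)) by (try lra; left; apply fz_pos).
    assert (fz z s <= 1).
    { unfold fz. rewrite <- exp_0. apply exp_mono. pose proof (pow2_ge_0 s). nra. }
    pose proof (fz_pos z s). pose proof (Rabs_pos s).
    apply Rle_trans with (2 * (PI * z) * (1 / 2) * 1); [|lra].
    apply Rmult_le_compat; try lra; [apply Rmult_le_pos; lra|]. apply Rmult_le_compat_l; lra.
Qed.

Lemma fz_lip : exists rho, 0 <= rho < 1 /\ forall n x, Rabs x <= 1 / 2 ->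
  Rabs (fz z (x + INR (S n)) - fz z (INR (S n))) <= 32 * rho ^ n * Rabs x.
Proof.
  pose proof PI_RGT_0. assert (Hk : 0 < PI * z) by (apply Rmult_lt_0_compat; lra).
  (* On the cell around [m] every point is at least [m / 2], which divides the exponent by 4; the
     constant 32 is [16 k * (2 / k)]. *)
  set (k := PI * z / 4). exists (exp (- (k / 2))). split; [apply exp_neg_lt1; unfold k; lra|]. intros n x Hx.
  set (m := INR (S n)). assert (Hm : 1 <= m) by apply INR_S_ge1.
  replace (Rabs x) with (Rabs (x + m - m)) by (f_equal; ring).
  apply (lip_bound (fz z) (fun s => - (2 * (PI * z) * s * fz z s))).
  - intros s _. unfold fz. auto_derive; auto. simpl. ring.
  - intros s Hs. assert (Hs' : m / 2 <= s <= 2 * m).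
    { apply Rabs_le_between in Hx. unfold Rmin, Rmax in Hs. destruct (Rle_dec m (x + m)); lra. }
    rewrite Rabs_Ropp, Rabs_right.
    2:{ apply Rle_ge. apply Rmult_le_pos; [apply Rmult_le_pos; lra|left; apply fz_pos]. }
    apply Rle_trans with (16 * k * (m * exp (- (k * m ^ 2)))).
    + replace (16 * k * (m * exp (- (k * m ^ 2)))) with (2 * (PI * z) * (2 * m) * exp (- (k * m ^ 2))) by (unfold k; field).
      apply Rmult_le_compat; [apply Rmult_le_pos; lra|left; apply fz_pos|apply Rmult_le_compat_l; lra|].
      unfold fz, k. apply exp_mono. assert ((m / 2) ^ 2 <= s ^ 2) by (apply pow_incr; lra).
      replace (PI * z / 4 * m ^ 2) with (PI * z * (m / 2) ^ 2) by field. nra.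
    + assert (Hk4 : 0 < k) by (unfold k; lra). pose proof (nexp_bound k n Hk4) as B. fold m in B.
      apply Rle_trans with (16 * k * (2 / k * exp (- (k / 2)) ^ n)); [apply Rmult_le_compat_l; lra|]. right. field. lra.
Qed.

(** Frequency side of the Abel mean: [SM] is integrated term by term, and converges uniformly to
    [PC]. The choice [r = 1 - eta^2] makes the kernel average of [|x|] over a period of order
    [eta]. *)
Lemma poisson_abel eta : 0 < eta <= 1 / 2 -> let r := 1 - eta ^ 2 in
  Ig (fun u => RtoC (fz z u * PR r u)) = RtoC (Re (Ig (fun u => RtoC (fz z u) * PC r u)%C)) /\
  clim eventually (fun M => chat 0 + 2 * csum (fun n => RtoC (r ^ S n) * chat (INR (S n))) M)%C (Ig (fun u => RtoC (fz z u) * PC r u)%C) /\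
  exists K, DomC K (fun u => RtoC (fz z u * PR r u)).
Proof.
  intros He r. assert (Hr : 0 < r < 1) by (unfold r; simpl; nra).
  destruct (fz_dom z Hz) as [K [HK Hf]].
  assert (Df : DomC K (fun u => RtoC (fz z u))).
  { split; [intro; apply ccr_RtoC, fz_cont|]. intro u. rewrite Cmod_pos_RtoC; [apply Hf|left; apply fz_pos]. }
  assert (DPC : DomC (2 / (1 - r) * K) (fun u => RtoC (fz z u) * PC r u)%C).
  { apply DomC_ext with (fun u => PC r u * RtoC (fz z u))%C; [intro; ring|].
    apply DomC_mult; auto; [intro; now apply ccr_PC|intro; now apply PC_bound]. }
  assert (Ere : forall u, Re (RtoC (fz z u) * PC r u)%C = fz z u * PR r u).
  { intro u. rewrite re_mult, re_RtoC, im_RtoC. unfold PR. ring. }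
  assert (DPR : DomC (2 / (1 - r) * K) (fun u => RtoC (fz z u * PR r u))).
  { split.
    - intro u. apply ccr_RtoC. apply (continuous_mult (fz z) (PR r)); [apply fz_cont|now apply PR_cont].
    - intro u. rewrite Cmod_R, <- Ere. eapply Rle_trans; [apply re_le_Cmod|apply DPC]. }
  split; [|split; [|eauto]].
  - rewrite (Ig_real _ _ DPR). f_equal. rewrite (Ig_re _ _ DPC). f_equal. apply Ig_ext. intro u. now rewrite Ere.
  - assert (Dm : forall m, DomC K (cpar (fz z) (2 * PI * m))).
    { intro m. apply cpar_Dom; [apply fz_cont|]. intro u. split; [left; apply fz_pos|apply Hf]. }
    set (am := fun (n : nat) (u : R) => (RtoC (r ^ S n) * cpar (fz z) (2 * PI * INR (S n)) u)%C).
    assert (Dam : forall n, exists K, DomC K (am n)) by (intro n; eexists; apply DomC_scal, Dm).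
    assert (ES : forall M, Ig (fun u => RtoC (fz z u) * SM r M u)%C = (chat 0 + 2 * csum (fun n => RtoC (r ^ S n) * chat (INR (S n))) M)%C).
    { intro M. destruct (DomC_csum am M Dam) as [K' D'].
      rewrite (Ig_ext _ (fun u => cpar (fz z) (2 * PI * 0) u + 2 * csum (fun n => am n u) M)%C).
      - rewrite (Ig_plus _ _ _ _ (Dm 0) (DomC_scal _ 2 _ D')), (Ig_scal _ _ _ D'), (Ig_csum am M Dam), fz_FT by auto.
        f_equal. f_equal. apply csum_ext. intros n _. unfold am. rewrite (Ig_scal _ _ _ (Dm _)), fz_FT by auto. reflexivity.
      - intro u. unfold SM. replace (cpar (fz z) (2 * PI * 0) u) with (RtoC (fz z u)).
        2:{ unfold cpar. replace (2 * PI * 0 * u) with 0 by ring. rewrite Cmult_0_r, cexp_0. ring. }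
        rewrite (csum_ext (fun n => am n u) (fun n => RtoC (fz z u) * qa r u ^ S n)%C), csum_scal; [ring|].
        intros n _. unfold am, cpar. rewrite qa_pow by auto. ring. }
    intros e Hepos.
    destruct (geo_small (2 * r / (1 - r) * (K * PI)) r (e / 2)) as [N HN]; auto; try lra.
    { pose proof PI_RGT_0. apply Rmult_le_pos; [apply Rmult_le_pos; [lra|left; apply Rinv_0_lt_compat; lra]|nra]. }
    exists N. intros M HM. rewrite <- ES.
    assert (DSM : DomC (2 * r ^ S M / (1 - r) * K) (fun u => (PC r u - SM r M u) * RtoC (fz z u))%C).
    { apply DomC_mult; auto; [intro; apply ccr_minus; [now apply ccr_PC|apply ccr_SM]|intro; now apply SM_PC]. }
    assert (EI : (Ig (fun u => RtoC (fz z u) * SM r M u) = Ig (fun u => RtoC (fz z u) * PC r u) - Ig (fun u => (PC r u - SM r M u) * RtoC (fz z u)))%C).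
    { rewrite <- (Ig_minus _ _ _ _ DPC DSM). apply Ig_ext. intro u. ring. }
    rewrite EI. set (X := Ig (fun u => RtoC (fz z u) * PC r u)%C).
    match goal with |- Cmod (X - ?Y - X) < _ => replace (X - Y - X)%C with (- Y)%C by ring end.
    rewrite Cmod_opp. eapply Rle_lt_trans; [apply (Ig_bound _ _ DSM)|]. specialize (HN M HM). simpl pow.
    replace (2 * (r * r ^ M) / (1 - r) * K * PI) with (2 * r / (1 - r) * (K * PI) * r ^ M) by (field; lra). lra.
Qed.

(** By Bernoulli [1 - r^m <= m (1 - r) <= m eta]; this is why [chat_seq_bound] dominates the
    coefficients multiplied by their index. *)
Lemma poisson_right : exists B, 0 <= B /\ forall eta, 0 < eta <= 1 / 2 ->
  Cmod (Ig (fun u => RtoC (fz z u * PR (1 - eta ^ 2) u)) - ssum') <= B * eta.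
Proof.
  destruct chat_seq_bound as [B [rho [HB [Hrho Hc]]]].
  exists (2 * (B / (1 - rho))). split; [apply Rmult_le_pos; [lra|]; apply Rmult_le_pos; auto; left; apply Rinv_0_lt_compat; lra|].
  intros eta He. set (r := 1 - eta ^ 2). assert (Hr : 0 < r < 1) by (unfold r; simpl; nra).
  destruct (poisson_abel eta He) as [E1 [E2 _]]. fold r in E1, E2.
  assert (Hcb : forall n, Cmod (chat (INR (S n))) <= B * rho ^ n).
  { intro n. eapply Rle_trans; [|apply Hc]. pose proof (INR_S_ge1 n). pose proof (Cmod_ge_0 (chat (INR (S n)))). nra. }
  assert (L2 : clim eventually (fun M => chat 0 + 2 * csum (fun n => chat (INR (S n))) M)%C ssum').
  { apply clim_plus; [apply clim_const|]. apply clim_mult; [apply clim_const|]. now apply (csum_geo_lim _ B rho). }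
  assert (Ereal : Ig (fun u => RtoC (fz z u) * PC r u)%C = RtoC (Re (Ig (fun u => RtoC (fz z u) * PC r u)%C))).
  { apply Ceq_parts; [reflexivity|]. rewrite im_RtoC.
    pose proof (clim_im _ _ E2) as L.
    assert (L' : filterlim (fun _ : nat => 0) eventually (locally (Im (Ig (fun u => RtoC (fz z u) * PC r u)%C)))).
    { assert (Hi : forall M, exists x, csum (fun n => RtoC (r ^ S n) * chat (INR (S n)))%C M = RtoC x).
      { induction M as [|M [x IHM]]; [now exists 0|]. cbn [csum]. rewrite IHM. unfold chat. rewrite <- RtoC_mult, <- RtoC_plus. eauto. }
      revert L. apply filterlim_ext. intro M. cbv beta. destruct (Hi M) as [x ->]. unfold chat.
      rewrite <- RtoC_mult, <- RtoC_plus. apply im_RtoC. }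
    apply (filterlim_locally_unique (F := eventually) (fun _ : nat => 0)); [exact L'|apply filterlim_const]. }
  rewrite E1, <- Ereal.
  apply (clim_Cmod_le (F := eventually) (fun M => (chat 0 + 2 * csum (fun n => RtoC (r ^ S n) * chat (INR (S n))) M)
     - (chat 0 + 2 * csum (fun n => chat (INR (S n))) M))%C); [now apply clim_minus|].
  exists 0%nat. intros M _.
  match goal with |- Cmod ?x <= _ => replace x with (2 * csum (fun n => RtoC (r ^ S n) * chat (INR (S n)) - chat (INR (S n))) M)%C
    by (rewrite csum_minus; ring) end.
  rewrite Cmod_mult, Cmod_pos_RtoC by lra. rewrite Rmult_assoc. apply Rmult_le_compat_l; [lra|].
  replace (csum (fun n => RtoC (r ^ S n) * chat (INR (S n)) - chat (INR (S n)))%C M)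
    with (csum (fun n => RtoC (r ^ S n) * chat (INR (S n)) - chat (INR (S n)))%C M - csum (fun n => RtoC (r ^ S n) * chat (INR (S n)) - chat (INR (S n)))%C 0)%C
    by (simpl; ring).
  eapply Rle_trans; [apply (csum_geo_tail _ (B * eta) rho 0 M)|]; auto; try lia.
  - nra.
  - intro n. replace (RtoC (r ^ S n) * chat (INR (S n)) - chat (INR (S n)))%C with (RtoC (r ^ S n - 1) * chat (INR (S n)))%C
      by (rewrite RtoC_minus; ring).
    rewrite Cmod_mult, Cmod_R.
    assert (Hb : Rabs (r ^ S n - 1) <= INR (S n) * eta).
    { assert (Bern : forall k, 1 - INR k * (1 - r) <= r ^ k <= 1).
      { induction k; [simpl; lra|]. rewrite S_INR. simpl. pose proof (pos_INR k).
        split; [|nra]. apply Rle_trans with (r * (1 - INR k * (1 - r))); [nra|]. apply Rmult_le_compat_l; lra. }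
      specialize (Bern (S n)). rewrite Rabs_left1 by lra. assert (1 - r <= eta) by (unfold r; simpl; nra).
      pose proof (INR_S_ge1 n). nra. }
    apply Rle_trans with (INR (S n) * eta * Cmod (chat (INR (S n)))); [apply Rmult_le_compat_r; [apply Cmod_ge_0|exact Hb]|].
    specialize (Hc n). replace (INR (S n) * eta * Cmod (chat (INR (S n)))) with (INR (S n) * Cmod (chat (INR (S n))) * eta) by ring.
    replace (B * eta * rho ^ n) with (B * rho ^ n * eta) by ring. apply Rmult_le_compat_r; lra.
  - simpl. right. field. lra.
Qed.

(** The line is cut into unit cells centred at the integers. On each the kernel has mass 1, so the
    integral differs from the value at the centre by [eta] times a Lipschitz constant, and these
    constants are summable. *)
Lemma poisson_left : exists B, 0 <= B /\ forall eta, 0 < eta <= 1 / 2 ->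
  Cmod (Ig (fun u => RtoC (fz z u * PR (1 - eta ^ 2) u)) - ssum) <= B * eta.
Proof.
  destruct fz_seq_bound as [rho1 [Hrho1 Hf1]]. destruct fz_lip as [rho [Hrho Hl]].
  pose proof PI_RGT_0. assert (Hk : 0 < PI * z) by (apply Rmult_lt_0_compat; lra).
  assert (H32 : 0 <= 32 / (1 - rho)) by (apply Rmult_le_pos; [lra|left; apply Rinv_0_lt_compat; lra]).
  exists (PI * z + 2 * (32 / (1 - rho))). split; [lra|].
  intros eta He. set (r := 1 - eta ^ 2). assert (Hr : 0 < r < 1) by (unfold r; simpl; nra).
  assert (Hc : (1 - r ^ 2) / (4 * r) <= eta * eta).
  { apply Rmult_le_reg_r with (4 * r); [lra|]. replace ((1 - r ^ 2) / (4 * r) * (4 * r)) with (1 - r ^ 2) by (field; lra).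
    unfold r. assert (0 <= eta * eta <= 1 / 4) by nra. simpl. nra. }
  destruct (poisson_abel eta He) as [_ [_ [K D]]]. fold r in D.
  set (g := fun u => RtoC (fz z u * PR r u)) in *.
  assert (Cg : forall x, ccr g x) by apply D.
  set (half := 1 / 2).
  set (I := fun m => cint (fun x => g (x + m)%R) (- half) half).
  assert (EI : forall n, I (INR n) = cint g (INR n - half) (INR n + half)).
  { intro n. unfold I. pose proof (cint_comp_lin g 1 (INR n) (- half) half (conab_all _ _ _ Cg)) as E.
    rewrite Cmult_1_l in E. replace (1 * - half + INR n) with (INR n - half) in E by ring. replace (1 * half + INR n) with (INR n + half) in E by ring.
    rewrite <- E. apply cint_ext. intros x _. f_equal. ring. }
  assert (EI' : forall n, I (INR n) = cint g (- (INR n + half)) (- (INR n - half))).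
  { intro n. rewrite EI. pose proof (cint_comp_lin g (-1) 0 (INR n - half) (INR n + half) (conab_all _ _ _ Cg)) as E.
    rewrite (cint_ext _ _ _ g) in E.
    2:{ intros x _. unfold g. replace (-1 * x + 0) with (- x) by ring. rewrite PR_even by auto. unfold fz. f_equal. f_equal. f_equal. ring. }
    replace (-1 * (INR n - half) + 0) with (- (INR n - half)) in E by ring. replace (-1 * (INR n + half) + 0) with (- (INR n + half)) in E by ring.
    rewrite (cint_rev g (- (INR n + half))) in E by auto.
    replace (cint g (INR n - half) (INR n + half)) with (- (RtoC (-1) * cint g (INR n - half) (INR n + half)))%C by (apply Ceq_parts; simpl; ring).
    rewrite E. ring. }
  assert (EJ : forall N, cint g (- (INR N + half)) (INR N + half) = (I 0 + 2 * csum (fun n => I (INR (S n))) N)%C).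
  { induction N as [|N IH].
    - simpl. pose proof (EI 0%nat) as E0. simpl in E0. rewrite E0. rewrite !Rplus_0_l. replace (0 - half) with (- half) by ring. ring.
    - rewrite <- (cint_Chasles g _ (- (INR N + half))), <- (cint_Chasles g (- (INR N + half)) (INR N + half)) by now apply conab_all.
      rewrite IH. cbn [csum]. pose proof (EI (S N)) as A1. pose proof (EI' (S N)) as A2.
      replace (- (INR (S N) - half)) with (- (INR N + half)) in A2 by (rewrite S_INR; unfold half; field).
      replace (INR (S N) - half) with (INR N + half) in A1 by (rewrite S_INR; unfold half; field).
      rewrite <- A1, <- A2. ring. }
  assert (Bd : forall m B, 0 <= B -> (forall x, PR r (x + m) = PR r x) -> (forall x, Rabs x <= 1 / 2 -> Rabs (fz z (x + m) - fz z m) <= B * Rabs x) ->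
    Cmod (I m - RtoC (fz z m)) <= B * eta).
  { intros m B HB Hper Hlip.
    assert (Hcf : forall x, continuous (fun x => fz z (x + m)) x).
    { intro x. unfold fz. rcont. }
    assert (E : (I m - RtoC (fz z m))%C = cint (fun x => RtoC ((fz z (x + m) - fz z m) * PR r x)) (- (1 / 2)) (1 / 2)).
    { assert (E1 : cint (fun x => RtoC (fz z m * PR r x)) (- (1 / 2)) (1 / 2) = RtoC (fz z m)).
      { rewrite (cint_ext _ _ _ (fun x => RtoC (fz z m) * RtoC (PR r x))%C) by (intros; apply RtoC_mult).
        rewrite cint_scal by (apply conab_all; intro; apply ccr_RtoC; now apply PR_cont).
        replace (cint (fun x => RtoC (PR r x)) (- (1 / 2)) (1 / 2)) with (RtoC 1); [ring|].
        apply Ceq_parts; unfold cint; simpl; [symmetry; now apply RInt_PR|].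
        rewrite RInt_const. unfold scal; simpl; unfold mult; simpl. ring. }
      rewrite <- E1 at 1. unfold I, half. rewrite <- cint_minus.
      - apply cint_ext. intros x _. unfold g. rewrite Hper, <- RtoC_minus. f_equal. ring.
      - apply conab_all. intro x. unfold g. apply ccr_RtoC. apply (continuous_mult (fun x => fz z (x + m)) (fun x => PR r (x + m))); auto.
        apply continuous_ext with (PR r); [intro; now rewrite Hper|now apply PR_cont].
      - apply conab_all. intro x. apply ccr_RtoC. apply (continuous_mult (fun _ => fz z m) (PR r)); [apply continuous_const|now apply PR_cont]. }
    rewrite E. eapply Rle_trans; [apply (PR_lipschitz r Hr (fun x => fz z (x + m) - fz z m) B eta eta); auto; try lra|].
    - intro x. apply (continuous_minus (fun x => fz z (x + m)) (fun _ => fz z m)); auto. apply continuous_const.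
    - right. field. }
  assert (L1 : clim eventually (fun N => cint g (- (INR N + half)) (INR N + half)) (Ig g)).
  { apply (clim_comp eventually (Rbar_locally p_infty) (fun N => INR N + half) (fun A => cint g (- A) A)); [|now apply (Ig_spec K)].
    intros P [A HA]. destruct (nfloor_ex (Rabs A)) as [N [_ HN]]; [apply Rabs_pos|]. exists (S N). intros n Hn. apply HA.
    apply le_INR in Hn. rewrite S_INR in Hn. pose proof (Rle_abs A). unfold half. lra. }
  assert (L2 : clim eventually (fun N => RtoC (fz z 0) + 2 * csum (fun n => RtoC (fz z (INR (S n)))) N)%C ssum).
  { apply clim_plus; [apply clim_const|]. apply clim_mult; [apply clim_const|].
    apply (csum_geo_lim _ (2 / (PI * z)) rho1); auto. left. apply Rdiv_lt_0_compat; lra. }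
  apply (clim_Cmod_le (F := eventually) (fun N => cint g (- (INR N + half)) (INR N + half) - (RtoC (fz z 0) + 2 * csum (fun n => RtoC (fz z (INR (S n)))) N))%C);
    [now apply clim_minus|].
  exists 0%nat. intros N _. rewrite EJ.
  match goal with |- Cmod ?x <= _ => replace x with ((I 0 - RtoC (fz z 0)) + 2 * csum (fun n => I (INR (S n)) - RtoC (fz z (INR (S n)))) N)%C
    by (rewrite csum_minus; ring) end.
  eapply Rle_trans; [apply Cmod_triangle|]. rewrite Rmult_plus_distr_r. apply Rplus_le_compat.
  - apply Bd; [lra| |].
    + intro x. now rewrite Rplus_0_r.
    + intros x Hx. rewrite Rplus_0_r. now apply fz_lip0.
  - rewrite Cmod_mult, Cmod_pos_RtoC by lra. rewrite Rmult_assoc. apply Rmult_le_compat_l; [lra|].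
    replace (csum (fun n => I (INR (S n)) - RtoC (fz z (INR (S n))))%C N)
      with (csum (fun n => I (INR (S n)) - RtoC (fz z (INR (S n))))%C N - csum (fun n => I (INR (S n)) - RtoC (fz z (INR (S n))))%C 0)%C by (simpl; ring).
    eapply Rle_trans; [apply (csum_geo_tail _ (32 * eta) rho 0 N)|]; auto; try lia; try lra.
    + intro n. replace (32 * eta * rho ^ n) with (32 * rho ^ n * eta) by ring. apply Bd.
      * apply Rmult_le_pos; [lra|apply pow_le; lra].
      * intro x. now apply PR_period.
      * intros x Hx. now apply Hl.
Qed.

Theorem poisson_gauss : ssum = ssum'.
Proof.
  destruct poisson_left as [B1 [HB1 H1]]. destruct poisson_right as [B2 [HB2 H2]].
  apply Cmod_small_eq. intros e He. set (eta := Rmin (1 / 2) (e / (B1 + B2 + 1))).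
  assert (0 < eta) by (apply Rmin_glb_lt; [lra|apply Rdiv_lt_0_compat; lra]).
  assert (eta <= 1 / 2) by apply Rmin_l. assert (eta <= e / (B1 + B2 + 1)) by apply Rmin_r.
  specialize (H1 eta ltac:(lra)). specialize (H2 eta ltac:(lra)). rewrite Cmod_minus_sym in H1.
  eapply Rle_trans; [eapply Cmod_triangle3|]. eapply Rle_trans; [apply Rplus_le_compat; [exact H1|exact H2]|].
  assert (eta * (B1 + B2 + 1) <= e).
  { apply Rle_trans with (e / (B1 + B2 + 1) * (B1 + B2 + 1)); [apply Rmult_le_compat_r; lra|]. right. field. lra. }
  lra.
Qed.
End Poisson.

Definition thk (Z : C) (n : nat) : C := cexp (- (RtoC PI * RtoC (INR (S n) ^ 2) * Z))%C.
(** Sum of [exp (- pi n^2 Z)] over [n >= 1]; Jacobi's theta function is [1 + 2 psi]. The index of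
    [thk] is shifted by one. *)
Definition psi (Z : C) : C := CL (csum (thk Z)).

Lemma thk_real z n : thk (RtoC z) n = RtoC (fz z (INR (S n))).
Proof.
  unfold thk, fz. rewrite <- cexp_RtoC. f_equal. rewrite <- !RtoC_mult, <- RtoC_opp. f_equal. ring.
Qed.

Lemma CL_ext a b : (forall n, a n = b n) -> CL (csum a) = CL (csum b).
Proof. intro H. f_equal. apply functional_extensionality. intro N. apply csum_ext. auto. Qed.

Lemma CL_scal c a B rho : 0 <= B -> 0 <= rho < 1 -> (forall n, Cmod (a n) <= B * rho ^ n) ->
  CL (csum (fun n => c * a n)%C) = (c * CL (csum a))%C.
Proof.
  intros HB Hr Ha. apply CL_eq. apply clim_ext with (f := fun N => (c * csum a N)%C).
  - apply filter_forall. intro N. symmetry. apply csum_scal.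
  - apply clim_mult; [apply clim_const|]. now apply (csum_geo_lim a B rho).
Qed.

Lemma theta_real_cg z : 0 < z -> (1 + 2 * psi (RtoC z) = RtoC (cg / sqrt z) * (1 + 2 * psi (RtoC (/ z))))%C.
Proof.
  intro Hz. pose proof (poisson_gauss z Hz) as P.
  assert (Hz' : 0 < / z) by now apply Rinv_0_lt_compat.
  destruct (fz_seq_bound (/ z) Hz') as [rho [Hr Hb]].
  assert (E0 : RtoC (fz z 0) = 1%C) by (unfold fz; rewrite pow_i, Rmult_0_r, Ropp_0, exp_0 by lia; reflexivity).
  assert (E1 : exp (- (PI / z * 0 ^ 2)) = 1) by (rewrite pow_i, Rmult_0_r, Ropp_0, exp_0 by lia; reflexivity).
  rewrite E0, E1, Rmult_1_r in P. unfold psi.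
  rewrite (CL_ext (thk (RtoC z)) (fun n => RtoC (fz z (INR (S n))))) by (intro; apply thk_real).
  rewrite P, (CL_ext (thk (RtoC (/ z))) (fun n => RtoC (fz (/ z) (INR (S n))))) by (intro; apply thk_real).
  rewrite (CL_ext (fun n => RtoC (cg / sqrt z * exp (- (PI / z * INR (S n) ^ 2)))) (fun n => RtoC (cg / sqrt z) * RtoC (fz (/ z) (INR (S n))))%C)
    by (intro; rewrite <- RtoC_mult; reflexivity).
  rewrite (CL_scal _ _ (2 / (PI * / z)) rho); auto; [ring|].
  left. apply Rdiv_lt_0_compat; [lra|]. apply Rmult_lt_0_compat; auto. apply PI_RGT_0.
Qed.

(** At the self-dual point the formula reads [s = cg * s] with [Re s >= 1], so [s] can be
    cancelled. *)
Lemma cg_1 : cg = 1.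
Proof.
  pose proof (theta_real_cg 1 Rlt_0_1) as E. rewrite Rinv_1, sqrt_1 in E. replace (cg / 1) with cg in E by field.
  assert (Hpos : 0 <= Re (psi (RtoC 1))).
  { destruct (fz_seq_bound 1 Rlt_0_1) as [rho [Hr Hb]]. pose proof PI_RGT_0.
    assert (L : clim eventually (csum (thk (RtoC 1))) (psi (RtoC 1))).
    { apply (csum_geo_lim _ (2 / (PI * 1)) rho); auto; [left; apply Rdiv_lt_0_compat; lra|]. intro n. rewrite thk_real. apply Hb. }
    apply clim_re in L. refine (filterlim_le (F := eventually) (fun _ => 0) _ (Finite 0) (Finite _) _ (filterlim_const _) L).
    exists 0%nat. intros N _. induction N; [simpl; lra|]. cbn [csum]. rewrite re_plus, thk_real, re_RtoC.
    pose proof (fz_pos 1 (INR (S N))). lra. }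
  set (s := (1 + 2 * psi (RtoC 1))%C) in *.
  assert (Hs : s <> RtoC 0).
  { intro K. apply (f_equal Re) in K. unfold s in K. rewrite re_plus, re_mult in K. simpl in K. unfold Re in *. lra. }
  apply RtoC_inj. replace (RtoC cg) with (RtoC cg * s / s)%C by (field; auto). rewrite <- E. field. auto.
Qed.

Theorem theta_real z : 0 < z -> (1 + 2 * psi (RtoC z) = RtoC (/ sqrt z) * (1 + 2 * psi (RtoC (/ z))))%C.
Proof. intro Hz. rewrite (theta_real_cg z Hz), cg_1. unfold Rdiv. now rewrite Rmult_1_l. Qed.

(** * Fourier inversion *)

(** Gaussian regularisation: inserting [exp (- pi e^2 t^2)] under the integral of [fh], Fubini and
    the known transform of the Gaussian give an average of [f (e s)] against a fixed Gaussian of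
    mass [2 pi]. Both forms are continuous as [e] tends to 0. *)
Lemma inversion_at_0 f fh K K' : DomC K f -> DomC K' fh ->
  (forall t, fh t = Ig (fun y => f y * cexp (Ci * RtoC (t * y)))%C) -> Ig fh = (RtoC (2 * PI) * f 0)%C.
Proof.
  intros Df Dh Hfh. pose proof PI_RGT_0 as HPI. pose proof (DomC_K _ _ Df) as HK. pose proof (DomC_K _ _ Dh) as HK'.
  assert (HPR : ProperFilter (at_right 0)) by apply at_right_proper_filter.
  assert (Hpos : at_right 0 (fun e => 0 < e)) by (exists (mkposreal 1 Rlt_0_1); intros y _ Hy; exact Hy).
  assert (Hsmall : forall d, 0 < d -> at_right 0 (fun e => 0 < e < d)).
  { intros d Hd. exists (mkposreal d Hd). intros y Hy Hy0. change (Rabs (y - 0) < d) in Hy. apply Rabs_def2 in Hy. lra. }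
  (* With the waves normalised as [exp (i t y)], the dual of [exp (- pi e^2 t^2)] is
     [exp (- pi z0 (y / e)^2) / e], and [fz z0] has total mass [1 / sqrt z0 = 2 pi]. *)
  set (z0 := / (4 * PI ^ 2)). assert (Hz0 : 0 < z0) by (apply Rinv_0_lt_compat, Rmult_lt_0_compat; [lra|now apply pow_lt]).
  destruct (fz_dom z0 Hz0) as [K0 [HK0 H0]].
  assert (Ez0 : Ig (fun s => RtoC (fz z0 s)) = RtoC (2 * PI)).
  { rewrite (Ig_ext _ (cpar (fz z0) (2 * PI * 0))).
    - rewrite fz_FT, cg_1 by auto. f_equal. rewrite pow_i, Rmult_0_r, Ropp_0, exp_0, Rmult_1_r by lia.
      unfold z0. replace (4 * PI ^ 2) with ((2 * PI) * (2 * PI)) by ring. rewrite Rinv_mult, sqrt_square.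
      + field. lra.
      + left. apply Rinv_0_lt_compat. lra.
    - intro u. unfold cpar. replace (2 * PI * 0 * u) with 0 by ring. rewrite Cmult_0_r, cexp_0. ring. }
  assert (Dz0 : DomC K0 (fun s => RtoC (fz z0 s))).
  { split; [intro; apply ccr_RtoC, fz_cont|]. intro u. rewrite Cmod_pos_RtoC; [apply H0|left; apply fz_pos]. }
  set (A := fun e => Ig (fun t => RtoC (fz (e ^ 2) t) * fh t)%C).
  assert (L1 : clim (at_right 0) A (Ig fh)).
  { apply (Ig_lim (at_right 0) (fun e t => RtoC (fz (e ^ 2) t) * fh t)%C fh (1 * K')).
    - apply filter_forall. intro e. apply DomC_mult; auto; [intro; apply ccr_RtoC, fz_cont|].
      intro u. rewrite Cmod_pos_RtoC by (left; apply fz_pos). unfold fz. rewrite <- exp_0. apply exp_mono.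
      assert (0 <= PI * e ^ 2 * u ^ 2) by (apply Rmult_le_pos; [apply Rmult_le_pos; [lra|apply pow2_ge_0]|apply pow2_ge_0]). lra.
    - revert Dh. apply DomC_le. lra.
    - intros B d HB Hd. set (M := PI * B ^ 2 * (K' + 1)). assert (HB2 : 0 < B ^ 2) by (apply pow_lt; lra).
      assert (HM : 0 < M) by (unfold M; apply Rmult_lt_0_compat; [apply Rmult_lt_0_compat|]; lra).
      assert (Hm : 0 < Rmin 1 (d / M)) by (apply Rmin_glb_lt; [lra|apply Rdiv_lt_0_compat; lra]).
      generalize (Hsmall _ Hm). apply filter_imp. intros e He t Ht.
      pose proof (Rmin_l 1 (d / M)). pose proof (Rmin_r 1 (d / M)).
      replace (RtoC (fz (e ^ 2) t) * fh t - fh t)%C with (RtoC (fz (e ^ 2) t - 1) * fh t)%C by (rewrite RtoC_minus; ring).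
      rewrite Cmod_mult, Cmod_R.
      assert (Ht2 : t ^ 2 <= B ^ 2) by (rewrite <- (Rabs_sq t); apply pow_incr; split; [apply Rabs_pos|apply Rabs_le; lra]).
      assert (Hf1 : Rabs (fz (e ^ 2) t - 1) <= PI * B ^ 2 * e).
      { unfold fz. pose proof (exp_ge_1p (- (PI * e ^ 2 * t ^ 2))) as E1. pose proof (pow2_ge_0 t).
        assert (He2 : 0 <= e ^ 2 <= e) by (simpl; nra).
        assert (0 <= PI * e ^ 2 * t ^ 2) by (apply Rmult_le_pos; [apply Rmult_le_pos; lra|auto]).
        assert (exp (- (PI * e ^ 2 * t ^ 2)) <= 1) by (rewrite <- exp_0; apply exp_mono; lra).
        rewrite Rabs_left1 by lra. apply Rle_trans with (PI * e ^ 2 * t ^ 2); [lra|].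
        replace (PI * B ^ 2 * e) with (PI * e * B ^ 2) by ring. apply Rmult_le_compat; try lra; [nra|]. apply Rmult_le_compat_l; lra. }
      assert (Hfh1 : Cmod (fh t) <= K').
      { eapply Rle_trans; [apply Dh|]. pose proof (wt_le1 t). pose proof (wt_pos t). nra. }
      apply Rle_trans with (PI * B ^ 2 * e * (K' + 1)).
      + apply Rmult_le_compat; [apply Rabs_pos|apply Cmod_ge_0|exact Hf1|lra].
      + replace (PI * B ^ 2 * e * (K' + 1)) with (e * M) by (unfold M; ring).
        apply Rle_trans with (d / M * M); [apply Rmult_le_compat_r; lra|]. right. field. lra. }
  assert (E : forall e, 0 < e -> A e = Ig (fun s => RtoC (fz z0 s) * f (e * s)%R)%C).
  { intros e He. assert (He2 : 0 < e ^ 2) by now apply pow_lt. destruct (fz_dom (e ^ 2) He2) as [Ke [HKe He']].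
    set (G := fun w : C => (RtoC (fz (e ^ 2) (Re w)) * (f (Im w) * cexp (Ci * (RtoC (Re w) * RtoC (Im w)))))%C).
    pose proof (fun t => DomC_wave K f t Df) as Dfy.
    assert (EG1 : A e = Ig (fun t => Ig (fun y => G (t, y)))).
    { unfold A. apply Ig_ext. intro t. rewrite Hfh, <- (Ig_scal _ _ _ (Dfy t)). apply Ig_ext. intro y. unfold G. simpl.
      rewrite RtoC_mult. ring. }
    rewrite EG1, (Ig_fubini G (Ke * K)).
    - assert (Dt : forall m, DomC Ke (cpar (fz (e ^ 2)) m)).
      { intro m. apply cpar_Dom; [apply fz_cont|]. intro u. split; [left; apply fz_pos|apply He']. }
      assert (EI : forall y, Ig (fun t => G (t, y)) = (RtoC (/ e) * (RtoC (fz z0 (y / e)) * f y))%C).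
      { intro y. rewrite (Ig_ext _ (fun t => f y * cpar (fz (e ^ 2)) (2 * PI * (y / (2 * PI))) t)%C).
        - rewrite (Ig_scal _ _ _ (Dt _)), fz_FT, cg_1 by auto.
          replace (sqrt (e ^ 2)) with e by (symmetry; apply sqrt_pow2; lra).
          replace (exp (- (PI / e ^ 2 * (y / (2 * PI)) ^ 2))) with (fz z0 (y / e)).
          + unfold Rdiv at 1. rewrite Rmult_1_l, RtoC_mult. ring.
          + unfold fz, z0. f_equal. field. lra.
        - intro t. unfold G, cpar. simpl. replace (2 * PI * (y / (2 * PI)) * t) with (t * y) by (field; lra). rewrite RtoC_mult. ring. }
      rewrite (Ig_ext _ _ EI).
      assert (D1 : DomC (1 * K) (fun y => RtoC (fz z0 (y / e)) * f y)%C).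
      { apply DomC_mult; auto.
        - intro y. apply ccr_RtoC. unfold fz. apply (ex_derive_continuous (V := R_NormedModule)). auto_derive. lra.
        - intro y. rewrite Cmod_pos_RtoC by (left; apply fz_pos). unfold fz. rewrite <- exp_0. apply exp_mono.
          pose proof (pow2_ge_0 (y / e)). assert (0 <= PI * z0) by (apply Rmult_le_pos; lra). assert (0 <= PI * z0 * (y / e) ^ 2) by now apply Rmult_le_pos. lra. }
      rewrite (Ig_scal _ _ _ D1), <- (Ig_lin_pos _ _ e 0 He D1), Cmult_assoc, <- RtoC_mult, Rinv_l, Cmult_1_l by lra.
      apply Ig_ext. intro s. rewrite Rplus_0_r. f_equal. f_equal. f_equal. field. lra.
    - intro w. unfold G. apply ccc_mult.
      + apply (ccc_RtoC (fz (e ^ 2)) Re); [apply fz_cont|apply ccc_re].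
      + apply ccc_mult; [apply (ccc_of_ccr f Im); [apply Df|apply ccc_im]|]. ccont.
    - intros t y. unfold G. simpl Re. simpl Im. rewrite !Cmod_mult, Cmod_cexp, !re_mult. simpl.
      match goal with |- context [exp ?x] => replace x with 0 by ring end. rewrite exp_0, (Rmult_1_r (Cmod (f y))), Cmod_pos_RtoC by (left; apply fz_pos).
      replace (Ke * K * wt t * wt y) with (Ke * wt t * (K * wt y)) by ring.
      apply Rmult_le_compat; [left; apply fz_pos|apply Cmod_ge_0|apply He'|apply Df]. }
  assert (L2 : clim (at_right 0) A (RtoC (2 * PI) * f 0)%C).
  { apply clim_ext with (f := fun e => Ig (fun s => RtoC (fz z0 s) * f (e * s)%R)%C).
    { generalize Hpos. apply filter_imp. intros e He. symmetry. auto. }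
    replace (RtoC (2 * PI) * f 0)%C with (Ig (fun s => f 0 * RtoC (fz z0 s))%C) by (rewrite (Ig_scal _ _ _ Dz0), Ez0; ring).
    apply (Ig_lim (at_right 0) (fun e s => RtoC (fz z0 s) * f (e * s)%R)%C _ (K * K0)).
    - generalize Hpos. apply filter_imp. intros e He. apply DomC_ext with (fun s => f (e * s)%R * RtoC (fz z0 s))%C; [intro; ring|].
      apply DomC_mult; auto.
      + intro s. apply (clim_comp (locally s) (locally (e * s)) (fun s => e * s) f); [|apply Df].
        apply (ex_derive_continuous (V := R_NormedModule) (fun s => e * s)). auto_derive. auto.
      + intro s. eapply Rle_trans; [apply Df|]. pose proof (wt_le1 (e * s)). pose proof (wt_pos (e * s)). nra.
    - apply DomC_mult; auto; [intro; apply ccr_const|]. intros _. eapply Rle_trans; [apply Df|]. pose proof (wt_le1 0). pose proof (wt_pos 0). nra.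
    - intros B d HB Hd. destruct Df as [Cf _]. specialize (Cf 0 d Hd). destruct Cf as [del Hdel].
      assert (Hd2 : 0 < del / (B + 1)) by (apply Rdiv_lt_0_compat; [apply cond_pos|lra]).
      generalize (Hsmall _ Hd2). apply filter_imp. intros e He s Hs.
      replace (RtoC (fz z0 s) * f (e * s)%R - f 0 * RtoC (fz z0 s))%C with (RtoC (fz z0 s) * (f (e * s)%R - f 0))%C by ring.
      rewrite Cmod_mult, Cmod_pos_RtoC by (left; apply fz_pos).
      assert (fz z0 s <= 1). { unfold fz. rewrite <- exp_0. apply exp_mono. pose proof (pow2_ge_0 s). assert (0 <= PI * z0) by (apply Rmult_le_pos; lra). assert (0 <= PI * z0 * s ^ 2) by now apply Rmult_le_pos. lra. }
      assert (Cmod (f (e * s) - f 0) < d).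
      { apply Hdel. change (Rabs (e * s - 0) < del). rewrite Rminus_0_r, Rabs_mult, (Rabs_right e) by lra.
        assert (Rabs s <= B) by (apply Rabs_le; lra). pose proof (Rabs_pos s).
        apply Rle_lt_trans with (e * B); [apply Rmult_le_compat_l; lra|].
        apply Rlt_le_trans with (del / (B + 1) * (B + 1)); [|right; field; lra].
        apply Rlt_le_trans with (del / (B + 1) * B + del / (B + 1)); [nra|]. lra. }
      pose proof (fz_pos z0 s). pose proof (Cmod_ge_0 (f (e * s) - f 0)). nra. }
  exact (clim_unique _ _ _ L1 L2).
Qed.

Theorem fourier_inversion f fh K K' u : DomC K f -> DomC K' fh ->
  (forall t, fh t = Ig (fun y => f y * cexp (Ci * RtoC (t * y)))%C) ->
  Ig (fun t => fh t * cexp (- (Ci * RtoC (t * u))))%C = (RtoC (2 * PI) * f u)%C.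
Proof.
  intros Df Dh Hfh.
  destruct (DomC_lin K f 1 u ltac:(lra) Df) as [K2 D2].
  assert (Df2 : DomC K2 (fun y => f (y + u)%R)) by (revert D2; apply DomC_ext; intro; f_equal; ring).
  replace (f u) with (f (0 + u)%R) by (f_equal; ring).
  apply (inversion_at_0 (fun y => f (y + u)%R) _ K2 K'); auto.
  - generalize (DomC_wave K' fh (- u) Dh). apply DomC_ext. intro t. f_equal. f_equal. rewrite !RtoC_mult, RtoC_opp. ring.
  - intro t. rewrite Hfh.
    pose proof (DomC_wave K f t Df) as Dt.
    rewrite Cmult_comm, <- (Ig_shift K _ u Dt).
    destruct (DomC_lin K _ 1 u ltac:(lra) Dt) as [K3 D3].
    assert (D4 : DomC K3 (fun y => f (y + u)%R * cexp (Ci * RtoC (t * (y + u))))%C).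
    { revert D3. apply DomC_ext. intro y. replace (1 * y + u) with (y + u) by ring. reflexivity. }
    rewrite <- (Ig_scal _ _ _ D4). apply Ig_ext. intro y.
    replace (RtoC (t * (y + u))) with (RtoC (t * y) + RtoC (t * u))%C by (rewrite <- RtoC_plus; f_equal; ring).
    rewrite Cmult_plus_distr_l, cexp_plus, cexp_opp. field. apply cexp_neq0.
Qed.

(** * The theta kernel of the xi function *)

(** The [j]-th derivative of a term of theta; [psij j] is the corresponding derivative of [psi]. *)
Definition thkj (j : nat) (Z : C) (n : nat) : C := ((- (RtoC PI * RtoC (INR (S n) ^ 2))) ^ j * thk Z n)%C.
Definition psij (j : nat) (Z : C) : C := CL (csum (thkj j Z)).

Lemma thk_bound Z m n : 0 < m -> m <= Re Z -> Cmod (thk Z n) <= exp (- (PI * m)) * exp (- (PI * m)) ^ n.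
Proof.
  intros Hm HZ. unfold thk. rewrite Cmod_cexp, <- RtoC_mult, exp_pow, <- exp_plus. apply exp_mono.
  rewrite re_opp, re_mult, re_RtoC, im_RtoC, Rmult_0_l, Rminus_0_r. pose proof PI_RGT_0. pose proof (INR_S_ge1 n) as H1.
  assert (E : INR (S n) = INR n + 1) by apply S_INR.
  replace (- (PI * m) + INR n * - (PI * m)) with (- (PI * INR (S n) * m)) by (rewrite E; ring).
  set (N := INR (S n)) in *. clearbody N.
  apply Ropp_le_contravar. apply Rmult_le_compat; try lra; [apply Rmult_le_pos; lra|]. apply Rmult_le_compat_l; [lra|]. simpl pow. nra.
Qed.

Lemma thkj0 Z n : thkj 0 Z n = thk Z n.
Proof. unfold thkj. simpl Cpow. ring. Qed.

Lemma psij0 Z : psij 0 Z = psi Z.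
Proof. apply CL_ext. intro. apply thkj0. Qed.

Lemma exp_PI_lt1 m : 0 < m -> 0 <= exp (- (PI * m)) < 1.
Proof. intro. apply exp_neg_lt1. apply Rmult_lt_0_compat; auto. apply PI_RGT_0. Qed.

Lemma psi_bound Z m : 0 < m -> m <= Re Z -> Cmod (psi Z) <= exp (- (PI * Re Z)) / (1 - exp (- (PI * m))).
Proof.
  intros Hm HZ. pose proof (exp_PI_lt1 m Hm). pose proof (exp_PI_lt1 (Re Z) ltac:(lra)) as [H1 H2].
  pose proof (CL_tail (thk Z) (exp (- (PI * Re Z))) (exp (- (PI * Re Z))) 0 H1 (conj H1 H2) ltac:(intro; apply thk_bound; lra)) as T.
  simpl in T. replace (CL (csum (thk Z)) - 0)%C with (psi Z) in T by (unfold psi; ring). eapply Rle_trans; [exact T|].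
  rewrite Rmult_1_r. unfold Rdiv. apply Rmult_le_compat_l; auto. apply Rinv_le_contravar; [lra|].
  apply Rplus_le_compat_l, Ropp_le_contravar, exp_mono. pose proof PI_RGT_0. nra.
Qed.

Lemma cder_thkj j Z n : cder (fun Z => thkj j Z n) Z (thkj (S j) Z n).
Proof.
  unfold thkj, thk. eapply gder_eq; [apply cder_mult; [apply cder_const|apply (cder_comp cexp); [apply cder_cexp|]]|].
  - apply cder_opp, cder_mult; [apply cder_const|apply cder_id].
  - set (q := RtoC (INR (S n) ^ 2)). clearbody q. cbv beta. rewrite Cpow_S. ring.
Qed.

Lemma cder_thk_sum j Z0 N h : cder (fun h => csum (thkj j (Z0 + h)) N) h (csum (thkj (S j) (Z0 + h)) N).
Proof.
  induction N; [exact (cder_const (RtoC 0) h)|]. cbn [csum]. apply cder_plus; auto.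
  eapply gder_eq; [apply (cder_comp (fun Z => thkj j Z N) (fun h => Z0 + h)%C); [apply cder_thkj|apply cder_plus; [apply cder_const|apply cder_id]]|]. ring.
Qed.

(* Locally uniform convergence passes to derivatives, so no estimate is needed for [j > 0]. *)
Lemma psij_step j Z0 : lunif (fun N h => csum (thkj j (Z0 + h)) N) (fun h => psij j (Z0 + h)%C) (Re Z0) ->
  (forall h, Cmod h < Re Z0 -> cder (fun h => psij j (Z0 + h)%C) h (psij (S j) (Z0 + h)%C)) /\
  lunif (fun N h => csum (thkj (S j) (Z0 + h)) N) (fun h => psij (S j) (Z0 + h)%C) (Re Z0).
Proof.
  intro U. destruct (weierstrass _ _ (Re Z0) ltac:(intros N h _; eexists; apply cder_thk_sum) U) as [Hh U'].
  assert (E : forall h, Cmod h < Re Z0 -> psij (S j) (Z0 + h)%C = Cder (fun h => psij j (Z0 + h)%C) h).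
  { intros h Hh'. apply CL_eq. intros e He. destruct (U' (Cmod h) e Hh' He) as [N HN]. exists N. intros n Hn.
    specialize (HN n Hn h (Rle_refl _)). rewrite (Cder_eq _ _ _ (cder_thk_sum j Z0 n h)) in HN. exact HN. }
  split.
  - intros h Hh'. rewrite E by auto. now apply (hol_Cder _ (Re Z0)).
  - intros r e Hr He. destruct (U' r e Hr He) as [N HN]. exists N. intros n Hn h Hh'.
    rewrite E, <- (Cder_eq _ _ _ (cder_thk_sum j Z0 n h)) by lra. now apply HN.
Qed.

Lemma psij_lunif j Z0 : lunif (fun N h => csum (thkj j (Z0 + h)) N) (fun h => psij j (Z0 + h)%C) (Re Z0).
Proof.
  induction j; [|now apply psij_step]. intros r e Hr He. destruct (Rlt_dec r 0) as [Hn|Hn].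
  { exists 0%nat. intros n _ h Hh. pose proof (Cmod_ge_0 h). lra. }
  set (m := Re Z0 - r). assert (Hm : 0 < m) by (unfold m; lra). pose proof (exp_PI_lt1 m Hm) as [H1 H2].
  set (rho := exp (- (PI * m))) in *.
  destruct (geo_small (rho / (1 - rho)) rho e) as [N HN]; auto; [apply Rmult_le_pos; auto; left; apply Rinv_0_lt_compat; lra|].
  exists N. intros n Hnn h Hh. rewrite Cmod_minus_sym.
  eapply Rle_lt_trans; [apply (CL_tail _ rho rho); auto|].
  - intro k. rewrite thkj0. apply thk_bound; auto. rewrite re_plus. pose proof (re_ge h). unfold m. lra.
  - replace (rho * rho ^ n / (1 - rho)) with (rho / (1 - rho) * rho ^ n) by (field; lra). auto.
Qed.

Lemma cder_psij j Z : 0 < Re Z -> cder (psij j) Z (psij (S j) Z).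
Proof.
  intro HZ. destruct (psij_step j Z (psij_lunif j Z)) as [H _]. specialize (H (RtoC 0) ltac:(rewrite Cmod_0; auto)).
  replace (Z + RtoC 0)%C with Z in H by ring.
  apply cder_ext_all with (fun w => psij j (Z + (w - Z))%C); [intro; f_equal; ring|].
  eapply gder_eq; [apply (cder_comp (fun h => psij j (Z + h)%C) (fun w => w - Z)%C)|].
  - replace (Z - Z)%C with (RtoC 0) by ring. exact H.
  - apply cder_minus; [apply cder_id|apply cder_const].
  - ring.
Qed.

(** Exactly the condition on the height of [w] that keeps [exp (2 w)] in the right half-plane, where
    theta converges, without winding around 0. *)
Definition strip (w : C) : Prop := Rabs (Im w) < PI / 4.
Definition e2 (w : C) : C := cexp (2 * w)%C.
Definition eh (w : C) : C := cexp (w / 2)%C.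

Lemma re_e2 w : Re (e2 w) = exp (2 * Re w) * cos (2 * Im w).
Proof. unfold e2, cexp. destruct w. unfold Re, Im. simpl. f_equal; f_equal; ring. Qed.

Lemma re_e2_pos w : strip w -> 0 < Re (e2 w).
Proof.
  intro H. rewrite re_e2. apply Rmult_lt_0_compat; [apply exp_pos|]. apply Rabs_def2 in H. apply cos_gt_0; lra.
Qed.

Lemma cder_e2 w : cder e2 w (2 * e2 w)%C.
Proof.
  eapply gder_eq; [apply (cder_comp cexp (fun w => 2 * w)%C); [apply cder_cexp|apply cder_mult; [apply cder_const|apply cder_id]]|].
  unfold e2. cbv beta. ring.
Qed.

Lemma cder_cexp_lin a w : cder (fun w => cexp (a * w)%C) w (a * cexp (a * w))%C.
Proof.
  eapply gder_eq; [apply (cder_comp cexp (fun w => a * w)%C); [apply cder_cexp|apply cder_mult; [apply cder_const|apply cder_id]]|]. cbv beta. ring.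
Qed.

Lemma two_neq0 : RtoC 2 <> RtoC 0. Proof. apply RtoC_neq0. lra. Qed.

Lemma cder_eh w : cder eh w (eh w / 2)%C.
Proof.
  apply cder_ext_all with (fun w => cexp (/ 2 * w)%C); [intro; unfold eh; f_equal; field; apply two_neq0|].
  eapply gder_eq; [apply cder_cexp_lin|]. unfold eh. replace (w / 2)%C with (/ 2 * w)%C by (field; apply two_neq0). field; apply two_neq0.
Qed.

(* [thB] is [2 Sum exp(w/2 - pi n^2 exp(2w))], with first derivative [thB1];
   [PhiC] is [thB'' - thB/4]. *)
Definition thB (w : C) : C := (2 * eh w * psij 0 (e2 w))%C.
Definition thB1 (w : C) : C := (eh w * (psij 0 (e2 w) + 4 * e2 w * psij 1 (e2 w)))%C.
Definition PhiC (w : C) : C := (eh w * (12 * e2 w * psij 1 (e2 w) + 8 * e2 w * e2 w * psij 2 (e2 w)))%C.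

Lemma cder_psi_e2 j w : strip w -> cder (fun w => psij j (e2 w)) w (psij (S j) (e2 w) * (2 * e2 w))%C.
Proof. intro H. apply (cder_comp (psij j) e2); [apply cder_psij; now apply re_e2_pos|apply cder_e2]. Qed.

Lemma cder_thB w : strip w -> cder thB w (thB1 w).
Proof.
  intro H. eapply gder_eq.
  - apply cder_mult; [apply cder_mult; [apply cder_const|apply cder_eh]|now apply cder_psi_e2].
  - unfold thB1. cbv beta. field; apply two_neq0.
Qed.

Lemma cder_thB1 w : strip w -> cder thB1 w (PhiC w + thB w / 4)%C.
Proof.
  intro H. eapply gder_eq.
  - apply cder_mult; [apply cder_eh|]. apply cder_plus; [now apply cder_psi_e2|].
    apply cder_mult; [apply cder_mult; [apply cder_const|apply cder_e2]|now apply cder_psi_e2].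
  - unfold PhiC, thB. cbv beta. field; repeat split; apply RtoC_neq0; lra.
Qed.

(** The complete theta function [exp (w/2) (1 + 2 psi (exp (2 w)))]; in this variable its functional
    equation is evenness. *)
Definition thE (w : C) : C := (eh w + thB w)%C.

Lemma cder_thE w : strip w -> cder thE w (eh w / 2 + thB1 w)%C.
Proof. intro H. apply cder_plus; [apply cder_eh|now apply cder_thB]. Qed.

Lemma thE_real u : thE (RtoC (- u)) = thE (RtoC u).
Proof.
  assert (Hh : forall x, eh (RtoC x) = RtoC (exp (x / 2))).
  { intro x. unfold eh. rewrite <- cexp_RtoC. f_equal. rewrite RtoC_div by lra. reflexivity. }
  assert (H2 : forall x, e2 (RtoC x) = RtoC (exp (2 * x))).
  { intro x. unfold e2. rewrite <- cexp_RtoC, RtoC_mult. reflexivity. }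
  assert (H : forall x, thE (RtoC x) = (RtoC (exp (x / 2)) * (1 + 2 * psi (RtoC (exp (2 * x)))))%C).
  { intro x. unfold thE, thB. rewrite Hh, H2, psij0. ring. }
  rewrite !H, (theta_real (exp (2 * u))) by apply exp_pos.
  rewrite Cmult_assoc, <- RtoC_mult, <- exp_Ropp. f_equal.
  - f_equal. replace (exp (2 * u)) with (exp u ^ 2) by (rewrite exp_pow; reflexivity).
    rewrite sqrt_pow2 by (left; apply exp_pos). rewrite <- exp_Ropp, <- exp_plus. f_equal. field.
  - repeat f_equal. ring.
Qed.

Lemma strip_opp w : strip w -> strip (- w)%C.
Proof. unfold strip. now rewrite im_opp, Rabs_Ropp. Qed.

(** Continued from the real line by the identity theorem, on the disc of radius [pi / 4] about the
    real part of [w]; this disc stays in the strip and reaches every point of the vertical line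
    through its centre. *)
Lemma thE_even w : strip w -> thE (- w)%C = thE w.
Proof.
  intro Hw. set (u := RtoC (Re w)).
  set (D := fun h => (thE (- (u + h)) - thE (u + h))%C).
  assert (HD : forall h, Cmod h < PI / 4 -> D h = RtoC 0).
  { apply identity_disc.
    - intros h Hh. assert (S : strip (u + h)%C).
      { unfold strip, u. rewrite im_plus, im_RtoC, Rplus_0_l. eapply Rle_lt_trans; [apply im_le_Cmod|auto]. }
      eexists. apply cder_minus.
      + apply (cder_comp thE (fun h => - (u + h))%C); [apply cder_thE; now apply strip_opp|].
        apply cder_opp, cder_plus; [apply cder_const|apply cder_id].
      + apply (cder_comp thE (fun h => u + h)%C); [now apply cder_thE|]. apply cder_plus; [apply cder_const|apply cder_id].
    - intros d Hd. exists (RtoC (d / 2)). split; [apply RtoC_neq0; lra|]. split; [rewrite Cmod_pos_RtoC; lra|].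
      unfold D, u. rewrite <- RtoC_plus, <- RtoC_opp, thE_real. ring. }
  specialize (HD (Ci * RtoC (Im w))%C). unfold D in HD.
  replace (u + Ci * RtoC (Im w))%C with w in HD.
  - assert (E : (thE (- w) - thE w)%C = RtoC 0).
    { apply HD. rewrite Cmod_mult, Cmod_R. replace (Cmod Ci) with 1; [rewrite Rmult_1_l; exact Hw|].
      unfold Cmod, Ci. simpl. rewrite Rmult_0_l, Rplus_0_l, !Rmult_1_l, sqrt_1. reflexivity. }
    replace (thE (- w)) with (thE (- w) - thE w + thE w)%C by ring. rewrite E. ring.
  - apply Ceq_parts; unfold u; simpl; ring.
Qed.

Lemma cnb_strip w : strip w -> cnb w strip.
Proof.
  intro H. unfold strip in *. assert (Hd : 0 < PI / 4 - Rabs (Im w)) by lra.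
  generalize (cnb_ball w _ Hd). apply filter_imp. intros z Hz.
  pose proof (im_le_Cmod (z - w)) as I. rewrite im_minus in I. pose proof (Rabs_triang (Im w) (Im z - Im w)) as T.
  replace (Im w + (Im z - Im w)) with (Im z) in T by ring. lra.
Qed.

Lemma even_cder f f1 w : (forall z, strip z -> f (- z)%C = f z) -> (forall z, strip z -> cder f z (f1 z)) -> strip w ->
  f1 (- w)%C = (- f1 w)%C.
Proof.
  intros He Hd Hw. assert (H : cder f w (f1 (- w) * - (1))%C).
  { apply cder_ext with (fun z => f (- z)%C).
    - generalize (cnb_strip w Hw). apply filter_imp. exact He.
    - apply (cder_comp f (fun z => - z)%C); [apply Hd; now apply strip_opp|]. apply cder_opp, cder_id. }
  rewrite (cder_unique f w _ _ (Hd w Hw) H). ring.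
Qed.

(** The operator [D^2 - 1/4] annihilates [exp (w/2)], so [PhiC] is also [thE'' - thE / 4] and
    inherits the evenness of theta. *)
Lemma PhiC_even w : strip w -> PhiC (- w)%C = PhiC w.
Proof.
  intro Hw. set (E1 := fun w => (eh w / 2 + thB1 w)%C).
  assert (O1 : forall z, strip z -> E1 (- z)%C = (- E1 z)%C).
  { intros z Hz. apply (even_cder thE E1); auto; [apply thE_even|apply cder_thE]. }
  set (E2 := fun w => (PhiC w + thE w / 4)%C).
  assert (D2 : forall z, strip z -> cder E1 z (E2 z)).
  { intros z Hz. eapply gder_eq; [apply cder_plus|].
    - apply cder_ext_all with (fun w => / 2 * eh w)%C; [intro; unfold Cdiv; ring|]. apply cder_mult; [apply cder_const|apply cder_eh].
    - now apply cder_thB1.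
    - unfold E2, thE. cbv beta. field; repeat split; apply RtoC_neq0; lra. }
  assert (H : cder E1 w (E2 (- w)%C)).
  { apply cder_ext with (fun z => - E1 (- z))%C.
    - generalize (cnb_strip w Hw). apply filter_imp. intros z Hz. rewrite O1 by auto. ring.
    - eapply gder_eq; [apply cder_opp, (cder_comp E1 (fun z => - z)%C); [apply D2; now apply strip_opp|apply cder_opp, cder_id]|]. ring. }
  pose proof (cder_unique E1 w _ _ (D2 w Hw) H) as E. unfold E2 in E. rewrite thE_even in E by auto.
  replace (PhiC w) with (PhiC w + thE w / 4 - thE w / 4)%C by ring. rewrite E. ring.
Qed.

Lemma psij_lim j Z : 0 < Re Z -> clim eventually (csum (thkj j Z)) (psij j Z).
Proof.
  intros HZ e He. destruct (psij_lunif j Z 0 e HZ He) as [N HN]. exists N. intros n Hn.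
  specialize (HN n Hn (RtoC 0) ltac:(rewrite Cmod_0; lra)). replace (Z + RtoC 0)%C with Z in HN by ring. exact HN.
Qed.

(** Each derivative is bounded by Cauchy's estimate on a disc of radius [1/4], at the price of [1/4]
    in the half-plane. Two derivatives can be taken before the boundary reaches 1, the least value
    of [exp (2 u)] for [u >= 0]. *)
Lemma psij_bound j : exists K, 0 < K /\ forall Z, 1 / 2 + INR j / 4 <= Re Z -> Cmod (psij j Z) <= K * exp (- (PI * Re Z)).
Proof.
  pose proof PI_RGT_0 as HPI. induction j as [|j [K [HK IH]]].
  - pose proof (exp_PI_lt1 (1 / 2) ltac:(lra)). exists (/ (1 - exp (- (PI * (1 / 2))))). split; [apply Rinv_0_lt_compat; lra|].
    intros Z HZ. simpl INR in HZ. rewrite psij0. eapply Rle_trans; [apply (psi_bound Z (1 / 2)); lra|]. right. unfold Rdiv. ring.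
  - exists (4 * (K * exp (PI / 4))). pose proof (exp_pos (PI / 4)). split; [apply Rmult_lt_0_compat; [lra|]; now apply Rmult_lt_0_compat|].
    intros Z HZ. rewrite S_INR in HZ. pose proof (pos_INR j).
    assert (HD : forall h, Cmod h < Re Z -> cder (fun h => psij j (Z + h)%C) h (psij (S j) (Z + h)%C)) by apply psij_step, psij_lunif.
    pose proof (cauchy_estimate (fun h => psij j (Z + h)%C) (Re Z) (1 / 4) (K * exp (PI / 4) * exp (- (PI * Re Z)))) as CE.
    rewrite (Cder_eq _ _ _ (HD (RtoC 0) ltac:(rewrite Cmod_0; lra))) in CE. replace (Z + RtoC 0)%C with Z in CE by ring.
    eapply Rle_trans; [apply CE|]; [lra|intros h Hh; eexists; now apply HD| |right; field].
    intros w Hw. pose proof (re_ge w). eapply Rle_trans; [apply IH; rewrite re_plus; lra|].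
    rewrite Rmult_assoc. apply Rmult_le_compat_l; [lra|]. rewrite <- exp_plus. apply exp_mono. rewrite re_plus. nra.
Qed.

Lemma eh_RtoC x : eh (RtoC x) = RtoC (exp (x / 2)).
Proof. unfold eh. rewrite <- cexp_RtoC. f_equal. rewrite RtoC_div by lra. reflexivity. Qed.
Lemma e2_RtoC x : e2 (RtoC x) = RtoC (exp (2 * x)).
Proof. unfold e2. rewrite <- cexp_RtoC, RtoC_mult. reflexivity. Qed.
Lemma strip_real x : strip (RtoC x).
Proof. unfold strip. rewrite im_RtoC, Rabs_R0. pose proof PI_RGT_0. lra. Qed.

(** * The kernel [Phi] on the real line *)

Definition Phi (u : R) : R := Re (PhiC (RtoC u)).

Lemma exp_exp_bound c A b : 0 < c -> 0 <= A -> 0 <= b -> exists K, forall u, 0 <= u -> b * u + A * u ^ 2 <= K + c * exp (2 * u).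
Proof.
  intros Hc HA Hb. set (D := 4 * A + b). exists (D ^ 2 / (4 * c)). intros u Hu.
  assert (E2 : exp (2 * u) = exp u * exp u) by (rewrite <- exp_plus; f_equal; ring).
  assert (E1 : exp u = exp (u / 2) * exp (u / 2)) by (rewrite <- exp_plus; f_equal; field).
  pose proof (exp_ge_1p (u / 2)) as H1. pose proof (exp_ge_1p u) as H2.
  set (a := exp (u / 2)) in *. set (y := exp u) in *. rewrite E2.
  assert (u ^ 2 <= 4 * y) by (rewrite E1; simpl; nra).
  assert (b * u + A * u ^ 2 <= D * y) by (unfold D; nra).
  assert (0 <= (D / (2 * c) - y) ^ 2 * c) by (apply Rmult_le_pos; [apply pow2_ge_0|lra]).
  replace (D ^ 2 / (4 * c)) with ((D / (2 * c) - y) ^ 2 * c + D * y - c * (y * y)) by (field; lra). lra.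
Qed.

Lemma exp2_ge1 u : 0 <= u -> 1 <= exp (2 * u).
Proof. intro. rewrite <- exp_0. apply exp_mono. lra. Qed.

Lemma PhiC_decay : exists K, 0 < K /\ forall u, 0 <= u -> Cmod (PhiC (RtoC u)) <= K * exp (9 / 2 * u) * exp (- (PI * exp (2 * u))).
Proof.
  destruct (psij_bound 1) as [K1 [H1 B1]], (psij_bound 2) as [K2 [H2 B2]]. exists (12 * K1 + 8 * K2). split; [lra|].
  intros u Hu. unfold PhiC. rewrite eh_RtoC, e2_RtoC. set (x := exp (2 * u)). assert (Hx : 1 <= x) by now apply exp2_ge1.
  specialize (B1 (RtoC x) ltac:(simpl; lra)). specialize (B2 (RtoC x) ltac:(simpl; lra)). rewrite re_RtoC in B1, B2.
  rewrite Cmod_mult, Cmod_pos_RtoC by (left; apply exp_pos). set (e := exp (- (PI * x))) in *. assert (He : 0 < e) by apply exp_pos.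
  assert (E : exp (9 / 2 * u) = exp (u / 2) * (x * x)) by (unfold x; rewrite <- !exp_plus; f_equal; field).
  rewrite E. replace ((12 * K1 + 8 * K2) * (exp (u / 2) * (x * x)) * e) with (exp (u / 2) * ((12 * K1 + 8 * K2) * (x * x) * e)) by ring.
  apply Rmult_le_compat_l; [left; apply exp_pos|]. eapply Rle_trans; [apply Cmod_triangle|].
  rewrite !Cmod_mult, !(Cmod_pos_RtoC x), !Cmod_pos_RtoC by lra.
  apply Rle_trans with (12 * x * (K1 * e) + 8 * x * x * (K2 * e)).
  - apply Rplus_le_compat; (apply Rmult_le_compat_l; [nra|auto]).
  - assert (0 <= (x * x - x) * (K1 * e)) by (apply Rmult_le_pos; [nra|apply Rmult_le_pos; lra]). lra.
Qed.

Lemma PhiC_ccr u : ccr (fun u => PhiC (RtoC u)) u.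
Proof.
  apply ccr_comp; [apply ccr_id|]. assert (H : exists d, cder PhiC (RtoC u) d); [|destruct H as [d H]; exact (cder_ccc _ _ _ H)].
  pose proof (strip_real u). eexists. apply cder_mult; [apply cder_eh|]. apply cder_plus; apply cder_mult.
  - apply cder_mult; [apply cder_const|apply cder_e2].
  - now apply cder_psi_e2.
  - apply cder_mult; [apply cder_mult; [apply cder_const|apply cder_e2]|apply cder_e2].
  - now apply cder_psi_e2.
Qed.

Definition phit (u : R) (n : nat) : R :=
  let x := exp (2 * u) in let q := PI * INR (S n) ^ 2 in exp (u / 2) * (4 * (q * x) * (2 * (q * x) - 3)) * fz x (INR (S n)).

Lemma thkj_real j x n : thkj j (RtoC x) n = RtoC ((- (PI * INR (S n) ^ 2)) ^ j * fz x (INR (S n))).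
Proof. unfold thkj. rewrite thk_real, <- RtoC_mult, <- RtoC_opp, RtoC_mult, RtoC_pow. reflexivity. Qed.

Lemma PhiC_series u : clim eventually (csum (fun n => RtoC (phit u n))) (PhiC (RtoC u)).
Proof.
  assert (Hx : 0 < Re (RtoC (exp (2 * u)))) by (rewrite re_RtoC; apply exp_pos).
  unfold PhiC. rewrite eh_RtoC, e2_RtoC. set (x := exp (2 * u)) in *.
  apply clim_ext with (f := fun N => (RtoC (exp (u / 2)) * (12 * RtoC x * csum (thkj 1 (RtoC x)) N + 8 * RtoC x * RtoC x * csum (thkj 2 (RtoC x)) N))%C).
  - apply filter_forall. intro N. induction N; [simpl; ring|]. cbn [csum]. rewrite <- IHN, !thkj_real. unfold phit. fold x.
    set (q := PI * INR (S N) ^ 2). set (f := fz x (INR (S N))). set (e := exp (u / 2)).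
    replace (e * (4 * (q * x) * (2 * (q * x) - 3)) * f) with (e * (12 * x * ((- q) ^ 1 * f) + 8 * x * x * ((- q) ^ 2 * f))) by ring.
    rewrite (RtoC_mult e), (RtoC_plus (12 * x * _)), (RtoC_mult (12 * x)), (RtoC_mult 12 x), (RtoC_mult (8 * x * x)), (RtoC_mult (8 * x)), (RtoC_mult 8 x). ring.
  - apply clim_mult; [apply clim_const|]. apply clim_plus; (apply clim_mult; [apply clim_const|now apply psij_lim]).
Qed.

(** The only sign to check is that of [2 q x - 3], and [q x >= pi > 3]. Negative [u] are reached by
    evenness, the single terms being of no fixed sign there. *)
Lemma phit_pos u n : 0 <= u -> 0 < phit u n.
Proof.
  intro Hu. unfold phit. pose proof (exp2_ge1 u Hu) as Hx. set (x := exp (2 * u)) in *. pose proof (INR_S_ge1 n). pose proof PI2_3_2.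
  assert (Hq : 3 < PI * INR (S n) ^ 2) by (assert (1 <= INR (S n) ^ 2) by (now apply pow_R1_Rle); apply Rlt_le_trans with PI; [lra|]; rewrite <- (Rmult_1_r PI) at 1; apply Rmult_le_compat_l; lra).
  set (q := PI * INR (S n) ^ 2) in *. assert (Hqx : 3 < q * x) by nra.
  apply Rmult_lt_0_compat; [|apply fz_pos]. apply Rmult_lt_0_compat; [apply exp_pos|]. apply Rmult_lt_0_compat; lra.
Qed.

Lemma csum_im0 (a : nat -> R) N : Im (csum (fun n => RtoC (a n)) N) = 0.
Proof. induction N; [reflexivity|]. cbn [csum]. rewrite im_plus, IHN, im_RtoC. ring. Qed.

Lemma PhiC_real u : PhiC (RtoC u) = RtoC (Phi u).
Proof.
  apply Ceq_parts; [reflexivity|]. rewrite im_RtoC. pose proof (clim_im _ _ (PhiC_series u)) as L.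
  apply (filterlim_locally_unique (F := eventually) (fun _ => 0)); [|apply filterlim_const].
  revert L. apply filterlim_ext. intro N. apply csum_im0.
Qed.

Lemma csum_re_mono (a : nat -> R) N : (forall n, 0 < a n) -> (1 <= N)%nat -> a 0%nat <= Re (csum (fun n => RtoC (a n)) N).
Proof.
  intros Ha HN. induction HN; cbn [csum]; rewrite re_plus, re_RtoC; [simpl; lra|]. specialize (Ha m). lra.
Qed.

Lemma Phi_even u : Phi (- u) = Phi u.
Proof. unfold Phi. rewrite RtoC_opp, PhiC_even; auto. apply strip_real. Qed.

Lemma Phi_pos u : 0 < Phi u.
Proof.
  assert (H : forall u, 0 <= u -> 0 < Phi u).
  { intros x Hx. pose proof (clim_re _ _ (PhiC_series x)) as L. apply Rlt_le_trans with (phit x 0); [now apply phit_pos|].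
    refine (filterlim_le (F := eventually) (fun _ => phit x 0) _ (Finite _) (Finite _) _ (filterlim_const _) L).
    exists 1%nat. intros N HN. apply csum_re_mono; auto. intro n. now apply phit_pos. }
  destruct (Rle_dec 0 u); auto. rewrite <- Phi_even. apply H. lra.
Qed.

Lemma even_abs (f : R -> R) u : (forall u, f (- u) = f u) -> f u = f (Rabs u).
Proof. intro H. unfold Rabs. destruct (Rcase_abs u); auto. Qed.

Lemma Kern_Phi : Kern Phi.
Proof.
  split; [|split; [exact Phi_even|split; [exact Phi_pos|]]].
  - intro u. apply (ccr_re (fun u => PhiC (RtoC u))), PhiC_ccr.
  - intros A HA. destruct PhiC_decay as [K [HK B]]. destruct (exp_exp_bound PI A (9 / 2)) as [K' B']; try lra; [apply PI_RGT_0|].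
    exists (K * exp K'). intro u. rewrite (even_abs Phi u Phi_even), <- (Rabs_sq u). set (x := Rabs u). assert (Hx : 0 <= x) by apply Rabs_pos.
    eapply Rle_trans; [apply re_le|]. eapply Rle_trans; [now apply B|]. rewrite !Rmult_assoc. apply Rmult_le_compat_l; [lra|].
    rewrite <- !exp_plus. apply exp_mono. specialize (B' x Hx). lra.
Qed.

(** * Decay of theta in strips and integration by parts *)

Lemma thB_decay al N : 0 <= al < PI / 4 -> 0 <= N ->
  exists K, 0 < K /\ forall w, 0 <= Re w -> Rabs (Im w) <= al -> Cmod (thB w) <= K * exp (- (N * Re w)).
Proof.
  intros Hal HN. set (c := cos (2 * al)). assert (Hc : 0 < c) by (apply cos_gt_0; lra). pose proof PI_RGT_0.
  destruct (exp_exp_bound (PI * c) 0 (N + 1 / 2)) as [K' B']; try lra; [now apply Rmult_lt_0_compat|].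
  pose proof (exp_PI_lt1 c Hc). set (m := / (1 - exp (- (PI * c)))). assert (Hm : 0 < m) by (apply Rinv_0_lt_compat; lra).
  exists (2 * m * exp K'). split; [apply Rmult_lt_0_compat; [lra|apply exp_pos]|].
  intros w Hu Hv. assert (HR : exp (2 * Re w) * c <= Re (e2 w)).
  { rewrite re_e2. apply Rmult_le_compat_l; [left; apply exp_pos|]. unfold c.
    replace (cos (2 * Im w)) with (cos (2 * Rabs (Im w))).
    - pose proof (Rabs_pos (Im w)). destruct (Req_dec (Rabs (Im w)) al) as [->|]; [lra|]. left. apply cos_decreasing_1; lra.
    - unfold Rabs. destruct (Rcase_abs (Im w)); auto. rewrite <- cos_neg. f_equal. ring. }
  assert (Hc1 : c <= Re (e2 w)) by (pose proof (exp2_ge1 _ Hu); nra).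
  pose proof (psi_bound (e2 w) c Hc Hc1) as HP. fold m in HP. unfold Rdiv in HP. fold m in HP. unfold thB. rewrite psij0, !Cmod_mult, Cmod_pos_RtoC by lra.
  replace (Cmod (eh w)) with (exp (Re w / 2)).
  2:{ unfold eh. rewrite Cmod_cexp. f_equal. destruct w. simpl. field. }
  apply Rle_trans with (2 * exp (Re w / 2) * (exp (- (PI * (exp (2 * Re w) * c))) * m)).
  - apply Rmult_le_compat_l; [pose proof (exp_pos (Re w / 2)); lra|]. eapply Rle_trans; [exact HP|].
    apply Rmult_le_compat_r; [lra|]. apply exp_mono. nra.
  - replace (2 * exp (Re w / 2) * (exp (- (PI * (exp (2 * Re w) * c))) * m)) with (2 * m * (exp (Re w / 2) * exp (- (PI * (exp (2 * Re w) * c))))) by ring.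
    rewrite (Rmult_assoc (2 * m)). apply Rmult_le_compat_l; [lra|]. rewrite <- !exp_plus. apply exp_mono. specialize (B' (Re w) Hu). lra.
Qed.

(** Theta with both exponentials [exp (w/2)] and [exp (- w/2)] removed. It is even like [thE], and
    of size [exp (- |u| / 2)] at both ends, so its transform exists on the real line. *)
Definition thK (w : C) : C := (thB w - cexp (- (w / 2)))%C.

Lemma thK_thE w : thK w = (thE w - eh w - eh (- w))%C.
Proof. unfold thK, thE. replace (eh (- w)) with (cexp (- (w / 2))); [ring|]. unfold eh. f_equal. field; apply two_neq0. Qed.

Lemma thK_even w : strip w -> thK (- w)%C = thK w.
Proof. intro H. rewrite !thK_thE, thE_even by auto. replace (- - w)%C with w by ring. ring. Qed.

Lemma Cmod_eh w : Cmod (eh w) = exp (Re w / 2).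
Proof. unfold eh. rewrite Cmod_cexp. f_equal. destruct w. simpl. field. Qed.

Lemma eh_opp w : cexp (- (w / 2))%C = eh (- w).
Proof. unfold eh. f_equal. field; apply two_neq0. Qed.

Lemma thK_bound al : 0 <= al < PI / 4 ->
  exists K, 0 < K /\ forall w, Rabs (Im w) <= al -> Cmod (thK w) <= K * exp (- (Rabs (Re w) / 2)).
Proof.
  intro Hal. destruct (thB_decay al (1 / 2) Hal ltac:(lra)) as [K [HK B]]. exists (K + 1). split; [lra|].
  assert (H : forall w, 0 <= Re w -> Rabs (Im w) <= al -> Cmod (thK w) <= (K + 1) * exp (- (Rabs (Re w) / 2))).
  { intros w Hu Hv. rewrite Rabs_right by lra. unfold thK, Cminus. rewrite eh_opp. eapply Rle_trans; [apply Cmod_triangle|].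
    rewrite Cmod_opp, Cmod_eh, re_opp. specialize (B w Hu Hv).
    replace (- (1 / 2 * Re w)) with (- (Re w / 2)) in B by field. replace (- Re w / 2) with (- (Re w / 2)) by field. lra. }
  intros w Hv. destruct (Rle_dec 0 (Re w)); auto.
  rewrite <- thK_even by (unfold strip; lra). rewrite <- Rabs_Ropp, <- re_opp. apply H; [rewrite re_opp; lra|]. now rewrite im_opp, Rabs_Ropp.
Qed.

Definition thK1 (w : C) : C := (thB1 w + eh (- w) / 2)%C.

Lemma cder_thK w : strip w -> cder thK w (thK1 w).
Proof.
  intro H. apply cder_ext_all with (fun w => thB w - eh (- w))%C; [intro; unfold thK; now rewrite eh_opp|].
  eapply gder_eq; [apply cder_minus; [now apply cder_thB|apply (cder_comp eh (fun w => - w)%C); [apply cder_eh|apply cder_opp, cder_id]]|].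
  unfold thK1. cbv beta. field; apply two_neq0.
Qed.

Lemma cder_thK1 w : strip w -> cder thK1 w (PhiC w + thK w / 4)%C.
Proof.
  intro H. eapply gder_eq; [apply cder_plus; [now apply cder_thB1|]|].
  - apply cder_ext_all with (fun w => / 2 * eh (- w))%C; [intro; unfold Cdiv; ring|].
    apply cder_mult; [apply cder_const|apply (cder_comp eh (fun w => - w)%C); [apply cder_eh|apply cder_opp, cder_id]].
  - unfold thK. rewrite eh_opp. cbv beta. field; repeat split; apply RtoC_neq0; lra.
Qed.

Lemma thB1_decay N : 0 <= N -> exists K, 0 < K /\ forall u, 0 <= u -> Cmod (thB1 (RtoC u)) <= K * exp (- (N * u)).
Proof.
  intro HN. destruct (psij_bound 0) as [K1 [H1 B1]], (psij_bound 1) as [K2 [H2 B2]].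
  destruct (exp_exp_bound PI 0 (N + 5 / 2)) as [K' B']; try lra; [apply PI_RGT_0|].
  exists ((K1 + 4 * K2) * exp K'). split; [apply Rmult_lt_0_compat; [lra|apply exp_pos]|].
  intros u Hu. unfold thB1. rewrite eh_RtoC, e2_RtoC. set (x := exp (2 * u)) in *. assert (Hx : 1 <= x) by now apply exp2_ge1.
  specialize (B1 (RtoC x) ltac:(simpl; lra)). specialize (B2 (RtoC x) ltac:(simpl; lra)). rewrite re_RtoC in B1, B2.
  rewrite Cmod_mult, Cmod_pos_RtoC by (left; apply exp_pos). set (e := exp (- (PI * x))) in *. assert (He : 0 < e) by apply exp_pos.
  apply Rle_trans with (exp (u / 2) * ((K1 + 4 * K2) * x * e)).
  - apply Rmult_le_compat_l; [left; apply exp_pos|]. eapply Rle_trans; [apply Cmod_triangle|].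
    rewrite !Cmod_mult, !(Cmod_pos_RtoC x), !Cmod_pos_RtoC by lra.
    apply Rle_trans with (K1 * e + 4 * x * (K2 * e)).
    + apply Rplus_le_compat; auto. apply Rmult_le_compat_l; [nra|auto].
    + assert (0 <= (x - 1) * (K1 * e)) by (apply Rmult_le_pos; [lra|apply Rmult_le_pos; lra]). lra.
  - replace (exp (u / 2) * ((K1 + 4 * K2) * x * e)) with ((K1 + 4 * K2) * (exp (u / 2) * x * e)) by ring.
    rewrite (Rmult_assoc (K1 + 4 * K2) (exp K')). apply Rmult_le_compat_l; [lra|]. unfold e, x. rewrite <- !exp_plus. apply exp_mono. specialize (B' u Hu). lra.
Qed.

Lemma thK1_bound : exists K, 0 < K /\ forall u, Cmod (thK1 (RtoC u)) <= K * exp (- (Rabs u / 2)).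
Proof.
  destruct (thB1_decay (1 / 2) ltac:(lra)) as [K [HK B]]. exists (K + 1). split; [lra|].
  assert (H : forall u, 0 <= u -> Cmod (thK1 (RtoC u)) <= (K + 1) * exp (- (Rabs u / 2))).
  { intros u Hu. rewrite Rabs_right by lra. unfold thK1. eapply Rle_trans; [apply Cmod_triangle|].
    unfold Cdiv. rewrite Cmod_mult, Cmod_eh, Cmod_inv, Cmod_pos_RtoC, re_opp, re_RtoC by (try apply two_neq0; lra).
    specialize (B u Hu). replace (- (1 / 2 * u)) with (- (u / 2)) in B by field. replace (- u / 2) with (- (u / 2)) by field.
    pose proof (exp_pos (- (u / 2))). lra. }
  intro u. destruct (Rle_dec 0 u); auto.
  rewrite <- Cmod_opp, <- (even_cder thK thK1), <- RtoC_opp, <- Rabs_Ropp; [apply H; lra|apply thK_even|apply cder_thK|apply strip_real].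
Qed.

Lemma exp_abs_wt c : 0 < c -> exists K, 0 < K /\ forall u, exp (- (c * Rabs u)) <= K * wt u.
Proof.
  intro Hc. destruct (wt_lin_bound (c / 2) 0 ltac:(lra)) as [K [HK H]]. exists K. split; auto. intro u.
  eapply Rle_trans; [|apply H]. rewrite exp_Ropp. unfold wt. rewrite Rplus_0_r. apply Rinv_le_contravar; [pose proof (pow2_ge_0 (c / 2 * u)); lra|].
  assert (E : exp (c * Rabs u) = exp (c / 2 * Rabs u) * exp (c / 2 * Rabs u)) by (rewrite <- exp_plus; f_equal; field).
  rewrite E, Rpow_mult_distr, <- (Rabs_sq u). pose proof (exp_ge_1p (c / 2 * Rabs u)). pose proof (Rabs_pos u).
  assert (0 <= c / 2 * Rabs u) by (apply Rmult_le_pos; lra). simpl. nra.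
Qed.

Lemma clim_exp_abs (f : R -> C) M c s : 0 < c -> (forall u, Cmod (f u) <= M * exp (- (c * Rabs u))) -> s = 1 \/ s = -1 ->
  clim (Rbar_locally p_infty) (fun A => f (s * A)) 0.
Proof.
  intros Hc H Hs e He. exists ((Rabs M + 1) / (c * e)). intros A HA.
  assert (Hce : 0 < c * e) by now apply Rmult_lt_0_compat.
  assert (HA0 : 0 < A). { pose proof (Rabs_pos M). apply Rlt_trans with ((Rabs M + 1) / (c * e)); auto. apply Rdiv_lt_0_compat; lra. }
  replace (f (s * A)%R - 0)%C with (f (s * A)%R) by ring.
  eapply Rle_lt_trans; [apply H|]. replace (Rabs (s * A)) with A.
  2:{ rewrite Rabs_mult, (Rabs_right A) by lra. destruct Hs as [-> | ->]; [rewrite Rabs_R1|rewrite Rabs_left by lra]; ring. }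
  rewrite exp_Ropp. pose proof (exp_ge_1p (c * A)). pose proof (Rle_abs M). pose proof (exp_pos (c * A)).
  apply Rmult_lt_reg_r with (exp (c * A)); auto. rewrite Rmult_assoc, Rinv_l, Rmult_1_r by lra.
  assert (HM : Rabs M + 1 < e * (c * A)).
  { replace (e * (c * A)) with (A * (c * e)) by ring. replace (Rabs M + 1) with ((Rabs M + 1) / (c * e) * (c * e)) by (field; lra).
    now apply Rmult_lt_compat_r. }
  assert (0 < c * A) by now apply Rmult_lt_0_compat. nra.
Qed.

(** Two integrations by parts turn [D^2 - 1/4] into [p^2 - 1/4]. It serves twice: for [thK] with
    imaginary [p], in Hardy's argument, and for [thB] with [Re p > 1/2], where the Mellin transform
    gives zeta. *)
Lemma parts_twice (f f1 P : R -> C) (p : C) M c : 0 < c -> (forall u, rder f u (f1 u)) -> (forall u, rder f1 u (P u + f u / 4)%C) ->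
  (forall u, Cmod (f u * cexp (p * RtoC u)) <= M * exp (- (c * Rabs u))) ->
  (forall u, Cmod (f1 u * cexp (p * RtoC u)) <= M * exp (- (c * Rabs u))) ->
  (exists K, DomC K (fun u => P u * cexp (p * RtoC u))%C) ->
  Ig (fun u => P u * cexp (p * RtoC u))%C = ((p * p - 1 / 4) * Ig (fun u => f u * cexp (p * RtoC u)))%C.
Proof.
  intros Hc D1 D2 B1 B2 [K DP].
  assert (Ce : forall u, rder (fun u => cexp (p * RtoC u)) u (p * cexp (p * RtoC u))%C).
  { intro u. eapply gder_eq; [apply (rder_comp (fun w => cexp (p * w)%C) RtoC); [apply cder_cexp_lin|apply rder_id]|]. ring. }
  destruct (exp_abs_wt c Hc) as [Kw [HKw Hw]].
  assert (HM : 0 <= M).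
  { specialize (B1 0). pose proof (Cmod_ge_0 (f 0 * cexp (p * RtoC 0))). rewrite Rabs_R0, Rmult_0_r, Ropp_0, exp_0 in B1. lra. }
  assert (Df : DomC (M * Kw) (fun u => f u * cexp (p * RtoC u))%C).
  { split.
    - intro u. apply ccr_mult; [exact (rder_ccr _ _ _ (D1 u))|exact (rder_ccr _ _ _ (Ce u))].
    - intro u. eapply Rle_trans; [apply B1|]. rewrite Rmult_assoc. now apply Rmult_le_compat_l. }
  pose proof (DomC_minus _ _ _ _ DP (DomC_scal _ (p * p - 1 / 4)%C _ Df)) as Dd.
  assert (Z : Ig (fun u => P u * cexp (p * RtoC u) - (p * p - 1 / 4) * (f u * cexp (p * RtoC u)))%C = 0).
  (* [G] is the sum of the boundary terms of both integrations; its derivative is the whole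
     integrand at once. *)
  { set (G := fun u => (f1 u * cexp (p * RtoC u) - p * (f u * cexp (p * RtoC u)))%C).
    refine (Ig_ftc _ G _ _ Dd _ _).
    - intro u. unfold G. eapply gder_eq.
      + apply gder_minus; apply rder_mult; [apply D2|apply Ce|apply rder_const|apply rder_mult; [apply D1|apply Ce]].
      + cbv beta. field; repeat split; apply RtoC_neq0; lra.
    - apply clim_eq with (0 - p * 0)%C; [|ring]. apply clim_ext with (f := fun A => (f1 (1 * A)%R * cexp (p * RtoC (1 * A)) - p * (f (1 * A)%R * cexp (p * RtoC (1 * A))))%C).
      { apply filter_forall. intro A. unfold G. now rewrite Rmult_1_l. }
      apply clim_minus; [apply (clim_exp_abs (fun u => f1 u * cexp (p * RtoC u))%C M c); auto|].
      apply clim_mult; [apply clim_const|apply (clim_exp_abs (fun u => f u * cexp (p * RtoC u))%C M c); auto].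
    - apply clim_eq with (0 - p * 0)%C; [|ring]. apply clim_ext with (f := fun A => (f1 (-1 * A)%R * cexp (p * RtoC (-1 * A)) - p * (f (-1 * A)%R * cexp (p * RtoC (-1 * A))))%C).
      { apply filter_forall. intro A. unfold G. now replace (-1 * A) with (- A) by ring. }
      apply clim_minus; [apply (clim_exp_abs (fun u => f1 u * cexp (p * RtoC u))%C M c); auto|].
      apply clim_mult; [apply clim_const|apply (clim_exp_abs (fun u => f u * cexp (p * RtoC u))%C M c); auto]. }
  rewrite (Ig_minus _ _ _ _ DP (DomC_scal _ (p * p - 1 / 4)%C _ Df)), (Ig_scal _ _ _ Df) in Z.
  match type of Z with (?a - ?b)%C = _ => replace a with (a - b + b)%C by ring end. rewrite Z. ring.
Qed.

Lemma rder_of_cder f u d : cder f (RtoC u) d -> rder (fun u => f (RtoC u)) u d.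
Proof. intro H. eapply gder_eq; [apply (rder_comp f RtoC); [exact H|apply rder_id]|]. ring. Qed.

Lemma thK_rder u : rder (fun u => thK (RtoC u)) u (thK1 (RtoC u)).
Proof. apply rder_of_cder, cder_thK, strip_real. Qed.

Lemma Cmod_cexp_it t u : Cmod (cexp (Ci * RtoC t * RtoC u)) = 1.
Proof. rewrite Cmod_cexp, <- exp_0. f_equal. simpl. ring. Qed.

Definition Khat (t : R) : C := Ig (fun u => thK (RtoC u) * cexp (Ci * RtoC (t * u)))%C.

Lemma FT_Phi_Khat t : FT Phi (RtoC t) = (- (RtoC (t ^ 2 + 1 / 4) * Khat t))%C.
Proof.
  destruct (thK_bound 0) as [K [HK B]]; [pose proof PI_RGT_0; lra|]. destruct thK1_bound as [K1 [HK1 B1]].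
  pose proof (parts_twice (fun u => thK (RtoC u)) (fun u => thK1 (RtoC u)) (fun u => RtoC (Phi u)) (Ci * RtoC t) (K + K1) (1 / 2)) as P.
  unfold FT. rewrite P; clear P.
  - replace (Khat t) with (Ig (fun u => thK (RtoC u) * cexp (Ci * RtoC t * RtoC u))%C).
    + replace (Ci * RtoC t * (Ci * RtoC t) - 1 / 4)%C with (- RtoC (t ^ 2 + 1 / 4))%C; [ring|].
      rewrite RtoC_plus, RtoC_div by lra. apply Ceq_parts; simpl; field.
    + apply Ig_ext. intro u. now rewrite RtoC_mult, Cmult_assoc.
  - lra.
  - apply thK_rder.
  - intro u. rewrite <- PhiC_real. apply rder_of_cder, cder_thK1, strip_real.
  - intro u. rewrite Cmod_mult, Cmod_cexp_it, Rmult_1_r. specialize (B (RtoC u) ltac:(rewrite im_RtoC, Rabs_R0; lra)).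
    rewrite re_RtoC in B. replace (1 / 2 * Rabs u) with (Rabs u / 2) by field. pose proof (exp_pos (- (Rabs u / 2))). nra.
  - intro u. rewrite Cmod_mult, Cmod_cexp_it, Rmult_1_r. specialize (B1 u).
    replace (1 / 2 * Rabs u) with (Rabs u / 2) by field. pose proof (exp_pos (- (Rabs u / 2))). nra.
  - apply FT_dom_ex, Kern_Phi.
Qed.

Lemma Cmod_cexp_lin p u : Cmod (cexp (p * RtoC u)) = exp (Re p * u).
Proof. rewrite Cmod_cexp. f_equal. rewrite re_mult, re_RtoC, im_RtoC. ring. Qed.

(** Towards minus infinity [thB] grows like [exp (|u| / 2)], the pole of theta, so the exponential
    needs [Re p > 1/2]; with [p = s - 1/2] this is the half-plane of absolute convergence
    [Re s > 1]. *)
Lemma thB_two_sided p : 1 / 2 < Re p -> exists M c, 0 < c /\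
  (forall u, Cmod (thB (RtoC u) * cexp (p * RtoC u)) <= M * exp (- (c * Rabs u))) /\
  (forall u, Cmod (thB1 (RtoC u) * cexp (p * RtoC u)) <= M * exp (- (c * Rabs u))).
Proof.
  intro Hp. set (c := Re p - 1 / 2). assert (Hc : 0 < c) by (unfold c; lra). pose proof PI_RGT_0.
  destruct (thB_decay 0 (Re p + c) ltac:(lra) ltac:(lra)) as [A [HA B]].
  destruct (thB1_decay (Re p + c) ltac:(lra)) as [A1 [HA1 B1]].
  destruct (thK_bound 0 ltac:(lra)) as [K [HK BK]]. destruct thK1_bound as [K1 [HK1 BK1]].
  exists (A + A1 + K + K1 + 1), c. split; auto.
  assert (Hr : forall u f, 0 <= u -> Cmod f <= (A + A1 + K + K1 + 1) * exp (- ((Re p + c) * u)) ->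
    Cmod (f * cexp (p * RtoC u)) <= (A + A1 + K + K1 + 1) * exp (- (c * Rabs u))).
  { intros u f Hu Hf. rewrite Cmod_mult, Cmod_cexp_lin, Rabs_right by lra.
    replace (- (c * u)) with (- ((Re p + c) * u) + Re p * u) by ring. rewrite exp_plus, <- Rmult_assoc.
    apply Rmult_le_compat_r; [left; apply exp_pos|exact Hf]. }
  assert (Hl : forall u f, u < 0 -> Cmod f <= (A + A1 + K + K1 + 1) * exp (- u / 2) ->
    Cmod (f * cexp (p * RtoC u)) <= (A + A1 + K + K1 + 1) * exp (- (c * Rabs u))).
  { intros u f Hu Hf. rewrite Cmod_mult, Cmod_cexp_lin, Rabs_left by lra.
    replace (- (c * - u)) with (- u / 2 + Re p * u) by (unfold c; field). rewrite exp_plus, <- Rmult_assoc.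
    apply Rmult_le_compat_r; [left; apply exp_pos|exact Hf]. }
  assert (Hexp : forall u, u < 0 -> exp (- (Rabs u / 2)) <= exp (- u / 2)).
  { intros u Hu. rewrite Rabs_left by lra. apply exp_mono. lra. }
  split; intro u; (destruct (Rle_dec 0 u) as [Hu|Hu]; [apply Hr; auto|apply Hl; [lra|]; apply Rnot_le_lt in Hu]).
  - specialize (B (RtoC u) ltac:(simpl; lra) ltac:(rewrite im_RtoC, Rabs_R0; lra)). rewrite re_RtoC in B.
    pose proof (exp_pos (- ((Re p + c) * u))). nra.
  - specialize (BK (RtoC u) ltac:(rewrite im_RtoC, Rabs_R0; lra)). rewrite re_RtoC in BK. specialize (Hexp u Hu).
    replace (thB (RtoC u)) with (thK (RtoC u) + eh (- RtoC u))%C by (unfold thK; rewrite eh_opp; ring).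
    eapply Rle_trans; [apply Cmod_triangle|]. rewrite Cmod_eh, re_opp, re_RtoC. pose proof (exp_pos (- u / 2)). nra.
  - specialize (B1 u Hu). pose proof (exp_pos (- ((Re p + c) * u))). nra.
  - specialize (BK1 u). specialize (Hexp u Hu).
    replace (thB1 (RtoC u)) with (thK1 (RtoC u) - eh (- RtoC u) / 2)%C by (unfold thK1; ring). unfold Cminus.
    eapply Rle_trans; [apply Cmod_triangle|]. unfold Cdiv. rewrite Cmod_opp, Cmod_mult, Cmod_eh, Cmod_inv, Cmod_pos_RtoC, re_opp, re_RtoC by (try apply two_neq0; lra).
    pose proof (exp_pos (- u / 2)). nra.
Qed.

Lemma thB_ccr u : ccr (fun u => thB (RtoC u)) u.
Proof. eapply rder_ccr. apply rder_of_cder, cder_thB, strip_real. Qed.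

Lemma Phi_thB p : 1 / 2 < Re p ->
  Ig (fun u => RtoC (Phi u) * cexp (p * RtoC u))%C = ((p * p - 1 / 4) * Ig (fun u => thB (RtoC u) * cexp (p * RtoC u)))%C.
Proof.
  intro Hp. destruct (thB_two_sided p Hp) as [M [c [Hc [B B1]]]].
  apply (parts_twice (fun u => thB (RtoC u)) (fun u => thB1 (RtoC u)) (fun u => RtoC (Phi u)) p M c); auto.
  - intro u. apply rder_of_cder, cder_thB, strip_real.
  - intro u. rewrite <- PhiC_real. apply rder_of_cder, cder_thB1, strip_real.
  - destruct (FT_dom_ex Phi (- (Ci * p))%C Kern_Phi) as [K HK]. exists K. revert HK. apply DomC_ext. intro u. f_equal. f_equal. f_equal.
    apply Ceq_parts; destruct p; simpl; ring.
Qed.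

Lemma thK_line_dom al : 0 <= al < PI / 4 -> exists K, DomC K (fun u => thK (u, al)).
Proof.
  intro Hal. destruct (thK_bound al Hal) as [K [HK B]]. destruct (exp_abs_wt (1 / 2) ltac:(lra)) as [Kw [HKw Hw]]. exists (K * Kw). split.
  - intro x. apply ccr_hor. assert (H : exists d, cder thK (x, al) d) by (eexists; apply cder_thK; unfold strip; simpl; rewrite Rabs_right; lra).
    destruct H as [d H]. exact (cder_ccc _ _ _ H).
  - intro x. specialize (B (x, al) ltac:(simpl; rewrite Rabs_right; lra)). eapply Rle_trans; [exact B|]. rewrite Rmult_assoc. apply Rmult_le_compat_l; [lra|].
    specialize (Hw x). simpl. replace (Rabs x / 2) with (1 / 2 * Rabs x) by field. exact Hw.
Qed.

(** Moving the line of integration up by [al] multiplies the transform by [exp (al t)]. This yields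
    its exponential decay, and exhibits [exp (al t) Khat t] as the transform of theta on a parallel
    line. *)
Lemma thK_shift al t : 0 <= al < PI / 4 ->
  (RtoC (exp (al * t)) * Khat t)%C = Ig (fun u => thK (u, al) * cexp (Ci * RtoC (t * u)))%C.
Proof.
  intro Hal. destruct (thK_bound al Hal) as [K [HK B]]. destruct (exp_abs_wt (1 / 2) ltac:(lra)) as [Kw [HKw Hw]].
  set (G := fun w => (thK w * cexp (Ci * RtoC t * w))%C).
  assert (Eexp : forall x y, cexp (Ci * RtoC t * (x, y)) = (RtoC (exp (- (y * t))) * cexp (Ci * RtoC (t * x)))%C).
  { intros x y. rewrite <- cexp_RtoC, <- cexp_plus. f_equal. apply Ceq_parts; simpl; ring. }
  assert (S : Ig (fun u => G (u, 0)) = Ig (fun u => G (u, al))).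
  { apply (contour_shift G (K * Kw * exp (al * Rabs t)) al); [lra| |].
    - intros x y Hy. eexists. apply cder_mult; [apply cder_thK; unfold strip; simpl; rewrite Rabs_right; lra|]. apply cder_cexp_lin.
    - intros x y Hy. unfold G. rewrite Cmod_mult, Cmod_cexp. replace (Re (Ci * RtoC t * (x, y))) with (- (t * y)) by (simpl; ring).
      replace (K * Kw * exp (al * Rabs t) * wt x) with (K * (Kw * wt x) * exp (al * Rabs t)) by ring.
      apply Rmult_le_compat; [apply Cmod_ge_0|left; apply exp_pos| |].
      + specialize (B (x, y) ltac:(simpl; rewrite Rabs_right; lra)). eapply Rle_trans; [exact B|]. apply Rmult_le_compat_l; [lra|].
        specialize (Hw x). simpl. replace (Rabs x / 2) with (1 / 2 * Rabs x) by field. exact Hw.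
      + apply exp_mono. pose proof (Rle_abs (- t)) as T. rewrite Rabs_Ropp in T. pose proof (Rabs_pos t). nra. }
  destruct (thK_line_dom al Hal) as [K2 D2].
  pose proof (DomC_wave _ _ t D2) as D.
  unfold Khat. rewrite (Ig_ext _ (fun u => G (u, 0))), S.
  - rewrite (Ig_ext (fun u => G (u, al)) (fun u => RtoC (exp (- (al * t))) * (thK (u, al) * cexp (Ci * RtoC (t * u))))%C).
    + rewrite (Ig_scal _ _ _ D), Cmult_assoc, <- RtoC_mult, <- exp_plus. replace (al * t + - (al * t)) with 0 by ring.
      rewrite exp_0, Cmult_1_l. reflexivity.
    + intro u. unfold G. rewrite Eexp. ring.
  - intro u. unfold G. rewrite Eexp. replace (- (0 * t)) with 0 by ring. rewrite exp_0. change (u, 0) with (RtoC u). ring.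
Qed.

(** * Hardy's theorem *)

Definition Xi (t : R) : R := Re (FT Phi (RtoC t)).
(** The real value of [Khat]. It changes sign exactly with [Xi], and decays fast enough to be
    integrated against [exp (a t)] for every [a < pi / 4]. *)
Definition kh (t : R) : R := - Xi t / (t ^ 2 + 1 / 4).

Lemma quarter_pos t : 0 < t ^ 2 + 1 / 4.
Proof. pose proof (pow2_ge_0 t). lra. Qed.

Lemma FT_Xi t : FT Phi (RtoC t) = RtoC (Xi t).
Proof.
  apply Ceq_parts; [reflexivity|]. rewrite im_RtoC. pose proof (FT_conj Phi (RtoC t) Kern_Phi) as E.
  replace (Cconj (RtoC t)) with (RtoC t) in E by (apply Ceq_parts; simpl; ring).
  apply (f_equal Im) in E. unfold Cconj, Im in E. simpl in E. unfold Im. lra.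
Qed.

Lemma Khat_kh t : Khat t = RtoC (kh t).
Proof.
  pose proof (FT_Phi_Khat t) as E. rewrite FT_Xi in E. unfold kh. pose proof (quarter_pos t). rewrite RtoC_div, RtoC_opp, E by lra.
  field. apply RtoC_neq0. lra.
Qed.

Lemma Xi_even t : Xi (- t) = Xi t.
Proof. unfold Xi. rewrite RtoC_opp, FT_even; auto. apply Kern_Phi. Qed.

Lemma kh_even t : kh (- t) = kh t.
Proof. unfold kh. rewrite Xi_even. f_equal. f_equal. ring. Qed.

Lemma Xi_cont t : continuous Xi t.
Proof.
  apply (ccr_re (fun t => FT Phi (RtoC t))). apply ccr_comp; [apply ccr_id|].
  destruct (FT_cder Phi (RtoC t) Kern_Phi) as [d H]. exact (cder_ccc _ _ _ H).
Qed.

Lemma kh_cont t : continuous kh t.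
Proof.
  unfold kh, Rdiv. apply (continuous_mult (K := R_AbsRing) (fun t => - Xi t) (fun t => / (t ^ 2 + 1 / 4))).
  - apply (continuous_opp (V := R_NormedModule)), Xi_cont.
  - apply (ex_derive_continuous (V := R_NormedModule)). auto_derive. pose proof (quarter_pos t). lra.
Qed.

Lemma kh_bound al : 0 <= al < PI / 4 -> exists K, 0 < K /\ forall t, Rabs (kh t) <= K * exp (- (al * Rabs t)).
Proof.
  intro Hal. destruct (thK_line_dom al Hal) as [K D]. pose proof (DomC_K _ _ D). exists (K * PI + 1). pose proof PI_RGT_0. split; [nra|].
  intro t. rewrite (even_abs kh t kh_even). set (x := Rabs t).
  rewrite <- Cmod_R, <- Khat_kh. pose proof (thK_shift al x Hal) as E.
  pose proof (DomC_wave _ _ x D) as D2. pose proof (Ig_bound _ _ D2) as B. cbv beta in B. rewrite <- E, Cmod_mult, Cmod_pos_RtoC in B by (left; apply exp_pos).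
  rewrite exp_Ropp. pose proof (exp_pos (al * x)). apply Rmult_le_reg_l with (exp (al * x)); auto.
  replace (exp (al * x) * ((K * PI + 1) * / exp (al * x))) with (K * PI + 1) by (field; lra). lra.
Qed.

Lemma kh_dom al M g : 0 <= al < PI / 4 -> (forall t, continuous g t) -> (forall t, Rabs (g t) <= M * exp (al * Rabs t)) ->
  exists K, DomC K (fun t => RtoC (g t * kh t)).
Proof.
  intros Hal Hg HM. set (al' := (al + PI / 4) / 2). destruct (kh_bound al') as [K [HK B]]; [unfold al'; lra|].
  destruct (exp_abs_wt (al' - al)) as [Kw [HKw Hw]]; [unfold al'; lra|]. exists (M * K * Kw). split.
  - intro t. apply ccr_RtoC. apply (continuous_mult (K := R_AbsRing) g kh); auto. apply kh_cont.
  - intro t. rewrite Cmod_R, Rabs_mult. specialize (HM t). specialize (B t). specialize (Hw t).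
    assert (HM0 : 0 <= M) by (pose proof (Rabs_pos (g t)); pose proof (exp_pos (al * Rabs t)); apply Rnot_lt_le; intro; nra).
    apply Rle_trans with (M * exp (al * Rabs t) * (K * exp (- (al' * Rabs t)))).
    + apply Rmult_le_compat; auto; apply Rabs_pos.
    + replace (M * exp (al * Rabs t) * (K * exp (- (al' * Rabs t)))) with (M * K * (exp (al * Rabs t) * exp (- (al' * Rabs t)))) by ring.
      rewrite <- exp_plus. replace (al * Rabs t + - (al' * Rabs t)) with (- ((al' - al) * Rabs t)) by ring.
      rewrite (Rmult_assoc (M * K)). apply Rmult_le_compat_l; auto. apply Rmult_le_pos; lra.
Qed.

Lemma exp_lin_cont a t : continuous (fun t => exp (a * t)) t.
Proof. rcont. Qed.

Lemma exp_lin_abs a t : 0 <= a -> exp (a * t) <= exp (a * Rabs t).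
Proof. intro. apply exp_mono. apply Rmult_le_compat_l; auto. apply Rle_abs. Qed.

(** Inversion on the line at height [al], evaluated at abscissa 0: the moment with weight
    [exp (al t)] is a value of theta on the imaginary axis. *)
Lemma kh_inv al : 0 <= al < PI / 4 -> Ig (fun t => RtoC (exp (al * t) * kh t)) = (RtoC (2 * PI) * thK (0%R, al))%C.
Proof.
  intro Hal. destruct (thK_line_dom al Hal) as [K D].
  destruct (kh_dom al 1 (fun t => exp (al * t)) Hal (exp_lin_cont al)) as [K' D'].
  { intro t. rewrite Rabs_right by (apply Rle_ge; left; apply exp_pos). rewrite Rmult_1_l. apply exp_lin_abs. lra. }
  apply (inversion_at_0 (fun u => thK (u, al)) _ K K' D D').
  intro t. rewrite RtoC_mult, <- Khat_kh. now apply thK_shift.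
Qed.

(** * Theta near the boundary point [i] *)

Lemma cexp_mPI : cexp (- (RtoC PI * Ci)) = RtoC (-1).
Proof.
  unfold cexp. simpl. replace (- (PI * 0 - 0 * 1)) with 0 by ring. replace (- (PI * 1 + 0 * 0)) with (- PI) by ring.
  rewrite exp_0, cos_neg, sin_neg, cos_PI, sin_PI. apply Ceq_parts; simpl; ring.
Qed.

Lemma thk_quarter Z n : thk (Ci + Z) n = (RtoC ((-1) ^ S n) * thk Z n)%C.
Proof.
  assert (E : cexp (- (RtoC PI * RtoC (INR (S n) ^ 2) * Ci)) = RtoC ((-1) ^ S n)).
  { replace (INR (S n) ^ 2) with (INR (S n * S n)) by (rewrite mult_INR; ring).
    replace (- (RtoC PI * RtoC (INR (S n * S n)) * Ci))%C with (RtoC (INR (S n * S n)) * - (RtoC PI * Ci))%C by ring.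
    rewrite <- cexp_pow, cexp_mPI, <- RtoC_pow, pow_mult. f_equal.
    destruct (Nat.Even_or_Odd (S n)) as [[k Hk]|[k Hk]]; rewrite Hk.
    - rewrite pow_1_even. apply pow1.
    - rewrite Nat.add_1_r, pow_1_odd. rewrite pow_1_odd. reflexivity. }
  unfold thk. rewrite <- E, <- cexp_plus. f_equal. ring.
Qed.

Lemma thk_four Z k : thk (4 * Z) k = thk Z (2 * k + 1).
Proof.
  unfold thk. f_equal. replace (INR (S (2 * k + 1))) with (2 * INR (S k)).
  - rewrite Rpow_mult_distr, RtoC_mult. replace (RtoC (2 ^ 2)) with (RtoC 4) by (f_equal; ring). ring.
  - replace (S (2 * k + 1)) with (2 * S k)%nat by lia. rewrite mult_INR. reflexivity.
Qed.

Lemma psi_lim Z : 0 < Re Z -> clim eventually (csum (thk Z)) (psi Z).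
Proof.
  intro H. rewrite <- psij0. generalize (psij_lim 0 Z H). apply clim_ext. apply filter_forall. intro N.
  apply csum_ext. intros n _. apply thkj0.
Qed.

Lemma clim_even_sub a l : clim eventually a l -> clim eventually (fun N => a (2 * N)%nat) l.
Proof. intros H e He. destruct (H e He) as [N HN]. exists N. intros n Hn. apply HN. lia. Qed.

(** Adding [i] multiplies the [n]-th term by [(-1)^n]. The alternating sum is twice the sum over
    even [n], which is theta at [4 Z], minus the full sum; partial sums of even length make this an
    identity of finite sums. *)
Lemma psi_quarter Z : 0 < Re Z -> psi (Ci + Z) = (2 * psi (4 * Z) - psi Z)%C.
Proof.
  intro HZ. assert (H1 : 0 < Re (Ci + Z)%C) by (rewrite re_plus; change (Re Ci) with 0; lra).
  assert (H4 : 0 < Re (4 * Z)%C) by (rewrite re_mult, re_RtoC, im_RtoC; lra).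
  apply (clim_unique (F := eventually) (fun N => csum (thk (Ci + Z)) (2 * N))).
  - apply clim_even_sub. now apply psi_lim.
  - apply clim_ext with (f := fun N => (2 * csum (thk (4 * Z)) N - csum (thk Z) (2 * N))%C).
    + apply filter_forall. intro N. induction N; [simpl; ring|].
      replace (2 * S N)%nat with (S (S (2 * N))) by lia. cbn [csum]. rewrite <- IHN, !thk_quarter, thk_four.
      rewrite pow_1_odd. replace (S (S (2 * N))) with (2 * S N)%nat by lia. rewrite pow_1_even.
      replace (S (2 * N)) with (2 * N + 1)%nat by lia.
      replace (RtoC (-1)) with (- (1))%C by (apply Ceq_parts; simpl; ring). ring.
    + apply clim_minus; [apply clim_mult; [apply clim_const|now apply psi_lim]|apply clim_even_sub; now apply psi_lim].
Qed.

Lemma thE_psi w : thE w = (eh w * (1 + 2 * psi (e2 w)))%C.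
Proof. unfold thE, thB. rewrite psij0. ring. Qed.

Lemma theta_inv w : strip w -> (1 + 2 * psi (e2 w))%C = (cexp (- w) * (1 + 2 * psi (e2 (- w))))%C.
Proof.
  intro H. pose proof (thE_even w H) as E. rewrite !thE_psi in E.
  assert (Ew : (cexp (- w) * eh w)%C = eh (- w)).
  { unfold eh. rewrite <- cexp_plus. f_equal. field; apply two_neq0. }
  assert (Hn : eh w <> RtoC 0) by apply cexp_neq0.
  replace (1 + 2 * psi (e2 w))%C with (eh w * (1 + 2 * psi (e2 w)) / eh w)%C by (field; auto).
  rewrite <- E, <- Ew. field; auto.
Qed.

Lemma pow_le_exp k y : 0 <= y -> y ^ S k <= (4 * INR (S k)) ^ S k * exp (y / 4).
Proof.
  intro Hy. pose proof (INR_S_ge1 k) as H1. set (n := INR (S k)) in *.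
  assert (E : exp (y / 4) = exp (y / (4 * n)) ^ S k) by (rewrite exp_pow; fold n; f_equal; field; lra).
  rewrite E, <- Rpow_mult_distr. apply pow_incr. split; auto.
  pose proof (exp_ge_1p (y / (4 * n))). replace y with (4 * n * (y / (4 * n))) at 1 by (field; lra). apply Rmult_le_compat_l; lra.
Qed.

(* At [i beta] with [beta = pi/4 - eta], [exp (2 i beta) = i + delta] where
   [delta = 2 sin eta exp(- i eta)]; the inversion formula at [delta] and
   [4 delta] makes theta exponentially small there. *)
Lemma thE_edge eta : 0 < eta <= PI / 4 -> let y := / (2 * sin eta) in
  Cmod (thE (0, PI / 4 - eta)) <= 4 / (1 - exp (- (PI * (1 / 16)))) * (1 + y) * exp (- (y / 4)).
Proof.
  intros He y. pose proof PI2_3_2 as HPI.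
  assert (Hsin : 0 < sin eta) by (apply sin_gt_0; lra).
  assert (Hcos : 1 / 2 <= cos eta).
  { rewrite <- cos_PI3. destruct (Req_dec eta (PI / 3)) as [->|]; [lra|]. left. apply cos_decreasing_1; lra. }
  assert (Hs1 : sin eta <= 1) by apply SIN_bound.
  assert (Hy : 1 / 2 <= y) by (unfold y; replace (1 / 2) with (/ 2) by field; apply Rinv_le_contravar; lra).
  set (w := ((- / 2 * ln y)%R, (- eta / 2)%R) : C).
  assert (Hw : forall d : R, strip (w + RtoC d)%C).
  { intro d. unfold strip, w. rewrite im_plus, im_RtoC. simpl. rewrite Rplus_0_r, Rabs_left; lra. }
  assert (Hwn : strip w) by (replace w with (w + RtoC 0)%C by ring; apply Hw).
  assert (Eexp : exp (- Re w) * exp (- Re w) = y).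
  { rewrite <- exp_plus. unfold w. simpl. replace (- (- / 2 * ln y) + - (- / 2 * ln y)) with (ln y) by field. apply exp_ln. lra. }
  assert (Ed : e2 (0, PI / 4 - eta) = (Ci + e2 w)%C).
  { assert (E2 : exp (2 * Re w) = 2 * sin eta).
    { replace (2 * Re w) with (- ln y) by (unfold w; simpl; field). rewrite exp_Ropp, exp_ln by lra. unfold y. field. lra. }
    apply Ceq_parts.
    - rewrite re_plus, !re_e2, E2. unfold w. simpl. rewrite Rmult_0_r, exp_0.
      replace (2 * (PI / 4 - eta)) with (PI / 2 - 2 * eta) by field. rewrite cos_shift, sin_2a.
      replace (2 * (- eta / 2)) with (- eta) by field. rewrite cos_neg. ring.
    - rewrite im_plus. unfold e2, cexp. rewrite !im_mult, !re_mult, !re_RtoC, !im_RtoC. unfold Im at 1, Im at 3. simpl Im. simpl Re. cbn [fst snd].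
      replace (2 * 0 - 0 * (PI / 4 - eta)) with 0 by ring.
      replace (2 * (PI / 4 - eta) + 0 * 0) with (PI / 2 - 2 * eta) by field. rewrite exp_0, sin_shift.
      match goal with |- context [exp ?x] => replace (exp x) with (2 * sin eta) by (rewrite <- E2; f_equal; unfold w; simpl; ring) end.
      match goal with |- context [_ * sin ?x] => replace x with (- eta) by field end.
      rewrite sin_neg, cos_2a_sin. ring. }
  assert (Hpos : 0 < Re (e2 w)) by now apply re_e2_pos.
  rewrite thE_psi, Ed, psi_quarter by auto.
  assert (E4 : (4 * e2 w)%C = e2 (w + RtoC (ln 2))).
  { unfold e2. replace (2 * (w + RtoC (ln 2)))%C with (2 * w + RtoC (ln 2 + ln 2))%C by (rewrite RtoC_plus; ring).
    rewrite cexp_plus, cexp_RtoC, exp_plus, exp_ln by lra. replace (2 * 2) with 4 by ring. ring. }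
  replace (1 + 2 * (2 * psi (4 * e2 w) - psi (e2 w)))%C with (2 * (1 + 2 * psi (4 * e2 w)) - (1 + 2 * psi (e2 w)))%C by ring.
  rewrite E4, (theta_inv _ Hwn), (theta_inv _ (Hw (ln 2))).
  replace (cexp (- (w + RtoC (ln 2)))) with (cexp (- w) / 2)%C.
  2:{ replace (- (w + RtoC (ln 2)))%C with (- w + - RtoC (ln 2))%C by ring. rewrite cexp_plus, (cexp_opp (RtoC (ln 2))), cexp_RtoC, exp_ln by lra. reflexivity. }
  set (p1 := psi (e2 (- (w + RtoC (ln 2))))). set (p2 := psi (e2 (- w))).
  replace (2 * (cexp (- w) / 2 * (1 + 2 * p1)) - cexp (- w) * (1 + 2 * p2))%C with (2 * cexp (- w) * (p1 - p2))%C by (field; apply two_neq0).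
  rewrite !Cmod_mult, Cmod_eh, Cmod_cexp, re_opp, Cmod_pos_RtoC by lra. simpl (Re (0, _)). replace (0 / 2) with 0 by field. rewrite exp_0, Rmult_1_l.
  assert (R2 : Re (e2 (- w)) = y * cos eta).
  { rewrite re_e2, re_opp, im_opp. f_equal; [rewrite <- Eexp, <- exp_plus; f_equal; ring|]. f_equal. unfold w. simpl. field. }
  assert (R1 : Re (e2 (- (w + RtoC (ln 2)))) = y * cos eta / 4).
  { rewrite re_e2, re_opp, im_opp, re_plus, im_plus, re_RtoC, im_RtoC. replace (2 * - (Re w + ln 2)) with (- Re w + - Re w + - (ln 2 + ln 2)) by ring.
    rewrite !exp_plus, Eexp, exp_Ropp, exp_plus, exp_ln by lra. replace (2 * - (Im w + 0)) with eta by (unfold w; simpl; field). field. }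
  assert (Hyc : y / 2 <= y * cos eta) by (unfold Rdiv; apply Rmult_le_compat_l; lra).
  pose proof (psi_bound (e2 (- w)) (1 / 16) ltac:(lra) ltac:(lra)) as B2. fold p2 in B2.
  pose proof (psi_bound (e2 (- (w + RtoC (ln 2)))) (1 / 16) ltac:(lra) ltac:(lra)) as B1. fold p1 in B1.
  pose proof (exp_PI_lt1 (1 / 16) ltac:(lra)) as HC. set (m := / (1 - exp (- (PI * (1 / 16))))). assert (Hm : 0 < m) by (apply Rinv_0_lt_compat; lra).
  unfold Rdiv in B1, B2. fold m in B1, B2.
  assert (X : forall r, y / 8 <= r -> exp (- (PI * r)) <= exp (- (y / 4))) by (intros r Hr; apply exp_mono; nra).
  assert (B12 : Cmod (p1 - p2) <= 2 * m * exp (- (y / 4))).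
  { unfold Cminus. eapply Rle_trans; [apply Cmod_triangle|]. rewrite Cmod_opp.
    pose proof (X (Re (e2 (- w))) ltac:(lra)) as X2. pose proof (X (Re (e2 (- (w + RtoC (ln 2))))) ltac:(lra)) as X1.
    apply Rle_trans with (exp (- (y / 4)) * m + exp (- (y / 4)) * m); [|right; ring].
    apply Rplus_le_compat; (eapply Rle_trans; [eassumption|]; apply Rmult_le_compat_r; [lra|assumption]). }
  assert (Hq : exp (- Re w) <= 1 + y) by (pose proof (exp_pos (- Re w)); nra).
  unfold Rdiv at 1. fold m. pose proof (exp_pos (- (y / 4))).
  replace (4 * m * (1 + y) * exp (- (y / 4))) with (2 * (1 + y) * (2 * m * exp (- (y / 4)))) by ring.
  apply Rmult_le_compat; auto; [pose proof (exp_pos (- Re w)); lra|apply Cmod_ge_0|lra].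
Qed.

Lemma thE_decay N : exists K, 0 < K /\ forall eta, 0 < eta <= PI / 4 -> Cmod (thE (0, PI / 4 - eta)) <= K * eta ^ N.
Proof.
  pose proof (exp_PI_lt1 (1 / 16) ltac:(lra)) as HC. remember (4 / (1 - exp (- (PI * (1 / 16))))) as m eqn:Em.
  assert (Hm : 0 < m) by (rewrite Em; apply Rdiv_lt_0_compat; lra).
  remember ((4 * INR (S N)) ^ S N) as q eqn:Eq. assert (Hq : 0 < q) by (rewrite Eq; apply pow_lt; pose proof (INR_S_ge1 N); lra).
  exists (m * 3 * q * 2 ^ N). pose proof (pow_lt 2 N ltac:(lra)) as H2.
  split; [apply Rmult_lt_0_compat; auto; apply Rmult_lt_0_compat; auto; lra|]. intros eta He. eapply Rle_trans; [now apply thE_edge|]. rewrite <- Em.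
  assert (Hsin : 0 < sin eta) by (apply sin_gt_0; pose proof PI2_3_2; lra).
  assert (Hs1 : sin eta <= 1) by apply SIN_bound. assert (Hse : sin eta <= eta) by (left; apply sin_lt_x; lra).
  set (s := 2 * sin eta) in *. assert (Hs : 0 < s) by (unfold s; lra). assert (Hy : 1 / 2 <= / s).
  { replace (1 / 2) with (/ 2) by field. apply Rinv_le_contravar; unfold s; lra. }
  pose proof (pow_le_exp N (/ s) ltac:(lra)) as P. rewrite <- Eq in P. set (E := exp (/ s / 4)) in *. assert (HE : 0 < E) by apply exp_pos.
  rewrite exp_Ropp. fold E. assert (Hsn : 0 < s ^ N) by now apply pow_lt.
  assert (P2 : / s * / E <= q * s ^ N).
  { simpl in P. rewrite pow_inv in P. apply Rmult_le_reg_r with E; auto. rewrite Rmult_assoc, Rinv_l, Rmult_1_r by lra.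
    apply Rmult_le_reg_r with (/ s ^ N); [now apply Rinv_0_lt_compat|].
    replace (q * s ^ N * E * / s ^ N) with (q * E) by (field; lra). exact P. }
  assert (Hsle : s ^ N <= (2 * eta) ^ N) by (apply pow_incr; unfold s; lra). rewrite Rpow_mult_distr in Hsle.
  assert (0 < / E) by now apply Rinv_0_lt_compat.
  apply Rle_trans with (m * (3 * (/ s * / E))).
  - rewrite Rmult_assoc. apply Rmult_le_compat_l; [lra|]. rewrite <- Rmult_assoc. apply Rmult_le_compat_r; lra.
  - replace (m * 3 * q * 2 ^ N * eta ^ N) with (m * (3 * (q * (2 ^ N * eta ^ N)))) by ring.
    apply Rmult_le_compat_l; [lra|]. apply Rmult_le_compat_l; [lra|]. eapply Rle_trans; [exact P2|]. apply Rmult_le_compat_l; lra.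
Qed.

(* Second differences: they turn [exp (a t)] into [exp (a t) (2 cosh (e t) - 2)],
   which replaces the derivatives of even order in Hardy's argument. *)
Fixpoint Dl (e : R) (m : nat) (g : R -> C) (a : R) : C :=
  match m with O => g a | S m => (Dl e m g (a + e)%R + Dl e m g (a - e)%R - 2 * Dl e m g a)%C end.

Lemma Dl_minus e m g h : forall a, Dl e m (fun b => g b - h b)%C a = (Dl e m g a - Dl e m h a)%C.
Proof. induction m; intro a; simpl; [reflexivity|]. rewrite !IHm. ring. Qed.

Lemma Dl_ext e m g h : 0 <= e -> forall a, (forall b, a - INR m * e <= b <= a + INR m * e -> g b = h b) -> Dl e m g a = Dl e m h a.
Proof.
  intro He. induction m; intros a H; [apply H; simpl; lra|]. cbn [Dl]. rewrite S_INR in H. pose proof (pos_INR m).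
  rewrite !IHm; auto; intros b Hb; apply H; nra.
Qed.

Lemma Dl_bound e m g M : 0 <= e -> forall a, (forall b, a - INR m * e <= b <= a + INR m * e -> Cmod (g b) <= M) ->
  Cmod (Dl e m g a) <= 4 ^ m * M.
Proof.
  intro He. induction m; intros a H; [simpl; rewrite Rmult_1_l; apply H; simpl; lra|]. cbn [Dl]. rewrite S_INR in H. pose proof (pos_INR m).
  assert (H1 : Cmod (Dl e m g (a + e)) <= 4 ^ m * M) by (apply IHm; intros b Hb; apply H; nra).
  assert (H2 : Cmod (Dl e m g (a - e)) <= 4 ^ m * M) by (apply IHm; intros b Hb; apply H; nra).
  assert (H3 : Cmod (Dl e m g a) <= 4 ^ m * M) by (apply IHm; intros b Hb; apply H; nra).
  unfold Cminus. eapply Rle_trans; [apply Cmod_triangle|]. rewrite Cmod_opp, Cmod_mult, Cmod_pos_RtoC by lra.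
  pose proof (Cmod_triangle (Dl e m g (a + e)) (Dl e m g (a - e))). simpl pow. lra.
Qed.

Lemma Dl_cos e m : forall a, Dl e m (fun b => RtoC (2 * cos (b / 2))) a = RtoC ((2 * cos (e / 2) - 2) ^ m * (2 * cos (a / 2))).
Proof.
  induction m; intro a; cbn [Dl pow]; [now rewrite Rmult_1_l|]. rewrite !IHm.
  replace ((a + e) / 2) with (a / 2 + e / 2) by field. replace ((a - e) / 2) with (a / 2 - e / 2) by field. rewrite cos_plus, cos_minus.
  rewrite <- !RtoC_mult, <- RtoC_plus, <- RtoC_minus. f_equal. ring.
Qed.

Lemma one_minus_cos e : 0 < e -> Rabs (2 * cos (e / 2) - 2) <= e ^ 2 / 4.
Proof.
  intro He. replace (e / 2) with (2 * (e / 4)) by field. rewrite cos_2a_sin. set (s := sin (e / 4)).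
  assert (Hs : Rabs s <= e / 4).
  { apply Rabs_le. split.
    - unfold s. pose proof (sin_lt_x (e / 4) ltac:(lra)). destruct (Rle_dec (- (e / 4)) (sin (e / 4))) as [|N]; auto. exfalso. apply Rnot_le_lt in N.
      pose proof (SIN_bound (e / 4)). pose proof PI2_3_2. assert (e / 4 < PI) by lra. pose proof (sin_gt_0 (e / 4) ltac:(lra) ltac:(lra)). lra.
    - left. apply sin_lt_x. lra. }
  assert (Hs2 : s * s <= (e / 4) * (e / 4)).
  { rewrite <- (Rabs_right (s * s)) by (apply Rle_ge, Rle_0_sqr). rewrite Rabs_mult. apply Rmult_le_compat; auto; apply Rabs_pos. }
  pose proof (Rle_0_sqr s) as H0. unfold Rsqr in H0. apply Rabs_le. split; nra.
Qed.

Lemma thK_imag b : thK (0, b) = (thE (0, b) - RtoC (2 * cos (b / 2)))%C.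
Proof.
  assert (E : forall b, eh (0, b) = (cos (b / 2), sin (b / 2))).
  { intro c. unfold eh. replace ((0, c) / 2)%C with (Ci * RtoC (c / 2))%C; [apply cexp_Ci|].
    rewrite RtoC_div by lra. unfold Cdiv. rewrite Cmult_assoc. f_equal. apply Ceq_parts; simpl; ring. }
  rewrite thK_thE. replace (- (0, b))%C with ((0%R, (- b)%R) : C) by (apply Ceq_parts; simpl; ring). rewrite !E.
  replace (- b / 2) with (- (b / 2)) by field. rewrite cos_neg, sin_neg. destruct (thE (0, b)). apply Ceq_parts; simpl; ring.
Qed.

Definition dw (e t : R) : R := exp (e * t) + exp (- (e * t)) - 2.

Lemma dw_cosh e t : dw e t = 2 * cosh (e * t) - 2.
Proof. unfold dw, cosh. field. Qed.

Lemma dw_ge e t : (e * t) ^ 2 <= dw e t.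
Proof. rewrite dw_cosh. pose proof (cosh_ge (e * t)). lra. Qed.

Lemma dw_pos e t : 0 <= dw e t.
Proof. eapply Rle_trans; [apply (pow2_ge_0 (e * t))|apply dw_ge]. Qed.

Lemma exp_half : exp (1 / 2) <= 9 / 4.
Proof.
  assert (E : exp (1 / 2) * exp (1 / 2) = exp 1) by (rewrite <- exp_plus; f_equal; field). pose proof exp_le_3. pose proof (exp_pos (1 / 2)). nra.
Qed.

(** From [2 (exp (x/2) - 1) <= x exp (x/2)] with [x = (e t)^2]. The crude constant suffices, as
    anything below 4 does: the opposing lower bound is taken at twice the abscissa. *)
Lemma dw_le e t : (e * t) ^ 2 <= 1 -> dw e t <= 9 / 4 * (e * t) ^ 2.
Proof.
  intro H. rewrite dw_cosh. pose proof (cosh_le_gauss (e * t)) as C1. set (x := (e * t) ^ 2) in *. assert (Hx : 0 <= x) by apply pow2_ge_0.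
  assert (E1 : exp (x / 2) - 1 <= x / 2 * exp (x / 2)).
  { pose proof (exp_ge_1p (- (x / 2))) as G. rewrite exp_Ropp in G. pose proof (exp_pos (x / 2)) as P.
    assert ((1 + - (x / 2)) * exp (x / 2) <= 1).
    { replace 1 with (/ exp (x / 2) * exp (x / 2)) at 2 by (field; lra). apply Rmult_le_compat_r; lra. }
    lra. }
  assert (E2 : exp (x / 2) <= 9 / 4) by (eapply Rle_trans; [apply exp_mono|apply exp_half]; lra).
  assert (x / 2 * exp (x / 2) <= x / 2 * (9 / 4)) by (apply Rmult_le_compat_l; lra). lra.
Qed.

Lemma dw_le_exp e t : 0 <= e -> dw e t <= 2 * exp (e * Rabs t).
Proof.
  intro He. unfold dw. pose proof (exp_lin_abs e t He). pose proof (exp_lin_abs e (- t) He) as H1. rewrite Rabs_Ropp in H1.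
  replace (e * - t) with (- (e * t)) in H1 by ring. lra.
Qed.

Lemma dw_dom e m a : 0 <= e -> 0 <= a -> a + INR m * e < PI / 4 -> exists K, DomC K (fun t => RtoC (exp (a * t) * dw e t ^ m * kh t)).
Proof.
  intros He Ha H. pose proof (pos_INR m) as Hm. assert (0 <= INR m * e) by now apply Rmult_le_pos.
  apply (kh_dom (a + INR m * e) (2 ^ m)); [lra| |].
  - intro t. unfold dw. rcont.
  - intro t. pose proof (dw_pos e t) as D0. rewrite Rabs_right by (apply Rle_ge, Rmult_le_pos; [left; apply exp_pos|now apply pow_le]).
    apply Rle_trans with (exp (a * Rabs t) * (2 * exp (e * Rabs t)) ^ m).
    + apply Rmult_le_compat; [left; apply exp_pos|now apply pow_le|now apply exp_lin_abs|]. apply pow_incr. split; auto. now apply dw_le_exp.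
    + rewrite Rpow_mult_distr, exp_pow. right.
      replace (exp (a * Rabs t) * (2 ^ m * exp (INR m * (e * Rabs t)))) with (2 ^ m * (exp (a * Rabs t) * exp (INR m * (e * Rabs t)))) by ring.
      rewrite <- exp_plus. f_equal. f_equal. ring.
Qed.

(** Each second difference of [exp (a t)] in [a] multiplies it by [dw e t]. The two bounds on [a]
    keep all sample points inside [[0, pi/4)], where the inversion formula is available. *)
Lemma kh_Dl e m : 0 <= e -> forall a, INR m * e <= a -> a + INR m * e < PI / 4 ->
  Ig (fun t => RtoC (exp (a * t) * dw e t ^ m * kh t)) = (RtoC (2 * PI) * Dl e m (fun b => thK (0%R, b)) a)%C.
Proof.
  intro He. induction m; intros a H1 H2.
  - simpl in *. rewrite <- kh_inv by lra. apply Ig_ext. intro t. f_equal. ring.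
  - rewrite S_INR in H1, H2. pose proof (pos_INR m) as Hm. assert (H0 : 0 <= INR m * e) by now apply Rmult_le_pos.
    assert (Ep : a + e + INR m * e < PI / 4) by lra. assert (Em : a - e + INR m * e < PI / 4) by lra. assert (E0 : a + INR m * e < PI / 4) by lra.
    destruct (dw_dom e m (a + e) He ltac:(lra) Ep) as [Kp Dp]. destruct (dw_dom e m (a - e) He ltac:(lra) Em) as [Km Dm].
    destruct (dw_dom e m a He ltac:(lra) E0) as [K0 D0]. pose proof (DomC_scal _ 2%C _ D0) as D2.
    cbn [Dl]. replace (RtoC (2 * PI) * (Dl e m (fun b => thK (0%R, b)) (a + e)%R + Dl e m (fun b => thK (0%R, b)) (a - e)%R - 2 * Dl e m (fun b => thK (0%R, b)) a))%C
      with (RtoC (2 * PI) * Dl e m (fun b => thK (0%R, b)) (a + e)%R + RtoC (2 * PI) * Dl e m (fun b => thK (0%R, b)) (a - e)%R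
        - 2 * (RtoC (2 * PI) * Dl e m (fun b => thK (0%R, b)) a))%C by ring.
    rewrite <- !IHm by lra. rewrite <- (Ig_scal _ _ _ D0), <- (Ig_plus _ _ _ _ Dp Dm), <- (Ig_minus _ _ _ _ (DomC_plus _ _ _ _ Dp Dm) D2).
    apply Ig_ext. intro t. rewrite <- RtoC_mult, <- RtoC_plus, <- RtoC_minus. f_equal.
    replace ((a + e) * t) with (a * t + e * t) by ring. replace ((a - e) * t) with (a * t + - (e * t)) by ring. rewrite !exp_plus.
    simpl pow. unfold dw at 1. ring.
Qed.

(** With [M = m + 1], all sample points lie at distance between [M e] and [3 M e] from [pi / 4].
    There theta is of order [e^(2 M + 1)], which for small [e] is below [e^(2 M)], and the
    differences of the cosine are at most [2 e^(2 M)]; the factor [2 pi] of the inversion gives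
    [6 pi]. *)
Lemma kh_moment m : exists e0, 0 < e0 /\ forall e, 0 < e < e0 ->
  let a := PI / 4 - 2 * (INR (S m) * e) in 0 <= a /\ a + INR (S m) * e < PI / 4 /\
  Cmod (Ig (fun t => RtoC (exp (a * t) * dw e t ^ S m * kh t))) <= 6 * PI * e ^ (2 * S m).
Proof.
  set (M := S m). pose proof (INR_S_ge1 m) as HM. fold M in HM. destruct (thE_decay (2 * M + 1)) as [K [HK B]]. pose proof PI2_3_2 as HPI.
  set (Q := 4 ^ M * K * (3 * INR M) ^ (2 * M + 1)).
  assert (HQ : 0 < Q) by (unfold Q; apply Rmult_lt_0_compat; [apply Rmult_lt_0_compat; auto; apply pow_lt; lra|apply pow_lt; lra]).
  (* The first bound keeps the sample points positive; the second lets one factor [e] absorb the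
     constant [Q] of the theta part. *)
  exists (Rmin (/ (8 * INR M)) (/ Q)). split; [apply Rmin_glb_lt; apply Rinv_0_lt_compat; lra|].
  intros e [He He0] a. pose proof (Rmin_l (/ (8 * INR M)) (/ Q)). pose proof (Rmin_r (/ (8 * INR M)) (/ Q)).
  assert (HMe : INR M * e <= 1 / 8).
  { replace (1 / 8) with (INR M * / (8 * INR M)) by (field; lra). apply Rmult_le_compat_l; lra. }
  assert (HMe0 : 0 < INR M * e) by (apply Rmult_lt_0_compat; lra).
  assert (HQe : Q * e <= 1). { apply Rle_trans with (Q * / Q); [apply Rmult_le_compat_l; lra|]. rewrite Rinv_r; lra. }
  assert (Ha : INR M * e <= a /\ a + INR M * e < PI / 4) by (unfold a; lra). split; [lra|]. split; [lra|].
  rewrite kh_Dl by lra. rewrite (Dl_ext e M _ (fun b => thE (0%R, b) - RtoC (2 * cos (b / 2)))%C) by (try lra; intros; apply thK_imag).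
  rewrite Dl_minus, Dl_cos, Cmod_mult, Cmod_pos_RtoC by lra.
  assert (H1 : Cmod (Dl e M (fun b => thE (0%R, b)) a) <= e ^ (2 * M)).
  { eapply Rle_trans; [apply (Dl_bound e M _ (K * (3 * INR M * e) ^ (2 * M + 1))); [lra|]|].
    - intros b Hb. replace b with (PI / 4 - (PI / 4 - b)) by ring. eapply Rle_trans; [apply B; unfold a in *; lra|].
      apply Rmult_le_compat_l; [lra|]. apply pow_incr. unfold a in *. lra.
    - rewrite Rpow_mult_distr. replace (4 ^ M * (K * ((3 * INR M) ^ (2 * M + 1) * e ^ (2 * M + 1)))) with (Q * e ^ (2 * M + 1)) by (unfold Q; ring).
      rewrite pow_add, pow_1. pose proof (pow_lt e (2 * M) He). replace (Q * (e ^ (2 * M) * e)) with (Q * e * e ^ (2 * M)) by ring. nra. }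
  assert (H2 : Cmod (RtoC ((2 * cos (e / 2) - 2) ^ M * (2 * cos (a / 2)))) <= 2 * e ^ (2 * M)).
  { rewrite Cmod_R, Rabs_mult, <- RPow_abs. rewrite (Rmult_comm 2 (e ^ (2 * M))). apply Rmult_le_compat; [apply pow_le, Rabs_pos|apply Rabs_pos| |].
    - rewrite pow_mult. apply pow_incr. split; [apply Rabs_pos|]. eapply Rle_trans; [now apply one_minus_cos|]. pose proof (pow2_ge_0 e). lra.
    - apply Rabs_le. pose proof (COS_bound (a / 2)). lra. }
  unfold Cminus. replace (6 * PI * e ^ (2 * M)) with (2 * PI * (e ^ (2 * M) + 2 * e ^ (2 * M))) by ring.
  apply Rmult_le_compat_l; [lra|]. eapply Rle_trans; [apply Cmod_triangle|]. rewrite Cmod_opp. lra.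
Qed.

Lemma constant_sign (f : R -> R) T : (forall t, continuous f t) -> (forall t, T <= t -> f t <> 0) ->
  exists s, (s = 1 \/ s = -1) /\ forall t, T <= t -> 0 < s * f t.
Proof.
  intros Hc Hn.
  assert (S : forall t, T <= t -> 0 < f T * f t).
  { intros t Ht. apply Rnot_le_lt. intro N.
    destruct (IVT_gen f T t 0) as [x [Hx E]].
    - intro x. apply continuity_pt_filterlim. apply Hc.
    - pose proof (Hn T (Rle_refl _)). pose proof (Hn t Ht). unfold Rmin, Rmax. destruct (Rle_dec (f T) (f t)); nra.
    - rewrite Rmin_left in Hx by lra. apply (Hn x); auto. lra. }
  destruct (Rlt_dec 0 (f T)).
  - exists 1. split; auto. intros t Ht. specialize (S t Ht). nra.
  - exists (-1). split; auto. intros t Ht. specialize (S t Ht). pose proof (Hn T (Rle_refl _)). nra.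
Qed.

(* A sign-definite tail beyond [T] is seen at [2 T] with weight [(4 T^2)^m], while the
   range below [T] contributes at most [(9/4 T^2)^m]. *)
Lemma kh_sign_bound T s : 1 <= T -> (s = 1 \/ s = -1) -> (forall t, T <= Rabs t -> 0 < s * kh t) ->
  exists mu Q, 0 < mu /\ 0 < Q /\ forall m, (4 * T ^ 2) ^ S m * mu <= 6 * PI + (9 / 4 * T ^ 2) ^ S m * Q.
Proof.
  intros HT Hs Hk. pose proof PI2_3_2 as HPI.
  assert (Hcs : forall t, continuous (fun t => s * kh t) t) by (intro t; apply (continuous_scal_r (V := R_NormedModule) s kh), kh_cont).
  destruct (continuity_ab_min (fun t => s * kh t) (2 * T) (2 * T + 1)) as [tm [Hmin Htm]]; [lra|intros; apply continuity_pt_filterlim; apply Hcs|].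
  set (mu := s * kh tm) in *. assert (Hmu : 0 < mu) by (apply Hk; rewrite Rabs_right; lra).
  destruct (kh_bound 0 ltac:(lra)) as [M0 [HM0 BM]].
  assert (BM' : forall t, Rabs (s * kh t) <= M0).
  { intro t. rewrite Rabs_mult. replace (Rabs s) with 1 by (destruct Hs as [-> | ->]; [rewrite Rabs_R1|rewrite Rabs_left by lra]; lra).
    specialize (BM t). rewrite Rmult_0_l, Ropp_0, exp_0 in BM. lra. }
  exists mu, (exp T * M0 * (1 + T ^ 2) * PI). split; auto. pose proof (exp_pos T). pose proof (pow2_ge_0 T).
  split; [apply Rmult_lt_0_compat; [apply Rmult_lt_0_compat; [apply Rmult_lt_0_compat|]|]; lra|]. intro m. destruct (kh_moment m) as [e0 [He0 HE]].
  (* [e <= 1 / T] makes [dw_le] available for all [|t| <= T]. *)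
  set (e := Rmin (e0 / 2) (/ T)). assert (HTi : 0 < / T) by (apply Rinv_0_lt_compat; lra).
  assert (He : 0 < e < e0). { split; [apply Rmin_glb_lt; lra|]. eapply Rle_lt_trans; [apply Rmin_l|lra]. }
  assert (HeT : e * T <= 1). { apply Rle_trans with (/ T * T); [apply Rmult_le_compat_r; [lra|apply Rmin_r]|]. rewrite Rinv_l; lra. }
  destruct (HE e He) as [Ha0 [Ha1 Hbd]]. set (a := PI / 4 - 2 * (INR (S m) * e)) in *. set (M := S m) in *.
  assert (Hale : a <= 1) by (unfold a; pose proof PI_4; assert (0 <= INR M * e) by (apply Rmult_le_pos; [apply pos_INR|lra]); lra).
  destruct (dw_dom e M a ltac:(lra) Ha0 Ha1) as [KA DA].
  set (A := fun t => exp (a * t) * dw e t ^ M * kh t) in *.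
  set (c := exp T * (9 / 4 * (e * T) ^ 2) ^ M * M0). assert (HeT2 : 0 < (e * T) ^ 2) by (apply pow_lt; apply Rmult_lt_0_compat; lra).
  assert (Hc : 0 < c) by (unfold c; apply Rmult_lt_0_compat; auto; apply Rmult_lt_0_compat; auto; apply pow_lt; lra).
  (* Below [T] the sign of the integrand is unknown but its modulus is at most [c], and
     [(1 + T^2) wt t >= 1] there. The added weight makes [g] nonnegative, so its integral bounds the
     one over any window. *)
  set (g := fun t => s * A t + c * (1 + T ^ 2) * wt t).
  assert (DW : DomC (c * (1 + T ^ 2)) (fun t => RtoC (c * (1 + T ^ 2) * wt t))).
  { split; [intro t; apply ccr_RtoC; apply (continuous_scal_r (V := R_NormedModule) (c * (1 + T ^ 2)) wt), wt_cont|].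
    intro u. rewrite Cmod_pos_RtoC; [lra|]. apply Rmult_le_pos; [apply Rmult_le_pos; lra|left; apply wt_pos]. }
  pose proof (DomC_scal _ (RtoC s) _ DA) as DsA. pose proof (DomC_plus _ _ _ _ DsA DW) as Dg0.
  assert (Dg : DomC (Cmod (RtoC s) * KA + c * (1 + T ^ 2)) (fun t => RtoC (g t))).
  { revert Dg0. apply DomC_ext. intro t. unfold g. now rewrite RtoC_plus, (RtoC_mult s). }
  assert (Gpos : forall t, 0 <= g t).
  { intro t. unfold g. pose proof (dw_pos e t) as D0. pose proof (pow_le _ M D0) as D1. pose proof (exp_pos (a * t)) as D2. pose proof (wt_pos t) as D3.
    destruct (Rle_dec T (Rabs t)) as [Ht|Ht].
    - specialize (Hk t Ht). assert (0 <= s * A t).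
      { unfold A. replace (s * (exp (a * t) * dw e t ^ M * kh t)) with (exp (a * t) * dw e t ^ M * (s * kh t)) by ring. apply Rmult_le_pos; [apply Rmult_le_pos|]; lra. }
      assert (0 <= c * (1 + T ^ 2) * wt t) by (apply Rmult_le_pos; [apply Rmult_le_pos|]; lra). lra.
    - apply Rnot_le_lt in Ht. assert (Ht2 : t ^ 2 <= T ^ 2) by (rewrite <- (Rabs_sq t); apply pow_incr; split; [apply Rabs_pos|lra]).
      assert (HA : Rabs (s * A t) <= c).
      { unfold A. replace (s * (exp (a * t) * dw e t ^ M * kh t)) with (exp (a * t) * dw e t ^ M * (s * kh t)) by ring.
        rewrite Rabs_mult, (Rabs_right (exp (a * t) * dw e t ^ M)) by (apply Rle_ge, Rmult_le_pos; lra). unfold c.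
        apply Rmult_le_compat; [apply Rmult_le_pos; lra|apply Rabs_pos| |apply BM'].
        apply Rmult_le_compat; [lra|auto| |].
        - apply exp_mono. apply Rle_trans with (a * Rabs t); [apply Rmult_le_compat_l; [auto|apply Rle_abs]|]. pose proof (Rabs_pos t). nra.
        - apply pow_incr. split; auto. assert (X : (e * t) ^ 2 <= (e * T) ^ 2) by (rewrite !Rpow_mult_distr; apply Rmult_le_compat_l; [apply pow2_ge_0|auto]).
          assert (X1 : (e * T) ^ 2 <= 1) by (rewrite <- (pow1 2); apply pow_incr; split; [apply Rmult_le_pos; lra|auto]).
          eapply Rle_trans; [apply dw_le; lra|]. lra. }
      assert (HW : 1 <= (1 + T ^ 2) * wt t).
      { unfold wt. pose proof (pow2_ge_0 t). apply Rmult_le_reg_r with (1 + t ^ 2); [lra|]. rewrite Rmult_assoc, Rinv_l; lra. }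
      assert (c <= c * (1 + T ^ 2) * wt t) by (rewrite Rmult_assoc; rewrite <- (Rmult_1_r c) at 1; apply Rmult_le_compat_l; lra).
      pose proof (Rle_abs (- (s * A t))) as R1. rewrite Rabs_Ropp in R1. lra. }
  pose proof (Ig_ge_cint _ g (2 * T) (2 * T + 1) ltac:(lra) Dg Gpos) as L.
  (* On the window [[2 T, 2 T + 1]] one has [dw e t >= (2 e T)^2] and [exp (a t) >= 1]. *)
  assert (L2 : ((e * (2 * T)) ^ 2) ^ M * mu <= RInt g (2 * T) (2 * T + 1)).
  { replace (((e * (2 * T)) ^ 2) ^ M * mu) with (RInt (fun _ => ((e * (2 * T)) ^ 2) ^ M * mu) (2 * T) (2 * T + 1)).
    2:{ rewrite RInt_const. unfold scal. simpl. unfold mult. simpl. ring. }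
    apply RInt_le; [lra|apply ex_RInt_const|apply (cint_ex_re (2 * T) (2 * T + 1) (fun u => RtoC (g u))); now apply (DomC_conab _ _ _ _ Dg)|].
    intros t Ht. pose proof (wt_pos t). assert (0 <= c * (1 + T ^ 2) * wt t) by (apply Rmult_le_pos; [apply Rmult_le_pos|]; lra).
    apply Rle_trans with (s * A t); [|unfold g; lra]. unfold A.
    replace (s * (exp (a * t) * dw e t ^ M * kh t)) with (exp (a * t) * dw e t ^ M * (s * kh t)) by ring.
    apply Rmult_le_compat; [apply pow_le, pow2_ge_0|lra| |apply Hmin; lra].
    rewrite <- (Rmult_1_l (((e * (2 * T)) ^ 2) ^ M)). apply Rmult_le_compat; [lra|apply pow_le, pow2_ge_0| |].
    - rewrite <- exp_0. apply exp_mono. apply Rmult_le_pos; lra.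
    - apply pow_incr. split; [apply pow2_ge_0|]. eapply Rle_trans; [|apply dw_ge]. rewrite !Rpow_mult_distr.
      apply Rmult_le_compat_l; [apply pow2_ge_0|]. rewrite <- Rpow_mult_distr. apply pow_incr. lra. }
  assert (U : Re (Ig (fun t => RtoC (g t))) <= 6 * PI * e ^ (2 * M) + c * (1 + T ^ 2) * PI).
  { rewrite (Ig_ext _ (fun t => RtoC s * RtoC (A t) + RtoC (c * (1 + T ^ 2) * wt t))%C) by (intro; unfold g; now rewrite RtoC_plus, (RtoC_mult s)).
    fold A in Hbd. rewrite (Ig_plus _ _ _ _ DsA DW : Ig (fun t => RtoC s * RtoC (A t) + RtoC (c * (1 + T ^ 2) * wt t))%C = _), (Ig_scal _ _ _ DA). eapply Rle_trans; [apply re_le|]. eapply Rle_trans; [apply Cmod_triangle|].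
    apply Rplus_le_compat; [|apply (Ig_bound _ _ DW)]. rewrite Cmod_mult, Cmod_R.
    replace (Rabs s) with 1 by (destruct Hs as [-> | ->]; [rewrite Rabs_R1|rewrite Rabs_left by lra]; lra). rewrite Rmult_1_l. exact Hbd. }
  assert (Hen : 0 < e ^ (2 * M)) by (apply pow_lt; lra).
  apply Rmult_le_reg_l with (e ^ (2 * M)); auto.
  replace (e ^ (2 * M) * ((4 * T ^ 2) ^ M * mu)) with (((e * (2 * T)) ^ 2) ^ M * mu).
  2:{ replace ((e * (2 * T)) ^ 2) with (e ^ 2 * (4 * T ^ 2)) by ring. rewrite Rpow_mult_distr, <- pow_mult. ring. }
  replace (e ^ (2 * M) * (6 * PI + (9 / 4 * T ^ 2) ^ M * (exp T * M0 * (1 + T ^ 2) * PI))) with (6 * PI * e ^ (2 * M) + c * (1 + T ^ 2) * PI).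
  2:{ unfold c. replace (9 / 4 * (e * T) ^ 2) with (e ^ 2 * (9 / 4 * T ^ 2)) by ring. rewrite Rpow_mult_distr, <- pow_mult. ring. }
  lra.
Qed.

Theorem Xi_zeros T : exists t, T < t /\ Xi t = 0.
Proof.
  apply NNPP. intro N. set (T0 := Rmax 1 (T + 1)). assert (H1 : 1 <= T0) by apply Rmax_l. assert (HT : T + 1 <= T0) by apply Rmax_r.
  destruct (constant_sign kh T0) as [s [Hs Hk]].
  - apply kh_cont.
  - intros t Ht E. apply N. exists t. split; [lra|]. unfold kh in E. pose proof (quarter_pos t).
    replace (Xi t) with (- (- Xi t / (t ^ 2 + 1 / 4)) * (t ^ 2 + 1 / 4)) by (field; lra). rewrite E. ring.
  - destruct (kh_sign_bound T0 s H1 Hs) as [mu [Q [Hmu [HQ B]]]].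
    { intros t Ht. rewrite (even_abs kh t kh_even). auto. }
    (* [16 / 9] is the ratio of the two bases [4 T^2] and [9/4 T^2]; its powers outgrow the
       constants. *)
    destruct (Pow_x_infinity (16 / 9) ltac:(rewrite Rabs_right; lra) ((6 * PI + Q + 1) / mu)) as [n Hn].
    specialize (Hn (S n) ltac:(lia)). specialize (B n). rewrite Rabs_right in Hn by (apply Rle_ge, pow_le; lra).
    assert (HP : 1 <= (9 / 4 * T0 ^ 2) ^ S n).
    { apply pow_R1_Rle. assert (1 <= T0 ^ 2) by now apply pow_R1_Rle. lra. }
    set (P := (9 / 4 * T0 ^ 2) ^ S n) in *.
    replace ((4 * T0 ^ 2) ^ S n) with ((16 / 9) ^ S n * P) in B by (unfold P; rewrite <- Rpow_mult_distr; f_equal; field).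
    assert (H2 : 6 * PI + Q + 1 <= (16 / 9) ^ S n * mu).
    { replace (6 * PI + Q + 1) with ((6 * PI + Q + 1) / mu * mu) by (field; lra). apply Rmult_le_compat_r; lra. }
    pose proof PI_RGT_0. assert (H3 : P * (6 * PI + Q + 1) <= P * ((16 / 9) ^ S n * mu)) by (apply Rmult_le_compat_l; lra). nra.
Qed.

(** * Convolution powers *)

Definition conv (P Q : R -> R) (u : R) : R := Re (Ig (fun y => RtoC (P y * Q (u - y)))).

Lemma conv_integrand P Q A : Kern P -> Kern Q -> 0 < A ->
  exists K, 0 < K /\ forall u y, 0 < P y * Q (u - y) <= K * exp (- A * u ^ 2) * exp (- y ^ 2).
Proof.
  (* As [u^2 <= 2 (y^2 + (u - y)^2)], the rate [4 A + 4] on both kernels leaves at least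
     [A u^2 + y^2] in the exponent. *)
  intros [_ [_ [P1 P2]]] [_ [_ [Q1 Q2]]] HA. set (A' := 4 * A + 4).
  destruct (P2 A' ltac:(unfold A'; lra)) as [K1 H1]. destruct (Q2 A' ltac:(unfold A'; lra)) as [K2 H2].
  assert (HK1 : 0 < K1) by now apply (kern_pos K1 P A'). assert (HK2 : 0 < K2) by now apply (kern_pos K2 Q A').
  exists (K1 * K2). split; [now apply Rmult_lt_0_compat|]. intros u y. split; [now apply Rmult_lt_0_compat|].
  apply Rle_trans with (K1 * exp (- A' * y ^ 2) * (K2 * exp (- A' * (u - y) ^ 2))).
  - apply Rmult_le_compat; auto; now left.
  - replace (K1 * exp (- A' * y ^ 2) * (K2 * exp (- A' * (u - y) ^ 2))) with (K1 * K2 * (exp (- A' * y ^ 2) * exp (- A' * (u - y) ^ 2))) by ring.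
    rewrite (Rmult_assoc (K1 * K2)), <- !exp_plus. apply Rmult_le_compat_l; [left; now apply Rmult_lt_0_compat|]. apply exp_mono.
    unfold A'. pose proof (pow2_ge_0 (u - 2 * y)) as S1. pose proof (pow2_ge_0 u) as S2. pose proof (pow2_ge_0 (u - y)) as S3. pose proof (pow2_ge_0 y) as S4.
    assert (S5 : u ^ 2 <= 2 * (y ^ 2 + (u - y) ^ 2)) by nra. assert (S6 : A * u ^ 2 <= A * (2 * (y ^ 2 + (u - y) ^ 2))) by (apply Rmult_le_compat_l; lra). nra.
Qed.

Lemma conv_fun_ccc P Q z : Kern P -> Kern Q -> ccc (fun w => RtoC (P (Im w)) * RtoC (Q (Re w - Im w)%R))%C z.
Proof.
  intros [CP _] [CQ _]. apply ccc_mult.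
  - apply (ccc_RtoC P Im); [apply CP|apply ccc_im].
  - apply (ccc_RtoC Q (fun w => Re w - Im w)); [apply CQ|].
    intros e He. generalize (ccc_minus _ _ z (ccc_re z) (ccc_im z) e He). apply filter_imp. intros w Hw. rewrite !RtoC_minus. exact Hw.
Qed.

Lemma conv_dom P Q u : Kern P -> Kern Q -> exists K, DomC K (fun y => RtoC (P y * Q (u - y))).
Proof.
  intros HP HQ. destruct (conv_integrand P Q 1 HP HQ Rlt_0_1) as [K [HK B]]. exists K. split.
  - intro y. apply ccr_RtoC. apply (continuous_mult (K := R_AbsRing) P (fun y => Q (u - y))); [apply HP|].
    apply (continuous_comp (fun y => u - y) Q); [|apply HQ]. rcont.
  - intro y. specialize (B u y). rewrite Cmod_pos_RtoC by lra. eapply Rle_trans; [apply B|]. rewrite Rmult_assoc. apply Rmult_le_compat_l; [lra|].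
    rewrite <- (Rmult_1_l (wt y)). apply Rmult_le_compat; try (left; apply exp_pos); [|apply exp_m2_wt].
    apply Rle_trans with (exp 0); [apply exp_mono|rewrite exp_0; lra]. pose proof (pow2_ge_0 u). lra.
Qed.

Lemma conv_eq P Q u : Kern P -> Kern Q -> Ig (fun y => RtoC (P y * Q (u - y))) = RtoC (conv P Q u).
Proof. intros HP HQ. destruct (conv_dom P Q u HP HQ) as [K D]. exact (Ig_real _ _ D). Qed.

Lemma conv_kern P Q : Kern P -> Kern Q -> Kern (conv P Q).
Proof.
  intros HP HQ. split; [|split; [|split]].
  - intro u. destruct (conv_integrand P Q 1 HP HQ Rlt_0_1) as [K [HK B]].
    apply (ccr_re (fun u => Ig (fun y => RtoC (P y * Q (u - y))))).
    set (f := fun w : C => (RtoC (P (Im w)) * RtoC (Q (Re w - Im w)%R))%C).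
    assert (H : ccr (fun x => Ig (fun y => f (x, y))) u).
    { apply (ccr_Ig f u K); [intro z; now apply conv_fun_ccc|]. apply filter_forall. intros x y. unfold f. simpl.
      rewrite <- RtoC_mult. specialize (B x y). rewrite Cmod_pos_RtoC by lra. eapply Rle_trans; [apply B|]. rewrite Rmult_assoc. apply Rmult_le_compat_l; [lra|].
      rewrite <- (Rmult_1_l (wt y)). apply Rmult_le_compat; try (left; apply exp_pos); [|apply exp_m2_wt].
      apply Rle_trans with (exp 0); [apply exp_mono|rewrite exp_0; lra]. pose proof (pow2_ge_0 x). lra. }
    assert (E : (fun x => Ig (fun y => f (x, y))) = (fun u => Ig (fun y => RtoC (P y * Q (u - y))))).
    { apply functional_extensionality. intro x. apply Ig_ext. intro y. unfold f. simpl. now rewrite RtoC_mult. }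
    rewrite E in H. exact H.
  - intro u. destruct (conv_dom P Q (- u) HP HQ) as [K D]. unfold conv. rewrite <- (Ig_reflect _ _ D). f_equal. apply Ig_ext. intro y.
    destruct HP as [_ [HP _]], HQ as [_ [HQ _]]. rewrite HP. replace (- u - - y) with (- (u - y)) by ring. now rewrite HQ.
  - intro u. destruct (conv_dom P Q u HP HQ) as [K D]. apply (Ig_pos _ _ D). intro y. apply Rmult_lt_0_compat; [apply HP|apply HQ].
  - intros A HA. destruct (conv_integrand P Q A HP HQ HA) as [K [HK B]]. exists (K * PI). intro u.
    assert (D : DomC (K * exp (- A * u ^ 2)) (fun y => RtoC (P y * Q (u - y)))).
    { destruct (conv_dom P Q u HP HQ) as [K' D]. split; [apply D|]. intro y. specialize (B u y). rewrite Cmod_pos_RtoC by lra. eapply Rle_trans; [apply B|].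
      apply Rmult_le_compat_l; [apply Rmult_le_pos; [lra|left; apply exp_pos]|apply exp_m2_wt]. }
    unfold conv. eapply Rle_trans; [apply re_le|]. eapply Rle_trans; [apply (Ig_bound _ _ D)|]. right. ring.
Qed.

Lemma FT_conv P Q z : Kern P -> Kern Q -> FT (conv P Q) z = (FT P z * FT Q z)%C.
Proof.
  intros HP HQ. set (f := fun w : C => (cexp (Ci * z * RtoC (Re w)) * (RtoC (P (Im w)) * RtoC (Q (Re w - Im w)%R)))%C).
  (* Of the rate 2, one unit pays for the wave through [|z| |u| <= |z|^2 / 4 + u^2], the origin of
     the constant [exp (|z|^2 / 4)], and the other gives the weight. *)
  destruct (conv_integrand P Q 2 HP HQ Rlt_0_2) as [K [HK B]].
  pose proof (Ig_fubini f (K * exp (Cmod z ^ 2 / 4))) as Fb. unfold FT at 1.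
  rewrite (Ig_ext _ (fun u => Ig (fun y => f (u, y)))).
  - rewrite Fb; clear Fb.
    + destruct (FT_dom_ex Q z HQ) as [KQ DQ]. destruct (FT_dom_ex P z HP) as [KP DP].
      rewrite (Ig_ext _ (fun y => FT Q z * (RtoC (P y) * cexp (Ci * z * RtoC y)))%C).
      * rewrite (Ig_scal _ _ _ DP). unfold FT. ring.
      * intro y. pose proof (DomC_scal _ (RtoC (P y) * cexp (Ci * z * RtoC y))%C _ DQ) as D.
        rewrite (Ig_ext _ (fun u => (RtoC (P y) * cexp (Ci * z * RtoC y)) * (RtoC (Q (u + - y)%R) * cexp (Ci * z * RtoC (u + - y)%R)))%C).
        -- rewrite (Ig_shift _ _ (- y) D), (Ig_scal _ _ _ DQ). unfold FT. ring.
        -- intro u. unfold f. simpl Re. simpl Im. replace (u + - y) with (u - y) by ring.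
           replace (cexp (Ci * z * RtoC u)) with (cexp (Ci * z * RtoC y) * cexp (Ci * z * RtoC (u - y)))%C; [ring|].
           rewrite <- cexp_plus. f_equal. rewrite RtoC_minus. ring.
    + intro w. apply ccc_mult; [|now apply conv_fun_ccc]. ccont.
    + intros u y. unfold f. simpl Re. simpl Im. rewrite <- RtoC_mult, Cmod_mult. specialize (B u y). rewrite (Cmod_pos_RtoC (P y * Q (u - y))) by lra.
      apply Rle_trans with (exp (Cmod z * Rabs u) * (K * exp (- (2) * u ^ 2) * exp (- y ^ 2))).
      * apply Rmult_le_compat; [apply Cmod_ge_0|lra|apply Cmod_cexp_izu|apply B].
      * replace (exp (Cmod z * Rabs u) * (K * exp (- (2) * u ^ 2) * exp (- y ^ 2))) with (K * (exp (Cmod z * Rabs u) * exp (- (2) * u ^ 2)) * exp (- y ^ 2)) by ring.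
        apply Rmult_le_compat; [apply Rmult_le_pos; [lra|]; rewrite <- exp_plus; left; apply exp_pos|left; apply exp_pos| |apply exp_m2_wt].
        rewrite Rmult_assoc. apply Rmult_le_compat_l; [lra|]. apply Rle_trans with (exp (Cmod z ^ 2 / 4) * exp (- u ^ 2)).
        -- rewrite <- !exp_plus. apply exp_mono. rewrite <- (Rabs_sq u). pose proof (pow2_ge_0 (Cmod z / 2 - Rabs u)). lra.
        -- apply Rmult_le_compat_l; [left; apply exp_pos|apply exp_m2_wt].
  - intro u. destruct (conv_dom P Q u HP HQ) as [K' D]. rewrite <- (conv_eq P Q u HP HQ), Cmult_comm, <- (Ig_scal _ _ _ D). apply Ig_ext. intro y. unfold f. simpl. now rewrite RtoC_mult.
Qed.

(** Index 0 is [P] itself, since the unit of convolution is not a function; [conv_pow P n] belongs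
    to the exponent [k = n + 1]. *)
Fixpoint conv_pow (P : R -> R) (n : nat) : R -> R := match n with O => P | S m => conv (conv_pow P m) P end.

Lemma conv_pow_kern P n : Kern P -> Kern (conv_pow P n).
Proof. intro H. induction n; simpl; auto. now apply conv_kern. Qed.

Lemma FT_conv_pow P n z : Kern P -> FT (conv_pow P n) z = (FT P z ^ S n)%C.
Proof.
  intro H. induction n; [simpl; ring|]. simpl conv_pow. rewrite FT_conv, IHn, (Cpow_S _ (S n)) by (auto; now apply conv_pow_kern). ring.
Qed.

Lemma Xi_dom : exists K, DomC K (fun t => RtoC (Xi t)).
Proof.
  pose proof PI2_3_2. destruct (kh_dom (1 / 2) 17 (fun t => - (t ^ 2 + 1 / 4))) as [K D]; [lra| | |].
  - intro t. rcont.
  - intro t. pose proof (quarter_pos t). rewrite Rabs_Ropp, Rabs_right by lra. rewrite <- (Rabs_sq t). set (x := Rabs t). assert (0 <= x) by apply Rabs_pos.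
    pose proof (exp_ge_1p (x / 4)) as E. assert (E2 : exp (1 / 2 * x) = exp (x / 4) * exp (x / 4)) by (rewrite <- exp_plus; f_equal; field). rewrite E2. nra.
  - exists K. revert D. apply DomC_ext. intro t. f_equal. unfold kh. pose proof (quarter_pos t). field. lra.
Qed.

Lemma Xi_pow_dom n : exists K, DomC K (fun t => RtoC (Xi t) ^ S n)%C.
Proof.
  destruct Xi_dom as [K D]. pose proof (DomC_K _ _ D) as HK. induction n as [|n [K' D']].
  - exists K. revert D. apply DomC_ext. intro t. simpl. ring.
  - exists (K * K'). apply DomC_ext with (fun t => RtoC (Xi t) * RtoC (Xi t) ^ S n)%C; [reflexivity|]. apply DomC_mult; auto; [apply D|].
    intro t. eapply Rle_trans; [apply D|]. pose proof (wt_le1 t). pose proof (wt_pos t). nra.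
Qed.

Lemma Xi_pow_inversion n u : Ig (fun t => RtoC (Xi t) ^ S n * cexp (Ci * RtoC (t * u)))%C = RtoC (2 * PI * conv_pow Phi n u).
Proof.
  pose proof (conv_pow_kern Phi n Kern_Phi) as HK. destruct (kern_DomC _ HK) as [K D]. destruct (Xi_pow_dom n) as [K' D'].
  pose proof (fourier_inversion (fun u => RtoC (conv_pow Phi n u)) _ K K' (- u) D D') as I.
  destruct HK as [_ [He _]]. cbv beta in I. rewrite He in I. rewrite RtoC_mult, <- I.
  - apply Ig_ext. intro t. f_equal. f_equal. replace (t * - u) with (- (t * u)) by ring. rewrite RtoC_opp. ring.
  - intro t. rewrite <- FT_Xi, <- FT_conv_pow by apply Kern_Phi. unfold FT. apply Ig_ext. intro y. rewrite RtoC_mult. f_equal. f_equal. ring.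
Qed.

(** * The Gamma function *)

(** Euler's integrand in the variable [v = ln t], which turns the half-line into the line. *)
Definition gmi (z : C) (v : R) : C := (cexp (z * RtoC v) * RtoC (exp (- exp v)))%C.
Definition Gam (z : C) : C := Ig (gmi z).

Lemma gmi_bound z : 0 < Re z -> exists M c, 0 < c /\ forall v, Cmod (gmi z v) <= M * exp (- (c * Rabs v)).
Proof.
  intro Hz. set (a := Re z) in *. destruct (exp_exp_bound 1 0 (4 * a)) as [K B]; try lra.
  exists (Rmax 1 (exp K)), a. split; auto. intro v. unfold gmi. rewrite Cmod_mult, Cmod_cexp_lin, Cmod_pos_RtoC, <- exp_plus by (left; apply exp_pos).
  fold a. destruct (Rle_dec 0 v) as [Hv|Hv].
  - rewrite Rabs_right by lra. apply Rle_trans with (exp K * exp (- (a * v))); [|apply Rmult_le_compat_r; [left; apply exp_pos|apply Rmax_r]].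
    rewrite <- exp_plus. apply exp_mono. specialize (B (v / 2) ltac:(lra)). replace (2 * (v / 2)) with v in B by field. lra.
  - rewrite Rabs_left by lra. apply Rle_trans with (1 * exp (- (a * - v))); [|apply Rmult_le_compat_r; [left; apply exp_pos|apply Rmax_l]].
    rewrite Rmult_1_l. apply exp_mono. pose proof (exp_pos v). lra.
Qed.

Lemma rder_gmi z v : rder (gmi z) v (z * gmi z v - gmi (z + 1) v)%C.
Proof.
  assert (D1 : rder (fun v => cexp (z * RtoC v)) v (z * cexp (z * RtoC v))%C) by (apply (rder_of_cder (fun w => cexp (z * w)%C)), cder_cexp_lin).
  assert (D2 : rder (fun v => RtoC (exp (- exp v))) v (RtoC (- exp v * exp (- exp v)))).
  { apply is_derive_carath. auto_derive; auto. ring. }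
  eapply gder_eq; [apply rder_mult; [exact D1|exact D2]|]. unfold gmi.
  replace ((z + 1) * RtoC v)%C with (z * RtoC v + RtoC v)%C by ring. rewrite cexp_plus, cexp_RtoC, RtoC_mult, RtoC_opp. ring.
Qed.

Lemma gmi_dom z : 0 < Re z -> exists K, DomC K (gmi z).
Proof.
  intro Hz. destruct (gmi_bound z Hz) as [M [c [Hc B]]]. destruct (exp_abs_wt c Hc) as [Kw [HKw Hw]]. exists (Rabs M * Kw). split.
  - intro v. exact (rder_ccr _ _ _ (rder_gmi z v)).
  - intro v. eapply Rle_trans; [apply B|]. rewrite Rmult_assoc. eapply Rle_trans; [apply Rmult_le_compat_r; [left; apply exp_pos|apply Rle_abs]|].
    apply Rmult_le_compat_l; [apply Rabs_pos|apply Hw].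
Qed.

Lemma Gam_rec z : 0 < Re z -> Gam (z + 1) = (z * Gam z)%C.
Proof.
  intro Hz. destruct (gmi_bound z Hz) as [M [c [Hc B]]]. destruct (gmi_dom z Hz) as [K D].
  destruct (gmi_dom (z + 1)) as [K' D']; [rewrite re_plus, re_RtoC; lra|].
  pose proof (DomC_minus _ _ _ _ (DomC_scal _ z _ D) D') as Dd.
  assert (E : Ig (fun v => z * gmi z v - gmi (z + 1) v)%C = 0).
  { refine (Ig_ftc _ (gmi z) _ (rder_gmi z) Dd _ _).
    - apply clim_ext with (f := fun A => gmi z (1 * A)); [apply filter_forall; intro; now rewrite Rmult_1_l|]. apply (clim_exp_abs _ M c); auto.
    - apply clim_ext with (f := fun A => gmi z (-1 * A)); [apply filter_forall; intro A; now replace (-1 * A) with (- A) by ring|]. apply (clim_exp_abs _ M c); auto. }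
  rewrite (Ig_minus _ _ _ _ (DomC_scal _ z _ D) D'), (Ig_scal _ _ _ D) in E. unfold Gam.
  replace (Ig (gmi (z + 1))) with (z * Ig (gmi z) - (z * Ig (gmi z) - Ig (gmi (z + 1))))%C by ring. change (Ig (fun u => gmi (z + 1) u)) with (Ig (gmi (z + 1))) in E.
  rewrite E. ring.
Qed.

Definition gmr (a v : R) : R := exp (a * v - exp v).

Lemma gmi_gmr a v : gmi (RtoC a) v = RtoC (gmr a v).
Proof. unfold gmi, gmr. rewrite <- RtoC_mult, cexp_RtoC, <- RtoC_mult, <- exp_plus. reflexivity. Qed.

Lemma gmr_dom a : 0 < a -> exists K, DomC K (fun v => RtoC (gmr a v)).
Proof. intro Ha. destruct (gmi_dom (RtoC a)) as [K D]; [now rewrite re_RtoC|]. exists K. revert D. apply DomC_ext. intro. apply gmi_gmr. Qed.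

Definition Gr (a : R) : R := Re (Ig (fun v => RtoC (gmr a v))).

Lemma Gam_Gr a : 0 < a -> Gam (RtoC a) = RtoC (Gr a).
Proof.
  intro Ha. destruct (gmr_dom a Ha) as [K D]. unfold Gr. rewrite <- (Ig_real _ _ D). apply Ig_ext. intro. apply gmi_gmr.
Qed.

Lemma Gr_pos a : 0 < a -> 0 < Gr a.
Proof. intro Ha. destruct (gmr_dom a Ha) as [K D]. apply (Ig_pos _ _ D). intro. apply exp_pos. Qed.

Lemma Gr_rec a : 0 < a -> Gr (a + 1) = a * Gr a.
Proof.
  intro Ha. apply RtoC_inj. rewrite <- Gam_Gr, RtoC_plus, Gam_rec, Gam_Gr, RtoC_mult by (rewrite ?re_RtoC; lra). reflexivity.
Qed.

Lemma cos_ge x : 1 - x ^ 2 / 2 <= cos x.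
Proof.
  assert (H : forall y, 0 < y -> 1 - y ^ 2 / 2 <= cos y).
  { intros y Hy. pose proof (one_minus_cos (2 * y) ltac:(lra)) as B. replace (2 * y / 2) with y in B by field.
    pose proof (Rle_abs (- (2 * cos y - 2))) as A. rewrite Rabs_Ropp in A. replace ((2 * y) ^ 2 / 4) with (y ^ 2) in B by field. lra. }
  destruct (Rtotal_order x 0) as [L|[->|L]]; [|rewrite cos_0; lra|auto].
  rewrite <- cos_neg. replace (x ^ 2) with ((- x) ^ 2) by ring. apply H. lra.
Qed.

(* Second moment of [v - ln a] under the weight [gmr a], using [x^2 <= e^x + e^-x - 2]. *)
Lemma Gam_large a y : 1 < a -> y ^ 2 / 2 < a - 1 -> Gam (a, y) <> RtoC 0.
Proof.
  intros Ha Hy E0. destruct (gmi_dom (a, y)) as [K D]; [simpl; lra|].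
  (* Rotation by the phase at [v = ln a], where the weight concentrates; the real part of the
     integrand becomes [gmr a v * cos (y (v - ln a))]. *)
  set (c := cexp (- (Ci * RtoC (y * ln a)))). pose proof (DomC_scal _ c _ D) as Dc.
  assert (Z : Re (Ig (fun v => c * gmi (a, y) v)%C) = 0).
  { rewrite (Ig_scal _ _ _ D). transitivity (Re (c * Gam (a, y))%C); [reflexivity|]. rewrite E0, Cmult_0_r. reflexivity. }
  rewrite (Ig_re _ _ Dc) in Z.
  destruct (gmr_dom a ltac:(lra)) as [K1 D1]. destruct (gmr_dom (a + 1) ltac:(lra)) as [K2 D2]. destruct (gmr_dom (a - 1) ltac:(lra)) as [K3 D3].
  set (q := y ^ 2 / 2). assert (Hq : 0 <= q) by (unfold q; pose proof (pow2_ge_0 y); lra).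
  pose proof (DomC_minus _ _ _ _ (DomC_scal _ (RtoC (1 + 2 * q)) _ D1) (DomC_plus _ _ _ _ (DomC_scal _ (RtoC (q / a)) _ D2) (DomC_scal _ (RtoC (q * a)) _ D3))) as Dl.
  (* With [q = y^2 / 2] and [x = v - ln a] this is [gmr a v * (1 - q (exp x + exp (- x) - 2))], a
     lower bound for the cosine integrand. Its integral needs only Gamma at [a - 1], [a], [a + 1],
     and the recurrence reduces it to [(a - 1 - q)] times the value at [a - 1]. *)
  set (low := fun v => (1 + 2 * q) * gmr a v - (q / a * gmr (a + 1) v + q * a * gmr (a - 1) v)).
  match type of Dl with DomC ?K _ => assert (Dlow : DomC K (fun v => RtoC (low v))) end.
  { revert Dl. apply DomC_ext. intro v. unfold low. rewrite RtoC_minus, (RtoC_plus (q / a * gmr (a + 1) v)), (RtoC_mult (1 + 2 * q)), (RtoC_mult (q / a)), (RtoC_mult (q * a) (gmr (a - 1) v)). reflexivity. }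
  assert (Dre : DomC (Cmod c * K) (fun v => RtoC (Re (c * gmi (a, y) v)%C))).
  { split; [intro x; apply ccr_RtoC, (ccr_re (fun v => c * gmi (a, y) v)%C), Dc|]. intro u. rewrite Cmod_R. eapply Rle_trans; [apply re_le_Cmod|apply Dc]. }
  assert (M : Re (Ig (fun v => RtoC (low v))) <= 0).
  { rewrite <- Z. apply (Ig_mono _ _ _ _ Dlow Dre). intro v. set (x := v - ln a).
    assert (Ea : exp x = exp v / a) by (unfold x; unfold Rminus; rewrite exp_plus, exp_Ropp, exp_ln by lra; reflexivity).
    assert (Ea' : exp (- x) = a * exp (- v)) by (unfold x; replace (- (v - ln a)) with (ln a + - v) by ring; rewrite exp_plus, exp_ln by lra; reflexivity).
    assert (E1 : gmr (a + 1) v = gmr a v * exp v) by (unfold gmr; rewrite <- exp_plus; f_equal; ring).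
    assert (E2 : gmr (a - 1) v = gmr a v * exp (- v)) by (unfold gmr; rewrite <- exp_plus; f_equal; ring).
    assert (ER : Re (c * gmi (a, y) v)%C = gmr a v * cos (y * x)).
    { unfold c, gmi. rewrite Cmult_assoc, <- cexp_plus.
      replace (- (Ci * RtoC (y * ln a)) + (a, y) * RtoC v)%C with (((a * v)%R, (y * x)%R) : C) by (apply Ceq_parts; unfold x; simpl; ring).
      rewrite re_mult, re_RtoC, im_RtoC. unfold cexp. simpl. unfold gmr, Rminus. rewrite exp_plus. ring. }
    rewrite ER. unfold low. rewrite E1, E2.
    replace ((1 + 2 * q) * gmr a v - (q / a * (gmr a v * exp v) + q * a * (gmr a v * exp (- v)))) with (gmr a v * (1 - q * (exp x + exp (- x) - 2)))
      by (rewrite Ea, Ea'; field; lra).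
    apply Rmult_le_compat_l; [left; apply exp_pos|]. eapply Rle_trans; [|apply cos_ge].
    pose proof (dw_ge 1 x) as Dx. unfold dw in Dx. rewrite Rmult_1_l in Dx. rewrite Rpow_mult_distr.
    assert (q * x ^ 2 <= q * (exp x + exp (- x) - 2)) by (apply Rmult_le_compat_l; auto). unfold q in *. lra. }
  assert (V : Re (Ig (fun v => RtoC (low v))) = (1 + 2 * q) * Gr a - (q / a * Gr (a + 1) + q * a * Gr (a - 1))).
  { rewrite (Ig_ext _ (fun v => RtoC (1 + 2 * q) * RtoC (gmr a v) - (RtoC (q / a) * RtoC (gmr (a + 1) v) + RtoC (q * a) * RtoC (gmr (a - 1) v)))%C)
      by (intro v; unfold low; rewrite RtoC_minus, (RtoC_plus (q / a * gmr (a + 1) v)), (RtoC_mult (1 + 2 * q)), (RtoC_mult (q / a)), (RtoC_mult (q * a) (gmr (a - 1) v)); reflexivity).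
    rewrite (Ig_minus _ _ _ _ (DomC_scal _ (RtoC (1 + 2 * q)) _ D1) (DomC_plus _ _ _ _ (DomC_scal _ (RtoC (q / a)) _ D2) (DomC_scal _ (RtoC (q * a)) _ D3))).
    rewrite (Ig_plus _ _ _ _ (DomC_scal _ (RtoC (q / a)) _ D2) (DomC_scal _ (RtoC (q * a)) _ D3)), (Ig_scal _ _ _ D1), (Ig_scal _ _ _ D2), (Ig_scal _ _ _ D3).
    rewrite re_minus, re_plus, !re_mult, !re_RtoC, !im_RtoC. unfold Gr. ring. }
  rewrite V in M. pose proof (Gr_rec a ltac:(lra)) as R1. pose proof (Gr_rec (a - 1) ltac:(lra)) as R2. replace (a - 1 + 1) with a in R2 by ring.
  pose proof (Gr_pos (a - 1) ltac:(lra)) as P. rewrite R1, R2 in M. set (g := Gr (a - 1)) in *. fold q in Hy.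
  replace ((1 + 2 * q) * ((a - 1) * g) - (q / a * (a * ((a - 1) * g)) + q * a * g)) with (g * (a - 1 - q)) in M by (field; lra).
  assert (0 < g * (a - 1 - q)) by (apply Rmult_lt_0_compat; lra). lra.
Qed.

(** By the recurrence a zero at [z] propagates to all [z + n]. The imaginary part stays fixed while
    the real part grows, and [Gam_large] applies. *)
Theorem Gam_neq0 z : 0 < Re z -> Gam z <> RtoC 0.
Proof.
  intros Hz E. assert (H : forall n, Gam (z + RtoC (INR n)) = RtoC 0).
  { induction n; [simpl INR; replace (z + RtoC 0)%C with z by ring; auto|].
    rewrite S_INR, RtoC_plus, Cplus_assoc, Gam_rec, IHn by (rewrite re_plus, re_RtoC; pose proof (pos_INR n); lra). ring. }
  destruct (INR_unbounded (Im z ^ 2 / 2 + 1)) as [n Hn]. specialize (H n).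
  replace (z + RtoC (INR n))%C with (((Re z + INR n)%R, Im z) : C) in H by (apply Ceq_parts; destruct z; simpl; ring).
  revert H. apply Gam_large; pose proof (pow2_ge_0 (Im z)); lra.
Qed.

Lemma Gamma_euler_Gam z : 0 < Re z -> Gamma_euler z = Gam z.
Proof.
  intro Hz. destruct (gmi_dom z Hz) as [K D].
  set (f := fun t => (rcpow t (z - 1) * RtoC (exp (- t)))%C).
  assert (E : forall v, (f (exp v) * RtoC (exp v))%C = gmi z v).
  { intro v. unfold f, gmi, rcpow. rewrite ln_exp. replace (z * RtoC v)%C with ((z - 1) * RtoC v + RtoC v)%C by ring. rewrite cexp_plus, cexp_RtoC. ring. }
  assert (D' : DomC K (fun v => f (exp v) * RtoC (exp v))%C) by (revert D; apply DomC_ext; intro; now rewrite E).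
  pose proof (is_RInt_gen_exp K f D') as I. rewrite (Ig_ext _ (gmi z) E) in I.
  assert (HP : ProperFilter' (at_right 0)) by (apply Proper_StrongProper, at_right_proper_filter).
  exact (is_RInt_gen_unique (V := C_R_CompleteNormedModule) f (Gam z) I).
Qed.

(** * The Mellin transform of theta and the zeta function *)

Definition dterm (s : C) (n : nat) : C := rcpow (INR (S n)) (- s).
(** One term of the Mellin integrand of theta, in the logarithmic variable; summed over [n] it gives
    [thB u * exp ((s - 1/2) u)]. *)
Definition mterm (s : C) (n : nat) (u : R) : C := (2 * cexp (s * RtoC u) * RtoC (fz (exp (2 * u)) (INR (S n))))%C.

(** The substitution [v = 2 u + ln (pi n^2)] separates the power of [pi n^2] from Euler's integrand
    at [s / 2]. *)
Lemma mterm_scaled s n u : let l := ln (PI * INR (S n) ^ 2) in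
  mterm s n u = (2 * cexp (- (s / 2 * RtoC l)) * gmi (s / 2) (2 * u + l)%R)%C.
Proof.
  intro l. pose proof PI_RGT_0. pose proof (INR_S_ge1 n). assert (Hl : 0 < PI * INR (S n) ^ 2) by (apply Rmult_lt_0_compat; [lra|apply pow_lt; lra]).
  unfold gmi, mterm, fz. rewrite exp_plus. unfold l at 3. rewrite exp_ln by auto.
  replace (s / 2 * RtoC (2 * u + l))%C with (s * RtoC u + s / 2 * RtoC l)%C.
  - rewrite cexp_plus, cexp_opp. replace (exp (2 * u) * (PI * INR (S n) ^ 2)) with (PI * exp (2 * u) * INR (S n) ^ 2) by ring.
    field; try apply cexp_neq0.
  - rewrite RtoC_plus, RtoC_mult. field; apply two_neq0.
Qed.

Lemma re_half s : Re (s / 2)%C = Re s / 2.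
Proof. destruct s. simpl. field. Qed.

Lemma mterm_dom s n : 0 < Re s -> exists K, DomC K (mterm s n).
Proof.
  intro Hs. set (l := ln (PI * INR (S n) ^ 2)). destruct (gmi_dom (s / 2)) as [K D]; [rewrite re_half; lra|].
  destruct (DomC_lin K _ 2 l ltac:(lra) D) as [K' D']. eexists. eapply DomC_ext; [|apply (DomC_scal _ (2 * cexp (- (s / 2 * RtoC l))) _ D')].
  intro u. symmetry. apply mterm_scaled.
Qed.

Lemma mterm_Ig s n : 0 < Re s -> Ig (mterm s n) = (rcpow PI (- (s / 2)) * Gam (s / 2) * dterm s n)%C.
Proof.
  intro Hs. set (l := ln (PI * INR (S n) ^ 2)). destruct (gmi_dom (s / 2)) as [K D]; [rewrite re_half; lra|].
  destruct (DomC_lin K _ 2 l ltac:(lra) D) as [K' D'].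
  rewrite (Ig_ext _ (fun u => (2 * cexp (- (s / 2 * RtoC l))) * gmi (s / 2) (2 * u + l)%R)%C) by (intro; apply mterm_scaled).
  rewrite (Ig_scal _ _ _ D').
  replace (2 * cexp (- (s / 2 * RtoC l)) * Ig (fun u => gmi (s / 2) (2 * u + l)%R))%C
    with (cexp (- (s / 2 * RtoC l)) * (RtoC 2 * Ig (fun u => gmi (s / 2) (2 * u + l)%R)))%C by ring.
  rewrite (Ig_lin_pos K (gmi (s / 2)) 2 l ltac:(lra) D). change (Ig (gmi (s / 2))) with (Gam (s / 2)).
  unfold dterm, rcpow. pose proof (INR_S_ge1 n). pose proof PI_RGT_0.
  assert (E : l = ln PI + 2 * ln (INR (S n))).
  { unfold l. rewrite ln_mult by (try apply pow_lt; lra). f_equal. replace (INR (S n) ^ 2) with (INR (S n) * INR (S n)) by ring. rewrite ln_mult by lra. ring. }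
  replace (- (s / 2 * RtoC l))%C with (- (s / 2) * RtoC (ln PI) + - s * RtoC (ln (INR (S n))))%C; [rewrite cexp_plus; ring|].
  rewrite E, RtoC_plus, RtoC_mult. field; apply two_neq0.
Qed.

Lemma mterm_sum s u N : csum (fun n => mterm s n u) N = (2 * cexp (s * RtoC u) * csum (thk (RtoC (exp (2 * u)))) N)%C.
Proof. rewrite <- csum_scal. apply csum_ext. intros n _. rewrite thk_real. reflexivity. Qed.

Lemma thB_cexp s u : (thB (RtoC u) * cexp ((s - 1 / 2) * RtoC u))%C = (2 * cexp (s * RtoC u) * psi (RtoC (exp (2 * u))))%C.
Proof.
  unfold thB. rewrite e2_RtoC, psij0, eh_RtoC, <- cexp_RtoC.
  replace (s * RtoC u)%C with (RtoC (u / 2) + (s - 1 / 2) * RtoC u)%C; [rewrite cexp_plus; ring|].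
  rewrite RtoC_div by lra. field; apply two_neq0.
Qed.

Lemma mterm_lim s u : clim eventually (csum (fun n => mterm s n u)) (thB (RtoC u) * cexp ((s - 1 / 2) * RtoC u))%C.
Proof.
  rewrite thB_cexp. apply clim_ext with (f := fun N => (2 * cexp (s * RtoC u) * csum (thk (RtoC (exp (2 * u)))) N)%C).
  - apply filter_forall. intro N. symmetry. apply mterm_sum.
  - apply clim_mult; [apply clim_const|apply psi_lim]. rewrite re_RtoC. apply exp_pos.
Qed.

Lemma csum_le_lim (a : nat -> C) (r : nat -> R) l N : (forall n, Cmod (a n) <= r n) -> clim eventually (csum (fun n => RtoC (r n))) l ->
  Cmod (csum a N) <= Re l.
Proof.
  intros Ha L. assert (H1 : forall N, Cmod (csum a N) <= Re (csum (fun n => RtoC (r n)) N)).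
  { induction N0; cbn [csum]; [rewrite Cmod_0; simpl; lra|]. rewrite re_plus, re_RtoC. eapply Rle_trans; [apply Cmod_triangle|]. specialize (Ha N0). lra. }
  eapply Rle_trans; [apply H1|]. apply clim_re in L.
  refine (filterlim_le (F := eventually) (fun _ => Re (csum (fun n => RtoC (r n)) N)) _ (Finite _) (Finite _) _ (filterlim_const _) L).
  exists N. intros M HM. induction HM; [lra|]. cbn [csum]. rewrite re_plus, re_RtoC. pose proof (Ha m). pose proof (Cmod_ge_0 (a m)). lra.
Qed.

Lemma Cmod_mterm s n u : Cmod (mterm s n u) = 2 * exp (Re s * u) * fz (exp (2 * u)) (INR (S n)).
Proof. unfold mterm. rewrite !Cmod_mult, Cmod_cexp_lin, !Cmod_pos_RtoC by (try (left; apply fz_pos); lra). reflexivity. Qed.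

(** The moduli of the terms are the terms at the real point [Re s], so all partial sums are
    dominated by [thB] with that exponent. *)
Lemma mterm_sum_bound s : 1 < Re s -> exists K, forall N u, Cmod (csum (fun n => mterm s n u) N) <= K * wt u.
Proof.
  intro Hs. set (p := RtoC (Re s - 1 / 2)). assert (Hp : 1 / 2 < Re p) by (unfold p; rewrite re_RtoC; lra).
  destruct (thB_two_sided p Hp) as [M [c [Hc [B _]]]]. destruct (exp_abs_wt c Hc) as [Kw [HKw Hw]]. exists (Rabs M * Kw). intros N u.
  apply Rle_trans with (Re (thB (RtoC u) * cexp (p * RtoC u))%C).
  - apply (csum_le_lim _ (fun n => 2 * exp (Re s * u) * fz (exp (2 * u)) (INR (S n)))); [intro n; rewrite Cmod_mterm; lra|].
    replace p with (RtoC (Re s) - 1 / 2)%C by (unfold p; rewrite RtoC_minus, RtoC_div by lra; reflexivity).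
    generalize (mterm_lim (RtoC (Re s)) u). apply clim_ext. apply filter_forall. intro k. apply csum_ext. intros n _.
    unfold mterm. rewrite <- RtoC_mult, cexp_RtoC, <- !RtoC_mult. reflexivity.
  - eapply Rle_trans; [apply re_le|]. eapply Rle_trans; [apply B|]. rewrite Rmult_assoc.
    eapply Rle_trans; [apply Rmult_le_compat_r; [left; apply exp_pos|apply Rle_abs]|]. apply Rmult_le_compat_l; [apply Rabs_pos|apply Hw].
Qed.

Lemma mellin_sum s : 1 < Re s ->
  clim eventually (csum (fun n => Ig (mterm s n))) (Ig (fun u => thB (RtoC u) * cexp ((s - 1 / 2) * RtoC u))%C).
Proof.
  intro Hs. destruct (mterm_sum_bound s Hs) as [K B]. assert (HD : forall n, exists K, DomC K (mterm s n)) by (intro n; apply mterm_dom; lra).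
  apply clim_ext with (f := fun N => Ig (fun u => csum (fun n => mterm s n u) N)).
  { apply filter_forall. intro N. now apply Ig_csum. }
  apply (Ig_lim eventually (fun N u => csum (fun n => mterm s n u) N) _ K).
  - apply filter_forall. intro N. split; auto. intro u. destruct (DomC_csum (mterm s) N HD) as [K' D]. apply D.
  - split.
    + intro u. apply ccr_mult; [apply thB_ccr|]. ccont.
    + intro u. apply (clim_Cmod_le (F := eventually) _ _ _ (mterm_lim s u)). apply filter_forall. intro N. apply B.
  - intros A d HA Hd. set (m := exp (- (2 * A))). assert (Hm : 0 < m) by apply exp_pos. pose proof (exp_PI_lt1 m Hm) as [H1 H2].
    set (rho := exp (- (PI * m))) in *. set (q := 2 * exp (Rabs (Re s) * A)). assert (Hq : 0 < q) by (unfold q; pose proof (exp_pos (Rabs (Re s) * A)); lra).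
    destruct (geo_small (q * (rho / (1 - rho))) rho d) as [N HN]; auto.
    { apply Rmult_le_pos; [lra|]. apply Rmult_le_pos; auto. left. apply Rinv_0_lt_compat. lra. }
    exists N. intros n Hn u Hu. rewrite mterm_sum, thB_cexp.
    replace (2 * cexp (s * RtoC u) * csum (thk (RtoC (exp (2 * u)))) n - 2 * cexp (s * RtoC u) * psi (RtoC (exp (2 * u))))%C
      with (2 * cexp (s * RtoC u) * (csum (thk (RtoC (exp (2 * u)))) n - psi (RtoC (exp (2 * u)))))%C by ring.
    rewrite !Cmod_mult, Cmod_cexp_lin, Cmod_pos_RtoC, Cmod_minus_sym by lra.
    apply Rle_trans with (q * (rho * rho ^ n / (1 - rho))).
    + apply Rmult_le_compat; [pose proof (exp_pos (Re s * u)); lra|apply Cmod_ge_0| |].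
      * unfold q. apply Rmult_le_compat_l; [lra|]. apply exp_mono. eapply Rle_trans; [apply Rle_abs|]. rewrite Rabs_mult.
        apply Rmult_le_compat_l; [apply Rabs_pos|]. apply Rabs_le. lra.
      * apply (CL_tail (thk (RtoC (exp (2 * u)))) rho rho); auto. intro k. apply thk_bound; auto. rewrite re_RtoC. apply exp_mono. lra.
    + left. replace (q * (rho * rho ^ n / (1 - rho))) with (q * (rho / (1 - rho)) * rho ^ n) by (field; lra). auto.
Qed.

Lemma Series_clim (a : nat -> R) l : filterlim (fun N => sum_n a N) eventually (locally l) -> Series a = l.
Proof. intro H. apply is_series_unique. exact H. Qed.

Lemma zeta_of_clim s l : clim eventually (csum (dterm s)) l -> zeta_dirichlet s = l.
Proof.
  intro L. assert (LS : clim eventually (fun N => csum (dterm s) (S N)) l).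
  { intros e He. destruct (L e He) as [N HN]. exists N. intros n Hn. apply HN. lia. }
  apply Ceq_parts; unfold zeta_dirichlet; simpl; apply Series_clim.
  - generalize (clim_re _ _ LS). apply filterlim_ext. intro N. induction N.
    + rewrite sum_O. cbn [csum]. rewrite re_plus. simpl (Re (RtoC 0)). apply Rplus_0_l.
    + rewrite sum_Sn, <- IHN. reflexivity.
  - generalize (clim_im _ _ LS). apply filterlim_ext. intro N. induction N.
    + rewrite sum_O. cbn [csum]. rewrite im_plus. simpl (Im (RtoC 0)). apply Rplus_0_l.
    + rewrite sum_Sn, <- IHN. reflexivity.
Qed.

Lemma rcpow_neq0 x z : rcpow x z <> RtoC 0.
Proof. apply cexp_neq0. Qed.

(** Convergence of the Dirichlet series is an output: its partial sums, times the factor [c] of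
    Gamma and [pi], are integrals converging by domination, and [c] does not vanish. *)
Theorem mellin_zeta s : 1 < Re s ->
  clim eventually (csum (dterm s)) (zeta_dirichlet s) /\
  Ig (fun u => thB (RtoC u) * cexp ((s - 1 / 2) * RtoC u))%C = (rcpow PI (- (s / 2)) * Gam (s / 2) * zeta_dirichlet s)%C.
Proof.
  intro Hs. set (I := Ig (fun u => thB (RtoC u) * cexp ((s - 1 / 2) * RtoC u))%C). set (c := (rcpow PI (- (s / 2)) * Gam (s / 2))%C).
  assert (Hc : c <> RtoC 0) by (apply Cmult_neq_0; [apply rcpow_neq0|apply Gam_neq0; rewrite re_half; lra]).
  assert (L : clim eventually (csum (dterm s)) (/ c * I)%C).
  { apply clim_ext with (f := fun N => (/ c * csum (fun n => Ig (mterm s n)) N)%C).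
    - apply filter_forall. intro N. rewrite <- csum_scal. apply csum_ext. intros n _. rewrite mterm_Ig by lra. fold c. field. auto.
    - apply clim_mult; [apply clim_const|now apply mellin_sum]. }
  rewrite (zeta_of_clim s _ L). split; auto. field. auto.
Qed.

(** * Sieving the Dirichlet series *)

Definition unsieved (m k : nat) : Prop := forall d, (2 <= d <= m + 1)%nat -> ~ Nat.divide d k.
Definition chi (m k : nat) : C := if excluded_middle_informative (unsieved m k) then RtoC 1 else RtoC 0.
(** Partial sums over the integers without divisors in [[2, m + 1]]: the sieve of Eratosthenes,
    acting on the series as the Euler factors [1 - p^(-s)] would on its sum. *)
Definition sieve (s : C) (m N : nat) : C := csum (fun n => chi m (S n) * dterm s n)%C N.

Lemma chi_1 m k : unsieved m k -> chi m k = RtoC 1.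
Proof. intro H. unfold chi. destruct (excluded_middle_informative (unsieved m k)); tauto. Qed.
Lemma chi_0 m k : ~ unsieved m k -> chi m k = RtoC 0.
Proof. intro H. unfold chi. destruct (excluded_middle_informative (unsieved m k)); tauto. Qed.
Lemma chi_iff m k m' k' : (unsieved m k <-> unsieved m' k') -> chi m k = chi m' k'.
Proof. intro H. destruct (classic (unsieved m k)); [rewrite !chi_1|rewrite !chi_0]; tauto. Qed.

Lemma Cmod_chi m k : Cmod (chi m k) <= 1.
Proof. unfold chi. destruct (excluded_middle_informative _); [rewrite Cmod_1|rewrite Cmod_0]; lra. Qed.

Lemma unsieved_S m k : unsieved (S m) k <-> unsieved m k /\ ~ Nat.divide (m + 2) k.
Proof.
  split.
  - intro H. split; [intros d Hd; apply H; lia|apply H; lia].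
  - intros [H1 H2] d Hd. destruct (Nat.eq_dec d (m + 2)) as [->|]; auto. apply H1. lia.
Qed.

(** The hypothesis says that [m + 2] is prime. Every [d <= m + 1] is coprime to it, since a common
    divisor above 1 would be a forbidden divisor of [m + 2]; Gauss's lemma concludes. *)
Lemma unsieved_mult m k : unsieved m (m + 2) -> (unsieved m ((m + 2) * k) <-> unsieved m k).
Proof.
  intro Hq. split; intros H d Hd D; apply (H d Hd).
  - now apply Nat.divide_mul_r.
  - apply (Nat.gauss d (m + 2)); auto.
    destruct (Nat.gcd_divide d (m + 2)) as [G1 G2]. set (g := Nat.gcd d (m + 2)) in *.
    assert (Hg : (g <= d)%nat) by (apply Nat.divide_pos_le; auto; lia).
    assert (g <> 0)%nat by (intro E; rewrite E in G1; destruct G1; lia).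
    destruct (Nat.eq_dec g 1); auto. exfalso. apply (Hq g); auto. lia.
Qed.

Lemma dterm_mult s q k : (0 < q)%nat -> (0 < k)%nat -> rcpow (INR (q * k)) s = (rcpow (INR q) s * rcpow (INR k) s)%C.
Proof.
  intros Hq Hk. unfold rcpow. rewrite mult_INR, ln_mult by now apply lt_0_INR. rewrite RtoC_plus, Cmult_plus_distr_l. apply cexp_plus.
Qed.

(* [m + 2] is prime when no [d <= m + 1] divides it; otherwise its multiples are already sieved. *)
Lemma sieve_step s m N : unsieved m (m + 2) ->
  sieve s (S m) N = (sieve s m N - rcpow (INR (m + 2)) (- s) * sieve s m (N / (m + 2)))%C.
Proof.
  intro Hq. set (q := (m + 2)%nat) in *. induction N.
  - rewrite Nat.Div0.div_0_l. unfold sieve. simpl. ring.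
  - unfold sieve in *. cbn [csum]. rewrite IHN. clear IHN.
    destruct (classic (Nat.divide q (S N))) as [[k Hk]|ND].
    + assert (Hk0 : (0 < k)%nat) by (destruct k; lia). rewrite Nat.mul_comm in Hk.
      assert (E1 : (S N / q = S (k - 1))%nat) by (rewrite Hk, Nat.mul_comm, Nat.div_mul by lia; lia).
      assert (E2 : (N / q = k - 1)%nat) by (symmetry; apply (Nat.div_unique N q (k - 1) (q - 1)); [lia|destruct k; [lia|]; simpl; lia]).
      rewrite E1, E2. cbn [csum]. rewrite (chi_0 (S m)) by (rewrite unsieved_S; intros [_ H]; apply H; exists k; lia).
      set (A := csum _ N). set (B := csum _ (k - 1)). clearbody A B. unfold dterm. replace (S (k - 1)) with k by lia. rewrite Hk, (chi_iff m (q * k) m k) by now apply unsieved_mult.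
      rewrite dterm_mult by lia. ring.
    + assert (E : (S N / q = N / q)%nat).
      { symmetry. apply (Nat.div_unique (S N) q _ (S (N mod q))).
        - pose proof (Nat.mod_upper_bound N q ltac:(lia)). destruct (Nat.eq_dec (S (N mod q)) q) as [Eq|]; [|lia].
          exfalso. apply ND. exists (S (N / q)). pose proof (Nat.div_mod_eq N q). lia.
        - pose proof (Nat.div_mod_eq N q). lia. }
      rewrite E, (chi_iff (S m) (S N) m (S N)) by (rewrite unsieved_S; tauto). ring.
Qed.

Lemma sieve_lim0 s m : clim eventually (csum (dterm s)) (RtoC 0) -> clim eventually (sieve s m) (RtoC 0).
Proof.
  intro H0. induction m.
  - revert H0. apply clim_ext. apply filter_forall. intro N. unfold sieve. apply csum_ext. intros n _.
    rewrite chi_1; [ring|]. intros d Hd. lia.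
  - destruct (classic (unsieved m (m + 2))) as [Hq|Hq].
    + apply clim_ext with (f := fun N => (sieve s m N - rcpow (INR (m + 2)) (- s) * sieve s m (N / (m + 2)))%C).
      { apply filter_forall. intro N. symmetry. now apply sieve_step. }
      apply clim_eq with (RtoC 0 - rcpow (INR (m + 2)) (- s) * RtoC 0)%C; [|ring].
      apply clim_minus; auto. apply clim_mult; [apply clim_const|].
      intros e He. destruct (IHm e He) as [N HN]. exists ((m + 2) * N)%nat. intros n Hn. apply HN. apply Nat.div_le_lower_bound; lia.
    + revert IHm. apply clim_ext. apply filter_forall. intro N. apply csum_ext. intros n _. f_equal. apply chi_iff.
      rewrite unsieved_S. split; [|tauto]. intro H. split; auto. intro D. apply Hq. intros d Hd Dd. apply (H d Hd). eapply Nat.divide_trans; eauto.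
Qed.

Lemma csum_diff_le (a : nat -> C) (r : nat -> R) N M : (forall n, Cmod (a n) <= r n) -> (N <= M)%nat ->
  Cmod (csum a M - csum a N) <= Re (csum (fun n => RtoC (r n)) M - csum (fun n => RtoC (r n)) N)%C.
Proof.
  intros Ha H. induction H.
  - replace (csum a N - csum a N)%C with (RtoC 0) by ring. rewrite Cmod_0, re_minus. lra.
  - cbn [csum]. replace (csum a m + a m - csum a N)%C with ((csum a m - csum a N) + a m)%C by ring.
    eapply Rle_trans; [apply Cmod_triangle|]. rewrite re_minus, re_plus, re_RtoC. rewrite re_minus in IHle. specialize (Ha m). lra.
Qed.

Lemma sieve_first s m : sieve s m (m + 1) = RtoC 1.
Proof.
  assert (H : forall N, (N <= m)%nat -> sieve s m (S N) = RtoC 1); [|rewrite Nat.add_1_r; now apply H].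
  induction N; intro HN; unfold sieve in *; cbn [csum].
  - rewrite chi_1 by (intros d Hd D; apply Nat.divide_1_r in D; lia). unfold dterm, rcpow. simpl INR. rewrite ln_1, Cmult_0_r, cexp_0. ring.
  - cbn [csum] in IHN. rewrite IHN by lia. rewrite chi_0; [ring|]. intro H. apply (H (S (S N))); [lia|apply Nat.divide_refl].
Qed.

(** The first [m + 1] terms of a sieved sum add up to 1, and the later ones are bounded by the tail
    of the series at [Re s], which is below [1/2] for suitable [m]. A vanishing zeta would send the
    sieved sums to 0. *)
Theorem zeta_neq0 s : 1 < Re s -> zeta_dirichlet s <> RtoC 0.
Proof.
  intros Hs E. destruct (mellin_zeta s Hs) as [L _]. rewrite E in L.
  destruct (mellin_zeta (RtoC (Re s)) ltac:(now rewrite re_RtoC)) as [L1 _]. set (l := zeta_dirichlet (RtoC (Re s))) in *.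
  destruct (L1 (1 / 4) ltac:(lra)) as [N0 H1]. set (m := N0).
  destruct (sieve_lim0 s m L (1 / 2) ltac:(lra)) as [N1 H2]. set (N := (m + 1 + N1)%nat). specialize (H2 N ltac:(unfold N; lia)).
  set (r := fun n => exp (- Re s * ln (INR (S n)))).
  assert (Hr : forall n, dterm (RtoC (Re s)) n = RtoC (r n)).
  { intro n. unfold dterm, rcpow, r. rewrite <- RtoC_opp, <- RtoC_mult. apply cexp_RtoC. }
  assert (Hd : forall n, Cmod (chi m (S n) * dterm s n) <= r n).
  { intro n. rewrite Cmod_mult. replace (Cmod (dterm s n)) with (r n).
    - pose proof (Cmod_chi m (S n)). assert (0 < r n) by apply exp_pos. nra.
    - unfold dterm, rcpow. rewrite Cmod_cexp_lin. reflexivity. }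
  pose proof (csum_diff_le _ r (m + 1) N Hd ltac:(unfold N; lia)) as T. fold (sieve s m N) in T. fold (sieve s m (m + 1)) in T. rewrite sieve_first in T.
  rewrite <- !(csum_ext (dterm (RtoC (Re s))) (fun n => RtoC (r n))) in T by auto.
  pose proof (H1 N ltac:(unfold N, m; lia)) as A1. pose proof (H1 (m + 1)%nat ltac:(unfold m; lia)) as A2.
  pose proof (re_le (csum (dterm (RtoC (Re s))) N - csum (dterm (RtoC (Re s))) (m + 1))) as A3.
  pose proof (Cmod_triangle3 (csum (dterm (RtoC (Re s))) N) l (csum (dterm (RtoC (Re s))) (m + 1))) as A4. rewrite (Cmod_minus_sym l) in A4.
  pose proof (Cmod_triangle3 (RtoC 1) (sieve s m N) (RtoC 0)) as A5. rewrite (Cmod_minus_sym 1 (sieve s m N)) in A5.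
  replace (RtoC 1 - RtoC 0)%C with (RtoC 1) in A5 by ring. rewrite Cmod_1 in A5. lra.
Qed.

(** * Identification with the functions of the statement *)

(** The explicit candidate for [xi], from [Xi t = 2 xi (1/2 + i t)] with [t = - i (s - 1/2)]. *)
Definition xiF (s : C) : C := (RtoC (1 / 2) * FT Phi (- (Ci * (s - 1 / 2))))%C.

Lemma cder_xiF s : exists d, cder xiF s d.
Proof.
  destruct (FT_cder Phi (- (Ci * (s - 1 / 2)))%C Kern_Phi) as [d H]. eexists. apply cder_mult; [apply cder_const|].
  apply (cder_comp (FT Phi) (fun s => - (Ci * (s - 1 / 2)))%C); [exact H|].
  apply cder_opp, cder_mult; [apply cder_const|]. apply cder_minus; [apply cder_id|apply cder_const].
Qed.

(** With [p = s - 1/2] the wave becomes [exp (p u)], and the factor [p^2 - 1/4] of the integrations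
    by parts is [s (s - 1)]. *)
Lemma FT_Phi_zeta s : 1 < Re s ->
  FT Phi (- (Ci * (s - 1 / 2))) = (s * (s - 1) * (rcpow PI (- (s / 2)) * Gam (s / 2) * zeta_dirichlet s))%C.
Proof.
  intro Hs. destruct (mellin_zeta s Hs) as [_ M]. rewrite <- M.
  replace (s * (s - 1))%C with ((s - 1 / 2) * (s - 1 / 2) - 1 / 4)%C.
  - rewrite <- Phi_thB.
    + unfold FT. apply Ig_ext. intro u. f_equal. f_equal. f_equal. destruct s. apply Ceq_parts; simpl; field.
    + rewrite re_minus. replace (Re (1 / 2)%C) with (1 / 2); [lra|]. simpl. field.
  - field; repeat split; apply RtoC_neq0; lra.
Qed.

Lemma xiF_product s : 1 < Re s -> xiF s = xi_product s.
Proof.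
  intro Hs. unfold xiF, xi_product. rewrite FT_Phi_zeta, Gamma_euler_Gam by (rewrite ?re_half; lra). ring.
Qed.

Lemma entire_unique f : entire f -> (forall s, 1 < Re s -> f s = xi_product s) -> forall s, f s = xiF s.
Proof.
  intros He Hp s. set (h := fun w => (f (2 + w) - xiF (2 + w))%C).
  assert (Hh : hol h (Cmod (s - 2) + 1)).
  { intros w _. destruct (proj1 (ex_derive_cder f (2 + w)%C) (He _)) as [d1 H1]. destruct (cder_xiF (2 + w)%C) as [d2 H2].
    eexists. apply cder_minus; [apply (cder_comp f (fun w => 2 + w)%C); [exact H1|]|apply (cder_comp xiF (fun w => 2 + w)%C); [exact H2|]];
      (apply cder_plus; [apply cder_const|apply cder_id]). }
  assert (Z : h (s - 2)%C = RtoC 0).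
  { apply (identity_disc h _ Hh); [|lra]. intros d Hd. exists (RtoC (d / 2)). split; [apply RtoC_neq0; lra|].
    split; [rewrite Cmod_pos_RtoC; lra|]. unfold h. rewrite Hp, xiF_product by (rewrite re_plus, !re_RtoC; lra). ring. }
  unfold h in Z. replace (2 + (s - 2))%C with s in Z by ring. replace (f s) with (f s - xiF s + xiF s)%C by ring. rewrite Z. ring.
Qed.

(** The existence of [xiF] makes the choice by [epsilon] meaningful; the identity theorem about the
    point 2 then determines the chosen function. *)
Lemma xi_eq s : xi s = xiF s.
Proof.
  assert (H : entire xi /\ forall s, 1 < Re s -> xi s = xi_product s).
  { unfold xi. apply epsilon_spec. exists xiF. split; [intro z; apply ex_derive_cder, cder_xiF|apply xiF_product]. }
  now apply entire_unique.
Qed.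

(** Below the strip [s = 1/2 + i z] has real part above 1, where every factor of the product is
    nonzero; evenness carries this above the strip. *)
Lemma FT_Phi_neq0 z : 1 / 2 < Rabs (Im z) -> FT Phi z <> RtoC 0.
Proof.
  assert (H : forall z, 1 / 2 < - Im z -> FT Phi z <> RtoC 0).
  { intros w Hw. set (s := (Ci * w + 1 / 2)%C).
    assert (Hs : 1 < Re s). { unfold s. rewrite re_plus, re_mult. replace (Re (1 / 2)%C) with (1 / 2) by (simpl; field). simpl. lra. }
    replace w with (- (Ci * (s - 1 / 2)))%C by (unfold s; destruct w; apply Ceq_parts; simpl; field).
    rewrite FT_Phi_zeta by auto. repeat apply Cmult_neq_0.
    - intro E. rewrite E, re_RtoC in Hs. lra.
    - intro E. apply (f_equal Re) in E. rewrite re_minus, !re_RtoC in E. lra.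
    - apply rcpow_neq0.
    - apply Gam_neq0. rewrite re_half. lra.
    - now apply zeta_neq0. }
  intro Hz. destruct (Rle_dec 0 (Im z)).
  - rewrite Rabs_right in Hz by lra. rewrite <- FT_even by apply Kern_Phi. apply H. rewrite im_opp. lra.
  - rewrite Rabs_left in Hz by lra. auto.
Qed.

Lemma Cpow_eq0 (z : C) n : (z ^ n)%C = RtoC 0 -> z = RtoC 0.
Proof.
  intro E. destruct (classic (z = RtoC 0)) as [|N]; auto. exfalso. revert E. apply Cpow_nz. exact N.
Qed.

Lemma conv_pow_zeros n : zeros_in (conv_pow Phi n) (1 / 4).
Proof.
  intros z E. rewrite FT_conv_pow in E by apply Kern_Phi. apply Cpow_eq0 in E. right.
  assert (H : Rabs (Im z) <= 1 / 2) by (apply Rnot_lt_le; intro L; now apply (FT_Phi_neq0 z L)).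
  rewrite <- Rabs_sq. pose proof (Rabs_pos (Im z)). simpl. nra.
Qed.

(** * The functions [v] and [F] in terms of the kernel *)

Lemma two_xi_critical t : (2 * xi ((1 / 2)%R, t))%C = RtoC (Xi t).
Proof.
  rewrite xi_eq. unfold xiF. replace (- (Ci * (((1 / 2)%R, t) - 1 / 2)))%C with (RtoC t) by (apply Ceq_parts; simpl; field).
  rewrite FT_Xi, RtoC_div by lra. field; apply two_neq0.
Qed.

(** On the critical line [x^(s - 1) = exp (- u / 2) exp (i t u)] with [u = ln x], so [v] is an
    inverse Fourier integral of [Xi^k]. That [v] is given by a two-ended improper integral is
    settled by [is_RInt_gen_Ig]. *)
Lemma v_eq n x : v (S n) x = RtoC (exp (- (ln x / 2)) * conv_pow Phi n (ln x)).
Proof.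
  set (u := ln x). set (c := RtoC (exp (- (u / 2)))). destruct (Xi_pow_dom n) as [K D].
  assert (D2 : DomC K (fun t => RtoC (Xi t) ^ S n * cexp (Ci * RtoC (t * u)))%C).
  { generalize (DomC_wave _ _ u D). apply DomC_ext. intro t. now rewrite (Rmult_comm u t). }
  pose proof (DomC_scal _ c _ D2) as D3.
  set (f := fun tau : R => (Cpow (2 * xi ((1 / 2)%R, tau)) (S n) * rcpow x (((1 / 2)%R, tau) - 1))%C).
  assert (E : forall t, (c * (RtoC (Xi t) ^ S n * cexp (Ci * RtoC (t * u))))%C = f t).
  { intro t. unfold f. rewrite two_xi_critical. unfold rcpow. fold u.
    replace ((((1 / 2)%R, t) - 1) * RtoC u)%C with (RtoC (- (u / 2)) + Ci * RtoC (t * u))%C by (apply Ceq_parts; simpl; field).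
    rewrite cexp_plus, cexp_RtoC. unfold c. ring. }
  assert (D4 : DomC (Cmod c * K) f) by (revert D3; apply DomC_ext; exact E).
  pose proof (is_RInt_gen_Ig _ f D4) as I. unfold v. fold f.
  rewrite (is_RInt_gen_unique (V := C_R_CompleteNormedModule) f (Ig f) I).
  rewrite <- (Ig_ext _ f E), (Ig_scal _ _ _ D2), Xi_pow_inversion. unfold c. rewrite <- !RtoC_mult. f_equal. pose proof PI_RGT_0. field. lra.
Qed.

(** Under [x = exp u] the measure [dx] supplies [exp u], and [sqrt x / x] together with the factor
    [exp (- u / 2)] of [v] cancels it exactly. *)
Lemma F_eq lam n t : 0 <= lam -> F lam (S n) t = FT (fun u => conv_pow Phi n u * exp (lam * u ^ 2)) t.
Proof.
  intro Hl. destruct (FT_dom_ex _ t (kern_gauss _ lam (conv_pow_kern Phi n Kern_Phi) Hl)) as [K D].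
  set (f := fun x : R => (cexp (RtoC (lam * (ln x) ^ 2) + Ci * t * RtoC (ln x)) * (RtoC (sqrt x / x) * v (S n) x))%C).
  assert (E : forall u, (f (exp u) * RtoC (exp u))%C = (RtoC (conv_pow Phi n u * exp (lam * u ^ 2)) * cexp (Ci * t * RtoC u))%C).
  { intro u. unfold f. rewrite v_eq, ln_exp, cexp_plus, cexp_RtoC.
    assert (Es : sqrt (exp u) = exp (u / 2)).
    { replace (exp u) with (exp (u / 2) ^ 2) by (rewrite exp_pow; f_equal; simpl; field). apply sqrt_pow2. left. apply exp_pos. }
    rewrite Es, RtoC_div, RtoC_mult, exp_Ropp, RtoC_inv, RtoC_mult by (apply Rgt_not_eq, exp_pos).
    field. split; apply RtoC_neq0, Rgt_not_eq, exp_pos. }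
  assert (D' : DomC K (fun u => f (exp u) * RtoC (exp u))%C) by (revert D; apply DomC_ext; intro; now rewrite E).
  pose proof (is_RInt_gen_exp K f D') as I. rewrite (Ig_ext _ _ E) in I.
  assert (HP : ProperFilter' (at_right 0)) by (apply Proper_StrongProper, at_right_proper_filter).
  exact (is_RInt_gen_unique (V := C_R_CompleteNormedModule) f _ I).
Qed.

Lemma list_bounded (l : list R) : exists T, forall x, In x l -> x <= T.
Proof.
  induction l as [|a l [T IH]]; [exists 0; intros x []|]. exists (Rmax a T). intros x [->|H]; [apply Rmax_l|].
  eapply Rle_trans; [now apply IH|apply Rmax_r].
Qed.

Theorem theorem3p1 (k : nat) (hk : (1 <= k)%nat) :
  (forall (lambda : R), 1/8 <= lambda ->
     forall t : C, F lambda k t = RtoC 0 -> Im t = 0) /\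
  (~ exists l : list R, forall t : R, F 0 k (RtoC t) = RtoC 0 -> In t l).
Proof.
  destruct k as [|n]; [lia|]. pose proof (conv_pow_kern Phi n Kern_Phi) as HK. split.
  - intros lam Hl t. rewrite F_eq by lra. apply (debruijn_gauss (conv_pow Phi n) (1 / 4) lam); auto; try lra. apply conv_pow_zeros.
  (* A finite list of reals is bounded, while [Xi] has a zero beyond every bound; at [lambda = 0] a
     zero of [Xi] is one of its power. *)
  - intros [l Hl]. destruct (list_bounded l) as [T HT]. destruct (Xi_zeros T) as [t [Ht E]].
    assert (I : In t l); [|specialize (HT t I); lra]. apply Hl. rewrite F_eq by lra.
    replace (FT (fun u => conv_pow Phi n u * exp (0 * u ^ 2)) (RtoC t)) with (FT (conv_pow Phi n) (RtoC t)).
    + rewrite FT_conv_pow, FT_Xi, E by apply Kern_Phi. simpl. ring.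
    + unfold FT. apply Ig_ext. intro u. now rewrite Rmult_0_l, exp_0, Rmult_1_r.
Qed.
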